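(* Consider the $n\times n$ system $\frac{dY}{dz}=\big(\Lambda(t)+\frac{\widehat A_1(t)}{z}\big)Y$ with $\Lambda(t)=\mathrm{diag}(u_1(t),\dots,u_n(t))$, $u_a(t)=u_a(0)+t_a$, $t=(t_1,\dots,t_n)$, and with $\widehat A_1(t)$ holomorphic on the closed polydisc $\mathcal U_{\epsilon_0}(0)$, whose radius satisfies $0<\epsilon_0<\min_{j\neq k}\delta_{jk}$ (see context). Let $\Delta$ be the coalescence locus in $\mathcal U_{\epsilon_0}(0)$, passing through $t=0$. Let the dependence on $t$ be isomonodromic in a domain $\mathcal V$ (admissible domain, see context). If the matrix entries of $\widehat A_1(t)$ satisfy in $\mathcal U_{\epsilon_0}(0)$ the vanishing conditions $$(\widehat A_1(t))_{ab}=\mathcal O(u_a(t)-u_b(t)),\qquad 1\le a\ne b\le n,$$ whenever $u_a(t)$ and $u_b(t)$ coalesce as $t$ tends to a point of $\Delta$, then: (1) The formal solution $Y_F(z,t)=\big(I+\sum_{k\ge1}F_k(t)z^{-k}\big)z^{B_1}e^{\Lambda(t)z}$ is holomorphic on the whole $\mathcal U_{\epsilon_0}(0)$ (i.e. all $F_k(t)$ are holomorphic on $\mathcal U_{\epsilon_0}(0)$). (2) The three fundamental matrix solutions $Y_r(z,t)$, $r=1,2,3$, defined on $\mathcal V$ by the asymptotics $Y_F(z,t)$ for $z\to\infty$ in $\mathcal S_r(\overline{\mathcal V})$, can be $t$-analytically continued as single-valued holomorphic functions on $\mathcal U_{\epsilon_0}(0)$, with asymptotic representation $Y_r(z,t)\sim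 Y_F(z,t)$ for $z\to\infty$ in $\widehat{\mathcal S}_r$, for any $t\in\mathcal U_{\epsilon_1}(0)$ and any $0<\epsilon_1<\epsilon_0$. In particular, they are defined at any $t_\Delta\in\Delta$ with asymptotic representation $Y_F(z,t_\Delta)$. The fundamental matrix solution $Y^{(0)}(z,t)$ is also $t$-analytically continued as a single-valued holomorphic function on $\mathcal U_{\epsilon_0}(0)$. (3) The constant Stokes matrices $\mathbb S_1,\mathbb S_2$ and the central connection matrix $C^{(0)}$, initially defined for $t\in\mathcal V$, are globally defined on $\mathcal U_{\epsilon_0}(0)$. They coincide with the Stokes and connection matrices of the fundamental solutions $Y_r(z,0)$ and $Y^{(0)}(z,0)$ of the system $\frac{dY}{dz}=\big(\Lambda(0)+\frac{\widehat A_1(0)}{z}\big)Y$. Also the remaining $t$-independent monodromy data $B_1$, $J^{(0)}$, $R^{(0)}$ coincide with those of this system at $t=0$. (4) The entries of the Stokes matrices satisfy $$(\mathbb S_1)_{ab}=(\mathbb S_1)_{ba}=(\mathbb S_2)_{ab}=(\mathbb S_2)_{ba}=0\quad\text{whenever } u_a(0)=u_b(0),\ 1\le a\neq b\le n.$$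
   Context: Notation. $\mathcal R$ is the universal covering of $\mathbb C\setminus\{0\}$, so $\arg z\in\mathbb R$ for $z\in\mathcal R$. For $t\in\mathbb C^n$, $|t|=\max_i|t_i|$ and $\mathcal U_{\epsilon}(0)=\{t\in\mathbb C^n: |t|\le\epsilon\}$. The values $u_a(0)$ take $s<n$ distinct values $\lambda_1,\dots,\lambda_s$, with $\Lambda(0)=\lambda_1I_{p_1}\oplus\cdots\oplus\lambda_sI_{p_s}$. Coalescence locus: $\Delta=\{t\in\mathcal U_{\epsilon_0}(0): u_a(t)=u_b(t)\text{ for some }a\ne b\}$. Stokes rays of $\Lambda(t)$: rays $\{z\in\mathcal R:\Re[(u_a(t)-u_b(t))z]=0\}$ for pairs with $u_a(t)\neq u_b(t)$. Fix $\widetilde\tau\in\mathbb R$ admissible: $\Re[(u_a(0)-u_b(0))z]\ne0$ on $\arg z=\widetilde\tau$ whenever $u_a(0)\ne u_b(0)$. Radius: $\epsilon_0<\min_{1\le j\ne k\le s}\delta_{jk}$, where $\delta_{jk}=\frac12\min_{\rho\in\mathbb R}|\lambda_k-\lambda_j+i\rho e^{-i\widetilde\tau}|$ (no such condition if $s=1$). Cells: $X(\widetilde\tau)$ is the set of $t\in\mathcal U_{\epsilon_0}(0)$ for which some Stokes ray of $\Lambda(t)$ coincides with $\arg z=\widetilde\tau$; a $\widetilde\tau$-cell is a connected component of $\mathcal U_{\epsilon_0}(0)\setminus(\Delta\cup X(\widetilde\tau))$. The deformation is admissible in $\mathcal V$ if $\mathcal V\subset\mathcal U_{\epsilon_0}(0)$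 is open, connected and $\overline{\mathcal V}$ is contained in a $\widetilde\tau$-cell. Formal solution: for $t\notin\Delta$ there is a unique formal solution $Y_F(z,t)=(I+\sum_{k\ge1}F_k(t)z^{-k})z^{B_1(t)}e^{\Lambda(t)z}$, $B_1(t)=\mathrm{diag}(\widehat A_1(t))$ (diagonal part); the $F_k$ are holomorphic off $\Delta$. Asymptotics: $Y(z,t)\sim Y_F(z,t)$ in an open sector means that $Y(z,t)e^{-\Lambda(t)z}z^{-B_1(t)}$ has asymptotic expansion $I+\sum_{k\ge1}F_k(t)z^{-k}$ as $z\to\infty$ in every proper closed subsector. Sectors: $\Pi_r=\{z\in\mathcal R:\widetilde\tau+(r-2)\pi<\arg z<\widetilde\tau+(r-1)\pi\}$, $r=1,2,3$. $\mathcal S_r(t)$ is the open sector containing $\Pi_r$ and extending up to the closest Stokes rays of $\Lambda(t)$ outside $\Pi_r$; $\mathcal S_r(\overline{\mathcal V})=\bigcap_{t\in\overline{\mathcal V}}\mathcal S_r(t)$. $\mathfrak R(t)$ is the set of Stokes rays $\Re[(u_a(t)-u_b(t))z]=0$ for pairs with $u_a(0)\neq u_b(0)$. $\widehat{\mathcal S}_r(t)$ is the open sector containing $\Pi_r$ and extending up to the closest rays of $\mathfrak R(t)$ outside $\Pi_r$; $\widehat{\mathcal S}_r=\bigcap_{t\in\mathcal U_{\epsilon_0}(0)}\widehat{\mathcal S}_r(t)$ (if $s=1$, $\widehat{\mathcal S}_r=\mathcal R$). Solutions and Stokes matrices: for $t\in\mathcal V$, $Y_r(z,t)$ is the unique fundamental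 solution with $Y_r\sim Y_F$ in $\mathcal S_r(\overline{\mathcal V})$; it is holomorphic in $t\in\mathcal V$. Stokes matrices: $Y_{r+1}(z,t)=Y_r(z,t)\mathbb S_r(t)$, $r=1,2$. Levelt form at $z=0$: $Y^{(0)}(z,t)=G^{(0)}(t)\big(I+\sum_{l\ge1}\Psi_l(t)z^l\big)z^{D^{(0)}}z^{S^{(0)}+R^{(0)}}$ (convergent series), where $J^{(0)}=(G^{(0)})^{-1}\widehat A_1G^{(0)}=D^{(0)}+S^{(0)}$ is a Jordan form of $\widehat A_1$, $D^{(0)}$ is a diagonal matrix of integers, $S^{(0)}$ is a Jordan matrix with eigenvalues of real part in $[0,1)$, and $R^{(0)}$ is nilpotent, its block relative to Jordan blocks $i,j$ (with eigenvalues $\widetilde\mu_i,\widetilde\mu_j$) being nonzero only if $\widetilde\mu_i-\widetilde\mu_j$ is a positive integer. Central connection matrix: $Y_1(z,t)=Y^{(0)}(z,t)C^{(0)}(t)$. Isomonodromic in $\mathcal V$: the deformation is admissible in $\mathcal V$; $\widehat A_1(t)$ is holomorphically similar on $\mathcal V$ to its Jordan form $J^{(0)}$; $\mathbb S_1,\mathbb S_2,B_1$ and the eigenvalues of $\widehat A_1$ (hence $J^{(0)}$) are independent of $t\in\mathcal V$; and there is a fundamental solution $Y^{(0)}(z,t)$ in Levelt form, holomorphic in $t\in\mathcal V$, whose $R^{(0)}$ and $C^{(0)}$ are independent of $t\in\mathcal V$. $Y^{(0)}(z,t)$ and $C^{(0)}$ in the claim refer to such a solution. *)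

(* Defs.v *)
From HB Require Import structures.
From mathcomp Require Import all_boot all_order all_algebra.
From mathcomp Require Import all_classical all_reals all_analysis.
From mathcomp Require Import complex.
Set Implicit Arguments.
Unset Strict Implicit.
Unset Printing Implicit Defensive.
Import Order.TTheory GRing.Theory Num.Theory.
Import numFieldNormedType.Exports.
Local Open Scope classical_set_scope.
Local Open Scope ring_scope.
Local Open Scope complex_scope.

(* The usual topology and norm of the complex numbers. On 'rV[R[i]]_n the norm
   `|t| is then the maximum of the `|t 0 a|. *)
HB.instance Definition _ (R : realType) := NormedModule.copy R[i] R[i]^o.

Section Calculus.
Variable R : realType.

Definition cexp (w : R[i]) : R[i] :=
  (expR (complex.Re w))%:C * (cos (complex.Im w) +i* sin (complex.Im w)).

(* The universal covering of C \ {0}, in its global coordinate log z. *)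
Definition ucov := R[i].
Definition ulog (z : ucov) : R[i] := z.
Definition arg (z : ucov) : R := complex.Im (ulog z).
Definition proj (z : ucov) : R[i] := cexp (ulog z).

(* L is the derivative dM/dz (with respect to z, not log z) at z. *)
Definition is_dz p q (M : ucov -> 'M[R[i]]_(p, q)) (z : ucov)
    (L : 'M[R[i]]_(p, q)) : Prop :=
  (fun y : R[i] => (proj y - proj z)^-1 *: (M y - M z)) @ (ulog z)^' --> L.

Definition mexp n (M : 'M[R[i]]_n) : 'M[R[i]]_n :=
  lim (series (fun k => (k`!%:R)^-1 *: M ^+ k) @ \oo).

(* z^M = exp (M log z) *)
Definition zpow n (M : 'M[R[i]]_n) (z : ucov) : 'M[R[i]]_n :=
  mexp (ulog z *: M).

(* On a set that is not open, such as a closed polydisc, holomorphic means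
   holomorphic on some open neighbourhood. Differentiability is over R[i]. *)
Definition holomorphic_on n p q (E : set 'rV[R[i]]_n)
    (f : 'rV[R[i]]_n -> 'M[R[i]]_(p, q)) : Prop :=
  exists O, [/\ open O, E `<=` O & forall t, O t -> differentiable f t].

End Calculus.

Section Systems.
Variables (R : realType) (n : nat).
Local Notation C := R[i].
Local Notation T := 'rV[C]_n.
Local Notation M := 'M[C]_n.
Implicit Types (L : T) (A B J S Q : M) (d : 'rV[int]_n).

Definition diag_part A : M := diag_mx (\row_a A a a).

(* Fundamental matrix solution of dY/dz = (diag(L) + A / z) Y. *)
Definition is_fundamental L A (Y : ucov R -> M) : Prop :=
  forall z, is_dz Y z ((diag_mx L + (proj z)^-1 *: A) *m Y z)
            /\ Y z \in unitmx.

(* (1 + sum_(k >= 1) F k z^-k) z^B exp(z diag(L)), with B = diag_part A, is a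
   formal solution of dY/dz = (diag(L) + A / z) Y. As B and diag(L) commute,
   this amounts to F' + F (diag(L) + B / z) = (diag(L) + A / z) F; the second
   condition is the coefficient of z^-(k+1). *)
Definition is_formal_solution L A (F : nat -> M) : Prop :=
  F 0%N = 1%:M /\
  forall k, F k *m diag_part A - k%:R *: F k + F k.+1 *m diag_mx L
            = diag_mx L *m F k.+1 + A *m F k.

(* Y ~ (1 + sum_(k >= 1) F k z^-k) z^B exp(z diag(L)) in the sector E of the
   universal covering, i.e. Y exp(-z diag(L)) z^-B has the asymptotic expansion
   1 + sum_(k >= 1) F k z^-k in all the proper closed subsectors of E. *)
Definition asymptotic_in (E : set (ucov R)) L B (F : nat -> M)
    (Y : ucov R -> M) : Prop :=
  forall a b : R, [set z : ucov R | a <= arg z <= b] `<=` E ->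
  forall N : nat, exists K rho : R, forall z : ucov R, a <= arg z <= b ->
    rho%:C <= `|proj z| ->
    `| Y z *m mexp (- (proj z *: diag_mx L)) *m zpow (- B) z
       - \sum_(k < N) (proj z) ^- k *: F k | <= K%:C * `|proj z| ^- N.

Definition is_jordan A : Prop :=
  (forall i j : 'I_n, j != i -> j != i.+1 :> nat -> A i j = 0) /\
  (forall i j : 'I_n, j = i.+1 :> nat ->
     A i j = 0 \/ A i j = 1 /\ A i i = A j j).

Definition int_diag d : M := diag_mx (map_mx (fun k : int => k%:~R) d).

(* J = D + S and the exponents of a Levelt form, D = int_diag d. The entries of
   a block of Q relative to two Jordan blocks of J are the Q a b, where J a a
   and J b b are the eigenvalues of these Jordan blocks. *)
Definition levelt_exponents J d S Q : Prop :=
  [/\ is_jordan J /\ is_jordan S, J = int_diag d + S,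
      forall a, 0 <= complex.Re (S a a) < 1,
      exists k, Q ^+ k = 0
    & forall a b, Q a b != 0 -> exists m : nat, J a a - J b b = m.+1%:R].

(* Y = G (1 + sum_(l >= 1) Psi l z^l) z^D z^(S + Q) with G^-1 A G = J. The power
   series P converges on the whole plane, as z = 0 is the only finite
   singularity of the systems considered. *)
Definition levelt_form A J d S Q (Y : ucov R -> M) : Prop :=
  exists (G : M) (Psi : nat -> M),
    [/\ G \in unitmx, invmx G *m A *m G = J, Psi 0%N = 1%:M
      & forall z, exists P : M,
          series (fun l => proj z ^+ l *: Psi l) @ \oo --> P /\
          Y z = G *m P *m zpow (int_diag d) z *m zpow (S + Q) z].

(* For the system with residue A at z = 0: B, J, D = int_diag d, S, Q are the
   exponents of the formal solution and of the solution Y0 in Levelt form,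
   St 1 and St 2 are the Stokes matrices of Y 1, Y 2, Y 3, and C0 is the
   central connection matrix. *)
Definition has_monodromy_data A (Y : nat -> ucov R -> M) (Y0 : ucov R -> M)
    B (St : nat -> M) (C0 : M) J d S Q : Prop :=
  [/\ diag_part A = B,
      forall r, (1 <= r <= 2)%N -> forall z, Y r.+1 z = Y r z *m St r,
      forall z, Y 1%N z = Y0 z *m C0,
      levelt_exponents J d S Q
    & levelt_form A J d S Q Y0].

End Systems.

Section Deformation.
Variables (R : realType) (n : nat).
Local Notation C := R[i].
Local Notation T := 'rV[C]_n.
Local Notation M := 'M[C]_n.
Implicit Types (t : T) (A : T -> M) (V : set T) (tau eps : R).

Definition polydisc eps : set T := [set t | `|t| <= eps%:C].

(* In all that follows u_a(t) is (u0 + t) 0 a. *)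
Definition coalescence (u0 : T) eps : set T :=
  [set t | polydisc eps t /\
           exists a b, a != b /\ (u0 + t) 0 a = (u0 + t) 0 b].

(* A ray of the universal covering is represented by its direction arg z. *)
Definition ray_of (c : C) (theta : R) : Prop :=
  complex.Re (c * cexp (0 +i* theta)) = 0.

Definition stokes_rays (u0 : T) t : set R :=
  [set theta | exists a b, (u0 + t) 0 a != (u0 + t) 0 b /\
                           ray_of ((u0 + t) 0 a - (u0 + t) 0 b) theta].

Definition stokes_rays0 (u0 : T) t : set R :=
  [set theta | exists a b, u0 0 a != u0 0 b /\
                           ray_of ((u0 + t) 0 a - (u0 + t) 0 b) theta].

(* delta_jk, for x = lambda_j and y = lambda_k *)
Definition delta tau (x y : C) : R :=
  2^-1 * inf (range (fun rho : R =>
    Normc.normc (y - x + (0 +i* rho) * cexp (0 -i* tau)))).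

Definition crossing (u0 : T) eps tau : set T :=
  [set t | polydisc eps t /\ stokes_rays u0 t tau].

Definition is_cell (u0 : T) eps tau (E : set T) : Prop :=
  let W := polydisc eps `\` (coalescence u0 eps `|` crossing u0 eps tau) in
  exists t, W t /\ E = connected_component W t.

Definition admissible_domain (u0 : T) eps tau V : Prop :=
  [/\ V !=set0, V `<=` polydisc eps, open V, connected V
    & exists E, is_cell u0 eps tau E /\ closure V `<=` E].

(* The open sector containing p < arg z < p + pi and extending up to the
   closest of the given rays outside; it is unbounded on a side where there is
   no ray. *)
Definition extended_sector (rays : set R) (p : R) : set (ucov R) :=
  [set z | forall theta, rays theta ->
     (theta <= p -> theta < arg z) /\ (p + pi <= theta -> arg z < theta)].

Definition Pi_start tau (r : nat) : R := tau + (r%:R - 2) * pi.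

(* S_r(closure V) *)
Definition sector (u0 : T) tau V (r : nat) : set (ucov R) :=
  \bigcap_(t in closure V) extended_sector (stokes_rays u0 t) (Pi_start tau r).

(* S^_r *)
Definition hat_sector (u0 : T) eps tau (r : nat) : set (ucov R) :=
  \bigcap_(t in polydisc eps)
    extended_sector (stokes_rays0 u0 t) (Pi_start tau r).

Definition vanishing_conditions (u0 : T) eps A : Prop :=
  forall a b, a != b ->
  forall t0, coalescence u0 eps t0 -> (u0 + t0) 0 a = (u0 + t0) 0 b ->
  let F := within (polydisc eps) (nbhs t0) in
  (fun t => A t a b) =O_F (fun t => (u0 + t) 0 a - (u0 + t) 0 b).

(* F k t is the k-th coefficient of the formal solution Y_F off Delta. *)
Definition is_formal_family (u0 : T) eps A (F : nat -> T -> M) : Prop :=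
  forall t, polydisc eps t -> ~ coalescence u0 eps t ->
    is_formal_solution (u0 + t) (A t) (F^~ t).

(* Y_r(z,t) for t in V; its holomorphy in t is Sibuya's theorem. *)
Definition canonical_solutions (u0 : T) tau A V (F : nat -> T -> M)
    (Y : nat -> T -> ucov R -> M) : Prop :=
  forall r, (1 <= r <= 3)%N ->
    (forall z, holomorphic_on V (fun t => Y r t z)) /\
    (forall t, V t ->
       is_fundamental (u0 + t) (A t) (Y r t) /\
       asymptotic_in (sector u0 tau V r) (u0 + t) (diag_part (A t)) (F^~ t)
         (Y r t)).

(* B, St, C0, J, d, S, Q do not depend on t. *)
Definition isomonodromic (u0 : T) eps tau A V (Y : nat -> T -> ucov R -> M)
    (Y0 : T -> ucov R -> M) (B : M) (St : nat -> M) (C0 J : M)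
    (d : 'rV[int]_n) (S Q : M) : Prop :=
  [/\ admissible_domain u0 eps tau V,
      exists G : T -> M, holomorphic_on V G /\
        forall t, V t -> G t \in unitmx /\ invmx (G t) *m A t *m G t = J,
      forall z, holomorphic_on V (Y0^~ z),
      forall t, V t -> is_fundamental (u0 + t) (A t) (Y0 t)
    & forall t, V t ->
        has_monodromy_data (A t) (fun r => Y r t) (Y0 t) B St C0 J d S Q].

End Deformation.

(* Main.v *)
(* Borel summation in a domain that contains the coalescence locus. On a small
   ball of V, Y(z,t+h) Y(z,t)^-1 is entire in z, because the monodromy data are
   constant, and its growth is controlled by the formal solution; this gives
   d_k F_m = [E_k, F_(m+1)] + [N1, E_k] F_m, where N1_ab = -A_ab / (u_a - u_b).
   The vanishing conditions make N1 holomorphic on a neighbourhood of the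
   polydisc. Since the equations contain no division by u_a - u_b, they extend
   every F_m holomorphically across the coalescence locus.

   The Borel transform phi of a column of the formal solution satisfies an Euler
   system (x d_x + sum_k t_k d_k) phi = M phi + g, obtained from the equation in
   x and the deformation equations, which is singular only at the points
   x = u_b - u_a with u_a(0) <> u_b(0). Hence phi extends holomorphically, and
   with polynomial growth, to the product of a neighbourhood of a sector of
   the x-plane and a ball larger than the polydisc. Laplace integrals of phi are
   the columns of solutions with the asymptotics Y_F in the large sectors,
   holomorphic in t. A fundamental solution is determined by its asymptotics on
   two opposite rays, so they continue the Y_r; the relations between the
   solutions continue by the identity theorem, and the Levelt form because the
   Laurent coefficients in z are holomorphic in t. Finally, on a ray that belongs
   to two sectors, S_ab exp((u_a - u_b) z) z^(..) is flat for a <> b, which for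
   u_a(0) = u_b(0) forces S_ab = 0 at t = 0. *)
Require Import Defs.
From HB Require Import structures.
From mathcomp Require Import all_boot all_order all_algebra.
From mathcomp Require Import all_classical all_reals all_analysis.
From mathcomp Require Import complex.
From mathcomp Require Import ring lra.
Set Implicit Arguments.
Unset Strict Implicit.
Unset Printing Implicit Defensive.
Import Order.TTheory GRing.Theory Num.Theory.
Import numFieldNormedType.Exports.
Local Open Scope classical_set_scope.
Local Open Scope ring_scope.
Local Open Scope complex_scope.

(** * Norms, limits and integrals *)

Section Norm.
Variable R : realType.
Local Notation C := R[i].
Implicit Types (U : normedModType C) (z w : C).

(** Two obstacles shape the argument. First, the asymptotics are given for each [t] of [V]
    separately, with constants depending on [t], whereas the growth argument for
    [Y(z,t+h) Y(z,t)^-1] needs them on an open set of [t]. Baire's theorem finds, for each order of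
    the expansion, a small ball where they are uniform; the identity theorem then leaves that ball.
    Second, for a coalescing pair the point [u_b - u_a] of the Borel plane runs into 0 as [t]
    approaches the coalescence locus, and the Borel equation in [x] alone degenerates. In the Euler
    operator the factor of [d_x phi_a] is [x + t_a - t_b], which for such a pair is exactly the
    singular factor [x + u_a - u_b], and it cancels. The Euler system is an ordinary equation along
    rays from the origin of [(x, t)], so its solution extends over star-shaped domains. It becomes
    contractive once a Taylor polynomial of large degree is removed; that all such removals give the
    same function yields asymptotics of every order. The strict inequality for the radius leaves a
    margin, spent on a larger polydisc and larger sectors. *)

Definition rn U (x : U) : R := complex.Re `|x|.

(** The norms are valued in [R[i]], where the order makes every nonnegative number real. All
    estimates are moved to [R], so that real arithmetic applies. *)
Lemma rnE U (x : U) : `|x| = (rn x)%:C.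
Proof.
have := normr_ge0 x; rewrite /rn; case: `|x| => a b.
by rewrite lecE /= => /andP[/eqP -> _].
Qed.

Lemma rn_le U (x : U) (K : R) : (`|x| <= K%:C) = (rn x <= K).
Proof. by rewrite rnE lecR. Qed.

Lemma rn_lt U (x : U) (K : R) : (`|x| < K%:C) = (rn x < K).
Proof. by rewrite rnE ltcR. Qed.

Lemma rn_ge0 U (x : U) : 0 <= rn x.
Proof. by rewrite -lecR -rnE normr_ge0. Qed.

Lemma rnD U (x y : U) : rn (x + y) <= rn x + rn y.
Proof. by rewrite -lecR -rnE rmorphD /= -!rnE ler_normD. Qed.

Lemma rnN U (x : U) : rn (- x) = rn x.
Proof. by rewrite /rn normrN. Qed.

Lemma rnB U (x y : U) : rn (x - y) = rn (y - x).
Proof. by rewrite /rn distrC. Qed.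

Lemma rnB_le U (x y : U) : rn (x - y) <= rn x + rn y.
Proof. by rewrite (le_trans (rnD _ _))// rnN. Qed.

Lemma rn_tri U (x y z : U) : rn (x - z) <= rn (x - y) + rn (y - z).
Proof. by rewrite (le_trans _ (rnD _ _))// addrA subrK. Qed.

Lemma rn_sub U (x y : U) : rn x <= rn y + rn (x - y).
Proof. by rewrite (le_trans _ (rnD _ _))// addrC subrK. Qed.

Lemma rnZ U (a : C) (x : U) : rn (a *: x) = rn a * rn x.
Proof. by apply: (@complexI R); rewrite rmorphM /= -!rnE normrZ. Qed.

Lemma rnM z w : rn (z * w) = rn z * rn w.
Proof. by apply: (@complexI R); rewrite rmorphM /= -!rnE normrM. Qed.

Lemma rn0 U : rn (0 : U) = 0.
Proof. by rewrite /rn normr0. Qed.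

Lemma rn_eq0 U (x : U) : (rn x == 0) = (x == 0).
Proof. by rewrite -(inj_eq (@complexI R)) -rnE normr_eq0. Qed.

Lemma rn_gt0 U (x : U) : (0 < rn x) = (x != 0).
Proof. by rewrite lt_def rn_ge0 andbT rn_eq0. Qed.

Lemma rn1 : rn (1 : C) = 1.
Proof. by rewrite /rn normr1. Qed.

Lemma rn_real (r : R) : rn (r%:C : C) = `|r|.
Proof. by rewrite /rn normc_def /= expr0n /= addr0 sqrtr_sqr. Qed.

Lemma rn_nat k : rn (k%:R : C) = k%:R.
Proof. by rewrite /rn normr_nat -(rmorph_nat (real_complex R)). Qed.

Lemma rnV z : rn z^-1 = (rn z)^-1.
Proof. by apply: (@complexI R); rewrite fmorphV /= -!rnE normfV. Qed.

Lemma rnX z k : rn (z ^+ k) = rn z ^+ k.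
Proof. by apply: (@complexI R); rewrite rmorphXn /= -!rnE normrX. Qed.

Lemma rn_sum U (I : Type) (r : seq I) (P : pred I) (F : I -> U) :
  rn (\sum_(i <- r | P i) F i) <= \sum_(i <- r | P i) rn (F i).
Proof.
by rewrite -lecR -rnE rmorph_sum /= (le_trans (ler_norm_sum _ _ _))//
  ler_sum// => i _; rewrite -rnE.
Qed.

Lemma Re_le_rn z : `|complex.Re z| <= rn z.
Proof. by rewrite -lecR -rnE normc_ge_Re. Qed.

Lemma rn_i : rn ('i : C) = 1.
Proof. by rewrite /rn normc_def /= expr0n expr1n add0r sqrtr1. Qed.

Lemma Im_le_rn z : `|complex.Im z| <= rn z.
Proof.
case: z => a b; have := Re_le_rn (- 'i * (a +i* b)).
rewrite rnM rnN rn_i mul1r; set w := _ * _.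
by have -> : complex.Re w = b by rewrite /w /=; ring.
Qed.

Lemma complex_ReIm z : z = (complex.Re z)%:C + 'i * (complex.Im z)%:C.
Proof. by case: z => a b; apply/eqP; rewrite eq_complex /=; apply/andP; split; apply/eqP; ring. Qed.

Lemma rn_ReIm z : rn z <= `|complex.Re z| + `|complex.Im z|.
Proof.
by rewrite [X in rn X]complex_ReIm (le_trans (rnD _ _))// rnM rn_i mul1r !rn_real.
Qed.

Lemma ReD z w : complex.Re (z + w) = complex.Re z + complex.Re w.
Proof. by case: z w => a b []. Qed.
Lemma ImD z w : complex.Im (z + w) = complex.Im z + complex.Im w.
Proof. by case: z w => a b []. Qed.
Lemma ReN z : complex.Re (- z) = - complex.Re z.
Proof. by case: z. Qed.
Lemma ImN z : complex.Im (- z) = - complex.Im z.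
Proof. by case: z. Qed.
Lemma ReM z w : complex.Re (z * w) =
  complex.Re z * complex.Re w - complex.Im z * complex.Im w.
Proof. by case: z w => a b []. Qed.
Lemma ImM z w : complex.Im (z * w) =
  complex.Re z * complex.Im w + complex.Im z * complex.Re w.
Proof. by case: z w => a b []. Qed.

End Norm.

Section Limits.
Variable R : realType.
Local Notation C := R[i].
Implicit Types (U : normedModType C).

(** The rank is explicit and the bound is real and not strict, so that bounds on [u] pass to the
    limit directly. *)
Definition clim U (u : nat -> U) (l : U) : Prop :=
  forall e : R, 0 < e -> exists N, forall k, (N <= k)%N -> rn (u k - l) <= e.

Lemma small_eq0 U (x : U) : (forall e : R, 0 < e -> rn x <= e) -> x = 0.
Proof.
move=> h; apply/eqP; rewrite -rn_eq0 eq_le rn_ge0 andbT.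
by apply/ler_addgt0Pl => e e0; rewrite addr0; exact: h.
Qed.

Lemma clim_unique U (u : nat -> U) l l' : clim u l -> clim u l' -> l = l'.
Proof.
move=> h h'; apply/eqP; rewrite -subr_eq0; apply/eqP; apply: small_eq0 => e e0.
have e2 : 0 < e / 2 by rewrite divr_gt0.
have [N hN] := h _ e2; have [N' hN'] := h' _ e2.
have := hN _ (leq_maxl N N'); have := hN' _ (leq_maxr N N').
set k := maxn _ _ => a b; have := rn_tri l (u k) l'.
by rewrite (rnB l (u k)); lra.
Qed.

Lemma clim_const U (l : U) : clim (fun=> l) l.
Proof. by move=> e e0; exists 0%N => k _; rewrite subrr rn0 ltW. Qed.

Lemma clim_ext U (u v : nat -> U) l : u =1 v -> clim u l -> clim v l.
Proof. by move=> uv h e /h [N hN]; exists N => k /hN; rewrite uv. Qed.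

Lemma climD U (u v : nat -> U) l m :
  clim u l -> clim v m -> clim (fun k => u k + v k) (l + m).
Proof.
move=> hu hv e e0; have e2 : 0 < e / 2 by rewrite divr_gt0.
have [N hN] := hu _ e2; have [N' hN'] := hv _ e2.
exists (maxn N N') => k; rewrite geq_max => /andP[/hN a /hN' b].
rewrite opprD addrACA (le_trans (rnD _ _))//; lra.
Qed.

Lemma climZ U (u : nat -> U) (a : C) l :
  clim u l -> clim (fun k => a *: u k) (a *: l).
Proof.
move=> hu e e0; have a0 : 0 < rn a + 1 by rewrite ltr_wpDl ?rn_ge0.
have [N hN] := hu _ (divr_gt0 e0 a0); exists N => k /hN h.
rewrite -scalerBr rnZ; rewrite ler_pdivlMr// in h.
rewrite (le_trans _ h)// mulrC ler_wpM2l ?rn_ge0//; lra.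
Qed.

Lemma climM (u : nat -> C) (a : C) l : clim u l -> clim (fun k => a * u k) (a * l).
Proof. exact: (@climZ C). Qed.

Lemma climN U (u : nat -> U) l : clim u l -> clim (fun k => - u k) (- l).
Proof.
by move=> h; rewrite -scaleN1r; apply: clim_ext (climZ (-1) h) => k; rewrite scaleN1r.
Qed.

Lemma climB U (u v : nat -> U) l m :
  clim u l -> clim v m -> clim (fun k => u k - v k) (l - m).
Proof. by move=> hu hv; apply: climD => //; exact: climN. Qed.

Lemma clim_sum U (I : Type) (r : seq I) (u : nat -> I -> U) (l : I -> U) :
  (forall i, clim (u^~ i) (l i)) ->
  clim (fun k => \sum_(i <- r) u k i) (\sum_(i <- r) l i).
Proof.
move=> h; elim: r => [|i r IH].
  by rewrite big_nil; apply: clim_ext (clim_const 0) => k; rewrite big_nil.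
by rewrite big_cons; apply: clim_ext (climD (h i) IH) => k; rewrite big_cons.
Qed.

Lemma clim_le U (u : nat -> U) l K :
  clim u l -> (forall k, rn (u k) <= K) -> rn l <= K.
Proof.
move=> h hK; apply/ler_addgt0Pl => e /h [N /(_ _ (leqnn _)) hN].
have := rn_sub l (u N); rewrite (rnB l); have := hK N; lra.
Qed.

Lemma clim_shift U (u : nat -> U) l m : clim u l -> clim (fun k => u (k + m)%N) l.
Proof.
move=> h e /h [N hN]; exists N => k Nk; apply: hN.
by rewrite (leq_trans Nk)// leq_addr.
Qed.

Lemma nat_above (x : R) : exists N : nat, x <= N%:R.
Proof.
exists (Num.bound `|x|); apply: le_trans (ler_norm x) _.
by apply: ltW; exact: archi_boundP.
Qed.

Lemma clim_bound U (u : nat -> U) l (b : nat -> R) (K : R) :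
  (forall k, rn (u k - l) <= b k) -> (forall k, b k <= K / k.+1%:R) -> clim u l.
Proof.
move=> h hb e e0; have [N hN] := nat_above (K / e).
exists N => k Nk; rewrite (le_trans (h _))// (le_trans (hb _))//.
rewrite ler_pdivrMr ?ltr0n// -ler_pdivrMl// mulrC (le_trans hN)//.
by rewrite ler_nat (leq_trans Nk).
Qed.

Lemma real_cauchy (u : nat -> R) :
  (forall e : R, 0 < e -> exists N, forall k l, (N <= k)%N -> (N <= l)%N ->
     `|u k - u l| <= e) ->
  exists l, forall e : R, 0 < e -> exists N, forall k, (N <= k)%N -> `|u k - l| <= e.
Proof.
move=> h; have : cvg (u @ \oo).
  apply/cauchy_cvgP; apply: cauchy_exP => e e0.
  have [N hN] := h _ (divr_gt0 e0 (@ltr0n R 2)).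
  exists (u N); exists N => // k /= Nk; rewrite /ball /=.
  by rewrite (le_lt_trans (hN _ _ _ _))//; lra.
move=> /cvgrPdist_le cu; exists (lim (u @ \oo)) => e /cu [N _ hN].
by exists N => k Nk; rewrite distrC; exact: hN.
Qed.

Lemma clim_cauchy (u : nat -> C) :
  (forall e : R, 0 < e -> exists N, forall k l, (N <= k)%N -> (N <= l)%N ->
     rn (u k - u l) <= e) ->
  exists l, clim u l.
Proof.
move=> h.
have [a ha] : exists l, forall e : R, 0 < e -> exists N, forall k, (N <= k)%N -> `|complex.Re (u k) - l| <= e.
  apply: real_cauchy => e /h [N hN]; exists N => k l Nk Nl.
  by rewrite -ReN -ReD (le_trans (Re_le_rn _))// hN.
have [b hb] : exists l, forall e : R, 0 < e -> exists N, forall k, (N <= k)%N -> `|complex.Im (u k) - l| <= e.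
  apply: real_cauchy => e /h [N hN]; exists N => k l Nk Nl.
  by rewrite -ImN -ImD (le_trans (Im_le_rn _))// hN.
exists (a +i* b) => e e0; have e2 : 0 < e / 2 by rewrite divr_gt0.
have [N hN] := ha _ e2; have [N' hN'] := hb _ e2.
exists (maxn N N') => k; rewrite geq_max => /andP[/hN x /hN' y].
by rewrite (le_trans (rn_ReIm _))// ReD ReN ImD ImN /=; lra.
Qed.

End Limits.

(** * Complex-valued functions of a real variable *)

Section RealVariable.
Variable R : realType.
Local Notation C := R[i].

Definition rder (f : R -> C) (x : R) (l : C) : Prop :=
  forall e : R, 0 < e -> exists2 d : R, 0 < d & forall h : R, `|h| < d ->
    rn (f (x + h) - f x - h%:C * l) <= e * `|h|.

Lemma real_is_derive (f : R -> R) (x l : R) :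
  (forall e : R, 0 < e -> exists2 d : R, 0 < d & forall h : R, `|h| < d ->
    `|f (x + h) - f x - h * l| <= e * `|h|) -> is_derive x 1 f l.
Proof.
move=> h.
have cv : (fun h0 : R => h0^-1 *: ((f \o shift x) (h0 *: (1:R)) - f x)) @ 0^' --> l.
  apply/cvgrPdist_le => e /h [d d0 hd].
  near=> k; have k0 : k != 0 by near: k; exact: nbhs_dnbhs_neq.
  have kd : `|k| < d.
    near: k; rewrite near_withinE; exists d => //= y.
    by rewrite /ball /= sub0r normrN.
  have := hd _ kd; rewrite /= /GRing.scale /= mulr1 (addrC k) => hk.
  rewrite -(ler_pM2l (_ : 0 < `|k|)) ?normr_gt0// -normrM.
  rewrite (mulrC `|k| e) -normrN (le_trans _ hk)// le_eqVlt; apply/orP; left; apply/eqP; congr `|_|.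
  by field.
apply: DeriveDef; first exact: cvgP cv.
exact: cvg_lim.
Unshelve. all: by end_near.
Qed.

(** There is no mean value theorem for complex values, so [f] is projected on the direction of
    [D = f b - f a]: the real function [Re(D^* f) - |D| m] has a nonpositive derivative, whence
    [|D|^2 <= |D| (m b - m a)]. *)
Lemma rmvi (f f' : R -> C) (m m' : R -> R) (a b : R) : a <= b ->
  (forall x, a <= x <= b -> rder f x (f' x)) ->
  (forall x, a <= x <= b -> is_derive x 1 m (m' x)) ->
  (forall x, a <= x <= b -> rn (f' x) <= m' x) ->
  rn (f b - f a) <= m b - m a.
Proof.
rewrite le_eqVlt => /predU1P[-> _ _ _|ab hf hm hle]; first by rewrite !subrr rn0.
pose D : C := f b - f a; pose g x := complex.Re (D^* * f x) - rn D * m x.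
pose g' x := complex.Re (D^* * f' x) - rn D * m' x.
have hg x : a <= x <= b -> is_derive x 1 g (g' x).
  move=> xab; have hRe : is_derive x (1:R) (fun x => complex.Re (D^* * f x)) (complex.Re (D^* * f' x)).
    apply: real_is_derive => e e0.
    have D1 : 0 < rn D + 1 by rewrite ltr_wpDl ?rn_ge0.
    have [d d0 hd] := hf _ xab _ (divr_gt0 e0 D1); exists d => // h /hd hh.
    have -> : complex.Re (D^* * f (x + h)) - complex.Re (D^* * f x) - h * complex.Re (D^* * f' x) =
      complex.Re (D^* * (f (x + h) - f x - h%:C * f' x)).
      by rewrite !(ReM, ReD, ReN, ImD, ImN, ImM) /=; ring.
    rewrite (le_trans (Re_le_rn _))// rnM.
    have -> : rn (D^* : C) = rn D by rewrite /rn normcJ.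
    move: hh; rewrite mulrAC ler_pdivlMr// => hh.
    rewrite (le_trans _ hh)// mulrC ler_wpM2l ?rn_ge0//; lra.
  have hm1 := hm _ xab; rewrite /g /g'.
  exact: is_deriveB.
have cg : {within `[a, b], continuous g}.
  apply: derivable_within_continuous => x; rewrite in_itv /= => xab.
  by have [] := hg _ xab.
have hg1 : forall x, x \in `]a, b[ -> is_derive x 1 g (g' x).
  move=> x; rewrite in_itv /= => /andP[/ltW ax /ltW xb]; apply: hg; exact/andP.
have [c cab gE] := MVT ab hg1 cg.
have cab' : a <= c <= b.
  by move: cab; rewrite in_itv /= => /andP[/ltW -> /ltW ->].
have gle : g b - g a <= 0.
  rewrite gE pmulr_lle0 ?subr_gt0// subr_le0 (le_trans (ler_norm _))//.
  rewrite (le_trans (Re_le_rn _))// rnM.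
  have -> : rn (D^* : C) = rn D by rewrite /rn normcJ.
  by rewrite ler_wpM2l ?rn_ge0// hle.
have DE : complex.Re (D^* * D) = rn D ^+ 2.
  apply: (@complexI R); rewrite rmorphXn /= -rnE sqr_normc mulrC.
  by case: (D) => x y; apply/eqP; rewrite eq_complex /=; apply/andP; split; apply/eqP; ring.
(* For [D = 0] nothing can be cancelled; the claim is then that [m] does not decrease, which follows
   from [0 <= |f'| <= m']. *)
have [D0|D0] := eqVneq (rn D) 0.
  rewrite -/D D0.
  have cm : {within `[a, b], continuous m}.
    apply: derivable_within_continuous => x; rewrite in_itv /= => xab.
    by have [] := hm _ xab.
  have hm1 : forall x, x \in `]a, b[ -> is_derive x 1 m (m' x).
    move=> x; rewrite in_itv /= => /andP[/ltW ax /ltW xb]; apply: hm; exact/andP.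
  have [y yab ->] := MVT ab hm1 cm.
  rewrite mulr_ge0 ?subr_ge0 ?(ltW ab)//; apply: le_trans (hle y _); first exact: rn_ge0.
  by move: yab; rewrite in_itv /= => /andP[/ltW -> /ltW ->].
have Dp : 0 < rn D by rewrite lt_def D0 rn_ge0.
rewrite -/D -(ler_pM2l Dp) -expr2 -DE.
suff -> : D^* * D = D^* * f b - D^* * f a.
  by move: gle; rewrite /g ReD ReN; set x := complex.Re _; set y := complex.Re _; lra.
by rewrite /D; ring.
Qed.

Lemma rmvi_le (f f' : R -> C) (K a b : R) : a <= b ->
  (forall x, a <= x <= b -> rder f x (f' x)) ->
  (forall x, a <= x <= b -> rn (f' x) <= K) ->
  rn (f b - f a) <= K * (b - a).
Proof.
move=> ab hf hK.
have := @rmvi f f' (fun x => K * x) (fun=> K) a b ab hf _ hK.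
rewrite -mulrBr; apply=> x _.
have h : is_derive x 1 (K \*: @id R) (K *: 1) by exact: is_deriveZ.
by move: h; rewrite /GRing.scale /= mulr1.
Qed.

Lemma rder_ext (f g : R -> C) x l : f =1 g -> rder f x l -> rder g x l.
Proof. by move=> fg h e /h [d d0 hd]; exists d => // k /hd; rewrite !fg. Qed.

Lemma rder_affine (f : R -> C) (a c x : R) l :
  rder f (a + c * x) l -> rder (fun s => f (a + c * s)) x (c%:C * l).
Proof.
move=> h e e0; have c1 : 0 < `|c| + 1 by rewrite ltr_wpDl.
have [d d0 hd] := h _ (divr_gt0 e0 c1); exists (d / (`|c| + 1)); first exact: divr_gt0.
move=> k; rewrite ltr_pdivlMr// => kd.
have ck : `|c * k| < d.
  rewrite normrM (le_lt_trans _ kd)// mulrC ler_wpM2l//; lra.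
have := hd _ ck; rewrite mulrDr addrA rmorphM /= => h1.
rewrite (_ : k%:C * _ = c%:C * k%:C * l); last by ring.
rewrite (le_trans h1)// normrM.
have -> : e / (`|c| + 1) * (`|c| * `|k|) = e * `|k| * (`|c| / (`|c| + 1)) by ring.
by rewrite ler_piMr ?mulr_ge0 ?(ltW e0)// ler_pdivrMr//; lra.
Qed.

Lemma rder_cont (f : R -> C) x l : rder f x l ->
  forall e : R, 0 < e -> exists2 d, 0 < d & forall y, `|y - x| < d -> rn (f y - f x) <= e.
Proof.
move=> h e e0; have [d d0 hd] := h _ ltr01.
have l1 : 0 < rn l + 1 by rewrite ltr_wpDl ?rn_ge0.
exists (Num.min d (e / (rn l + 1))); first by rewrite lt_min d0 divr_gt0.
move=> y; rewrite lt_min => /andP[/hd]; rewrite (addrC x) subrK mul1r => h1.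
rewrite ltr_pdivlMr// => h2; rewrite (le_trans (rn_sub _ ((y - x)%:C * l)))// rnM rn_real.
by move: h1 h2; set a := `|_|; set b := rn _; set c := rn _; rewrite mulrDr; lra.
Qed.

End RealVariable.

(** * The integral over [0, 1] *)

Section Integral.
Variable R : realType.
Local Notation C := R[i].
Implicit Types (f g : R -> C).

(** The supremum of the [x] with [P 0 x] has the property itself and cannot be below 1, by the local
    hypothesis there. This form of the compactness of [0, 1] stands in for finite subcovers in
    [heine], [tube] and [identity_segment]. *)
Lemma cousin (P : R -> R -> Prop) :
  (forall a c b, 0 <= a <= c -> c <= b <= 1 -> P a c -> P c b -> P a b) ->
  (forall s, 0 <= s <= 1 -> exists2 d, 0 < d & forall a b, 0 <= a -> b <= 1 ->
     a <= s <= b -> b - a < d -> P a b) ->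
  P 0 1.
Proof.
move=> hcat hloc; pose S := [set x | 0 <= x <= 1 /\ P 0 x].
have S0 : S 0.
  have [|d d0 hd] := hloc 0; first by rewrite lexx ler01.
  split; first by rewrite lexx ler01.
  by apply: hd; rewrite ?lexx ?ler01 ?subrr.
have bS : has_sup S.
  by split; [exists 0 | exists 1 => x [/andP[]]].
pose t := sup S; have t0 : 0 <= t by apply: (ub_le_sup bS.2).
have t1 : t <= 1 by apply: ge_sup; [exists 0 | move=> x [/andP[]]].
have [|d d0 hd] := hloc t; first by rewrite t0.
have d2 : 0 < d / 2 by rewrite divr_gt0.
have [x [/andP[x0 x1] Px] tx] := sup_adherent d2 bS; rewrite -/t in tx.
have xt : x <= t by apply: (ub_le_sup bS.2); split; rewrite ?x0.
pose y := Num.min 1 (t + d / 4).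
have y1 : y <= 1 by rewrite ge_min lexx.
have ty : t <= y by rewrite le_min t1 lerDl divr_ge0// ltW.
have yd : y <= t + d / 4 by rewrite ge_min lexx orbT.
have Sy : S y.
  split; first by rewrite y1 (le_trans t0 ty).
  apply: (hcat _ x) => //; first by rewrite lexx.
    by rewrite y1 (le_trans xt ty).
  apply: hd => //; first by rewrite xt.
  lra.
have yt : y <= t by apply: (ub_le_sup bS.2).
have e1 : y = 1.
  by move: yt; rewrite /y; case: (leP 1 (t + d / 4)) => // _; lra.
by rewrite -e1; case: Sy.
Qed.

Definition cont01 f := forall s, 0 <= s <= 1 -> forall e : R, 0 < e ->
  exists2 d : R, 0 < d & forall s', 0 <= s' <= 1 -> `|s' - s| < d -> rn (f s' - f s) <= e.

(** In the interval property only [s] is confined to the interval while [s'] ranges over [0, 1], so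
    the common endpoint of two intervals causes no trouble. *)
Lemma heine f : cont01 f -> forall e : R, 0 < e -> exists2 d : R, 0 < d &
  forall s s', 0 <= s <= 1 -> 0 <= s' <= 1 -> `|s - s'| < d -> rn (f s - f s') <= e.
Proof.
move=> cf e e0.
have := @cousin (fun a b => exists2 d : R, 0 < d &
  forall s s', a <= s <= b -> 0 <= s' <= 1 -> `|s - s'| < d -> rn (f s - f s') <= e).
apply.
  move=> a c b _ _ [d d0 hd] [d' d0' hd']; exists (Num.min d d'); first by rewrite lt_min d0.
  move=> s s' /andP[as_ sb] s1; rewrite lt_min => /andP[h1 h2].
  by have [sc|cs] := leP s c; [apply: hd | apply: hd'] => //; rewrite ?as_ ?sb// ltW.
move=> s s1; have [d d0 hd] := cf _ s1 _ (divr_gt0 e0 (@ltr0n R 2)).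
have d2 : 0 < d / 2 by rewrite divr_gt0.
exists (d / 2) => // a b a0 b1 /andP[as_ sb] ab; exists (d / 2) => // u v /andP[au ub] v1 uv.
have u1 : 0 <= u <= 1 by rewrite (le_trans a0 au) (le_trans ub b1).
have su : `|u - s| < d / 2 by rewrite ltr_norml; apply/andP; split; lra.
have h1 := hd u u1; have h2 := hd v v1.
have sv : `|v - s| < d.
  have -> : v - s = (u - s) - (u - v) by ring.
  by rewrite (le_lt_trans (ler_normB _ _))//; lra.
rewrite (le_trans (rn_tri _ (f s) _))// (rnB (f s)).
by move: (h1 ltac:(lra)) (h2 sv); lra.
Qed.

(** The mean of [f] over the left endpoints of the dyadic intervals of length [2^-k]. Halving from
    outside makes it split by computation into the sums over the two halves, so that properties
    follow by induction with [f] rescaled. *)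
Fixpoint rsum k f : C := if k is k'.+1 then
  2^-1 * (rsum k' (fun s => f (s / 2)) + rsum k' (fun s => f ((1 + s) / 2))) else f 0.

Lemma rsum_bound k f K : (forall s, 0 <= s <= 1 -> rn (f s) <= K) -> rn (rsum k f) <= K.
Proof.
elim: k f => [|k IH] f h /=; first by apply: h; rewrite lexx ler01.
have a := IH (fun s => f (s / 2)) ltac:(move=> s s1; apply: h; lra).
have b := IH (fun s => f ((1 + s) / 2)) ltac:(move=> s s1; apply: h; lra).
rewrite rnM rnV rn_nat ler_pdivrMl// (le_trans (rnD _ _))//; lra.
Qed.

Lemma rsumD k f g : rsum k (fun s => f s + g s) = rsum k f + rsum k g.
Proof.
elim: k f g => [//|k IH] f g /=.
by rewrite (IH (fun s => f (s / 2))) (IH (fun s => f ((1 + s) / 2))); ring.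
Qed.

Lemma rsumZ k (a : C) f : rsum k (fun s => a * f s) = a * rsum k f.
Proof.
elim: k f => [//|k IH] f /=.
by rewrite (IH (fun s => f (s / 2))) (IH (fun s => f ((1 + s) / 2))); ring.
Qed.

Lemma rsum_const k (a : C) : rsum k (fun=> a) = a.
Proof. by elim: k => [//|k IH] /=; rewrite IH; field. Qed.

Lemma rsumB k f g : rsum k (fun s => f s - g s) = rsum k f - rsum k g.
Proof.
rewrite -mulN1r -rsumZ -rsumD; congr (rsum _ _).
by apply/funext => s; rewrite mulN1r.
Qed.

Lemma rsum_eq k f g : (forall s, 0 <= s <= 1 -> f s = g s) -> rsum k f = rsum k g.
Proof.
elim: k f g => [|k IH] f g h /=; first by apply: h; rewrite lexx ler01.
congr (_ * (_ + _)); apply: IH => s s1; apply: h; lra.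
Qed.

Lemma dist_half (s s' d : R) : `|s - s'| <= 2 * d -> `|s / 2 - s' / 2| <= d.
Proof. by rewrite -mulrBl normrM [`|2^-1|]gtr0_norm ?invr_gt0//; lra. Qed.

Lemma dist_half1 (s s' d : R) : `|s - s'| <= 2 * d -> `|(1 + s) / 2 - (1 + s') / 2| <= d.
Proof.
move=> /dist_half; rewrite (_ : s / 2 - s' / 2 = (1 + s) / 2 - (1 + s') / 2)//; ring.
Qed.

(** Restricting to a half and rescaling doubles the modulus [d], so the induction ends with [k = 0]
    and [d >= 1], where all of [0, 1] is within [d] of 0. *)
Lemma rsum_osc k m f (d e : R) : 2^-1 ^+ k <= d ->
  (forall s s', 0 <= s <= 1 -> 0 <= s' <= 1 -> `|s - s'| <= d -> rn (f s - f s') <= e) ->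
  rn (rsum (k + m) f - rsum k f) <= e.
Proof.
elim: k f d => [|k IH] f d hd h.
  rewrite add0n /= -(rsum_const m (f 0)) -rsumB; apply: rsum_bound => s s1.
  apply: h => //; first by rewrite lexx ler01.
  by rewrite subr0 ger0_norm; move: hd; rewrite expr0; lra.
rewrite addSn /= -mulrBr rnM rnV rn_nat ler_pdivrMl//.
have h2 : 2^-1 ^+ k <= 2 * d :> R by move: hd; rewrite exprS; lra.
have a := IH (fun s => f (s / 2)) _ h2 ltac:(move=> s s' s1 s1' ss; apply: h; try lra; exact: dist_half).
have b := IH (fun s => f ((1 + s) / 2)) _ h2 ltac:(move=> s s' s1 s1' ss; apply: h; try lra; exact: dist_half1).
rewrite opprD addrACA (le_trans (rnD _ _))//; lra.
Qed.

Lemma half_small (d : R) : 0 < d -> exists k, 2^-1 ^+ k < d.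
Proof.
move=> d0; have [k hk] := nat_above (d^-1); exists k.
rewrite exprVn invf_plt ?posrE ?exprn_gt0// (le_lt_trans hk)//.
by rewrite -natrX ltr_nat ltn_expl.
Qed.

(* The integral over [0, 1], which is 0 if the dyadic Riemann sums do not converge. *)
Definition cint f : C := xget 0 (clim (rsum^~ f)).

Lemma rsum_near f (e : R) : cont01 f -> 0 < e -> exists k0, forall k m, (k0 <= k)%N ->
  rn (rsum (k + m) f - rsum k f) <= e.
Proof.
move=> cf e0; have [d d0 hd] := heine cf e0; have [k hk] := half_small d0.
exists k => k1 m kk; apply: (@rsum_osc _ _ _ (2^-1 ^+ k1)) => // s s' s1 s1' ss.
apply: hd => //; apply: le_lt_trans ss (le_lt_trans _ hk).
by rewrite ler_wiXn2l// invr_le1// ?unitfE// ler1n.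
Qed.

Lemma cintP f : cont01 f -> clim (rsum^~ f) (cint f).
Proof.
move=> cf; apply: xgetPex; apply: clim_cauchy => e e0.
have [k0 h] := rsum_near cf (divr_gt0 e0 (@ltr0n R 2)).
exists k0 => k l Nk Nl.
have := h k0 (k - k0)%N (leqnn _); have := h k0 (l - k0)%N (leqnn _).
rewrite !subnKC// => a b; rewrite (le_trans (rn_tri _ (rsum k0 f) _))// (rnB (rsum k0 f)); lra.
Qed.

Lemma cint_lim f l : clim (rsum^~ f) l -> cint f = l.
Proof.
move=> h; have h' : clim (rsum^~ f) (cint f) by apply: xgetPex; exists l.
exact: clim_unique h' h.
Qed.

Lemma cint_bound f K : cont01 f -> (forall s, 0 <= s <= 1 -> rn (f s) <= K) -> rn (cint f) <= K.
Proof. by move=> cf h; apply: clim_le (cintP cf) _ => k; exact: rsum_bound. Qed.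

Lemma cintD f g : cont01 f -> cont01 g -> cint (fun s => f s + g s) = cint f + cint g.
Proof.
move=> cf cg; apply: cint_lim; apply: clim_ext (climD (cintP cf) (cintP cg)) => k.
by rewrite rsumD.
Qed.

Lemma cintZ (a : C) f : cont01 f -> cint (fun s => a * f s) = a * cint f.
Proof.
move=> cf; apply: cint_lim; apply: clim_ext (climM a (cintP cf)) => k.
by rewrite rsumZ.
Qed.

Lemma cint_eq f g : (forall s, 0 <= s <= 1 -> f s = g s) -> cint f = cint g.
Proof.
move=> h; rewrite /cint; congr (xget _ (clim _)); apply/funext => k; exact: rsum_eq.
Qed.

Lemma cont01D f g : cont01 f -> cont01 g -> cont01 (fun s => f s + g s).
Proof.
move=> cf cg s s1 e e0; have e2 : 0 < e / 2 by rewrite divr_gt0.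
have [d d0 hd] := cf _ s1 _ e2; have [d' d0' hd'] := cg _ s1 _ e2.
exists (Num.min d d'); first by rewrite lt_min d0.
move=> s' s1'; rewrite lt_min => /andP[/(hd _ s1') a /(hd' _ s1') b].
rewrite opprD addrACA (le_trans (rnD _ _))//; lra.
Qed.

Lemma cont01Z (a : C) f : cont01 f -> cont01 (fun s => a * f s).
Proof.
move=> cf s s1 e e0; have a0 : 0 < rn a + 1 by rewrite ltr_wpDl ?rn_ge0.
have [d d0 hd] := cf _ s1 _ (divr_gt0 e0 a0); exists d => // s' s1' /(hd _ s1') h.
rewrite -mulrBr rnM; rewrite ler_pdivlMr// in h.
rewrite (le_trans _ h)// mulrC ler_wpM2l ?rn_ge0//; lra.
Qed.

Lemma cintB f g : cont01 f -> cont01 g -> cint (fun s => f s - g s) = cint f - cint g.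
Proof.
move=> cf cg; rewrite -mulN1r -cintZ// -cintD//; last exact: cont01Z.
by apply: cint_eq => s _; rewrite mulN1r.
Qed.

Lemma rder_cont01 f f' : (forall s, 0 <= s <= 1 -> rder f s (f' s)) -> cont01 f.
Proof.
move=> h s s1 e e0; have [d d0 hd] := rder_cont (h _ s1) e0.
by exists d => // s' _ /hd.
Qed.

Lemma cont01_affine f (a c : R) : 0 <= a -> 0 <= c -> a + c <= 1 ->
  cont01 f -> cont01 (fun s => f (a + c * s)).
Proof.
move=> a0 c0 ac cf s /andP[s0 s1].
have hs u : 0 <= u <= 1 -> 0 <= a + c * u <= 1.
  move=> /andP[u0 u1]; rewrite addr_ge0 ?mulr_ge0//= (le_trans _ ac)// lerD2l.
  by rewrite -[leRHS]mulr1 ler_wpM2l.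
move=> e e0; have [|d d0 hd] := cf (a + c * s) _ _ e0; first by apply: hs; rewrite s0.
exists d => // s' s1' ss; apply: hd; first exact: hs.
rewrite (_ : _ - _ = c * (s' - s)); last by ring.
rewrite normrM (le_lt_trans _ ss)// -[leRHS]mul1r ler_wpM2r// ger0_norm//; lra.
Qed.

Lemma cint_split f : cont01 f ->
  cint f = 2^-1 * (cint (fun s => f (s / 2)) + cint (fun s => f ((1 + s) / 2))).
Proof.
move=> cf.
have c1 : cont01 (fun s => f (s / 2)).
  have := @cont01_affine f 0 (2^-1) _ _ _ cf; rewrite add0r invr_ge0 => /(_ (lexx _) (ler0n _ _)).
  rewrite invf_le1// ler1n => /(_ isT); congr cont01; apply/funext => s; congr f; ring.
have c2 : cont01 (fun s => f ((1 + s) / 2)).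
  have := @cont01_affine f (2^-1) (2^-1) _ _ _ cf; rewrite invr_ge0 => /(_ (ler0n _ _) (ler0n _ _)).
  move=> /(_ ltac:(lra)); congr cont01; apply/funext => s; congr f; ring.
have h := climM (2^-1) (climD (cintP c1) (cintP c2)).
by apply: clim_unique h; have := clim_shift 1 (cintP cf); apply: clim_ext => k; rewrite addn1.
Qed.

(** The modulus doubles as in [rsum_osc], and the error for [0, 1] is the mean of the errors for the
    halves, with the primitives [2 F(s / 2)] and [2 F((1 + s) / 2)]. At depth 0 it is the mean value
    inequality for [F s - s f 0]. *)
Lemma cint_ftc F f : cont01 f -> (forall s, 0 <= s <= 1 -> rder F s (f s)) ->
  cint f = F 1 - F 0.
Proof.
move=> cf hF; apply: cint_lim => e e0.
have [d d0 hd] := heine cf e0; have [k0 hk] := half_small d0.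
suff H : forall k F f (d' : R), (forall s, 0 <= s <= 1 -> rder F s (f s)) -> 2^-1 ^+ k <= d' ->
    (forall s s', 0 <= s <= 1 -> 0 <= s' <= 1 -> `|s - s'| <= d' -> rn (f s - f s') <= e) ->
    rn (rsum k f - (F 1 - F 0)) <= e.
  exists k0 => k kk; apply: (H k _ _ (2^-1 ^+ k)) => // s s' s1 s1' ss; apply: hd => //.
  apply: le_lt_trans ss (le_lt_trans _ hk).
  by rewrite ler_wiXn2l// invr_le1// ?unitfE// ler1n.
clear cf hF hd F f; elim=> [|k IH] F f d' hF kd h /=.
  rewrite rnB (_ : _ - _ = (F 1 - 1%:C * f 0) - (F 0 - 0%:C * f 0)); last by rewrite rmorph1 rmorph0; ring.
  have := @rmvi_le R (fun s => F s - s%:C * f 0) (fun s => f s - f 0) e 0 1 ler01.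
  rewrite subr0 mulr1; apply.
    move=> s s1 e1 /(hF _ s1) [d1 d10 hd1]; exists d1 => // h1 /hd1; congr (rn _ <= _).
    by rewrite rmorphD /=; ring.
  move=> s s1; apply: h => //; first by rewrite lexx ler01.
  by rewrite subr0 ger0_norm; move: kd; rewrite expr0; lra.
have h2 : 2^-1 ^+ k <= 2 * d' :> R by move: kd; rewrite exprS; lra.
have ha := IH (fun s => 2 * F (s / 2)) (fun s => f (s / 2)) _ _ h2.
have hb := IH (fun s => 2 * F ((1 + s) / 2)) (fun s => f ((1 + s) / 2)) _ _ h2.
have rd (c s : R) l : rder F (c + 2^-1 * s) l -> rder (fun s => 2 * F (c + 2^-1 * s)) s l.
  move=> /rder_affine hr e1 e10; have [d1 d10 hd1] := hr _ (divr_gt0 e10 (@ltr0n R 2)).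
  exists d1 => // u /hd1; rewrite -mulrBr.
  rewrite (_ : 2 * (F (c + 2^-1 * (s + u)) - F (c + 2^-1 * s)) - u%:C * l =
    2 * (F (c + 2^-1 * (s + u)) - F (c + 2^-1 * s) - u%:C * ((2^-1)%:C * l))).
    by rewrite [X in _ -> X <= _]rnM rn_nat => hh; move: hh; set y := rn _; lra.
  have -> : (2^-1 : R)%:C = 2^-1 :> C by rewrite fmorphV rmorph_nat.
  by field.
have a := ha _ _; have b := hb _ _.
rewrite (_ : _ - _ = 2^-1 * ((rsum k (fun s => f (s / 2)) - (2 * F (1 / 2) - 2 * F (0 / 2))) +
  (rsum k (fun s => f ((1 + s) / 2)) - (2 * F ((1 + 1) / 2) - 2 * F ((1 + 0) / 2))))); last first.
  rewrite !mul0r addr0 (_ : (1 + 1) / 2 = 1 :> R) ?divff//; by field.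
rewrite rnM rnV rn_nat ler_pdivrMl// (le_trans (rnD _ _))//.
have -> : 2 * e = e + e by ring.
apply: lerD.
- apply: a => [s s1|s s' s1 s1' ss].
    have hs : 0 <= 0 + 2^-1 * s <= 1 by lra.
    have := rd 0 s _ (hF _ hs); rewrite add0r (mulrC _ s).
    by apply: rder_ext => u; rewrite add0r (mulrC _ u).
  by apply: h; [lra..|exact: dist_half].
- apply: b => [s s1|s s' s1 s1' ss].
    have hs : 0 <= 1 / 2 + 2^-1 * s <= 1 by lra.
    have := rd (1/2) s _ (hF _ hs).
    rewrite (_ : 1 / 2 + 2^-1 * s = (1 + s) / 2); last by field.
    by apply: rder_ext => u; congr (_ * F _); field.
  by apply: h; [lra..|exact: dist_half1].
Qed.

End Integral.

(** * Holomorphic functions on normed modules *)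

Section Holomorphic.
Variable R : realType.
Local Notation C := R[i].
Implicit Types (U : normedModType C).

(** Complex Frechet differentiability, with the derivative as a plain function required to be linear
    and bounded. Over arbitrary normed modules one theory covers functions of [z], of [t] and of
    pairs. *)
Definition isd U (f : U -> C) (x : U) (L : U -> C) : Prop :=
  [/\ forall a u v, L (a *: u + v) = a * L u + L v,
      exists2 K, 0 <= K & forall u, rn (L u) <= K * rn u
    & forall e : R, 0 < e -> exists2 d, 0 < d &
        forall h, rn h < d -> rn (f (x + h) - f x - L h) <= e * rn h].

Definition hol U (f : U -> C) (x : U) : Prop := exists L, isd f x L.

Definition dd U (f : U -> C) (x : U) : U -> C := xget (fun=> 0) (isd f x).

Lemma isd_unique U (f : U -> C) x L L' : isd f x L -> isd f x L' -> L = L'.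
Proof.
move=> [lL _ hL] [lL' _ hL']; apply/funext => h.
have L0 : L 0 = 0 by have := lL (-1) 0 0; rewrite scaler0 addr0 mulN1r addNr.
have L0' : L' 0 = 0 by have := lL' (-1) 0 0; rewrite scaler0 addr0 mulN1r addNr.
have [->|h0] := eqVneq h 0; first by rewrite L0 L0'.
have hp : 0 < rn h by rewrite rn_gt0.
apply/eqP; rewrite -subr_eq0; apply/eqP; apply: small_eq0 => e e0.
have e2 : 0 < e / 2 / rn h by rewrite !divr_gt0.
have [d d0 hd] := hL _ e2; have [d' d0' hd'] := hL' _ e2.
pose m := Num.min d d' / 2 / rn h.
have m0 : 0 < m by rewrite !divr_gt0// lt_min d0.
have mh : rn (m%:C *: h) = Num.min d d' / 2.
  by rewrite rnZ rn_real gtr0_norm// divfK// gt_eqF.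
have mn : Num.min d d' <= d /\ Num.min d d' <= d' by rewrite !ge_min !lexx orbT.
have mp : 0 < Num.min d d' by rewrite lt_min d0.
have a := hd (m%:C *: h) ltac:(rewrite mh; lra).
have b := hd' (m%:C *: h) ltac:(rewrite mh; lra).
have c := rn_tri (L (m%:C *: h)) (f (x + m%:C *: h) - f x) (L' (m%:C *: h)).
rewrite (rnB (L (m%:C *: h)) (f (x + m%:C *: h) - f x)) in c.
have La : L (m%:C *: h) = m%:C * L h by have := lL m%:C h 0; rewrite addr0 L0 addr0.
have Lb : L' (m%:C *: h) = m%:C * L' h by have := lL' m%:C h 0; rewrite addr0 L0' addr0.
have := le_trans c (lerD a b).
rewrite La Lb -mulrBr rnM rn_real rnZ rn_real gtr0_norm//.
have -> : e / 2 / rn h * (m * rn h) + e / 2 / rn h * (m * rn h) = m * e by field; exact: lt0r_neq0.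
by rewrite ler_pM2l.
Qed.

Lemma ddP U (f : U -> C) x : hol f x -> isd f x (dd f x).
Proof. by move=> h; exact: xgetPex. Qed.

Lemma ddE U (f : U -> C) x L : isd f x L -> dd f x = L.
Proof. by move=> h; apply: (isd_unique _ h); apply: ddP; exists L. Qed.

Lemma isd_lin0 U (f : U -> C) x L : isd f x L -> L 0 = 0.
Proof. by case=> lL _ _; have := lL (-1) 0 0; rewrite scaler0 addr0 mulN1r addNr. Qed.

Lemma isd_linZ U (f : U -> C) x L a u : isd f x L -> L (a *: u) = a * L u.
Proof. by move=> h; have := isd_lin0 h; case: h => lL _ _ L0; have := lL a u 0; rewrite !addr0 L0 addr0. Qed.

Lemma isd_linD U (f : U -> C) x L u v : isd f x L -> L (u + v) = L u + L v.
Proof. by case=> lL _ _; have := lL 1 u v; rewrite scale1r mul1r. Qed.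

Lemma isd_eqL U (f : U -> C) x L L' : L =1 L' -> isd f x L -> isd f x L'.
Proof. by move=> /funext ->. Qed.

Lemma isd_near U (f g : U -> C) x L (r : R) : 0 < r ->
  (forall y, rn (y - x) < r -> f y = g y) -> isd f x L -> isd g x L.
Proof.
move=> r0 fg [lL bL hL]; split => // e /hL [d d0 hd].
exists (Num.min d r); first by rewrite lt_min d0.
move=> h; rewrite lt_min => /andP[/hd h1 h2]; rewrite -!fg ?subrr ?rn0//.
by rewrite (addrC x) addrK.
Qed.

Lemma isd_ext U (f g : U -> C) x L : f =1 g -> isd f x L -> isd g x L.
Proof. by move=> fg; apply: (isd_near ltr01). Qed.

Lemma hol_near U (f g : U -> C) x (r : R) : 0 < r ->
  (forall y, rn (y - x) < r -> f y = g y) -> hol f x -> hol g x.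
Proof. by move=> r0 fg [L h]; exists L; exact: (isd_near r0 fg). Qed.

Lemma hol_ext U (f g : U -> C) x : f =1 g -> hol f x -> hol g x.
Proof. by move=> fg [L h]; exists L; exact: isd_ext h. Qed.

Lemma isd_cont U (f : U -> C) x L : isd f x L ->
  forall e : R, 0 < e -> exists2 d, 0 < d & forall y, rn (y - x) < d -> rn (f y - f x) <= e.
Proof.
move=> [_ [K K0 hK] hL] e e0; have [d d0 hd] := hL _ ltr01.
have K1 : 0 < K + 1 by rewrite ltr_wpDl.
exists (Num.min d (e / (K + 1))); first by rewrite lt_min d0 divr_gt0.
move=> y; rewrite lt_min => /andP[/hd]; rewrite (addrC x) subrK mul1r => h1.
rewrite ltr_pdivlMr// => h2; rewrite (le_trans (rn_sub _ (L (y - x))))//.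
have := hK (y - x); move: h1 h2; set a := rn _; set b := rn _; set c := rn _.
by rewrite mulrDr; lra.
Qed.

Lemma hol_cont U (f : U -> C) x : hol f x ->
  forall e : R, 0 < e -> exists2 d, 0 < d & forall y, rn (y - x) < d -> rn (f y - f x) <= e.
Proof. by case=> L /isd_cont. Qed.

Lemma isd_const U (c : C) (x : U) : isd (fun=> c) x (fun=> 0).
Proof.
split => [a u v||e e0]; first by rewrite mulr0 addr0.
  by exists 0 => // u; rewrite rn0 mul0r.
by exists 1 => // h _; rewrite !subrr rn0 mulr_ge0 ?rn_ge0// ltW.
Qed.

Lemma isd_linear U (L : U -> C) (K : R) x : 0 <= K ->
  (forall a u v, L (a *: u + v) = a * L u + L v) ->
  (forall u, rn (L u) <= K * rn u) -> isd L x L.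
Proof.
move=> K0 lL bL; split => //; first by exists K.
move=> e e0; exists 1 => // h _.
have -> : L (x + h) = L x + L h by have := lL 1 x h; rewrite scale1r mul1r.
by rewrite (addrC (L x)) addrK subrr rn0 mulr_ge0 ?rn_ge0// ltW.
Qed.

Lemma isdD U (f g : U -> C) x L M : isd f x L -> isd g x M ->
  isd (fun y => f y + g y) x (fun h => L h + M h).
Proof.
move=> [lL [K K0 hK] hL] [lM [K' K0' hK'] hM]; split.
- by move=> a u v; rewrite lL lM; ring.
- exists (K + K'); first exact: addr_ge0.
  by move=> u; rewrite mulrDl (le_trans (rnD _ _))// lerD.
- move=> e e0; have e2 : 0 < e / 2 by rewrite divr_gt0.
  have [d d0 hd] := hL _ e2; have [d' d0' hd'] := hM _ e2.
  exists (Num.min d d'); first by rewrite lt_min d0.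
  move=> h; rewrite lt_min => /andP[/hd a /hd' b].
  rewrite (_ : _ - _ = (f (x + h) - f x - L h) + (g (x + h) - g x - M h)); last by ring.
  by rewrite (le_trans (rnD _ _))//; lra.
Qed.

Lemma isdM U (f g : U -> C) x L M : isd f x L -> isd g x M ->
  isd (fun y => f y * g y) x (fun h => f x * M h + g x * L h).
Proof.
move=> hf hg; have cg := isd_cont hg.
case: hf => lL [K K0 hK] hL; case: hg => lM [K' K0' hK'] hM; split.
- by move=> a u v; rewrite lL lM; ring.
- exists (rn (f x) * K' + rn (g x) * K); first by rewrite addr_ge0 ?mulr_ge0 ?rn_ge0.
  move=> u; rewrite mulrDl (le_trans (rnD _ _))// !rnM -!mulrA lerD// ler_wpM2l ?rn_ge0//.
- move=> e e0; pose A := rn (f x) + rn (g x) + K + 1.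
  have A0 : 0 < A by rewrite /A ltr_wpDl// !addr_ge0 ?rn_ge0.
  have e3 : 0 < e / 3 / A by rewrite !divr_gt0.
  have [d d0 hd] := hL _ (divr_gt0 e0 (ltr0n _ 3)); have [d1 d10 hd1] := hL _ e3.
  have [d' d0' hd'] := hM _ e3.
  have mp : 0 < Num.min 1 (e / 3 / A) by rewrite lt_min ltr01.
  have [c c0 hc] := cg _ mp.
  exists (Num.min (Num.min d1 d') (Num.min c d)); first by rewrite !lt_min d10 d0' c0.
  move=> h; rewrite !lt_min => /andP[/andP[/hd1 a1 /hd' b] /andP[hhc /hd a]].
  have hh : rn (x + h - x) < c by rewrite (addrC x) addrK.
  have := hc _ hh; rewrite le_min => /andP[c1 c2].
  rewrite (_ : _ - _ = (f (x + h) - f x - L h) * g x + f x * (g (x + h) - g x - M h)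
     + (f (x + h) - f x - L h) * (g (x + h) - g x) + L h * (g (x + h) - g x)); last by ring.
  rewrite (le_trans (rnD _ _))// (le_trans (lerD (rnD _ _) (lexx _)))//.
  rewrite (le_trans (lerD (lerD (rnD _ _) (lexx _)) (lexx _)))// !rnM.
  have F0 := rn_ge0 (f x); have G0 := rn_ge0 (g x); have H0 := rn_ge0 h.
  have hA : e / 3 / A * rn h * A = e / 3 * rn h by field; exact: lt0r_neq0.
  have EE : 0 <= e / 3 / A * rn h by rewrite mulr_ge0// ltW.
  have t1 : rn (f (x + h) - f x - L h) * rn (g x) <= e / 3 / A * rn h * rn (g x) by rewrite ler_wpM2r.
  have t2 : rn (f x) * rn (g (x + h) - g x - M h) <= rn (f x) * (e / 3 / A * rn h) by rewrite ler_wpM2l.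
  have t3 : rn (f (x + h) - f x - L h) * rn (g (x + h) - g x) <= e / 3 * rn h.
    by rewrite -[leRHS]mulr1 ler_pM ?rn_ge0.
  have t4 : rn (L h) * rn (g (x + h) - g x) <= K * rn h * (e / 3 / A).
    by rewrite ler_pM ?rn_ge0.
  rewrite (le_trans (lerD (lerD (lerD t1 t2) t3) t4))//.
  have : e / 3 / A * rn h * rn (g x) + rn (f x) * (e / 3 / A * rn h) + K * rn h * (e / 3 / A) <= e / 3 * rn h.
    rewrite -hA /A !mulrDr mulr1; move: EE; set y := e / 3 / _ => EE.
    rewrite (_ : K * rn h * y = y * rn h * K); last by ring.
    rewrite (mulrC (rn (f x))); lra.
  have : 0 <= e * rn h by rewrite mulr_ge0// ltW.
  lra.
Qed.

Lemma isdZ U (f : U -> C) x L (c : C) : isd f x L -> isd (fun y => c * f y) x (fun h => c * L h).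
Proof.
move=> h; have := isdM (isd_const c x) h; congr isd.
by apply/funext => u; rewrite mulr0 addr0.
Qed.

Lemma isdN U (f : U -> C) x L : isd f x L -> isd (fun y => - f y) x (fun h => - L h).
Proof.
by move=> /(isdZ (-1)) h; have -> : (fun h => - L h) = (fun h => -1 * L h);
  [apply/funext => u; rewrite mulN1r | apply: isd_ext h => u; rewrite mulN1r].
Qed.

Lemma isdB U (f g : U -> C) x L M : isd f x L -> isd g x M ->
  isd (fun y => f y - g y) x (fun h => L h - M h).
Proof. by move=> hf /isdN hg; exact: isdD. Qed.

Lemma isd_comp U (V : normedModType C) (phi : U -> V) (f : V -> C) (x : U) (P : U -> V) L (K : R) :
  (forall u v a, P (a *: u + v) = a *: P u + P v) ->
  0 <= K -> (forall u, rn (P u) <= K * rn u) ->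
  (forall e : R, 0 < e -> exists2 d, 0 < d &
        forall h, rn h < d -> rn (phi (x + h) - phi x - P h) <= e * rn h) ->
  isd f (phi x) L -> isd (f \o phi) x (L \o P).
Proof.
move=> lP K0 bP hP hf; case: (hf) => lL [K' K0' hK'] hL; split.
- by move=> a u v /=; rewrite lP lL.
- exists (K' * K); first exact: mulr_ge0.
  by move=> u /=; rewrite (le_trans (hK' _))// -mulrA ler_wpM2l.
- move=> e e0; have K1 : 0 < K + 1 by rewrite ltr_wpDl.
  have K1' : 0 < K' + 1 by rewrite ltr_wpDl.
  have [d d0 hd] := hL _ (divr_gt0 (divr_gt0 e0 (ltr0n _ 2)) K1).
  have mp : 0 < Num.min 1 (e / 2 / (K' + 1)) by rewrite lt_min ltr01 !divr_gt0.
  have [d1 d10 hd1] := hP _ mp.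
  exists (Num.min d1 (d / (K + 1))); first by rewrite lt_min d10 divr_gt0.
  move=> h; rewrite lt_min ltr_pdivlMr// => /andP[/hd1 h1 h2] /=.
  have H0 := rn_ge0 h.
  have m1 : Num.min 1 (e / 2 / (K' + 1)) <= 1 by rewrite ge_min lexx.
  have m2 : Num.min 1 (e / 2 / (K' + 1)) <= e / 2 / (K' + 1) by rewrite ge_min lexx orbT.
  have b1 : rn (phi (x + h) - phi x) <= (K + 1) * rn h.
    have := rn_sub (phi (x + h) - phi x) (P h); have := bP h.
    have : rn (phi (x + h) - phi x - P h) <= 1 * rn h by rewrite (le_trans h1)// ler_wpM2r.
    by rewrite mulrDl; lra.
  have h3 := hd (phi (x + h) - phi x) (le_lt_trans b1 _).
  rewrite (addrC (phi x)) subrK in h3.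
  rewrite (_ : _ - _ = (f (phi (x + h)) - f (phi x) - L (phi (x + h) - phi x)) +
     (L (phi (x + h) - phi x) - L (P h))); last by ring.
  rewrite (le_trans (rnD _ _))//.
  have -> : L (phi (x + h) - phi x) - L (P h) = L (phi (x + h) - phi x - P h).
    have := lL (-1) (P h) (phi (x + h) - phi x); rewrite scaleN1r mulN1r addrC.
    by move=> ->; ring.
  have a1 := h3 ltac:(by rewrite mulrC).
  have a2 : e / 2 / (K + 1) * rn (phi (x + h) - phi x) <= e / 2 * rn h.
    have -> : e / 2 * rn h = e / 2 / (K + 1) * ((K + 1) * rn h) by field; exact: lt0r_neq0.
    by rewrite ler_wpM2l// !divr_ge0// ltW.
  have a3 : rn (L (phi (x + h) - phi x - P h)) <= e / 2 * rn h.
    rewrite (le_trans (hK' _))//.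
    have -> : e / 2 * rn h = (K' + 1) * (e / 2 / (K' + 1) * rn h) by field; exact: lt0r_neq0.
    rewrite ler_pM ?rn_ge0//; first by rewrite lerDl.
    by rewrite (le_trans h1)// ler_wpM2r.
  lra.
Qed.

Lemma isd_compl U (V : normedModType C) (P : U -> V) (y : V) (f : V -> C) (x : U) L (K : R) :
  (forall u v a, P (a *: u + v) = a *: P u + P v) ->
  0 <= K -> (forall u, rn (P u) <= K * rn u) ->
  isd f (y + P x) L -> isd (fun u => f (y + P u)) x (L \o P).
Proof.
move=> lP K0 bP; apply: (@isd_comp _ _ (fun u => y + P u) _ _ P) K0 bP _ => // e e0.
exists 1 => // h _.
have -> : P (x + h) = P x + P h by have := lP x h 1; rewrite !scale1r.
by rewrite addrA [X in rn X](_ : _ = 0) ?rn0 ?mulr_ge0 ?rn_ge0 ?(ltW e0)//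
  (addrC (y + P x)) addrK subrr.
Qed.

Lemma isd_chain U (phi : U -> C) (f : C -> C) (x : U) P L :
  isd phi x P -> isd f (phi x) L -> isd (f \o phi) x (L \o P).
Proof.
by move=> [lP [K K0 bP] hP]; apply: isd_comp K0 bP hP => u v a; rewrite lP.
Qed.

Lemma isd_line U (a c : U) (f : U -> C) (w : C) L :
  isd f (a + w *: c) L -> isd (fun z : C => f (a + z *: c)) w (fun h => h * L c).
Proof.
move=> h; have := @isd_compl C U ( *:%R^~ c) a f w L (rn c) _ (rn_ge0 _) _ h.
have -> : (L \o *:%R^~ c) = (fun h => h * L c) by apply/funext => u /=; rewrite (isd_linZ _ _ h).
apply=> [u v b|u]; last by rewrite rnZ mulrC.
by rewrite scalerDl scalerA.
Qed.

Lemma rder_line U (a c : U) (f : U -> C) (s : R) L :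
  isd f (a + s%:C *: c) L -> rder (fun s => f (a + s%:C *: c)) s (L c).
Proof.
move=> /isd_line [_ _ h] e /h [d d0 hd]; exists d => // k kd.
by have := hd k%:C; rewrite rn_real rmorphD /= => /(_ kd).
Qed.

Lemma isd_id (w : C) : isd id w id.
Proof. by apply: (@isd_linear C _ 1) => // u; rewrite mul1r. Qed.

Lemma isd_sum U (I : Type) (r : seq I) (f : I -> U -> C) x (L : I -> U -> C) :
  (forall i, isd (f i) x (L i)) ->
  isd (fun y => \sum_(i <- r) f i y) x (fun h => \sum_(i <- r) L i h).
Proof.
move=> h; elim: r => [|i r IH].
  have := isd_const 0 x; congr isd; apply/funext => y; by rewrite big_nil.
have := isdD (h i) IH; congr isd; apply/funext => y; by rewrite big_cons.
Qed.

Lemma hol_const U (c : C) (x : U) : hol (fun=> c) x.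
Proof. by eexists; exact: isd_const. Qed.
Lemma holD U (f g : U -> C) x : hol f x -> hol g x -> hol (fun y => f y + g y) x.
Proof. by move=> [L hL] [M hM]; eexists; exact: (isdD hL hM). Qed.
Lemma holB U (f g : U -> C) x : hol f x -> hol g x -> hol (fun y => f y - g y) x.
Proof. by move=> [L hL] [M hM]; eexists; exact: (isdB hL hM). Qed.
Lemma holN U (f : U -> C) x : hol f x -> hol (fun y => - f y) x.
Proof. by move=> [L hL]; eexists; exact: (isdN hL). Qed.
Lemma holM U (f g : U -> C) x : hol f x -> hol g x -> hol (fun y => f y * g y) x.
Proof. by move=> [L hL] [M hM]; eexists; exact: (isdM hL hM). Qed.
Lemma hol_sum U (I : Type) (r : seq I) (f : I -> U -> C) x :
  (forall i, hol (f i) x) -> hol (fun y => \sum_(i <- r) f i y) x.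
Proof.
move=> h; elim: r => [|i r IH].
  by apply: hol_ext (hol_const 0 x) => y; rewrite big_nil.
by apply: hol_ext (holD (h i) IH) => y; rewrite big_cons.
Qed.
Lemma holX U (f : U -> C) x k : hol f x -> hol (fun y => f y ^+ k) x.
Proof.
move=> h; elim: k => [|k IH]; first exact: hol_const.
by apply: hol_ext (holM h IH) => y; rewrite exprS.
Qed.

Lemma isd_inv (w : C) : w != 0 -> isd (fun z : C => z^-1) w (fun h => - (h / w ^+ 2)).
Proof.
move=> w0; have rw : 0 < rn w by rewrite rn_gt0.
split.
- by move=> a u v; rewrite /GRing.scale /=; field.
- exists (rn w ^- 2); first by rewrite invr_ge0 exprn_ge0// rn_ge0.
  by move=> u; rewrite rnN rnM rnV rnX mulrC.
- move=> e e0; pose d := Num.min (rn w / 2) (e * rn w ^+ 3 / 2).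
  have dp : 0 < d by rewrite lt_min !divr_gt0// mulr_gt0// exprn_gt0.
  exists d => // h; rewrite lt_min => /andP[h1 h2].
  have wh : rn w / 2 <= rn (w + h) by have := rnB_le (w + h) h; rewrite addrK; lra.
  have wh0 : w + h != 0 by rewrite -rn_gt0; lra.
  rewrite (_ : _ - _ = h * (h / (w ^+ 2 * (w + h)))); last by field; rewrite w0 wh0.
  rewrite rnM mulrC ler_wpM2r ?rn_ge0// !rnM rnV rnM rnX.
  rewrite ler_pdivrMr; last by rewrite mulr_gt0 ?exprn_gt0 ?rn_gt0.
  apply: le_trans (ltW h2) _.
  have -> : e * rn w ^+ 3 / 2 = e * (rn w ^+ 2 * (rn w / 2)) by ring.
  by rewrite ler_wpM2l ?(ltW e0)// ler_wpM2l// exprn_ge0// rn_ge0.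
Qed.

Lemma holV U (f : U -> C) x : f x != 0 -> hol f x -> hol (fun y => (f y)^-1) x.
Proof. by move=> f0 [L hL]; eexists; exact: (isd_chain hL (isd_inv f0)). Qed.

End Holomorphic.

(** * The complex exponential *)

Section ComplexExponential.
Variable R : realType.
Local Notation C := R[i].
Implicit Types (w h : C).

Lemma is_derive_real (f : R -> R) (x l : R) : is_derive x (1 : R) f l ->
  forall e : R, 0 < e -> exists2 d : R, 0 < d & forall h : R, `|h| < d ->
    `|f (x + h) - f x - h * l| <= e * `|h|.
Proof.
case=> df fl e e0.
have : (fun h0 : R => h0^-1 *: ((f \o shift x) (h0 *: (1:R)) - f x)) @ 0^' --> l.
  by rewrite -fl; exact: df.
move=> /cvgrPdist_le /(_ _ e0); rewrite near_withinE => /nbhs_ballP[d /= d0 hd].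
exists d => // h hd1; have [->|h0] := eqVneq h 0.
  by rewrite addr0 subrr mul0r subr0 normr0 mulr0.
have := hd h; rewrite /ball /= sub0r normrN => /(_ hd1 h0).
rewrite /GRing.scale /= mulr1 (addrC h) => hk.
rewrite -ler_pdivrMr ?normr_gt0// -normfV -normrM (le_trans _ hk)// -normrN le_eqVlt.
by apply/orP; left; apply/eqP; congr `|_|; field.
Qed.

Lemma Re_cexp w : complex.Re (cexp w) = expR (complex.Re w) * cos (complex.Im w).
Proof. by rewrite /cexp /=; ring. Qed.
Lemma Im_cexp w : complex.Im (cexp w) = expR (complex.Re w) * sin (complex.Im w).
Proof. by rewrite /cexp /=; ring. Qed.

Lemma complexP (z w : C) : complex.Re z = complex.Re w -> complex.Im z = complex.Im w -> z = w.
Proof. by case: z w => a b [c d] /= -> ->. Qed.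

Lemma cexpD w h : cexp (w + h) = cexp w * cexp h.
Proof.
have hR := (Re_cexp, Im_cexp).
apply: complexP.
  by rewrite [RHS]ReM !hR ReD ImD expRD cosD; ring.
by rewrite [RHS]ImM !hR ReD ImD expRD sinD; ring.
Qed.

Lemma cexp0 : cexp (0 : C) = 1.
Proof. by apply: complexP; rewrite ?Re_cexp ?Im_cexp /= expR0 ?cos0 ?sin0 ?mulr1 ?mulr0. Qed.

Lemma rn_cexp w : rn (cexp w) = expR (complex.Re w).
Proof.
rewrite /rn normc_def Re_cexp Im_cexp /= !exprMn -mulrDr cos2Dsin2 mulr1 sqrtr_sqr.
by rewrite ger0_norm// expR_ge0.
Qed.

Lemma cexp_neq0 w : cexp w != 0.
Proof. by rewrite -rn_gt0 rn_cexp expR_gt0. Qed.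

Lemma cexpN w : cexp (- w) = (cexp w)^-1.
Proof.
apply: (mulfI (cexp_neq0 w)); rewrite -cexpD subrr cexp0 divff//; exact: cexp_neq0.
Qed.

Lemma cexp_exp_lin (e : R) : 0 < e -> exists2 d, 0 < d &
  forall h, rn h < d -> rn (cexp h - 1 - h) <= e * rn h.
Proof.
move=> e0.
pose e1 := Num.min 1 (e / 8).
have e10 : 0 < e1 by rewrite lt_min ltr01 divr_gt0.
have e11 : e1 <= 1 by rewrite ge_min lexx.
have e18 : e1 <= e / 8 by rewrite ge_min lexx orbT.
have [d1 d10 h1] := is_derive_real (is_derive_expR 0) e10.
have [d2 d20 h2] := is_derive_real (is_derive_cos 0) e10.
have [d3 d30 h3] := is_derive_real (is_derive_sin 0) e10.
exists (Num.min (Num.min 1 (e / 16)) (Num.min d1 (Num.min d2 d3))).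
  by rewrite !lt_min ltr01 divr_gt0// d10 d20.
move=> h; rewrite !lt_min => /andP[/andP[n1 n8] /and3P[n2 n3 n4]].
have X := Re_le_rn h; have Y := Im_le_rn h.
set x := complex.Re h in X *; set y := complex.Im h in Y *.
have := h1 _ (le_lt_trans X n2); have := h2 _ (le_lt_trans Y n3); have := h3 _ (le_lt_trans Y n4).
rewrite !add0r expR0 cos0 sin0 subr0 oppr0 mulr0 subr0 !mulr1 => a b c.
have N0 := rn_ge0 h.
have c' : `|expR x - 1 - x| <= e / 8 * rn h by rewrite (le_trans c)// ler_pM// ltW.
have b' : `|cos y - 1| <= e / 8 * rn h by rewrite (le_trans b)// ler_pM// ltW.
have a' : `|sin y - y| <= e / 8 * rn h by rewrite (le_trans a)// ler_pM// ltW.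
have ex : expR x <= 3.
  have : `|expR x - 1 - x| <= 1 * 1 by rewrite (le_trans c)// ler_pM// ?ltW// (le_lt_trans X).
  rewrite ler_norml => /andP[_]; have := le_lt_trans X n1; rewrite ltr_norml => /andP[]; lra.
have ex0 := expR_gt0 x.
have ex1 : `|expR x - 1| <= 2 * rn h.
  have -> : expR x - 1 = (expR x - 1 - x) + x by ring.
  rewrite (le_trans (ler_normD _ _))//.
  have : `|expR x - 1 - x| <= 1 * rn h by rewrite (le_trans c)// ler_pM// ltW.
  lra.
rewrite (le_trans (rn_ReIm _))// !ReD !ImD !ReN !ImN Re_cexp Im_cexp -/x -/y /=.
have -> : expR x * cos y - 1 - x = expR x * (cos y - 1) + (expR x - 1 - x) by ring.
have -> : expR x * sin y - 0 - y = expR x * (sin y - y) + (expR x - 1) * y by ring.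
have t1 := ler_normD (expR x * (cos y - 1)) (expR x - 1 - x).
have t2 := ler_normD (expR x * (sin y - y)) ((expR x - 1) * y).
rewrite !normrM (ger0_norm (ltW ex0)) in t1 t2.
have u1 : expR x * `|cos y - 1| <= 3 * (e / 8 * rn h) by rewrite ler_pM// ltW.
have u2 : expR x * `|sin y - y| <= 3 * (e / 8 * rn h) by rewrite ler_pM// ltW.
have u3 : `|expR x - 1| * `|y| <= 2 * rn h * (e / 16).
  by rewrite ler_pM// (le_trans Y)// ltW.
have : 0 <= e * rn h by rewrite mulr_ge0// ltW.
lra.
Qed.

Lemma isd_cexp w : isd (@cexp R) w (fun h => h * cexp w).
Proof.
split.
- by move=> a u v; rewrite /GRing.scale /=; ring.
- by exists (rn (cexp w)) => [|u]; rewrite ?rn_ge0// rnM mulrC.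
- move=> e e0; have c0 : 0 < rn (cexp w) by rewrite rn_gt0 cexp_neq0.
  have [d d0 hd] := cexp_exp_lin (divr_gt0 e0 c0); exists d => // h /hd hh.
  rewrite cexpD (_ : _ - _ = cexp w * (cexp h - 1 - h)); last by ring.
  rewrite rnM (le_trans (ler_wpM2l (ltW c0) hh))// le_eqVlt; apply/orP; left; apply/eqP.
  by field; rewrite lt0r_neq0.
Qed.

Lemma hol_cexp (U : normedModType C) (f : U -> C) x : hol f x -> hol (fun y => cexp (f y)) x.
Proof. by move=> [L hL]; eexists; exact: (isd_chain hL (isd_cexp _)). Qed.

Opaque cexp.
Lemma cexp_2pi (w : C) : cexp (w + 0 +i* (2 * pi)) = cexp w.
Proof.
rewrite cexpD (_ : cexp (0 +i* (2 * pi)) = 1) ?mulr1//.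
apply: complexP; rewrite ?Re_cexp ?Im_cexp /= expR0 mul1r.
  by rewrite mulr_natl mulr2n cosD cospi sinpi mulr0 subr0 mulrNN mulr1.
by rewrite mulr_natl mulr2n sinD cospi sinpi mul0r mulr0 addr0.
Qed.

End ComplexExponential.

(** * Goursat's theorem on rectangles *)

Section Goursat.
Variable R : realType.
Local Notation C := R[i].
Implicit Types (f : C -> C) (w v z : C).

Lemma isd_lin1 f p L z : isd f p L -> L z = L (1 : C) * z.
Proof. by move=> h; have := isd_linZ z (1 : C) h; rewrite /GRing.scale /= mulr1 mulrC. Qed.

(** The integral of [f(z) dz] along the segment from [w] to [w + v]. *)
Definition edge f w v : C := v * cint (fun s : R => f (w + s%:C * v)).

(** The counterclockwise integral along the boundary of [box w a b]; the top and left edges are run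
    through backwards, hence the signs. *)
Definition rect f w (a b : R) : C :=
  edge f w a%:C + edge f (w + a%:C) ('i * b%:C)
  - edge f (w + 'i * b%:C) a%:C - edge f w ('i * b%:C).

Definition box w (a b : R) z : Prop :=
  complex.Re w <= complex.Re z <= complex.Re w + a /\
  complex.Im w <= complex.Im z <= complex.Im w + b.

Lemma rder_seg f w v (s : R) l : isd f (w + s%:C * v) l ->
  rder (fun s : R => f (w + s%:C * v)) s (l v).
Proof. exact: (@rder_line R C w v f s l). Qed.

Lemma cont_seg f w v : (forall s, 0 <= s <= 1 -> hol f (w + s%:C * v)) ->
  cont01 (fun s : R => f (w + s%:C * v)).
Proof.
move=> h; apply: (@rder_cont01 _ _ (fun s => dd f (w + s%:C * v) v)) => s /h hs.
by apply: rder_seg; exact: ddP.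
Qed.

Lemma edge_split f w v : cont01 (fun s : R => f (w + s%:C * v)) ->
  edge f w v = edge f w (v / 2) + edge f (w + v / 2) (v / 2).
Proof.
move=> h; rewrite /edge cint_split//.
set I := cint _; set I' := cint _; rewrite (_ : cint _ = I); last first.
  by apply: cint_eq => s _; congr f; rewrite (rmorphM (real_complex R)) fmorphV rmorph_nat; field.
rewrite (_ : cint _ = I'); last first.
  by apply: cint_eq => s _; congr f; rewrite (rmorphM (real_complex R)) rmorphD rmorph1 fmorphV rmorph_nat; field.
by field.
Qed.

Lemma edge_bound f w v K : cont01 (fun s : R => f (w + s%:C * v)) ->
  (forall s, 0 <= s <= 1 -> rn (f (w + s%:C * v)) <= K) -> rn (edge f w v) <= rn v * K.
Proof. by move=> cf h; rewrite /edge rnM ler_wpM2l ?rn_ge0//; exact: cint_bound. Qed.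

Lemma edge_ftc F f w v : (forall s, 0 <= s <= 1 -> isd F (w + s%:C * v) (fun h => h * f (w + s%:C * v))) ->
  cont01 (fun s : R => f (w + s%:C * v)) -> edge f w v = F (w + v) - F w.
Proof.
move=> hF cf; rewrite /edge -cintZ//.
rewrite (@cint_ftc _ (fun s => F (w + s%:C * v))) ?rmorph1 ?mul1r ?rmorph0 ?mul0r ?addr0//.
  exact: cont01Z.
by move=> s /hF /rder_seg.
Qed.

Lemma boxP f w a b (P : C -> Prop) : 0 <= a -> 0 <= b -> (forall z, box w a b z -> P z) ->
  [/\ forall s, 0 <= s <= 1 -> P (w + s%:C * a%:C),
      forall s, 0 <= s <= 1 -> P (w + a%:C + s%:C * ('i * b%:C)),
      forall s, 0 <= s <= 1 -> P (w + 'i * b%:C + s%:C * a%:C)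
    & forall s, 0 <= s <= 1 -> P (w + s%:C * ('i * b%:C))].
Proof.
move=> a0 b0 h.
have mono (s c : R) : 0 <= s <= 1 -> 0 <= c -> 0 <= s * c <= c.
  by move=> /andP[s0 s1] c0; rewrite mulr_ge0//= ler_piMl.
by split=> s s1; apply: h; rewrite /box !(ReD, ImD, ReM, ImM) /=;
  have /andP[m1 m2] := mono s a s1 a0; have /andP[m3 m4] := mono s b s1 b0; split;
  apply/andP; split; lra.
Qed.

Lemma rect_bound f w a b K : 0 <= a -> 0 <= b -> (forall z, box w a b z -> hol f z) ->
  (forall z, box w a b z -> rn (f z) <= K) -> rn (rect f w a b) <= 2 * (a + b) * K.
Proof.
move=> a0 b0 /(boxP f a0 b0)[h1 h2 h3 h4] /(boxP f a0 b0)[k1 k2 k3 k4].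
have e1 := edge_bound (cont_seg h1) k1; have e2 := edge_bound (cont_seg h2) k2.
have e3 := edge_bound (cont_seg h3) k3; have e4 := edge_bound (cont_seg h4) k4.
rewrite rn_real ger0_norm// in e1 e3; rewrite (rnM 'i) rn_i mul1r rn_real ger0_norm// in e2 e4.
rewrite /rect (le_trans (rnB_le _ _))// (le_trans (lerD (rnB_le _ _) (lexx _)))//.
rewrite (le_trans (lerD (lerD (rnD _ _) (lexx _)) (lexx _)))//; lra.
Qed.

Local Opaque edge.
Lemma rect_split f w a b : 0 <= a -> 0 <= b -> (forall z, box w a b z -> hol f z) ->
  rect f w a b = rect f w (a / 2) (b / 2) + rect f (w + (a / 2)%:C) (a / 2) (b / 2)
   + rect f (w + 'i * (b / 2)%:C) (a / 2) (b / 2)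
   + rect f (w + (a / 2)%:C + 'i * (b / 2)%:C) (a / 2) (b / 2).
Proof.
move=> a0 b0 /(boxP f a0 b0)[h1 h2 h3 h4].
have aE : (a / 2)%:C = a%:C / 2 :> C by rewrite rmorphM /= fmorphV rmorph_nat.
have bE : 'i * (b / 2)%:C = 'i * b%:C / 2 :> C by rewrite rmorphM /= fmorphV rmorph_nat mulrA.
rewrite /rect !aE !bE.
rewrite (edge_split (cont_seg h1)) (edge_split (cont_seg h2)) (edge_split (cont_seg h3)) (edge_split (cont_seg h4)).
set A := a%:C / 2; set B := _ / 2.
have -> : a%:C = A + A by rewrite /A; field.
have -> : 'i * b%:C = B + B by rewrite /B; field.
rewrite !(addrA w A A) !(addrA w B B).
have -> : w + B + A = w + A + B by ring.
have -> : w + A + B + A = w + A + A + B by ring.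
have -> : w + B + B + A = w + A + B + B by ring.
by ring.
Qed.

Local Transparent edge.
(** An affine function has an explicit primitive. In [goursat] the tangent of [f] can therefore be
    subtracted without changing the integral. *)
Lemma rect_affine w a b (c l p : C) : 0 <= a -> 0 <= b ->
  rect (fun z => c + l * (z - p)) w a b = 0.
Proof.
move=> a0 b0; pose F z := c * z + l * z * z / 2 - l * p * z.
have hF z : isd F z (fun h => h * (c + l * (z - p))).
  have hi := isd_id z; have h1 := isdZ c hi; have h2 := isdZ (l / 2) (isdM hi hi).
  have h3 := isdZ (l * p) hi; have := isdB (isdD h1 h2) h3.
  move=> h; apply: isd_eqL (isd_ext _ h) => u; rewrite /F /=; by field.
have ho u : hol (fun z => c + l * (z - p)) u.
  apply: holD; first exact: hol_const.
  apply: holM; first exact: hol_const.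
  by apply: holB; [exists id; exact: isd_id | exact: hol_const].
have e x v : edge (fun z => c + l * (z - p)) x v = F (x + v) - F x.
  by apply: edge_ftc => // ; apply: (@cont_seg (fun z => c + l * (z - p))) => s _; exact: ho.
rewrite /rect !e (_ : w + 'i * b%:C + a%:C = w + a%:C + 'i * b%:C); last by ring.
by move: F {hF e} => F; ring.
Qed.

Lemma edgeB f g w v : cont01 (fun s : R => f (w + s%:C * v)) ->
  cont01 (fun s : R => g (w + s%:C * v)) ->
  edge (fun z => f z - g z) w v = edge f w v - edge g w v.
Proof. by move=> cf cg; rewrite /edge cintB// mulrBr. Qed.

Lemma rectB f g w a b : 0 <= a -> 0 <= b -> (forall z, box w a b z -> hol f z) ->
  (forall z, box w a b z -> hol g z) ->
  rect (fun z => f z - g z) w a b = rect f w a b - rect g w a b.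
Proof.
move=> a0 b0 /(boxP f a0 b0)[h1 h2 h3 h4] /(boxP f a0 b0)[k1 k2 k3 k4].
rewrite /rect !edgeB; try exact: cont_seg.
by ring.
Qed.

Lemma box_dist w a b z z' : box w a b z -> box w a b z' -> rn (z - z') <= a + b.
Proof.
move=> [/andP[h1 h2] /andP[h3 h4]] [/andP[k1 k2] /andP[k3 k4]].
rewrite (le_trans (rn_ReIm _))// ReD ImD ReN ImN lerD// ler_norml; apply/andP; split; lra.
Qed.

Lemma box_closed w a b (u : nat -> C) p : (forall k, box w a b (u k)) -> clim u p -> box w a b p.
Proof.
move=> h hp.
have H (e : R) : 0 < e -> exists k, `|complex.Re p - complex.Re (u k)| <= e /\
    `|complex.Im p - complex.Im (u k)| <= e.
  move=> /hp [N /(_ _ (leqnn _)) hN]; exists N; rewrite -!ReN -!ImN -ReD -ImD.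
  by split; rewrite ?(le_trans (Re_le_rn _)) ?(le_trans (Im_le_rn _))// rnB.
split; apply/andP; split; apply/ler_addgt0Pl => e /H [k];
  rewrite !ler_norml => -[/andP[a1 a2] /andP[a3 a4]];
  have [/andP[b1 b2] /andP[b3 b4]] := h k; lra.
Qed.

Lemma box_quarter w a b : 0 <= a -> 0 <= b ->
  [/\ forall z, box w (a / 2) (b / 2) z -> box w a b z,
      forall z, box (w + (a / 2)%:C) (a / 2) (b / 2) z -> box w a b z,
      forall z, box (w + 'i * (b / 2)%:C) (a / 2) (b / 2) z -> box w a b z
    & forall z, box (w + (a / 2)%:C + 'i * (b / 2)%:C) (a / 2) (b / 2) z -> box w a b z].
Proof.
move=> a0 b0; split => z; rewrite /box ?ReD ?ImD ?ReM ?ImM /=;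
  by move=> [/andP[h1 h2] /andP[h3 h4]]; split; apply/andP; split; lra.
Qed.

Local Opaque rect.
(** Bisection: some quarter keeps at least a fourth of the integral, and the chosen boxes shrink to
    a point [p]. After subtraction of the tangent [g] at [p] the integrand is small compared with
    the diameter, and diameter times perimeter is of the order [4^-k]. *)
Theorem goursat f w a b : 0 <= a -> 0 <= b -> (forall z, box w a b z -> hol f z) ->
  rect f w a b = 0.
Proof.
move=> a0 b0 hf; apply/eqP; apply: contraT; rewrite -rn_gt0.
set eta := rn _ => eta0.
pose A k := a * 2^-1 ^+ k; pose B k := b * 2^-1 ^+ k.
have h2 k : 0 <= 2^-1 ^+ k :> R by rewrite exprn_ge0// invr_ge0.
have A0 k : 0 <= A k by rewrite mulr_ge0.
have B0 k : 0 <= B k by rewrite mulr_ge0.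
have AS k : A k.+1 = A k / 2 by rewrite /A exprSr mulrA.
have BS k : B k.+1 = B k / 2 by rewrite /B exprSr mulrA.
pose good k v := (forall z, box v (A k) (B k) z -> box w a b z) /\
  eta * 4^-1 ^+ k <= rn (rect f v (A k) (B k)).
pose sub k v v' := forall z, box v' (A k.+1) (B k.+1) z -> box v (A k) (B k) z.
have step k v : good k v -> exists v', good k.+1 v' /\ sub k v v'.
  move=> [hb hr]; rewrite /good /sub !AS !BS.
  have [q1 q2 q3 q4] := box_quarter v (A0 k) (B0 k).
  apply: contrapT => hno; have hn v' : (forall z, box v' (A k / 2) (B k / 2) z -> box v (A k) (B k) z) ->
      rn (rect f v' (A k / 2) (B k / 2)) < eta * 4^-1 ^+ k.+1.
    move=> hs; rewrite ltNge; apply/negP => hle; apply: hno; exists v'; split => //; split => //.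
    by move=> z /hs /hb.
  have := hn _ q1; have := hn _ q2; have := hn _ q3; have := hn _ q4 => r4 r3 r2 r1.
  suff : rn (rect f v (A k) (B k)) < eta * 4^-1 ^+ k by rewrite ltNge hr.
  rewrite rect_split//; last by move=> z /hb /hf.
  rewrite (le_lt_trans (rnD _ _))// (le_lt_trans (lerD (rnD _ _) (lexx _)))//.
  rewrite (le_lt_trans (lerD (lerD (rnD _ _) (lexx _)) (lexx _)))//.
  by move: r1 r2 r3 r4; rewrite exprSr; lra.
pose nxt k v := xget v [set v' | good k.+1 v' /\ sub k v v'].
pose W := fix W k := if k is k'.+1 then nxt k' (W k') else w.
have gW k : good k (W k).
  elim: k => [|k IH] /=; first by split; rewrite /A /B !expr0 !mulr1.
  have [v' hv'] := step _ _ IH; rewrite /nxt.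
  by have [] := xgetPex (W k) (ex_intro _ v' hv' : exists v', [set v' | good k.+1 v' /\ sub k (W k) v'] v').
have sW k : sub k (W k) (W k.+1).
  have [v' hv'] := step _ _ (gW k); rewrite /= /nxt.
  by have [] := xgetPex (W k) (ex_intro _ v' hv' : exists v', [set v' | good k.+1 v' /\ sub k (W k) v'] v').
have nW k m z : box (W (k + m)%N) (A (k + m)%N) (B (k + m)%N) z -> box (W k) (A k) (B k) z.
  by elim: m => [|m IH]; rewrite ?addn0// addnS => /sW /IH.
have bW k m : box (W k) (A k) (B k) (W (k + m)%N).
  by apply: (nW k m); rewrite /box !lexx !lerDl A0 B0.
have small (e : R) : 0 < e -> exists N, forall k, (N <= k)%N -> A k + B k <= e.
  move=> e0; have ab : 0 < a + b + 1 by rewrite ltr_wpDl// addr_ge0.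
  have [N hN] := half_small (divr_gt0 e0 ab); exists N => k Nk.
  rewrite /A /B -mulrDl; move: hN; rewrite ltr_pdivlMr// => hN.
  have : 2^-1 ^+ k <= 2^-1 ^+ N :> R by rewrite ler_wiXn2l// invr_le1// ?unitfE// ler1n.
  have := h2 k; move: hN; set x := _ ^+ N; set y := _ ^+ k; nra.
have [p hp] : exists p, clim W p.
  apply: clim_cauchy => e /small [N hN]; exists N => k l Nk Nl.
  rewrite (le_trans _ (hN _ (leqnn _)))//; apply: (@box_dist (W N)).
    by rewrite -(subnKC Nk).
  by rewrite -(subnKC Nl).
have bp k : box (W k) (A k) (B k) p.
  by apply: box_closed (clim_shift k hp) => m; rewrite addnC.
have [L [lL bL hL]] : hol f p by apply: hf; have := bp 0%N; rewrite /A /B !expr0 !mulr1.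
have LE z : L z = L 1 * z.
  by apply: (@isd_lin1 f p).
(* With this constant the final bound is [eta 4^-N] times a number below 1/2; the summand 1 covers
   [a + b = 0]. *)
have c0 : 0 < 4 * ((a + b) ^+ 2 + 1) by rewrite mulr_gt0// ltr_wpDl// exprn_ge0// addr_ge0.
have [d d0 hd] := hL _ (divr_gt0 eta0 c0).
have [N hN] := small _ (divr_gt0 d0 (ltr0n _ 2)); have {}hN := hN _ (leqnn _).
have [hb hr] := gW N.
pose g z := f p + L 1 * (z - p).
have hg z : hol g z.
  apply: holD; first exact: hol_const.
  apply: holM; first exact: hol_const.
  by apply: holB; [exists id; exact: isd_id | exact: hol_const].
have E : rect f (W N) (A N) (B N) = rect (fun z => f z - g z) (W N) (A N) (B N).
  by rewrite rectB// ?rect_affine ?subr0// => z /hb /hf.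
have := @rect_bound (fun z => f z - g z) (W N) (A N) (B N)
  (eta / (4 * ((a + b) ^+ 2 + 1)) * (A N + B N)) (A0 N) (B0 N).
move=> /(_ _ _)/wrap[].
  by move=> z hz; apply: holB => //; apply: hf; exact: hb.
  move=> z hz; have zp := box_dist hz (bp N).
  have := hd (z - p); rewrite (addrC p) subrK LE /g opprD addrA => h.
  apply: le_trans (h _) _; first by lra.
  by rewrite ler_wpM2l// divr_ge0// ltW.
rewrite -E => /(le_trans hr).
have -> : 2 * (A N + B N) * (eta / (4 * ((a + b) ^+ 2 + 1)) * (A N + B N)) =
   eta * 4^-1 ^+ N * ((a + b) ^+ 2 / (2 * ((a + b) ^+ 2 + 1))).
  have -> : 4^-1 ^+ N = 2^-1 ^+ N * 2^-1 ^+ N :> R by rewrite -exprMn; congr (_ ^+ _); field.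
  rewrite /A /B; field; move: c0; rewrite pmulr_rgt0// => c0; exact: lt0r_neq0.
have q0 : 0 < eta * 4^-1 ^+ N by rewrite mulr_gt0// exprn_gt0// invr_gt0.
rewrite -[leLHS]mulr1 ler_pM2l// ler_pdivlMr; last by rewrite mulr_gt0// ltr_wpDl// exprn_ge0// addr_ge0.
have := exprn_ge0 2 (addr_ge0 a0 b0); lra.
Qed.

Local Transparent rect.
(** In the coordinate log z an annulus is a rectangle of height [2 pi] whose horizontal edges cancel
    by periodicity. So the mean over [|z| = r] equals the means over small circles, which tend to
    [f 0]. Only continuity is asked at 0, so the lemma applies to difference quotients. *)
Lemma circle_max f (r M : R) : 0 < r -> (forall z, 0 < rn z <= r -> hol f z) ->
  (forall e : R, 0 < e -> exists2 d, 0 < d & forall z, rn z < d -> rn (f z - f 0) <= e) ->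
  (forall z, rn z = r -> rn (f z) <= M) -> rn (f 0) <= M.
Proof.
move=> r0 hf cf hM; pose g w := f (cexp w); pose T : C := 'i * (2 * pi)%:C.
have pi0 := pi_gt0 R; have pp : 0 <= 2 * pi :> R by rewrite mulr_ge0// ltW.
have gT w : g (w + T) = g w.
  rewrite /g /T -(cexp_2pi w); congr (f (cexp (w + _))); apply: complexP; rewrite ?ReM ?ImM /=; ring.
apply/ler_addgt0Pl => e e0; have [d d0 hd] := cf _ e0.
(* On the circle of radius [exp s], which is below [d], [f] is within [e] of [f 0]. *)
pose s1 := ln r; pose s := Num.min s1 (ln d - 1).
have ss1 : s <= s1 by rewrite ge_min lexx.
have hg w : complex.Re w <= s1 -> hol g w.
  move=> ws; apply: (@hol_near _ _ (f \o @cexp R) _ _ 1) => //.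
  have [|L hL] := hf (cexp w).
    by rewrite rn_cexp expR_gt0 (le_trans (_ : _ <= expR s1)) ?ler_expR// /s1 lnK// posrE.
  by eexists; exact: (isd_chain (isd_cexp w) hL).
have hb z : box s%:C (s1 - s) (2 * pi) z -> hol g z.
  by move=> [/andP[_] /= h _]; apply: hg; lra.
have s10 : 0 <= s1 - s by rewrite subr_ge0.
have := goursat s10 pp hb; rewrite /rect.
have -> : edge g (s%:C + 'i * (2 * pi)%:C) (s1 - s)%:C = edge g s%:C (s1 - s)%:C.
  by rewrite /edge; congr (_ * _); apply: cint_eq => u _; rewrite -/T addrAC gT.
have -> : s%:C + (s1 - s)%:C = s1%:C :> C by rewrite -rmorphD /=; congr (_%:C); ring.
rewrite -/T => E0; have {E0} E : edge g s1%:C T = edge g s%:C T.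
  move: E0; move: (edge g s1%:C T) (edge g s%:C T) (edge _ _ _) => x1 x2 x3 E0.
  by apply/eqP; rewrite -subr_eq0 -E0; apply/eqP; ring.
have c1 (u : R) : u <= s1 -> cont01 (fun v : R => g (u%:C + v%:C * T)).
  move=> us; apply: cont_seg => v _; apply: hg; rewrite ReD !ReM /=; lra.
have RE (u v : R) : complex.Re (u%:C + v%:C * T) = u by rewrite ReD !ReM /=; ring.
have nT : rn T = 2 * pi by rewrite /T (rnM 'i) rn_i mul1r rn_real ger0_norm.
have b1 : rn (edge g s1%:C T) <= 2 * pi * M.
  rewrite -nT; apply: edge_bound; first exact: c1.
  by move=> v _; apply: hM; rewrite rn_cexp RE /s1 lnK// posrE.
have b2 : rn (edge (fun z => g z - f 0) s%:C T) <= 2 * pi * e.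
  rewrite -nT; apply: edge_bound.
    by apply: (@cont_seg (fun z => g z - f 0)) => v _; apply: holB; [apply: hg; rewrite RE | exact: hol_const].
  move=> v _; apply: hd; rewrite rn_cexp RE (@le_lt_trans _ _ (expR (ln d - 1)))//.
    by rewrite ler_expR ge_min lexx orbT.
  by rewrite -[ltRHS]lnK ?posrE// ltr_expR ltrBlDr ltrDl.
have c2 : cont01 (fun v : R => f 0) by apply: (@cont_seg (fun=> f 0) 0 0) => v _; exact: hol_const.
rewrite (@edgeB g (fun=> f 0)) in b2; [|exact: c1|exact: c2].
have E2 : edge (fun=> f 0) s%:C T = T * f 0.
  by rewrite /edge; congr (_ * _); apply: cint_lim => e1 e10; exists 0%N => k _; rewrite rsum_const subrr rn0 ltW.
rewrite E2 -E in b2.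
have := rn_sub (T * f 0) (edge g s1%:C T); rewrite rnM nT (rnB (T * f 0)) => h3.
have p2 : 0 < 2 * pi :> R by rewrite mulr_gt0.
rewrite -(ler_pM2l p2); apply: (le_trans h3); rewrite [leRHS]mulrDr addrC; exact: lerD.
Qed.

End Goursat.

(** * Cauchy's inequality and limits of holomorphic functions *)

Section Cauchy.
Variable R : realType.
Local Notation C := R[i].
Implicit Types (U : normedModType C).

Lemma isd_val U (f : U -> C) x (h : U) : hol f x -> forall e : R, 0 < e ->
  exists2 d, 0 < d & forall s : C, rn s < d -> rn (f (x + s *: h) - f x - s * dd f x h) <= e * rn s.
Proof.
move=> /ddP hf e e0; case: (hf) => _ _ hL.
have h1 : 0 < rn h + 1 by rewrite ltr_wpDl ?rn_ge0.
have [d d0 hd] := hL _ (divr_gt0 e0 h1); exists (d / (rn h + 1)); first exact: divr_gt0.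
move=> s; rewrite ltr_pdivlMr// mulrDr mulr1 => sd.
have S0 := rn_ge0 s; have H0 := rn_ge0 h; have SH := mulr_ge0 S0 H0.
have := hd (s *: h); rewrite rnZ (isd_linZ _ _ hf) => /(_ ltac:(lra)) h2.
rewrite (le_trans h2)//.
have -> : e / (rn h + 1) * (rn s * rn h) = e * rn s * (rn h / (rn h + 1)) by ring.
by rewrite ler_piMr ?mulr_ge0// ?(ltW e0)// ler_pdivrMr//; lra.
Qed.

Lemma hol_line U (f : U -> C) (a c : U) (w : C) : hol f (a + w *: c) -> hol (fun z : C => f (a + z *: c)) w.
Proof. by move=> /ddP /isd_line h; eexists; exact: h. Qed.

(** [circle_max] is applied to the difference quotient in the direction [h], completed by [dd f x h]
    at [z = 0]. On [|z| = r / (2 |h|)] the quotient is at most [2 M / |z|], whence the constant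
    4. *)
Lemma cauchy_ineq U (f : U -> C) x (r M : R) h : 0 < r ->
  (forall y, rn (y - x) < r -> hol f y) -> (forall y, rn (y - x) < r -> rn (f y) <= M) ->
  rn (dd f x h) <= 4 * M / r * rn h.
Proof.
move=> r0 hf hM; have hx : hol f x by apply: hf; rewrite subrr rn0.
have hd := ddP hx.
have M0 : 0 <= M by rewrite (le_trans (rn_ge0 (f x)))// hM// subrr rn0.
have [->|h0] := eqVneq h 0; first by rewrite (isd_lin0 hd) !rn0 mulr0.
have H0 : 0 < rn h by rewrite rn_gt0.
pose q (z : C) := if z == 0 then dd f x h else (f (x + z *: h) - f x) / z.
pose rho := r / 2 / rn h; have rho0 : 0 < rho by rewrite !divr_gt0.
have hy (z : C) : rn z <= rho -> rn (x + z *: h - x) < r.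
  rewrite (addrC x) addrK rnZ => zr.
  have : rn z * rn h <= rho * rn h by rewrite ler_wpM2r// ltW.
  by rewrite divfK ?gt_eqF//; lra.
have := @circle_max R q rho (2 * M / rho) rho0 _ _ _.
have qz z : z != 0 -> q z = (f (x + z *: h) - f x) / z by rewrite /q => /negbTE ->.
have q0 : q 0 = dd f x h by rewrite /q eqxx.
rewrite q0 => H; rewrite (le_trans (H _ _ _))//.
- move=> z /andP[z0 zr].
  apply: (@hol_near _ _ (fun z : C => (f (x + z *: h) - f x) / z) _ _ (rn z)) => //.
    move=> y yz; rewrite qz// -rn_gt0; have := rn_sub z y; rewrite (rnB z); lra.
  apply: holM; first by apply: holB; [apply: hol_line; exact/hf/hy | exact: hol_const].
  by apply: holV; [rewrite -rn_gt0 | exists id; exact: isd_id].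
- move=> e e0; have [d d0 hd1] := isd_val h hx e0; exists d => // z zd.
  have [->|z0] := eqVneq z 0; first by rewrite q0 subrr rn0 ltW.
  rewrite qz//; have z1 : 0 < rn z by rewrite rn_gt0.
  have -> : (f (x + z *: h) - f x) / z - dd f x h = (f (x + z *: h) - f x - z * dd f x h) / z by field.
  by rewrite rnM rnV ler_pdivrMr//; exact: hd1.
- move=> z zr; have z0 : z != 0 by rewrite -rn_gt0 zr.
  rewrite qz// rnM rnV zr ler_wpM2r ?invr_ge0 ?(ltW rho0)// (le_trans (rnB_le _ _))//.
  have -> : 2 * M = M + M by ring.
  apply: lerD; apply: hM; last by rewrite subrr rn0.
  by apply: hy; rewrite zr.
- by rewrite le_eqVlt; apply/orP; left; apply/eqP; rewrite /rho; field; rewrite !lt0r_neq0.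
Qed.

Lemma hol_rder U (f : U -> C) (a h : U) (s : R) : hol f (a + s%:C *: h) ->
  rder (fun s => f (a + s%:C *: h)) s (dd f (a + s%:C *: h) h).
Proof. by move=> /ddP /rder_line. Qed.

Lemma hol_mvi U (f : U -> C) x h K :
  (forall s : R, 0 <= s <= 1 -> hol f (x + s%:C *: h)) ->
  (forall s : R, 0 <= s <= 1 -> rn (dd f (x + s%:C *: h) h) <= K) ->
  rn (f (x + h) - f x) <= K.
Proof.
move=> hf hK; have := @rmvi_le R (fun s => f (x + s%:C *: h)) _ K 0 1 ler01
  (fun s s1 => hol_rder (hf s s1)) hK.
by rewrite rmorph1 rmorph0 scale1r scale0r addr0 subr0 mulr1.
Qed.

Lemma hol_shift U (f : U -> C) x (c : U) : hol f (x + c) -> isd (fun y => f (y + c)) x (dd f (x + c)).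
Proof.
move=> /ddP [lL bL hL]; split => // e /hL [d d0 hd]; exists d => // h /hd.
by rewrite (addrAC x c h).
Qed.

Lemma ddB U (f g : U -> C) x : hol f x -> hol g x -> dd (fun y => f y - g y) x = (fun h => dd f x h - dd g x h).
Proof. by move=> /ddP hf /ddP hg; apply: ddE; exact: isdB. Qed.

(** Cauchy's inequality twice. The increment [G y = f (y + s h) - f y] is at most [8 M / r |h|], and
    the inequality for [G] on the radius [r / 4] bounds the variation of the derivative; this makes
    [128 = 4 * 8 * 4]. *)
Lemma second_order U (f : U -> C) x (r M : R) h : 0 < r ->
  (forall y, rn (y - x) < r -> hol f y) -> (forall y, rn (y - x) < r -> rn (f y) <= M) ->
  rn h <= r / 4 -> rn (f (x + h) - f x - dd f x h) <= 128 * M / r ^+ 2 * rn h ^+ 2.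
Proof.
move=> r0 hf hM hr; have H0 := rn_ge0 h.
have M0 : 0 <= M by rewrite (le_trans (rn_ge0 (f x)))// hM// subrr rn0.
have c1 y (k : U) : rn (y - x) < r / 2 -> rn (dd f y k) <= 4 * M / (r / 2) * rn k.
  move=> yx; apply: cauchy_ineq; first lra.
    by move=> z zy; apply: hf; have := rn_tri z y x; lra.
  by move=> z zy; apply: hM; have := rn_tri z y x; lra.
have sh (s : R) : 0 <= s <= 1 -> rn (s%:C *: h) <= rn h.
  by move=> /andP[s0 s1]; rewrite rnZ rn_real ger0_norm// ler_piMl.
have c2 (s : R) : 0 <= s <= 1 -> rn (dd f (x + s%:C *: h) h - dd f x h) <= 128 * M / r ^+ 2 * rn h ^+ 2.
  move=> s1; have shs := sh _ s1; pose G y := f (y + s%:C *: h) - f y.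
  have hx y : rn (y - x) < r / 4 -> hol f (y + s%:C *: h).
    by move=> yx; apply: hf; rewrite addrAC; have := rnD (y - x) (s%:C *: h); lra.
  have hG y : rn (y - x) < r / 4 -> hol G y.
    move=> yx; apply: holB; last by apply: hf; lra.
    by eexists; apply: hol_shift; exact: hx.
  have bG y : rn (y - x) < r / 4 -> rn (G y) <= 4 * M / (r / 2) * rn h.
    move=> yx; have nn u : 0 <= u <= 1 -> rn (y + u%:C *: (s%:C *: h) - x) < r / 2.
      move=> /andP[u0 u1]; rewrite addrAC.
      have : rn (u%:C *: (s%:C *: h)) <= rn (s%:C *: h) by rewrite [leLHS]rnZ rn_real ger0_norm// ler_piMl ?rn_ge0.
      by have := rnD (y - x) (u%:C *: (s%:C *: h)); lra.
    apply: hol_mvi => u u1; first by apply: hf; have := nn _ u1; lra.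
    by apply: le_trans (c1 _ _ (nn _ u1)) _; rewrite ler_wpM2l// divr_ge0 ?mulr_ge0 ?(ltW r0)//.
  have r4 : 0 < r / 4 by lra.
  have := cauchy_ineq h r4 hG bG.
  have hx0 : hol f (x + s%:C *: h) by apply: hx; rewrite subrr rn0.
  have hxx : hol f x by apply: hf; rewrite subrr rn0.
  rewrite /G (ddE (isdB (hol_shift hx0) (ddP hxx))).
  congr (_ <= _); field; exact: lt0r_neq0.
have hs (s : R) : 0 <= s <= 1 -> hol f (x + s%:C *: h).
  by move=> s1; apply: hf; rewrite (addrC x) addrK; have := sh _ s1; lra.
pose F (s : R) := f (x + s%:C *: h) - s%:C * dd f x h.
have rF (s : R) : 0 <= s <= 1 -> rder F s (dd f (x + s%:C *: h) h - dd f x h).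
  move=> /hs /hol_rder hr1 e /hr1 [d d0 hd]; exists d => // k /hd; congr (rn _ <= _).
  by rewrite /F rmorphD /=; ring.
have := rmvi_le ler01 rF c2.
by rewrite /F rmorph1 rmorph0 scale1r scale0r addr0 mul0r mul1r subr0 subr0 mulr1 addrAC.
Qed.

(** The bound of [second_order] is the same for all [f k], so one difference quotient with a fixed
    step approximates all the derivatives at once. Pointwise convergence at two points then makes
    the derivatives a Cauchy sequence, and the second-order bound passes to the limit. *)
Lemma vitali U (f : nat -> U -> C) (g : U -> C) x (r M : R) : 0 < r ->
  (forall k y, rn (y - x) < r -> hol (f k) y) ->
  (forall k y, rn (y - x) < r -> rn (f k y) <= M) ->
  (forall y, rn (y - x) < r -> clim (f^~ y) (g y)) ->
  hol g x /\ forall h, clim (fun k => dd (f k) x h) (dd g x h).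
Proof.
move=> r0 hf hM hg; have xx : rn (x - x) < r by rewrite subrr rn0.
have M0 : 0 <= M by rewrite (le_trans (rn_ge0 (f 0%N x)))// hM.
have ex h : exists l, clim (fun k => dd (f k) x h) l.
  apply: clim_cauchy => e e0; have H0 := rn_ge0 h.
  pose K := 128 * M / r ^+ 2 * (rn h + 1) ^+ 2.
  have K0 : 0 <= K by rewrite mulr_ge0 ?divr_ge0 ?mulr_ge0// ?exprn_ge0// ?addr_ge0// ltW.
  have K1 : 0 < K + 1 by lra.
  (* The step keeps [x + s h] in the ball and makes the quadratic remainder at most [s e / 4] for
     every [k]; the four distances to the limits below are each at most [s e / 8], so the total is
     [s e]. *)
  pose s := Num.min (r / 4 / (rn h + 1)) (e / 4 / (K + 1)).
  have h1 : 0 < rn h + 1 by lra.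
  have s0 : 0 < s by rewrite lt_min !divr_gt0.
  have sr : s * (rn h + 1) <= r / 4 by rewrite -ler_pdivlMr// ge_min lexx.
  have se : s * (K + 1) <= e / 4 by rewrite -ler_pdivlMr// ge_min lexx orbT.
  have nsh : rn (s%:C *: h) <= r / 4 by rewrite rnZ rn_real gtr0_norm//; nra.
  have nsh2 : rn (s%:C *: h) < r by lra.
  have B k : rn (f k (x + s%:C *: h) - f k x - s%:C * dd (f k) x h) <= s * (e / 4).
    have := second_order r0 (hf k) (hM k) nsh.
    rewrite (isd_linZ _ _ (ddP (hf k _ xx))) => B; rewrite (le_trans B)//.
    rewrite rnZ rn_real gtr0_norm// exprMn.
    have : s * K <= e / 4 by nra.
    move=> sK; apply: (@le_trans _ _ (s * (s * K))); last by rewrite ler_wpM2l// ltW.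
    rewrite /K expr2 [leRHS](_ : _ = 128 * M / r ^+ 2 * (s * s * (rn h + 1) ^+ 2)); last by ring.
    rewrite ler_wpM2l ?divr_ge0 ?mulr_ge0 ?exprn_ge0// ?(ltW r0)// ler_wpM2l ?mulr_ge0 ?(ltW s0)//.
    by rewrite lerXn2r ?nnegrE//; lra.
  have yx : rn (x + s%:C *: h - x) < r by rewrite (addrC x) addrK.
  have se4 : 0 < s * (e / 8) by rewrite mulr_gt0// divr_gt0.
  have [N1 hN1] := hg _ yx _ se4; have [N2 hN2] := hg _ xx _ se4.
  exists (maxn N1 N2) => k l; rewrite !geq_max => /andP[k1 k2] /andP[l1 l2].
  have := hN1 _ k1; have := hN1 _ l1; have := hN2 _ k2; have := hN2 _ l2.
  have := B k; have := B l.
  set a := f k _; set b := f k x; set a' := f l _; set b' := f l x.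
  set D := dd (f k) x h; set D' := dd (f l) x h => B1 B2 e1 e2 e3 e4.
  rewrite -(ler_pM2l s0) -[s in leLHS]gtr0_norm// -rn_real -rnM.
  have -> : s%:C * (D - D') = (a - g (x + s%:C *: h)) - (a' - g (x + s%:C *: h)) - (b - g x) + (b' - g x)
    - (a - b - s%:C * D) + (a' - b' - s%:C * D') by ring.
  rewrite (le_trans (rnD _ _))// (le_trans (lerD (rnB_le _ _) (lexx _)))//.
  rewrite (le_trans (lerD (lerD (rnD _ _) (lexx _)) (lexx _)))//.
  rewrite (le_trans (lerD (lerD (lerD (rnB_le _ _) (lexx _)) (lexx _)) (lexx _)))//.
  rewrite (le_trans (lerD (lerD (lerD (lerD (rnB_le _ _) (lexx _)) (lexx _)) (lexx _)) (lexx _)))//.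
  lra.
pose L h := xget 0 (clim (fun k => dd (f k) x h)).
have hL h : clim (fun k => dd (f k) x h) (L h) by apply: xgetPex; exact: ex.
have lin k := ddP (hf k _ xx).
have isL : isd g x L.
  split.
  - move=> a u v; apply: clim_unique (hL _) _.
    apply: clim_ext (climD (climM a (hL u)) (hL v)) => k.
    by case: (lin k) => -> _ _.
  - exists (4 * M / r); first by rewrite divr_ge0 ?mulr_ge0// ltW.
    by move=> u; apply: clim_le (hL u) _ => k; exact: cauchy_ineq (hf k) (hM k).
  - move=> e e0; pose K := 128 * M / r ^+ 2.
    have K0 : 0 <= K by rewrite divr_ge0 ?mulr_ge0 ?exprn_ge0 ?(ltW r0)//.
    have K1 : 0 < K + 1 by lra.
    exists (Num.min (r / 4) (e / (K + 1))); first by rewrite lt_min !divr_gt0.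
    move=> h; rewrite lt_min => /andP[h1]; rewrite ltr_pdivlMr// => h2.
    have yx : rn (x + h - x) < r by rewrite (addrC x) addrK; lra.
    have H0 := rn_ge0 h.
    apply: (@le_trans _ _ (K * rn h ^+ 2)); last first.
      by rewrite expr2 mulrA ler_wpM2r//; nra.
    apply: clim_le (climB (climB (hg _ yx) (hg _ xx)) (hL h)) _ => k.
    by apply: second_order (hf k) (hM k) _ => //; exact: ltW.
by split; [exists L | move=> h; rewrite (ddE isL)].
Qed.

Lemma hol_bounded U (f : U -> C) x : hol f x ->
  exists2 d, 0 < d & forall y, rn (y - x) < d -> rn (f y) <= rn (f x) + 1.
Proof.
move=> /hol_cont /(_ _ ltr01) [d d0 hd]; exists d => // y /hd.
by have := rn_sub (f y) (f x); lra.
Qed.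

Lemma isd_quotient U (f : U -> C) x h : hol f x ->
  clim (fun k => k.+1%:R * (f (x + k.+1%:R^-1 *: h) - f x)) (dd f x h).
Proof.
move=> hf e e0; have [d d0 hd] := isd_val h hf e0.
have [N hN] := nat_above (d^-1).
exists N => k Nk; have k0 : (0 : R) < k.+1%:R by rewrite ltr0n.
have nk : rn (k.+1%:R^-1 : C) = k.+1%:R^-1 by rewrite rnV rn_nat.
have := hd (k.+1%:R^-1); rewrite nk => /(_ _)/wrap[].
  rewrite invf_plt ?posrE// (le_lt_trans hN)// ltr_nat ltnS//.
rewrite ler_pdivlMr// => h1; rewrite (le_trans _ h1)// mulrC -(rn_nat R) -rnM.
rewrite le_eqVlt; apply/orP; left; apply/eqP; congr rn; field.
by rewrite -mulrS pnatr_eq0.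
Qed.

(** The derivative is the limit of the quotients of step [1 / (k + 1)], which are holomorphic and,
    by Cauchy's inequality, bounded near [x]; [vitali] applies. *)
Lemma hol_dd U (f : U -> C) x (r : R) h : 0 < r ->
  (forall y, rn (y - x) < r -> hol f y) -> hol (fun y => dd f y h) x.
Proof.
move=> r0 hf; have xx : rn (x - x) < r by rewrite subrr rn0.
have [d d0 hd] := hol_bounded (hf _ xx); set M := _ + 1 in hd.
pose q := Num.min r d; have q0 : 0 < q by rewrite lt_min r0.
have H0 := rn_ge0 h.
have hq y : rn (y - x) < q -> hol f y by rewrite lt_min => /andP[/hf].
have bq y : rn (y - x) < q -> rn (f y) <= M by rewrite lt_min => /andP[_ /hd].
have M0 : 0 <= M by rewrite addr_ge0 ?rn_ge0.
have [N hN] := nat_above (rn h / (q / 4)).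
have q4 : 0 < q / 4 by lra.
(* The shift by [N] keeps all the steps at most [q / 4], so that the translates stay in the ball. *)
pose g k y := (k + N).+1%:R * (f (y + (k + N).+1%:R^-1 *: h) - f y) : C.
have sm k : rn ((k + N).+1%:R^-1 *: h) <= q / 4.
  rewrite rnZ rnV rn_nat mulrC ler_pdivrMr ?ltr0n// mulrC -ler_pdivrMr// (le_trans hN)//.
  by rewrite ler_nat leqW// leq_addl.
have q2 : 0 < q / 4 by lra.
apply: (@vitali _ g (fun y => dd f y h) x (q / 4) (4 * M / (q / 4) * rn h) q2 _ _ _).1.
- move=> k y yx; apply: holM; first exact: hol_const.
  apply: holB; last by apply: hq; lra.
  eexists; apply: hol_shift; apply: hq; rewrite addrAC.
  by have := rnD (y - x) ((k + N).+1%:R^-1 *: h); have := sm k; lra.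
- move=> k y yx; rewrite /g rnM rn_nat mulrC -ler_pdivlMr ?ltr0n//.
  have -> : 4 * M / (q / 4) * rn h / (k + N).+1%:R = 4 * M / (q / 4) * rn ((k + N).+1%:R^-1 *: h).
    by rewrite rnZ rnV rn_nat; ring.
  have nn u : 0 <= u <= 1 -> rn (y + u%:C *: ((k + N).+1%:R^-1 *: h) - x) < q / 2.
    move=> /andP[u0 u1]; rewrite addrAC.
    have : rn (u%:C *: ((k + N).+1%:R^-1 *: h)) <= rn ((k + N).+1%:R^-1 *: h).
      by rewrite [leLHS]rnZ rn_real ger0_norm// ler_piMl ?rn_ge0.
    have := rnD (y - x) (u%:C *: ((k + N).+1%:R^-1 *: h)); have := sm k.
    by set A := rn (_ *: (_ *: _)); lra.
  apply: hol_mvi => u u1; first by apply: hq; have := nn _ u1; lra.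
  apply: cauchy_ineq => // z zy.
    by apply: hq; have := rn_tri z (y + u%:C *: ((k + N).+1%:R^-1 *: h)) x; have := nn _ u1; lra.
  by apply: bq; have := rn_tri z (y + u%:C *: ((k + N).+1%:R^-1 *: h)) x; have := nn _ u1; lra.
- move=> y yx; apply: (clim_shift N (isd_quotient h _)); apply: hq; lra.
Qed.

End Cauchy.

(** * The identity theorem *)

Section Identity.
Variable R : realType.
Local Notation C := R[i].
Implicit Types (U : normedModType C).

Lemma geom_small (q M e : R) : 0 <= q < 1 -> 0 < e -> exists N, forall k, (N <= k)%N -> M * q ^+ k <= e.
Proof.
move=> /andP[q0 q1] e0; have M1 : 0 < `|M| + 1 by rewrite ltr_wpDl.
have : q ^+ n @[n --> \oo] --> (0 : R) by apply: cvg_expr; rewrite ger0_norm.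
move=> /cvgrPdist_le /(_ _ (divr_gt0 e0 M1))[N _ hN]; exists N => k /hN.
rewrite sub0r normrN ger0_norm ?exprn_ge0// ler_pdivlMr// => h.
apply: le_trans h; rewrite mulrC ler_wpM2l ?exprn_ge0//.
by apply: le_trans (ler_norm _) _; rewrite lerDl.
Qed.

Definition opn U (E : set U) := forall x, E x -> exists2 r : R, 0 < r & forall y, rn (y - x) < r -> E y.

Lemma opn_ball U (c : U) r : opn [set y | rn (y - c) < r].
Proof.
move=> x /= xc; exists (r - rn (x - c)); first lra.
by move=> y; have := rn_tri y x c; lra.
Qed.

Lemma opn_hol U (E : set U) (f : U -> C) x : opn E -> (forall y, E y -> hol f y) -> E x ->
  exists r M : R, 0 < r /\ forall y, rn (y - x) < r -> hol f y /\ rn (f y) <= M.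
Proof.
move=> oE hf Ex; have [r r0 hr] := oE _ Ex; have [d d0 hd] := hol_bounded (hf _ Ex).
exists (Num.min r d), (rn (f x) + 1); rewrite lt_min r0; split => // y.
by rewrite lt_min => /andP[/hr/hf ? /hd].
Qed.

(** Flatness keeps [f(w) / w^k] holomorphic at 0 for all [k]. The circle of radius [r / 2] around
    [z] stays at distance [r / 4] from 0, so the maximum principle gives [|f z| <= M (4 |z| / r)^k],
    which tends to 0. *)
Lemma flat_eq0 (f : C -> C) (r M : R) : 0 < r ->
  (forall z, rn z < r -> hol f z) -> (forall z, rn z < r -> rn (f z) <= M) ->
  (forall k, exists K d, 0 < d /\ forall z, rn z < d -> rn (f z) <= K * rn z ^+ k) ->
  forall z, rn z < r / 4 -> f z = 0.
Proof.
move=> r0 hf hM flat z zr.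
have M0 : 0 <= M by rewrite (le_trans (rn_ge0 (f 0)))// hM// rn0.
have B k : rn (f z) <= M * (4 * rn z / r) ^+ k.
  pose g (w : C) := f w / w ^+ k.
  have f0 : f 0 = 0.
    have [K [d [d0 hd]]] := flat 1%N; have := hd 0; rewrite rn0 expr1 mulr0 => /(_ d0) h.
    by apply/eqP; rewrite -rn_eq0 eq_le h rn_ge0.
  have hg w : rn w < r -> hol g w.
    move=> wr; have [->|w0] := eqVneq w 0; last first.
      apply: holM; first exact: hf.
      apply: holV; first by rewrite expf_neq0.
      by apply: holX; exists id; exact: isd_id.
    (* Order [k + 2] makes the quotient quadratically small, so its derivative at 0 is 0. *)
    have [K [d [d0 hd]]] := flat k.+2.
    exists (fun=> 0); split => [a u v||e e0]; first by rewrite mulr0 addr0.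
      by exists 0 => // u; rewrite rn0 mul0r.
    have K1 : 0 < `|K| + 1 by rewrite ltr_wpDl.
    exists (Num.min d (e / (`|K| + 1))); first by rewrite lt_min d0 divr_gt0.
    move=> h; rewrite lt_min => /andP[h1]; rewrite ltr_pdivlMr// => h2.
    rewrite add0r subr0 /g f0 mul0r subr0.
    have [->|hn0] := eqVneq h 0; first by rewrite f0 mul0r rn0 mulr0.
    have hp : 0 < rn h by rewrite rn_gt0.
    rewrite rnM rnV rnX ler_pdivrMr ?exprn_gt0//.
    apply: le_trans (hd _ h1) _; rewrite !exprS !mulrA ler_wpM2r ?exprn_ge0 ?rn_ge0//.
    rewrite ler_wpM2r ?rn_ge0//; apply: le_trans (ltW h2); rewrite mulrC ler_wpM2l ?rn_ge0//.
    by apply: le_trans (ler_norm _) _; rewrite lerDl.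
  have r2 : 0 < r / 2 by lra.
  have zz w : rn w <= r / 2 -> rn (z + w) < r by have := rnD z w; lra.
  have sg w : rn w <= r / 2 -> hol (fun w => g (z + w)) w.
    by move=> wr; eexists; apply: (isd_ext (fun u => congr1 g (addrC u z)));
      apply: hol_shift; apply: hg; rewrite addrC; exact: zz.
  have := @circle_max R (fun w => g (z + w)) (r / 2) (M * (4 / r) ^+ k) r2.
  rewrite addr0 => /(_ _ _ _)/wrap[].
  - by move=> w /andP[_ wr]; exact: sg.
  - move=> e e0; have := hol_cont (sg 0 _); rewrite rn0 addr0 => /(_ (ltW r2) _ e0)[d d0 hd].
    by exists d => // w wd; apply: hd; rewrite subr0.
  - move=> w wr; have rw : r / 4 <= rn (z + w).
      by have := rnB_le (z + w) z; rewrite addrC addKr wr; lra.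
    have p4 : 0 < rn (z + w) by lra.
    rewrite /g rnM rnV rnX ler_pM ?rn_ge0 ?invr_ge0 ?exprn_ge0 ?rn_ge0//; first by apply/hM/zz; rewrite wr.
    rewrite -exprVn lerXn2r ?nnegrE ?invr_ge0 ?rn_ge0 ?divr_ge0 ?(ltW r0)//.
    by rewrite -[4 / r]invrK invf_div lef_pV2// posrE; lra.
  have [->|z0] := eqVneq z 0; first by rewrite f0 rn0 mulr_ge0// exprn_ge0// mulr0 mul0r.
  have zp : 0 < rn z by rewrite rn_gt0.
  rewrite /g rnM rnV rnX ler_pdivrMr ?exprn_gt0// => h; apply: le_trans h _.
  by rewrite (_ : 4 * rn z / r = 4 / r * rn z) ?exprMn ?mulrA//; ring.
apply: small_eq0 => e e0; have [|N hN] := @geom_small (4 * rn z / r) M e _ e0.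
  by rewrite divr_ge0 ?mulr_ge0 ?rn_ge0 ?(ltW r0)//= ltr_pdivrMr//; lra.
exact: le_trans (B N) (hN _ (leqnn _)).
Qed.

(** On the complex line through [c] and [y], [f] vanishes near 0 and [flat_eq0] applies. The radius
    [r / 8] of the conclusion does not depend on [d]: this uniform gain is what lets the vanishing
    travel along a segment. *)
Lemma identity_ball U (f : U -> C) x c (r M d : R) : 0 < r -> 0 < d ->
  (forall y, rn (y - x) < r -> hol f y /\ rn (f y) <= M) -> rn (c - x) < r / 2 ->
  (forall y, rn (y - c) < d -> f y = 0) -> forall y, rn (y - c) < r / 8 -> f y = 0.
Proof.
move=> r0 d0 hf cx fc y yc; have [->|v0] := eqVneq y c; first by apply: fc; rewrite subrr rn0.
have vp : 0 < rn (y - c) by rewrite rn_gt0 subr_eq0.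
pose q := r / 2 / rn (y - c); have q0 : 0 < q by rewrite !divr_gt0.
have inb (z : C) : rn z < q -> rn (c + z *: (y - c) - x) < r.
  rewrite ltr_pdivlMr// => zq; rewrite addrAC.
  by have := rnD (c - x) (z *: (y - c)); rewrite rnZ; lra.
have := @flat_eq0 (fun z => f (c + z *: (y - c))) q M q0 _ _ _ 1.
rewrite scale1r (addrC c) subrK; apply.
- by move=> z /inb /hf[h _]; exact: hol_line.
- by move=> z /inb /hf[].
- move=> k; exists 0, (d / rn (y - c)); split; first exact: divr_gt0.
  move=> z; rewrite ltr_pdivlMr// => zd; rewrite fc ?rn0 ?mul0r//.
  by rewrite (addrC c) addrK rnZ.
- by rewrite rn1 ltr_pdivlMr// ltr_pdivlMr//; lra.
Qed.

(** The property given to [cousin] is that vanishing near the first point of a piece implies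
    vanishing near all its points; a piece within [r / 16] of a point is covered by one use of
    [identity_ball]. *)
Lemma identity_segment U (E : set U) (f : U -> C) t0 t1 (d : R) : opn E ->
  (forall y, E y -> hol f y) -> (forall s : R, 0 <= s <= 1 -> E (t0 + s%:C *: (t1 - t0))) ->
  0 < d -> (forall y, rn (y - t0) < d -> f y = 0) -> f t1 = 0.
Proof.
move=> oE hf hE d0 fd; pose p (s : R) := t0 + s%:C *: (t1 - t0).
have p0 : p 0 = t0 by rewrite /p rmorph0 scale0r addr0.
have p1 : p 1 = t1 by rewrite /p rmorph1 scale1r addrC subrK.
pose Z s := exists2 d : R, 0 < d & forall y, rn (y - p s) < d -> f y = 0.
suff : Z 0 -> forall s, 0 <= s <= 1 -> Z s.
  move=> /(_ _ 1)/wrap[]; first by exists d; rewrite ?p0.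
  by move=> /(_ _)/wrap[]; [rewrite lexx ler01 | move=> [e e0]; rewrite p1; apply; rewrite subrr rn0].
apply: (@cousin R (fun a b => Z a -> forall s, a <= s <= b -> Z s)).
  move=> a c b h1 h2 hac hcb Za s /andP[as_ sb].
  have [sc|cs] := leP s c; first by apply: hac; rewrite ?as_.
  apply: hcb; last by rewrite ltW.
  by apply: hac => //; move: h1 => /andP[_ ->] /=; rewrite lexx.
move=> s s1; have [r [M [r0 hr]]] := opn_hol oE hf (hE _ s1).
have T1 : 0 < rn (t1 - t0) + 1 by rewrite ltr_wpDl ?rn_ge0.
have near u v : `|u - v| < r / 16 / (rn (t1 - t0) + 1) -> rn (p u - p v) < r / 16.
  rewrite ltr_pdivlMr// => uv; rewrite /p opprD addrACA subrr add0r -scalerBl -rmorphB /= rnZ rn_real.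
  by have := rn_ge0 (t1 - t0); have := normr_ge0 (u - v); nra.
exists (r / 16 / (rn (t1 - t0) + 1)); first by rewrite !divr_gt0.
move=> a b _ _ /andP[as_ sb] ab [e e0 he] u /andP[au ub].
have r2 : rn (p a - p s) < r / 2.
  by have := near a s; rewrite ler0_norm ?subr_le0//; move=> /(_ ltac:(lra)); lra.
exists (r / 16); first lra.
move=> y yu; apply: (identity_ball r0 e0 hr r2 he).
have := near u a; rewrite ger0_norm ?subr_ge0// => /(_ ltac:(lra)).
by have := rn_tri y (p u) (p a); lra.
Qed.

Lemma identity_segment_eq U (E : set U) (f g : U -> C) t0 t1 (d : R) : opn E ->
  (forall y, E y -> hol f y) -> (forall y, E y -> hol g y) ->
  (forall s : R, 0 <= s <= 1 -> E (t0 + s%:C *: (t1 - t0))) ->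
  0 < d -> (forall y, rn (y - t0) < d -> f y = g y) -> f t1 = g t1.
Proof.
move=> oE hf hg hE d0 fg; apply/eqP; rewrite -subr_eq0; apply/eqP.
apply: (@identity_segment U E (fun y => f y - g y) t0 t1 d) => //.
  by move=> y Ey; apply: holB; [exact: hf | exact: hg].
by move=> y /fg ->; rewrite subrr.
Qed.

Lemma ball_convex U (t0 t1 : U) r (s : R) : rn t0 < r -> rn t1 < r -> 0 <= s <= 1 ->
  rn (t0 + s%:C *: (t1 - t0)) < r.
Proof.
move=> h0 h1 /andP[s0 s1].
have -> : t0 + s%:C *: (t1 - t0) = (1 - s)%:C *: t0 + s%:C *: t1.
  by rewrite rmorphB rmorph1 /= scalerBr scalerBl scale1r addrA addrAC.
apply: le_lt_trans (rnD _ _) _; rewrite !rnZ !rn_real !ger0_norm ?subr_ge0//.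
have a : 0 <= (1 - s) * (r - rn t0) by rewrite mulr_ge0// subr_ge0// ltW.
have [->|sn0] := eqVneq s 0; first by rewrite subr0 mul1r mul0r addr0.
have b : 0 < s * (r - rn t1) by rewrite mulr_gt0 ?subr_gt0// lt_def sn0.
lra.
Qed.

Lemma identity_convex_ball U (f g : U -> C) t0 t1 (r d : R) :
  (forall y, rn y < r -> hol f y) -> (forall y, rn y < r -> hol g y) -> rn t0 < r -> rn t1 < r ->
  0 < d -> (forall y, rn (y - t0) < d -> f y = g y) -> f t1 = g t1.
Proof.
move=> hf hg h0 h1 d0 fg.
apply: (@identity_segment_eq U [set y | rn (y - 0) < r] f g t0 t1 d) => //.
- exact: opn_ball.
- by move=> y /=; rewrite subr0; exact: hf.
- by move=> y /=; rewrite subr0; exact: hg.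
- by move=> s s1 /=; rewrite subr0; exact: ball_convex.
Qed.

Lemma entire_max (g : C -> C) (x : C) (r M : R) : 0 < r -> (forall z, hol g z) ->
  (forall z, rn (z - x) = r -> rn (g z) <= M) -> rn (g x) <= M.
Proof.
move=> r0 hg hM; have sg w : hol (fun w => g (x + w)) w.
  by eexists; apply: (isd_ext (fun u => congr1 g (addrC u x))); apply: hol_shift; exact: hg.
have := @circle_max R (fun w => g (x + w)) r M r0; rewrite addr0; apply=> //.
  move=> e e0; have := hol_cont (sg 0); rewrite addr0 => /(_ _ e0)[d d0 hd].
  by exists d => // w wd; apply: hd; rewrite subr0.
by move=> z zr; apply: hM; rewrite addrC addKr.
Qed.

End Identity.

(** * Integrals that depend on a parameter *)

Section ParametricIntegral.
Variable R : realType.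
Local Notation C := R[i].
Implicit Types (U : normedModType C).

Lemma isd_rsum U m (k : R -> U -> C) x (L : R -> U -> C) :
  (forall s, 0 <= s <= 1 -> isd (k s) x (L s)) ->
  isd (fun y => rsum m (k^~ y)) x (fun h => rsum m (L^~ h)).
Proof.
elim: m k L => [|m IH] k L h /=; first by apply: h; rewrite lexx ler01.
apply: isdZ; apply: isdD.
  by apply: (IH (fun s => k (s / 2)) (fun s => L (s / 2))) => s s1; apply: h; lra.
by apply: (IH (fun s => k ((1 + s) / 2)) (fun s => L ((1 + s) / 2))) => s s1; apply: h; lra.
Qed.

Lemma cint_hol U (k : R -> U -> C) x (r M : R) : 0 < r ->
  (forall s y, 0 <= s <= 1 -> rn (y - x) < r -> hol (k s) y /\ rn (k s y) <= M) ->
  (forall y, rn (y - x) < r -> cont01 (k^~ y)) ->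
  hol (fun y => cint (k^~ y)) x /\
  forall h, clim (fun m => rsum m (fun s => dd (k s) x h)) (dd (fun y => cint (k^~ y)) x h).
Proof.
move=> r0 hk ck; have xx : rn (x - x) < r by rewrite subrr rn0.
have hl m y : rn (y - x) < r -> isd (fun y => rsum m (k^~ y)) y (fun h => rsum m (fun s => dd (k s) y h)).
  by move=> yx; apply: isd_rsum => s s1; apply: ddP; case: (hk s y s1 yx).
have [||| h1 h2] := @vitali R U (fun m y => rsum m (k^~ y)) (fun y => cint (k^~ y)) x r M r0.
- by move=> m y yx; eexists; exact: hl.
- by move=> m y yx; apply: rsum_bound => s s1; case: (hk s y s1 yx).
- by move=> y yx; apply: cintP; exact: ck.
split=> // h; apply: clim_ext (h2 h) => m.
by rewrite (ddE (hl m x xx)).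
Qed.

End ParametricIntegral.

(** * Functions on products *)

Section Products.
Variable R : realType.
Local Notation C := R[i].
Implicit Types (U V : normedModType C).

Lemma rn_pair U V (x : U * V) : rn x = Num.max (rn x.1) (rn x.2).
Proof.
apply: (@complexI R); rewrite -rnE prod_normE !rnE.
by have [h|h] := leP (rn x.1) (rn x.2); [rewrite max_r ?lecR | rewrite max_l ?lecR// ltW].
Qed.

Lemma rn_pair_le U V (x : U) (y : V) (K : R) : rn (x, y) <= K <-> rn x <= K /\ rn y <= K.
Proof. by rewrite rn_pair ge_max; split => [/andP[]|[-> ->]]. Qed.

Lemma rn_pair_lt U V (x : U) (y : V) (K : R) : rn (x, y) < K <-> rn x < K /\ rn y < K.
Proof. by rewrite rn_pair gt_max; split => [/andP[]|[-> ->]]. Qed.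

Lemma rn_fst U V (x : U * V) : rn x.1 <= rn x.
Proof. by rewrite rn_pair le_max lexx. Qed.
Lemma rn_snd U V (x : U * V) : rn x.2 <= rn x.
Proof. by rewrite rn_pair le_max lexx orbT. Qed.

Lemma isd_fst V (x : C * V) : isd (fun x : C * V => x.1) x (fun x => x.1).
Proof. by apply: (@isd_linear _ _ _ 1) => // u; rewrite mul1r rn_fst. Qed.
Lemma hol_fst V (x : C * V) : hol (fun x : C * V => x.1) x.
Proof. by eexists; exact: isd_fst. Qed.

Lemma isd_pair U V (f : V -> C) (x : U * V) L : isd f x.2 L -> isd (fun x : U * V => f x.2) x (fun h => L h.2).
Proof.
move=> h; have := @isd_compl R (U * V)%type V (fun x => x.2) 0 f x L 1 _ ler01.
rewrite add0r => /(_ _ _ h) H; apply: (isd_ext _ (H _ _)) => [u||u]; rewrite ?add0r// ?mul1r ?rn_snd//.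
Qed.

Lemma hol_snd U V (f : V -> C) (x : U * V) : hol f x.2 -> hol (fun x : U * V => f x.2) x.
Proof. by move=> [L /isd_pair h]; eexists; exact: h. Qed.

Lemma hol_fst_comp V (f : C -> C) (x : C * V) : hol f x.1 -> hol (fun x : C * V => f x.1) x.
Proof. by move=> [L h]; eexists; exact: (isd_chain (isd_fst x) h). Qed.

Lemma isd_slice1 U V (f : U * V -> C) (x : U) (y : V) L : isd f (x, y) L ->
  isd (fun x => f (x, y)) x (fun h => L (h, 0)).
Proof.
move=> h; have := @isd_compl R U (U * V)%type (fun x => (x, 0)) (0, y) f x L 1 _ ler01.
have E u : (0, y) + (u, 0) = (u, y) :> U * V by apply: injective_projections; rewrite /= ?addr0 ?add0r.
rewrite E => /(_ _ _ h) H; apply: (isd_ext _ (H _ _)) => [u|u v a|u]; first by rewrite E.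
  by apply: injective_projections; rewrite /= ?scaler0 ?addr0.
by rewrite mul1r; apply/rn_pair_le; rewrite rn0 rn_ge0.
Qed.

Lemma isd_slice2 U V (f : U * V -> C) (x : U) (y : V) L : isd f (x, y) L ->
  isd (fun y => f (x, y)) y (fun h => L (0, h)).
Proof.
move=> h; have := @isd_compl R V (U * V)%type (fun y => (0, y)) (x, 0) f y L 1 _ ler01.
have E u : (x, 0) + (0, u) = (x, u) :> U * V by apply: injective_projections; rewrite /= ?addr0 ?add0r.
rewrite E => /(_ _ _ h) H; apply: (isd_ext _ (H _ _)) => [u|u v a|u]; first by rewrite E.
  by apply: injective_projections; rewrite /= ?scaler0 ?addr0.
by rewrite mul1r; apply/rn_pair_le; rewrite rn0 rn_ge0.
Qed.

Lemma hol_slice1 U V (f : U * V -> C) (x : U) (y : V) : hol f (x, y) -> hol (fun x => f (x, y)) x.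
Proof. by move=> [L /isd_slice1 h]; eexists; exact: h. Qed.
Lemma hol_slice2 U V (f : U * V -> C) (x : U) (y : V) : hol f (x, y) -> hol (fun y => f (x, y)) y.
Proof. by move=> [L /isd_slice2 h]; eexists; exact: h. Qed.

Lemma isd_scale1 V (f : C * V -> C) (s : C) (x : C * V) L : isd f (s * x.1, x.2) L ->
  isd (fun x => f (s * x.1, x.2)) x (fun h => L (s * h.1, h.2)).
Proof.
move=> h; have := @isd_compl R (C * V)%type (C * V)%type (fun x => (s * x.1, x.2)) 0 f x L (rn s + 1).
rewrite add0r => /(_ _ _ _ h) H; apply: (isd_ext _ (H _ _ _)) => [u|[u1 u2] [v1 v2] a||[u1 u2]].
- by rewrite add0r.
- by apply: injective_projections => //=; rewrite /GRing.scale /=; ring.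
- by rewrite addr_ge0 ?rn_ge0.
apply/rn_pair_le; rewrite rnM /=; split.
  by rewrite ler_pM ?rn_ge0// ?rn_fst// ?lerDl// (@rn_fst C V (u1, u2)).
rewrite (le_trans (@rn_snd C V (u1, u2)))// ler_peMl ?rn_ge0// lerDr rn_ge0 //.
Qed.

Lemma hol_real (f : C -> C) (s : R) : hol f s%:C -> rder (fun s => f s%:C) s (dd f s%:C 1).
Proof.
move=> h; have := @hol_rder R C f 0 1 s; rewrite add0r /GRing.scale /= mulr1 => /(_ h).
by apply: rder_ext => u; rewrite add0r /GRing.scale /= mulr1.
Qed.

Lemma cont01_hol (f : C -> C) : (forall s : R, 0 <= s <= 1 -> hol f s%:C) -> cont01 (fun s => f s%:C).
Proof. by move=> h; apply: (@rder_cont01 _ _ (fun s => dd f s%:C 1)) => s /h /hol_real. Qed.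

Lemma opn_fst V (O : set V) : opn O -> opn [set x : C * V | O x.2].
Proof.
move=> oO x /= /oO [r r0 hr]; exists r => // y yx; apply: hr.
exact: le_lt_trans (@rn_snd C V (y - x)) yx.
Qed.

End Products.

(** * The norm of a matrix and its entries *)

Section MatrixNorm.
Variable R : realType.
Local Notation C := R[i].

Lemma rn_entry p q (M : 'M[C]_(p, q)) i j : rn (M i j) <= rn M.
Proof.
rewrite -lecR -!rnE {2}/Num.Def.normr /= /mx_norm.
by rewrite -[leLHS]nngE num_le; apply: (le_bigmax _ (fun ij => `|M ij.1 ij.2|%:nng) (i, j)).
Qed.

Lemma rn_mx_le p q (M : 'M[C]_(p, q)) (K : R) : 0 <= K ->
  (forall i j, rn (M i j) <= K) -> rn M <= K.
Proof.
move=> K0 h; have KC : 0 <= K%:C :> C by rewrite lecR.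
rewrite -lecR -rnE /Num.Def.normr /= /mx_norm -[leRHS]/((NngNum KC)%:num) num_le.
apply/bigmax_leP; split=> [|[i j] _]; first by rewrite -num_le.
by rewrite -num_le /= rnE lecR.
Qed.

Lemma rn_mx_lt p q (M : 'M[C]_(p, q)) (K : R) : 0 < K ->
  (forall i j, rn (M i j) < K) -> rn M < K.
Proof.
move=> K0 h; have KC : 0 <= K%:C :> C by rewrite lecR ltW.
rewrite -ltcR -rnE /Num.Def.normr /= /mx_norm -[ltRHS]/((NngNum KC)%:num) num_lt.
apply/bigmax_ltP; split=> [|[i j] _]; first by rewrite -num_lt /= ltcR.
by rewrite -num_lt /= rnE ltcR.
Qed.

End MatrixNorm.

(** * Uniformity along arcs, and primitives *)

Section Tube.
Variable R : realType.
Local Notation C := R[i].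
Implicit Types (U V : normedModType C).

Lemma fin_bounds (I : eqType) (r : seq I) (P : I -> R -> R -> Prop) :
  (forall i e e' M M', 0 < e' <= e -> M <= M' -> P i e M -> P i e' M') ->
  (forall i, i \in r -> exists e M, 0 < e /\ P i e M) -> exists e M, 0 < e /\ forall i, i \in r -> P i e M.
Proof.
move=> mono; elim: r => [|i r IH] h; first by exists 1, 0.
have [|e [M [e0 he]]] := IH; first by move=> j jr; apply: h; rewrite inE jr orbT.
have [e' [M' [e0' he']]] := h i (mem_head _ _).
exists (Num.min e e'), (Num.max M M'); rewrite lt_min e0 e0'; split=> // j; rewrite inE => /predU1P[->|jr].
  by apply: mono he'; rewrite ?lt_min ?e0 ?e0' ?ge_min ?le_max ?lexx ?orbT.
by apply: mono (he j jr); rewrite ?lt_min ?e0 ?e0' ?ge_min ?le_max ?lexx ?orbT.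
Qed.

(** The arc of the [q s x] is compact: near each of its points [E] contains a ball where [f] is
    bounded, and [cousin] joins the pieces, keeping the smaller radius and the larger bound. *)
Lemma tube U (W : normedModType C) (E : set W) (f : W -> C) (q : R -> U -> W) (x : U) : opn E ->
  (forall y, E y -> hol f y) -> (forall s, 0 <= s <= 1 -> E (q s x)) ->
  (forall s, 0 <= s <= 1 -> forall e : R, 0 < e -> exists2 d : R, 0 < d &
     forall s' y, `|s' - s| < d -> rn (y - x) < d -> rn (q s' y - q s x) < e) ->
  exists r M : R, 0 < r /\ forall s y, 0 <= s <= 1 -> rn (y - x) < r ->
    E (q s y) /\ rn (f (q s y)) <= M.
Proof.
move=> oE hf hE hq.
apply: (@cousin R (fun a b => exists r M : R, 0 < r /\ forall s y, a <= s <= b -> rn (y - x) < r ->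
    E (q s y) /\ rn (f (q s y)) <= M)).
  move=> a c b _ _ [r [M [r0 h]]] [r' [M' [r0' h']]].
  exists (Num.min r r'), (Num.max M M'); rewrite lt_min r0 r0'; split=> // s y /andP[as_ sb].
  rewrite lt_min => /andP[yr yr']; have [sc|cs] := leP s c.
    by have [|? ?] := h s y _ yr; rewrite ?as_ //; split=> //; rewrite le_max; apply/orP; left.
  by have [|? ?] := h' s y _ yr'; rewrite ?(ltW cs)//; split=> //; rewrite le_max; apply/orP; right.
move=> s s1; have [r r0 hr] := oE _ (hE _ s1); have [d d0 hd] := hol_bounded (hf _ (hE _ s1)).
have [|d' d0' hd'] := hq _ s1 (Num.min r d); first by rewrite lt_min r0.
exists d' => // a b _ _ /andP[as_ sb] ab; exists d', (rn (f (q s x)) + 1); split=> // u y /andP[au ub] yx.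
have us : `|u - s| < d' by rewrite ltr_norml; apply/andP; split; lra.
by have := hd' _ _ us yx; rewrite lt_min => /andP[/hr ? /hd].
Qed.

Lemma tube_scale1 V (E : set (C * V)) (f : C * V -> C) (x : C * V) : opn E ->
  (forall y, E y -> hol f y) -> (forall s : R, 0 <= s <= 1 -> E (s%:C * x.1, x.2)) ->
  exists r M : R, 0 < r /\ forall s y, 0 <= s <= 1 -> rn (y - x) < r ->
    E (s%:C * y.1, y.2) /\ rn (f (s%:C * y.1, y.2)) <= M.
Proof.
move=> oE hf hE; apply: (@tube (C * V)%type (C * V)%type E f (fun (s : R) (y : C * V) => (s%:C * y.1, y.2) : C * V) x) => // s s1 e e0.
have x1 : 0 < rn x.1 + 2 by rewrite ltr_wpDl ?rn_ge0.
exists (Num.min 1 (e / (rn x.1 + 2) / 2)); first by rewrite lt_min ltr01 !divr_gt0.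
move=> s' y; rewrite !lt_min => /andP[s'1 s'2] /andP[y1 y2].
have ee : e / (rn x.1 + 2) / 2 <= e / 2 / 2.
  by rewrite !ler_wpM2r// ?invr_ge0// ler_wpM2l ?(ltW e0)// lef_pV2 ?posrE// lerDr rn_ge0.
have ye : rn (y - x) < e by lra.
have Y1 := @rn_fst R C V (y - x); have Y2 := @rn_snd R C V (y - x).
apply/rn_pair_lt => /=; split; last exact: le_lt_trans Y2 ye.
have -> : s'%:C * y.1 - s%:C * x.1 = (s' - s)%:C * y.1 + s%:C * (y.1 - x.1) by rewrite rmorphB /=; ring.
apply: le_lt_trans (rnD _ _) _; rewrite !rnM !rn_real.
rewrite /= in Y1; have := rn_sub y.1 x.1 => yx1; clear Y2.
have a1 : `|s' - s| * rn y.1 <= e / (rn x.1 + 2) / 2 * (rn x.1 + 2).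
  by rewrite ler_pM ?rn_ge0//; lra.
have a2 : `|s| * rn (y.1 - x.1) <= rn (y.1 - x.1).
  by rewrite ler_piMl ?rn_ge0// ger0_norm; lra.
have a3 : e / (rn x.1 + 2) / 2 * (rn x.1 + 2) = e / 2 by field; exact: lt0r_neq0.
lra.
Qed.

(** The integral of [f(., t)] along the segment from 0 to [x], for domains that are star-shaped in
    the first variable. *)
Definition prim V (f : C * V -> C) (x : C * V) : C := x.1 * cint (fun s : R => f (s%:C * x.1, x.2)).

Lemma seg1 V (x : C) (t : V) (z : C) : (z * x, t) = (0, t) + z *: (x, 0) :> C * V.
Proof. by apply: injective_projections; rewrite /= ?scaler0 ?addr0 ?add0r. Qed.

Lemma hol_seg1 V (f : C * V -> C) (x : C) (t : V) (z : C) : hol f (z * x, t) -> hol (fun z : C => f (z * x, t)) z.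
Proof. by rewrite seg1 => /hol_line; apply: hol_ext => u; rewrite seg1. Qed.

Lemma dd_seg1 V (f : C * V -> C) (x : C) (t : V) (z : C) : hol f (z * x, t) ->
  dd (fun z : C => f (z * x, t)) z 1 = x * dd f (z * x, t) (1, 0).
Proof.
move=> h; have hs := ddP h.
have : isd f ((0, t) + z *: (x, 0)) (dd f (z * x, t)) by rewrite -seg1.
move=> /isd_line /(isd_ext (fun u => congr1 f (esym (seg1 x t u)))) /ddE ->; rewrite mul1r.
have -> : (x, 0) = x *: (1, 0) :> C * V by apply: injective_projections; rewrite /= ?scaler0 // /GRing.scale /= mulr1.
by rewrite (isd_linZ _ _ hs).
Qed.

Lemma prim_cont V (E : set (C * V)) (f : C * V -> C) x : 
  (forall y, E y -> hol f y) -> (forall s : R, 0 <= s <= 1 -> E (s%:C * x.1, x.2)) ->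
  cont01 (fun s : R => f (s%:C * x.1, x.2)).
Proof.
move=> hf hE; apply: (@cont01_hol R (fun z : C => f (z * x.1, x.2))) => s s1.
by apply: hol_seg1; apply: hf; exact: hE.
Qed.

(** Differentiation under the integral gives the integral over [0, 1] of [f(s x) + s x f'(s x)], the
    derivative of [s f(s x)] in [s]; so it is [f x]. *)
Lemma prim_hol V (E : set (C * V)) (f : C * V -> C) x : opn E ->
  (forall y, E y -> hol f y) ->
  (forall s : R, 0 <= s <= 1 -> E (s%:C * x.1, x.2)) ->
  hol (prim f) x /\ dd (prim f) x (1, 0) = f x.
Proof.
move=> oE hf hE; have [r [M [r0 hr]]] := tube_scale1 oE hf hE.
pose k (s : R) (y : C * V) := f (s%:C * y.1, y.2).
have hk s y : 0 <= s <= 1 -> rn (y - x) < r -> hol (k s) y /\ rn (k s y) <= M.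
  move=> s1 yx; have [Ey by_] := hr _ _ s1 yx; split=> //.
  by eexists; apply: isd_scale1; apply: ddP; exact: hf.
have ck y : rn (y - x) < r -> cont01 (k^~ y).
  by move=> yx; apply: (prim_cont hf) => s s1; case: (hr _ _ s1 yx).
have [h1 h2] := cint_hol r0 hk ck.
have hp := isdM (isd_fst x) (ddP h1); split; first by eexists; exact: hp.
rewrite (ddE hp) /= mulr1.
have xx : rn (x - x) < r by rewrite subrr rn0.
have Ex s : 0 <= s <= 1 -> E (s%:C * x.1, x.2) by move=> s1; case: (hr _ _ s1 xx).
have kd s : 0 <= s <= 1 -> dd (k s) x (1, 0) = s%:C * dd f (s%:C * x.1, x.2) (1, 0).
  move=> /Ex Es; rewrite (ddE (isd_scale1 (ddP (hf _ Es)))) /= mulr1.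
  have -> : (s%:C, 0) = s%:C *: (1, 0) :> C * V by apply: injective_projections; rewrite /= ?scaler0 // /GRing.scale /= mulr1.
  by rewrite (isd_linZ _ _ (ddP (hf _ Es))).
pose g y := dd f y (1, 0).
have hg y : E y -> hol g y by move=> /oE [e e0 he]; apply: (hol_dd _ e0) => z /he /hf.
have cg : cont01 (fun s : R => s%:C * g (s%:C * x.1, x.2)).
  apply: (@cont01_hol R (fun z : C => z * g (z * x.1, x.2))) => s s1.
  by apply: holM; [exists id; exact: isd_id | apply: hol_seg1; apply: hg; exact: hE].
have cf := prim_cont hf Ex.
have cg' : cont01 (fun s : R => x.1 * (s%:C * g (s%:C * x.1, x.2)) + f (s%:C * x.1, x.2)).
  by apply: cont01D => //; exact: cont01Z.
have -> : dd (fun y => cint (k^~ y)) x (1, 0) = cint (fun s : R => s%:C * g (s%:C * x.1, x.2)).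
  apply: clim_unique (h2 _) _; apply: clim_ext (cintP cg) => m.
  by apply: rsum_eq => s s1; rewrite kd.
rewrite -cintZ// -cintD//; last exact: cont01Z.
rewrite (@cint_ftc _ (fun s : R => s%:C * f (s%:C * x.1, x.2)))//.
  by rewrite rmorph1 rmorph0 !mul1r mul0r subr0; case: (x).
move=> s s1; have Es := hf _ (Ex _ s1).
have := @hol_real R (fun z : C => z * f (z * x.1, x.2)) s.
have hz := isdM (isd_id s%:C) (ddP (hol_seg1 Es)).
rewrite (ddE hz) dd_seg1// mulr1 => /(_ ltac:(by eexists; exact: hz)).
by rewrite /g mulrCA.
Qed.

Lemma prim0 V (f : C * V -> C) t : prim f (0, t) = 0.
Proof. by rewrite /prim mul0r. Qed.

End Tube.

(** * Linear differential systems *)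

Section LinearSystems.
Variable R : realType.
Local Notation C := R[i].
Implicit Types (V : normedModType C).

Lemma clim_ratio (u : nat -> C) (E q : R) : 0 <= q < 1 ->
  (forall m, rn (u m.+1 - u m) <= E * q ^+ m) ->
  exists l, [/\ clim u l, forall m, rn (u m - u 0%N) <= E / (1 - q)
    & forall m, rn (l - u m) <= E * q ^+ m / (1 - q)].
Proof.
move=> /andP[q0 q1] h; have p0 : 0 < 1 - q by lra.
have E0 : 0 <= E by have := h 0%N; rewrite expr0 mulr1; apply: le_trans; exact: rn_ge0.
have B m k : rn (u (m + k)%N - u m) <= E * q ^+ m / (1 - q) * (1 - q ^+ k).
  elim: k => [|k IH]; first by rewrite addn0 !subrr rn0 mulr0.
  apply: le_trans (rn_tri _ (u (m + k)%N) _) _; rewrite addnS.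
  apply: le_trans (lerD (h _) IH) _; rewrite exprD exprS le_eqVlt; apply/orP; left; apply/eqP.
  by field; exact: lt0r_neq0.
have B' m k : rn (u (m + k)%N - u m) <= E * q ^+ m / (1 - q).
  apply: le_trans (B m k) _; rewrite ler_piMr ?divr_ge0 ?mulr_ge0 ?exprn_ge0// ?(ltW p0)//.
  by rewrite gerBl exprn_ge0.
have [l hl] : exists l, clim u l.
  apply: clim_cauchy => e e0; have [|N hN] := @geom_small R q (E / (1 - q)) (e / 2) _ (divr_gt0 e0 (ltr0n _ 2)).
    by rewrite q0.
  have {}hN := hN _ (leqnn _).
  exists N => k m Nk Nm; have := B' N (k - N)%N; have := B' N (m - N)%N; rewrite !subnKC//.
  rewrite (mulrAC E) => b1 b2; apply: le_trans (rn_tri _ (u N) _) _; rewrite (rnB (u N)); lra.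
exists l; split=> // m; first by have := B' 0%N m; rewrite expr0 mulr1.
have hs := climB (clim_shift m hl) (clim_const (u m)).
by apply: clim_le hs _ => k; rewrite addnC.
Qed.

Lemma pow_fact_le_exp (y : R) m : 0 <= y -> y ^+ m / m`!%:R <= expR y.
Proof.
move=> y0; case: m => [|m]; last by have := expR_ge1Dxn m y0; lra.
by rewrite expr0 divr1; have := expR_ge1Dxn 0 y0; rewrite expr1 divr1; lra.
Qed.

Lemma is_derive_monomial (c x : R) m : is_derive x 1 (fun x => c * x ^+ m.+1) (c * (m.+1%:R * x ^+ m)).
Proof.
have h : is_derive x (1:R) (@id R) 1 by exact: is_derive_id.
have h1 := is_deriveX m.+1 h; have := is_deriveZ c h1.
have -> : c \*: id ^+ m.+1 = (fun x : R => c * x ^+ m.+1).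
  by apply/funext => y; rewrite !fctE.
by rewrite /GRing.scale /= mulr1 mulr_natl.
Qed.

Lemma cint_const (c : C) : cint (fun=> c) = c.
Proof. by apply: cint_lim => e e0; exists 0%N => k _; rewrite rsum_const subrr rn0 ltW. Qed.

Section Iteration.
Variables (V : normedModType C) (O : set V) (n : nat) (a : 'I_n -> 'I_n -> C * V -> C).
Hypothesis oO : opn O.
Hypothesis ha : forall i k x, O x.2 -> hol (a i k) x.

(** Starting from 0 makes the difference of successive iterates the [m]-th iterated integral,
    beginning with the identity matrix. *)
Fixpoint picard m (i j : 'I_n) (x : C * V) : C := if m is m'.+1 then
  (i == j)%:R + prim (fun x => \sum_k a i k x * picard m' k j x) x else 0.

Let E : set (C * V) := [set x | O x.2].

Let integrand_hol m i j x : (forall i j x, E x -> hol (picard m i j) x) -> E x ->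
  hol (fun x => \sum_k a i k x * picard m k j x) x.
Proof. by move=> h Ex; apply: hol_sum => k; apply: holM; [exact: ha | exact: h]. Qed.

Lemma picard_hol m i j x : E x -> hol (picard m i j) x.
Proof.
elim: m i j x => [|m IH] i j x Ex /=; first exact: hol_const.
apply: holD; first exact: hol_const.
by apply: (@prim_hol _ _ E _ _ (opn_fst oO) _ _).1 => // y Ey; apply: integrand_hol.
Qed.

Lemma picard_dd m i j x : E x -> dd (picard m.+1 i j) x (1, 0) = \sum_k a i k x * picard m k j x.
Proof.
move=> Ex /=.
have [h1 h2] : hol (prim (fun x => \sum_k a i k x * picard m k j x)) x /\
   dd (prim (fun x => \sum_k a i k x * picard m k j x)) x (1, 0) = \sum_k a i k x * picard m k j x.
  by apply: (@prim_hol _ _ E _ _ (opn_fst oO)) => // y Ey; apply: integrand_hol => //; exact: picard_hol.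
by rewrite (ddE (isdD (isd_const _ x) (ddP h1))) add0r.
Qed.

(** At the point [s] of the segment to [y] the [m]-th difference is at most [(K |y|)^m s^m / m!],
    where [K] bounds the row sums of [a]: its derivative is controlled by the previous difference
    and [rmvi] integrates the bound. All constants are uniform for [y] near [x]. *)
Lemma picard_diff x : E x -> exists r X : R, [/\ 0 < r, 0 <= X, forall y, rn (y - x) < r -> E y
  & forall m i j y, rn (y - x) < r -> rn (picard m.+1 i j y - picard m i j y) <= X ^+ m / m`!%:R].
Proof.
move=> Ex.
pose P (ik : 'I_n * 'I_n) (e M : R) := forall s y, 0 <= s <= 1 -> rn (y - x) < e ->
    E (s%:C * y.1, y.2) /\ rn (a ik.1 ik.2 (s%:C * y.1, y.2)) <= M.
have [||r [M [r0 hr]]] := @fin_bounds R _ (enum [set: 'I_n * 'I_n]) P.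
- move=> ik e e' M M' /andP[e0 ee] MM h s y s1 yx.
  by have [|? h2] := h s y s1; [exact: lt_le_trans ee | split=> //; exact: le_trans MM].
- move=> ik _; have [||r [M [r0 h]]] := @tube_scale1 R V E (a ik.1 ik.2) x (opn_fst oO) _ _ => //.
    by move=> y; exact: ha.
  by exists r, M.
have [rb rr0 hb] := oO Ex.
pose r' := Num.min r rb; pose K := `|M| * n%:R; pose X := K * (rn x.1 + r').
have r'0 : 0 < r' by rewrite lt_min r0.
have K0 : 0 <= K by rewrite mulr_ge0.
have X0 : 0 <= X by rewrite mulr_ge0// addr_ge0 ?rn_ge0// ltW.
have hE y : rn (y - x) < r' -> E y.
  rewrite lt_min => /andP[_ h]; apply: hb; exact: le_lt_trans (@rn_snd _ _ _ (y - x)) h.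
have ab i k s y : 0 <= s <= 1 -> rn (y - x) < r' -> rn (a i k (s%:C * y.1, y.2)) <= `|M|.
  move=> s1; rewrite lt_min => /andP[h _].
  have [|_ h2] := hr (i, k) _ s y s1 h; first by rewrite mem_enum inE.
  exact: le_trans h2 (ler_norm _).
exists r', X; split=> // m i j y yx.
suff H s : 0 <= s <= 1 -> rn (picard m.+1 i j (s%:C * y.1, y.2) - picard m i j (s%:C * y.1, y.2)) <=
    (K * rn y.1) ^+ m / m`!%:R * s ^+ m.
  have := H 1; rewrite lexx ler01 => /(_ isT); rewrite rmorph1 mul1r -surjective_pairing expr1n mulr1 => h.
  have hx : K * rn y.1 <= X.
    rewrite ler_wpM2l//; have := @rn_fst _ _ _ (y - x) => /= h1; apply: le_trans (rn_sub _ x.1) _.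
    by rewrite lerD2l (le_trans h1)// ltW.
  apply: le_trans h _; rewrite ler_wpM2r ?invr_ge0// lerXn2r ?nnegrE//.
  by rewrite mulr_ge0 ?rn_ge0.
elim: m i j s => [|m IH] i j s s1.
  rewrite !expr0 fact0 divr1 mulr1 [picard 1 i j _]/= [picard 0 i j _]/= subr0 /prim.
  rewrite (_ : cint _ = 0) ?mulr0 ?addr0.
    by case: (i == j); rewrite ?rn1 ?rn0.
  rewrite -[RHS](cint_const 0); apply: cint_eq => u _; apply: big1 => k _.
  by rewrite /= mulr0.
pose D m i j x := picard m.+1 i j x - picard m i j x.
have Ey : O y.2 by exact: hE yx.
have hD m' i' j' z : hol (D m' i' j') (z * y.1, y.2).
  by apply: holB; apply: picard_hol.
have D0 : D m.+1 i j (0, y.2) = 0 by rewrite /D [picard m.+2 _ _ _]/= [picard m.+1 _ _ _]/= !prim0 subrr.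
pose c := (K * rn y.1) ^+ m.+1 / (m.+1)`!%:R.
have s0 : 0 <= s by lra.
have := @rmvi R (fun u : R => D m.+1 i j (u%:C * y.1, y.2)) _ (fun u => c * u ^+ m.+1) _ 0 s s0 _
   (fun u _ => is_derive_monomial c u m).
have hr1 : forall u : R, 0 <= u <= s -> rder (fun u : R => D m.+1 i j (u%:C * y.1, y.2)) u
    (y.1 * \sum_k a i k (u%:C * y.1, y.2) * D m k j (u%:C * y.1, y.2)).
  move=> u us; have := @hol_real R (fun z : C => D m.+1 i j (z * y.1, y.2)) u (hol_seg1 (hD _ _ _ _)).
  rewrite dd_seg1; last exact: hD.
  congr (rder _ _ (_ * _)).
  rewrite {1}/D ddB; [|exact: picard_hol..].
  by rewrite !picard_dd// -sumrB; apply: eq_bigr => k _; rewrite -mulrBr.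
move=> /(_ _ hr1 _)/wrap[].
  move=> u /andP[u0 us]; have u1 : 0 <= u <= 1 by rewrite u0 /=; lra.
  rewrite rnM.
  have -> : c * (m.+1%:R * u ^+ m) = rn y.1 * (K * ((K * rn y.1) ^+ m / m`!%:R * u ^+ m)).
    rewrite /c factS natrM exprS; field; rewrite !pnatr_eq0 -lt0n fact_gt0 /=; exact: lt0r_neq0.
  rewrite ler_wpM2l ?rn_ge0//; apply: le_trans (rn_sum _ _ _) _.
  apply: (@le_trans _ _ (\sum_(k < n) `|M| * ((K * rn y.1) ^+ m / m`!%:R * u ^+ m))).
    apply: ler_sum => k _; rewrite rnM ler_pM ?rn_ge0//; first exact: ab.
    exact: IH.
  by rewrite sumr_const card_ord -mulr_natr le_eqVlt /K; apply/orP; left; apply/eqP; ring.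
by rewrite rmorph0 mul0r D0 subr0 expr0n mulr0 subr0.
Qed.

Theorem sys_exists : exists Phi : 'I_n -> 'I_n -> C * V -> C,
  (forall i j x, O x.2 -> hol (Phi i j) x /\ dd (Phi i j) x (1, 0) = \sum_k a i k x * Phi k j x) /\
  (forall i j t, O t -> Phi i j (0, t) = (i == j)%:R).
Proof.
pose Phi i j x := xget 0 (clim (fun m => picard m i j x)).
have L x : E x -> exists r B, [/\ 0 < r, forall y, rn (y - x) < r -> E y
   & forall i j y, rn (y - x) < r -> clim (fun m => picard m i j y) (Phi i j y) /\ forall m, rn (picard m i j y) <= B].
  (* From [X^m / m! = (2 X)^m / m! 2^-m <= exp(2 X) 2^-m] comes a geometric majorant of ratio
     1/2. *)
  move=> /picard_diff [r [X [r0 X0 hE hD]]]; exists r, (expR (2 * X) / (1 - 2^-1)); split=> // i j y yx.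
  have [||l [cl bl _]] := @clim_ratio (fun m => picard m i j y) (expR (2 * X)) (2^-1).
  - by rewrite invr_ge0 ler0n /= invf_lt1// ltr1n.
  - move=> m; apply: le_trans (hD m i j y yx) _.
    have -> : X ^+ m / m`!%:R = (2 * X) ^+ m / m`!%:R * 2^-1 ^+ m.
      rewrite exprMn exprVn; field; rewrite !pnatr_eq0 -lt0n fact_gt0 andbT /=.
      by rewrite expf_neq0.
    by rewrite ler_wpM2r ?exprn_ge0 ?invr_ge0// pow_fact_le_exp// mulr_ge0.
  split; first by apply: xgetPex; exists l.
  by move=> m; have := bl m; rewrite [picard 0 i j y]/= subr0.
exists Phi; split.
  move=> i j x Ex; have [r [B [r0 hE hL]]] := L x Ex.
  have [||| h1 h2] := @vitali R _ (fun m => picard m i j) (Phi i j) x r B r0.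
  - by move=> m y /hE; exact: picard_hol.
  - by move=> m y /(hL i j)[].
  - by move=> y /(hL i j)[].
  split=> //; have h3 := clim_shift 1 (h2 (1, 0)).
  apply: clim_unique h3 _.
  apply: (@clim_ext _ _ (fun m => \sum_k a i k x * picard m k j x)).
    by move=> m; rewrite addn1 picard_dd.
  apply: clim_sum => k; apply: climM.
  by case: (hL k j x _); rewrite // subrr rn0.
move=> i j t Ot; have [r [B [r0 _ hL]]] := L (0, t) Ot.
have [h _] : clim (fun m => picard m i j (0, t)) (Phi i j (0, t)) /\ forall m, rn (picard m i j (0, t)) <= B.
  by apply: hL; rewrite subrr rn0.
apply: clim_unique (clim_shift 1 h) _; apply: clim_ext (clim_const _) => m.
by rewrite addn1 /= prim0 addr0.
Qed.

End Iteration.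

End LinearSystems.

(** * The derivative in z in the coordinate log z *)

Section LogPlane.
Variable R : realType.
Local Notation C := R[i].

Lemma const_seg (U : normedModType C) (f : U -> C) x h :
  (forall s : R, 0 <= s <= 1 -> hol f (x + s%:C *: h) /\ dd f (x + s%:C *: h) h = 0) -> f (x + h) = f x.
Proof.
move=> H; apply/eqP; rewrite -subr_eq0 -rn_eq0 eq_le rn_ge0 andbT.
by apply: hol_mvi => s /H[h1 h2] //; rewrite h2 rn0.
Qed.

Lemma const_entire (f : C -> C) x y : (forall w, isd f w (fun=> 0)) -> f x = f y.
Proof.
move=> H; have := @const_seg C f y (x - y); rewrite (addrC y) subrK; apply=> s _.
by split; [eexists; exact: H | rewrite (ddE (H _))].
Qed.

(** This is [dz = exp(w) dw]. With [p = |exp w|], the increment of the exponential lies between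
    [p / 2 |h|] and [(p + 1) |h|] for small [h], so errors relative to it and to [h] are
    comparable. *)
Lemma isd_dz (f : C -> C) (w l : C) :
  (fun y : C => (cexp y - cexp w)^-1 * (f y - f w)) @ w^' --> l <->
  isd f w (fun h => h * (cexp w * l)).
Proof.
have cw : 0 < rn (cexp w) by rewrite rn_gt0 cexp_neq0.
have [_ _ hexp] := isd_cexp w.
split.
  move=> /cvgrPdist_le hl; split.
  - by move=> a u v; rewrite /GRing.scale /=; ring.
  - by exists (rn (cexp w * l)) => [|u]; rewrite ?rn_ge0// rnM mulrC.
  - move=> e e0; pose p := rn (cexp w).
    pose e1 := Num.min 1 (e / 2 / (p + 1)).
    have p1 : 0 < p + 1 by rewrite ltr_wpDl// ltW.
    have e10 : 0 < e1 by rewrite lt_min ltr01 !divr_gt0.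
    have l1 : 0 < rn l + 1 by rewrite ltr_wpDl ?rn_ge0.
    pose e2 := Num.min 1 (Num.min (p / 2) (e / 2 / (rn l + 1))).
    have e20 : 0 < e2 by rewrite !lt_min ltr01 !divr_gt0.
    have e1C : 0 < e1%:C :> C by rewrite ltcR.
    have := hl _ e1C; rewrite near_withinE => /nbhs_ballP[d0 /= d00 hd0].
    have [d dE] : exists d : R, d0 = d%:C by exists (complex.Re d0); move: d00; rewrite ltcE /= => /andP[/eqP ? _]; apply: complexP.
    have dp : 0 < d by rewrite -ltcR -dE.
    have [d' d0' hd'] := hexp _ e20.
    exists (Num.min d d'); first by rewrite lt_min dp.
    move=> h; rewrite lt_min => /andP[h1 /hd' h2].
    have [->|h0] := eqVneq h 0; first by rewrite addr0 subrr mul0r subr0 rn0 mulr0.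
    have hp : 0 < rn h by rewrite rn_gt0.
    have e2p : e2 <= p / 2 by rewrite !ge_min lexx orbT.
    have e2e : e2 <= e / 2 / (rn l + 1) by rewrite !ge_min lexx !orbT.
    have e21 : e2 <= 1 by rewrite ge_min lexx.
    have nE : rn (cexp (w + h) - cexp w) <= (p + 1) * rn h.
      have := rn_sub (cexp (w + h) - cexp w) (h * cexp w); rewrite rnM -/p; nra.
    have n0 : cexp (w + h) - cexp w != 0.
      rewrite -rn_gt0; have := rn_sub (h * cexp w) (cexp (w + h) - cexp w).
      rewrite rnM -/p (rnB (h * cexp w)).
      have : e2 * rn h <= p / 2 * rn h by rewrite ler_wpM2r// ltW.
      have : 0 < p * rn h by rewrite mulr_gt0.
      lra.
    have := hd0 (w + h); rewrite /ball /= => /(_ _ _)/wrap[].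
      by rewrite dE rn_lt opprD addrA subrr add0r rnN.
      by rewrite -subr_eq0 addrC addKr.
    rewrite rn_le rnB => hq.
    set q := (cexp (w + h) - cexp w)^-1 * (f (w + h) - f w) in hq.
    have -> : f (w + h) - f w - h * (cexp w * l) = (cexp (w + h) - cexp w) * (q - l) +
       (cexp (w + h) - cexp w - h * cexp w) * l by rewrite /q; field.
    apply: le_trans (rnD _ _) _; rewrite !rnM.
    have a1 : rn (cexp (w + h) - cexp w) * rn (q - l) <= (p + 1) * rn h * (e / 2 / (p + 1)).
      by rewrite ler_pM ?rn_ge0//; apply: le_trans hq _; rewrite ge_min lexx orbT.
    have a2 : rn (cexp (w + h) - cexp w - h * cexp w) * rn l <= e / 2 / (rn l + 1) * rn h * (rn l + 1).
      rewrite ler_pM ?rn_ge0//; last by rewrite lerDl.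
      by apply: le_trans h2 _; rewrite ler_wpM2r// ltW.
    have b1 : (p + 1) * rn h * (e / 2 / (p + 1)) = e / 2 * rn h by field; exact: lt0r_neq0.
    have b2 : e / 2 / (rn l + 1) * rn h * (rn l + 1) = e / 2 * rn h by field; exact: lt0r_neq0.
    lra.
move=> [_ _ hf]; apply/cvgrPdist_le => eC eC0.
have [e eE] : exists e : R, eC = e%:C by exists (complex.Re eC); move: eC0; rewrite ltcE /= => /andP[/eqP ? _]; apply: complexP.
have e0 : 0 < e by rewrite -ltcR -eE.
pose p := rn (cexp w); have l1 : 0 < rn l + 1 by rewrite ltr_wpDl ?rn_ge0.
pose e1 := Num.min (p / 2) (e * p / 4 / (rn l + 1)).
have e10 : 0 < e1 by rewrite lt_min !divr_gt0// mulr_gt0.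
have e3 : 0 < e * p / 4 by rewrite divr_gt0// mulr_gt0.
have [d d0 hd] := hf _ e3; have [d' d0' hd'] := hexp _ e10.
rewrite near_withinE; apply/nbhs_ballP; exists (Num.min d d')%:C => /=; first by rewrite ltcR lt_min d0.
move=> y; rewrite /ball /= rn_lt lt_min rnB => /andP[y1 y2] yw.
have := hd _ y1; have := hd' _ y2; rewrite (addrC w) subrK.
have h0 : 0 < rn (y - w) by rewrite rn_gt0 subr_eq0.
set h := y - w in h0 * => H1 H2.
have e1p : e1 <= p / 2 by rewrite ge_min lexx.
have e1e : e1 <= e * p / 4 / (rn l + 1) by rewrite ge_min lexx orbT.
have nE : p / 2 * rn h <= rn (cexp y - cexp w).
  have := rn_sub (h * cexp w) (cexp y - cexp w).
  rewrite rnM -/p (rnB (h * cexp w)).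
  have : e1 * rn h <= p / 2 * rn h by rewrite ler_wpM2r// ltW.
  lra.
have ph : 0 < p / 2 * rn h by rewrite mulr_gt0// divr_gt0.
have n0 : cexp y - cexp w != 0 by rewrite -rn_gt0; lra.
rewrite eE rn_le rnB.
have -> : (cexp y - cexp w)^-1 * (f y - f w) - l = ((f y - f w - h * (cexp w * l)) -
   (cexp y - cexp w - h * cexp w) * l) / (cexp y - cexp w) by field.
rewrite rnM rnV ler_pdivrMr; last by rewrite rn_gt0.
apply: le_trans (rnB_le _ _) _; rewrite rnM.
have a2 : rn (cexp y - cexp w - h * cexp w) * rn l <= e * p / 4 / (rn l + 1) * rn h * (rn l + 1).
  rewrite ler_pM ?rn_ge0//; last by rewrite lerDl.
  by apply: le_trans H1 _; rewrite ler_wpM2r// ltW.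
have b2 : e * p / 4 / (rn l + 1) * rn h * (rn l + 1) = e * p / 4 * rn h by field; exact: lt0r_neq0.
have : e * (p / 2 * rn h) <= e * rn (cexp y - cexp w) by rewrite ler_wpM2l// ltW.
lra.
Qed.

Lemma mx_cvg_entry p q (F : C -> 'M[C]_(p, q)) (w : C) (L : 'M[C]_(p, q)) :
  (F y @[y --> w^'] --> L) <-> forall i j, (fun y => F y i j) @ w^' --> L i j.
Proof.
split.
  move=> /cvgrPdist_le h i j; apply/cvgrPdist_le => e /h; apply: filterS => y.
  by apply: le_trans; rewrite !rnE lecR -[L i j - _](_ : (L - F y) i j = _) ?rn_entry// !mxE.
move=> h; apply/cvgrPdist_le => e e0.
have H : \forall y \near w^', forall ij : 'I_p * 'I_q, `|L ij.1 ij.2 - F y ij.1 ij.2| <= e.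
  apply: filter_forall => -[i j]; have /cvgrPdist_le := h i j; exact.
apply: filterS H => y H.
have [d dE] : exists d : R, e = d%:C by exists (complex.Re e); move: e0; rewrite ltcE /= => /andP[/eqP ? _]; apply: complexP.
rewrite dE rn_le; apply: rn_mx_le => [|i j].
  by rewrite ltW// -ltcR -dE.
by have := H (i, j); rewrite dE rn_le /= !mxE.
Qed.

Definition mder n p (Y : C -> 'M[C]_(n, p)) (w : C) (M : 'M[C]_(n, p)) :=
  forall i j, isd (fun w => Y w i j) w (fun h => h * M i j).

Lemma is_dzP p q (M : ucov R -> 'M[C]_(p, q)) (z : ucov R) L :
  is_dz M z L <-> mder M z (cexp z *: L).
Proof.
rewrite /is_dz mx_cvg_entry /mder; split => h i j.
  have := h i j; under [X in X @ _]eq_fun do rewrite !mxE.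
  by move=> /isd_dz; rewrite mxE.
under [X in X @ _]eq_fun do rewrite !mxE.
by apply/isd_dz; have := h i j; rewrite mxE.
Qed.

End LogPlane.

(** * Linear matrix systems and the matrix exponential *)

Section MatrixSystems.
Variable R : realType.
Local Notation C := R[i].

Lemma mderM n p q (Y : C -> 'M[C]_(n, p)) (Z : C -> 'M[C]_(p, q)) w M N :
  mder Y w M -> mder Z w N -> mder (fun w => Y w *m Z w) w (M *m Z w + Y w *m N).
Proof.
move=> hY hZ i j; have H := isd_sum (index_enum 'I_p) (fun k => isdM (hY i k) (hZ k j)).
apply: isd_eqL (isd_ext _ H) => [h|u]; last by rewrite mxE.
by rewrite !mxE mulrDr !mulr_sumr -big_split; apply: eq_bigr => k _ /=; ring.
Qed.

Lemma mderD n p (Y Z : C -> 'M[C]_(n, p)) w M N :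
  mder Y w M -> mder Z w N -> mder (fun w => Y w + Z w) w (M + N).
Proof.
move=> hY hZ i j; apply: isd_eqL (isd_ext _ (isdD (hY i j) (hZ i j))) => [h|u]; last by rewrite mxE.
by rewrite mxE mulrDr.
Qed.

Lemma mder_const n p (A : 'M[C]_(n, p)) w : mder (fun=> A) w 0.
Proof. by move=> i j; apply: isd_eqL (isd_const _ _) => h; rewrite mxE mulr0. Qed.

Lemma mderMr n p q (Y : C -> 'M[C]_(n, p)) (A : 'M[C]_(p, q)) w M :
  mder Y w M -> mder (fun w => Y w *m A) w (M *m A).
Proof. by move=> h; have := mderM h (mder_const A w); rewrite mulmx0 addr0. Qed.

Lemma mder_ext n p (Y Z : C -> 'M[C]_(n, p)) w M : Y =1 Z -> mder Y w M -> mder Z w M.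
Proof. by move=> YZ h i j; apply: isd_ext (h i j) => u; rewrite YZ. Qed.

Lemma mder0_const n p (Y : C -> 'M[C]_(n, p)) x y : (forall w, mder Y w 0) -> Y x = Y y.
Proof.
move=> h; apply/matrixP => i j; apply: (@const_entire R (fun w => Y w i j)) => w.
by apply: isd_eqL (h w i j) => u; rewrite mxE mulr0.
Qed.

(* The adjoint system turns products into constants. *)
Lemma adjoint_const n p (N : C -> 'M[C]_n) (Psi : C -> 'M[C]_n) (Y : C -> 'M[C]_(n, p)) x y :
  (forall w, mder Psi w (- (Psi w *m N w))) -> (forall w, mder Y w (N w *m Y w)) ->
  Psi x *m Y x = Psi y *m Y y.
Proof.
move=> hP hY; apply: (@mder0_const _ _ (fun w => Psi w *m Y w)) => w.
by have := mderM (hP w) (hY w); rewrite mulmxA mulNmx addNr.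
Qed.

(* The coefficient of the system in the coordinate [w = log z]. *)
Definition sysM n (L : 'rV[C]_n) (A : 'M[C]_n) (w : C) : 'M[C]_n := cexp w *: diag_mx L + A.

Lemma is_fundamentalP n (L : 'rV[C]_n) (A : 'M[C]_n) (Y : ucov R -> 'M[C]_n) :
  is_fundamental L A Y <-> forall z, mder Y z (sysM L A z *m Y z) /\ Y z \in unitmx.
Proof.
have E z : cexp z *: ((diag_mx L + (Defs.proj z)^-1 *: A) *m Y z) = sysM L A z *m Y z.
  by rewrite /sysM scalemxAl scalerDr scalerA divff ?scale1r//; exact: cexp_neq0.
by split => h z; have [h1 h2] := h z; split => //; [have := (is_dzP _ _ _).1 h1 | apply/is_dzP]; rewrite E.
Qed.

(** [Psi] solves the adjoint system with the same value 1 at [w = 0], so [Psi Phi] is constant in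
    [w]. The inverse of [Phi] is thus available as a function holomorphic in [(w, t)]. *)
Lemma param_system (V : normedModType C) (O : set V) n (L : V -> 'rV[C]_n) (A : V -> 'M[C]_n) :
  opn O -> (forall t i, O t -> hol (fun t => L t 0 i) t) ->
  (forall t i j, O t -> hol (fun t => A t i j) t) ->
  exists Phi Psi : C * V -> 'M[C]_n,
   [/\ forall x i j, O x.2 -> hol (fun x => Phi x i j) x /\ hol (fun x => Psi x i j) x,
       forall w t, O t -> mder (fun w => Phi (w, t)) w (sysM (L t) (A t) w *m Phi (w, t)),
       forall w t, O t -> mder (fun w => Psi (w, t)) w (- (Psi (w, t) *m sysM (L t) (A t) w))
     & forall w t, O t -> Psi (w, t) *m Phi (w, t) = 1%:M].
Proof.
move=> oO hL hA; pose a i k (x : C * V) : C := sysM (L x.2) (A x.2) x.1 i k.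
have ha i k x : O x.2 -> hol (a i k) x.
  move=> Ox; apply: (@hol_ext _ _ (fun x : C * V => cexp x.1 * (L x.2 0 k *+ (i == k)) + A x.2 i k)).
    by move=> y; rewrite /a /sysM !mxE; case: eqP => // ->.
  apply: holD; last exact: (@hol_snd R C V (fun t => A t i k) x (hA _ i k Ox)).
  apply: holM; first by apply: hol_cexp; exact: hol_fst.
  case: (i == k); last exact: hol_const.
  exact: (@hol_snd R C V (fun t => L t 0 k) x (hL _ k Ox)).
have [f [hf f0]] := sys_exists oO ha.
have ha' i k x : O x.2 -> hol (fun x => - a k i x) x by move=> Ox; apply: holN; exact: ha.
have [g [hg g0]] := sys_exists oO ha'.
exists (fun x => \matrix_(i, j) f i j x), (fun x => \matrix_(i, j) g j i x).
have slice (F : C * V -> C) w t : hol F (w, t) -> isd (fun w => F (w, t)) w (fun h => h * dd F (w, t) (1, 0)).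
  move=> /ddP hF; apply: isd_eqL (isd_slice1 hF) => h /=.
  rewrite -(isd_linZ _ _ hF); congr (dd _ _ _); apply: injective_projections; rewrite /= ?scaler0//.
  by rewrite /GRing.scale /= mulr1.
have dP w t : O t -> mder (fun w => \matrix_(i, j) f i j (w, t)) w (sysM (L t) (A t) w *m (\matrix_(i, j) f i j (w, t))).
  move=> Ot i j; have [h1 h2] := hf i j (w, t) Ot.
  apply: isd_eqL (isd_ext _ (slice _ _ _ h1)) => [h|u]; last by rewrite mxE.
  by rewrite h2 mxE; congr (_ * _); apply: eq_bigr => k _; congr (_ * _); rewrite mxE.
have dQ w t : O t -> mder (fun w => \matrix_(i, j) g j i (w, t)) w (- ((\matrix_(i, j) g j i (w, t)) *m sysM (L t) (A t) w)).
  move=> Ot i j; have [h1 h2] := hg j i (w, t) Ot.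
  apply: isd_eqL (isd_ext _ (slice _ _ _ h1)) => [h|u]; last by rewrite mxE.
  rewrite h2 !mxE -sumrN; congr (_ * _); apply: eq_bigr => k _.
  by rewrite mulNr mulrC; congr (- (_ * _)); rewrite mxE.
split=> //.
  move=> x i j Ox; split.
    by apply: hol_ext (hf i j x Ox).1 => y; rewrite mxE.
  by apply: hol_ext (hg j i x Ox).1 => y; rewrite mxE.
move=> w t Ot; rewrite (adjoint_const w 0 (dQ^~ t ^~ Ot) (dP^~ t ^~ Ot)).
have -> : \matrix_(i, j) g j i (0, t) = 1%:M by apply/matrixP => i j; rewrite !mxE g0// eq_sym.
have -> : \matrix_(i, j) f i j (0, t) = 1%:M by apply/matrixP => i j; rewrite !mxE f0.
by rewrite mulmx1.
Qed.

Lemma entry_mulmx_le n (M N : 'M[C]_n) (K K' : R) : 0 <= K -> 0 <= K' ->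
  (forall i j, rn (M i j) <= K) -> (forall i j, rn (N i j) <= K') ->
  forall i j, rn ((M *m N) i j) <= n%:R * K * K'.
Proof.
move=> K0 K0' hM hN i j; rewrite mxE; apply: le_trans (rn_sum _ _ _) _.
apply: (@le_trans _ _ (\sum_(k < n) K * K')).
  by apply: ler_sum => k _; rewrite rnM ler_pM ?rn_ge0.
by rewrite sumr_const card_ord -mulr_natr le_eqVlt; apply/orP; left; apply/eqP; ring.
Qed.

Lemma scalemxX n (w : C) (M : 'M[C]_n) k : (w *: M) ^+ k = w ^+ k *: M ^+ k.
Proof.
elim: k => [|k IH]; first by rewrite !expr0 scale1r.
by rewrite !exprS IH -[LHS]/((w *: M) *m (w ^+ k *: M ^+ k)) -scalemxAl -scalemxAr scalerA.
Qed.

Lemma isd_pow m (w : C) : isd (fun w : C => w ^+ m.+1) w (fun h => h * (m.+1%:R * w ^+ m)).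
Proof.
elim: m => [|m IH].
  by apply: isd_eqL (isd_ext _ (isd_id w)) => u; rewrite ?expr0 ?expr1 ?mulr1.
apply: isd_eqL (isd_ext _ (isdM (isd_id w) IH)) => u; last by rewrite [RHS]exprS.
by rewrite -[m.+2%:R]natr1 exprS; ring.
Qed.

(** Everything about [mexp] and [zpow] is later derived from the equation [E' = M E] rather than
    from the series. *)
Lemma mexp_series n (M : 'M[C]_n) :
  exists E : C -> 'M[C]_n, [/\ forall w, mexp (w *: M) = E w, E 0 = 1%:M
    & forall w, mder E w (M *m E w)].
Proof.
pose S m (w : C) : 'M[C]_n := \sum_(k < m) (k`!%:R)^-1 *: (w *: M) ^+ k.
have hS m i j w : hol (fun w => S m w i j) w.
  apply: (@hol_ext _ _ (fun w : C => \sum_(k < m) (k`!%:R)^-1 * (w ^+ k * (M ^+ k) i j))).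
    by move=> u; rewrite /S summxE; apply: eq_bigr => k _; rewrite scalemxX !mxE.
  apply: hol_sum => k; apply: holM; first exact: hol_const.
  by apply: holM; [apply: holX; exists id; exact: isd_id | exact: hol_const].
have dS m w : mder (S m.+1) w (M *m S m w).
  elim: m => [|m IH].
    rewrite /S big_ord0 mulmx0; apply: mder_ext (mder_const 1%:M w) => u.
    by rewrite big_ord1 fact0 invr1 scale1r expr0.
  have -> : M *m S m.+1 w = M *m S m w + M *m ((m`!%:R)^-1 *: (w *: M) ^+ m).
    by rewrite {1}/S big_ord_recr mulmxDr.
  have hk : mder (fun w => ((m.+1)`!%:R)^-1 *: (w *: M) ^+ m.+1) w (M *m ((m`!%:R)^-1 *: (w *: M) ^+ m)).
    move=> i j.
    have hX := isd_pow m w.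
    apply: isd_eqL (isd_ext _ (isdZ (((m.+1)`!%:R)^-1 * (M ^+ m.+1) i j) hX)) => u; last first.
      by rewrite scalemxX !mxE; ring.
    rewrite scalemxX -scalemxAr -scalemxAr -[M *m _]exprS !mxE factS natrM; field.
    by rewrite -mulrS !pnatr_eq0 -lt0n fact_gt0.
  apply: mder_ext (mderD IH hk) => u.
  by rewrite /S [in RHS]big_ord_recr.
pose K := rn M + 1; have K0 : 0 < K by rewrite ltr_wpDl ?rn_ge0.
have Mk k i j : rn ((M ^+ k) i j) <= (n%:R * K) ^+ k.
  have nK : 0 <= n%:R * K by rewrite mulr_ge0// ltW.
  elim: k i j => [|k IH] i j; first by rewrite !expr0 mxE; case: (i == j); rewrite ?rn1 ?rn0.
  rewrite !exprS; apply: entry_mulmx_le => //; [exact: ltW | by rewrite exprn_ge0|].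
  by move=> a b; apply: le_trans (rn_entry _ _ _) _; rewrite lerDl.
(* The factor 2 turns the factorial bound into a geometric one of ratio 1/2. *)
pose X (w : C) := 2 * (rn w * (n%:R * K)).
have X0 w : 0 <= X w by rewrite !mulr_ge0 ?rn_ge0// ltW.
have dif m w i j : rn (S m.+1 w i j - S m w i j) <= expR (X w) * 2^-1 ^+ m.
  have -> : S m.+1 w i j - S m w i j = m`!%:R^-1 * (w ^+ m * (M ^+ m) i j).
    have -> : S m.+1 w = S m w + m`!%:R^-1 *: (w *: M) ^+ m by rewrite {1}/S big_ord_recr.
    have E (P Q : 'M[C]_n) : (P + Q) i j - P i j = Q i j by rewrite mxE addrAC subrr add0r.
    by rewrite E scalemxX !mxE.
  rewrite !rnM rnV rn_nat rnX.
  apply: (@le_trans _ _ ((X w) ^+ m / m`!%:R * 2^-1 ^+ m)); last first.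
    by rewrite ler_wpM2r ?exprn_ge0 ?invr_ge0// pow_fact_le_exp.
  rewrite /X !exprMn exprVn.
  have -> : 2 ^+ m * (rn w ^+ m * (n%:R ^+ m * K ^+ m)) / m`!%:R / 2 ^+ m =
     m`!%:R^-1 * (rn w ^+ m * (n%:R * K) ^+ m).
    rewrite exprMn; field; rewrite ?expf_neq0// pnatr_eq0 -lt0n fact_gt0 //.
  by rewrite ler_wpM2l ?invr_ge0// ler_wpM2l ?exprn_ge0 ?rn_ge0.
have q1 : 0 <= (2^-1 : R) < 1 by rewrite invr_ge0 ler0n /= invf_lt1// ltr1n.
pose E w : 'M[C]_n := \matrix_(i, j) xget 0 (clim (fun m => S m w i j)).
have cE w i j : clim (fun m => S m w i j) (E w i j).
  have [l [cl _ _]] := clim_ratio q1 (fun m => dif m w i j).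
  by rewrite mxE; apply: xgetPex; exists l.
have bE w m i j : rn (S m w i j) <= expR (X w) / (1 - 2^-1).
  have [l [_ bl _]] := clim_ratio q1 (fun m => dif m w i j).
  by have := bl m; rewrite [S 0%N _]/S big_ord0 mxE subr0.
exists E; split.
- move=> w; rewrite /mexp.
  have -> : series (fun k => k`!%:R^-1 *: (w *: M) ^+ k) = S^~ w.
    by apply/funext => m; rewrite /series /= /S big_mkord.
  apply: cvg_lim => //; apply/cvgrPdist_le => e e0.
  have [d dE] : exists d : R, e = d%:C by exists (complex.Re e); move: e0; rewrite ltcE /= => /andP[/eqP ? _]; apply: complexP.
  have d0 : 0 < d by rewrite -ltcR -dE.
  have [||N hN] := @fin_bounds R _ (enum [set: 'I_n * 'I_n])
    (fun ij _ M => forall m, M <= m%:R -> rn (S m w ij.1 ij.2 - E w ij.1 ij.2) <= d).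
  + by move=> ij e1 e2 M1 M2 _ MM h m /(le_trans MM); exact: h.
  + move=> ij _; have [N hN] := cE w ij.1 ij.2 _ d0; exists 1, N%:R; split=> // m.
    by rewrite ler_nat; exact: hN.
  case: hN => N1 [_ hN]; have [N2 hN2] := nat_above N1; exists N2 => // m /= Nm.
  rewrite dE rn_le; apply: rn_mx_le => [|i j]; first exact: ltW.
  rewrite !mxE rnB; have := hN (i, j); rewrite mem_enum inE => /(_ I m) /=; rewrite mxE; apply.
  by rewrite (le_trans hN2)// ler_nat.
- apply/matrixP => i j; apply: clim_unique (cE 0 i j) _.
  apply: (@clim_ext _ _ (fun m => if m is 0%N then 0 else (1%:M : 'M[C]_n) i j)); last first.
    by move=> e e0; exists 1%N => -[//|m] _; rewrite subrr rn0 ltW.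
  case=> [|m]; first by rewrite /S big_ord0 mxE.
  rewrite /S big_ord_recl fact0 invr1 scale1r expr0 big1 ?addr0// => k _.
  by rewrite scalemxX expr0n /= scale0r scaler0.
- move=> w i j.
  have [||| h1 h2] := @vitali R C (fun m w => S m w i j) (fun w => E w i j) w 1
     (expR (2 * ((rn w + 1) * (n%:R * K))) / (1 - 2^-1)) ltr01.
  + by move=> m y _; exact: hS.
  + move=> m y yw; apply: le_trans (bE y m i j) _.
    rewrite ler_wpM2r// ?invr_ge0 ?subr_ge0 ?invf_le1// ?ler1n// ler_expR ler_wpM2l// ler_wpM2r ?mulr_ge0// ?(ltW K0)//.
    by have := rn_sub y w; lra.
  + by move=> y _; exact: cE.
  have hE := ddP h1; apply: isd_eqL hE => h; rewrite (isd_lin1 h (ddP h1)) mulrC; congr (_ * _).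
  apply: clim_unique (clim_shift 1 (h2 1)) _.
  rewrite mxE; apply: (@clim_ext _ _ (fun m => \sum_k M i k * S m w k j)).
    by move=> m; rewrite addn1 (ddE (dS m w i j)) mul1r mxE.
  by apply: clim_sum => k; apply: climM; exact: cE.
Qed.

End MatrixSystems.

(** * Asymptotic expansions *)

Section Asymptotics.
Variable R : realType.
Local Notation C := R[i].
Variable n : nat.
Implicit Types (L b : 'rV[C]_n) (A B : 'M[C]_n) (Y : ucov R -> 'M[C]_n) (F : nat -> 'M[C]_n) (th : R).

Lemma mxsubE p q (P Q : 'M[C]_(p, q)) i j : (P - Q) i j = P i j - Q i j.
Proof. by rewrite !mxE. Qed.

Lemma sysM0 A (w : C) : sysM 0 A w = A.
Proof. by rewrite /sysM (_ : diag_mx 0 = 0) ?scaler0 ?add0r//; apply/matrixP => i j; rewrite !mxE mul0rn. Qed.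

Lemma adjoint_system A : exists Psi : C -> 'M[C]_n,
  (forall w, mder Psi w (- (Psi w *m A))) /\ forall w, Psi w \in unitmx.
Proof.
have oT : opn [set: C] by move=> x _; exists 1.
have [Phi [Psi [_ _ h1 h2]]] := @param_system R C [set: C] n (fun=> 0) (fun=> A) oT
  (fun _ _ _ => hol_const _ _) (fun _ _ _ _ => hol_const _ _).
exists (fun w => Psi (w, 0)); split => w; first by have := h1 w 0 I; rewrite sysM0.
by have [] := mulmx1_unit (h2 w 0 I).
Qed.

Lemma exp_system_unique A (Y Z : C -> 'M[C]_n) w : (forall w, mder Y w (A *m Y w)) ->
  (forall w, mder Z w (A *m Z w)) -> Y 0 = Z 0 -> Y w = Z w.
Proof.
move=> hY hZ YZ; have [Psi [hP uP]] := adjoint_system A.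
have h1 := adjoint_const w 0 hP hY; have h2 := adjoint_const w 0 hP hZ.
by rewrite -[Y w](mulKmx (uP w)) h1 YZ -h2 mulKmx.
Qed.

Lemma zpow_mder A w : mder (fun w => zpow A w) w (A *m zpow A w).
Proof.
have [E [hE _ dE]] := mexp_series A; rewrite /zpow /ulog hE.
by apply: mder_ext (dE w) => u; rewrite hE.
Qed.

Lemma zpow0 A : zpow A (0 : C) = 1%:M.
Proof. by have [E [hE E0 _]] := mexp_series A; rewrite /zpow /ulog hE. Qed.

Lemma zpow_unit A w : zpow A w \in unitmx.
Proof.
have [Psi [hP uP]] := adjoint_system A.
have h := adjoint_const w 0 hP (zpow_mder A); rewrite zpow0 mulmx1 in h.
have : Psi w *m zpow A w \in unitmx by rewrite h uP.
by rewrite unitmx_mul => /andP[].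
Qed.

Lemma mexp_diag b (w : C) : mexp (w *: diag_mx b) = diag_mx (\row_i cexp (w * b 0 i)).
Proof.
apply: (@exp_system_unique (diag_mx b) (zpow (diag_mx b)) (fun w => diag_mx (\row_i cexp (w * b 0 i)))).
- exact: zpow_mder.
- move=> u i j; have hb := isd_chain (isdZ (b 0 i) (isd_id u)) (isd_cexp (b 0 i * u)).
  apply: isd_eqL (isd_ext _ (isdM (isd_const (i == j)%:R u) hb)) => [h|v].
    rewrite mul_diag_mx !mxE /= mulr0 addr0 (mulrC u) -mulr_natl.
    by case: eqP => [->|_]; rewrite ?mul1r ?mul0r ?mulr0n ?mulr1n ?mulr0 //; ring.
  by rewrite !mxE /=; case: (i == j); rewrite ?mul1r ?mul0r ?mulr1n ?mulr0n // (mulrC v).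
- by rewrite zpow0; apply/matrixP => i j; rewrite !mxE mul0r cexp0.
Qed.

(* [Y exp(-z diag(L)) z^-diag(b)], the formal part of which is a power series in 1/z. *)
Definition reduced L b Y (z : C) : 'M[C]_n :=
  \matrix_(i, j) (Y z i j * cexp (- (cexp z * L 0 j)) * cexp (- (z * b 0 j))).

Lemma reducedE L b Y z :
  Y z *m mexp (- (Defs.proj z *: diag_mx L)) *m zpow (- diag_mx b) z = reduced L b Y z.
Proof.
have dN c : - diag_mx c = diag_mx (- c) :> 'M[C]_n.
  by apply/matrixP => i j; rewrite !mxE; case: (i == j); rewrite ?mulr1n ?mulr0n ?oppr0.
rewrite -scalerN dN /zpow dN !mexp_diag !mul_mx_diag; apply/matrixP => i j.
by rewrite !mxE !mulrN.
Qed.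

Definition asymp (p q : R) L b F Y : Prop := forall N : nat, exists K rho : R, forall z : C,
  p <= complex.Im z <= q -> rho <= expR (complex.Re z) -> forall i j,
  rn (reduced L b Y z i j - \sum_(k < N) cexp z ^- k * F k i j) <= K * expR (complex.Re z) ^- N.

Lemma asymptotic_inP (E : set (ucov R)) L b F Y : asymptotic_in E L (diag_mx b) F Y <->
  forall p q : R, [set z : ucov R | p <= arg z <= q] `<=` E -> asymp p q L b F Y.
Proof.
have S N z i j : (\sum_(k < N) Defs.proj z ^- k *: F k) i j = \sum_(k < N) cexp z ^- k * F k i j.
  by rewrite summxE; apply: eq_bigr => k _; rewrite mxE.
have eN (N : nat) (K e : R) : K%:C / e%:C ^+ N = (K / e ^+ N)%:C :> C.
  by rewrite rmorphM fmorphV rmorphXn.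
split=> h p q /h H N; have [K [rho hK]] := H N.
  exists K, rho => z zp zr i j; have := hK z zp; rewrite rnE rn_cexp lecR => /(_ zr).
  rewrite eN rnE lecR reducedE; apply: le_trans.
  by rewrite -S -mxsubE; exact: rn_entry.
exists `|K|, rho => z zp; rewrite rnE rn_cexp lecR => zr.
rewrite eN rnE lecR reducedE; apply: rn_mx_le => [|i j].
  by rewrite mulr_ge0// invr_ge0 exprn_ge0// expR_ge0.
have := hK z zp zr i j; rewrite -S -mxsubE => h1; apply: le_trans h1 _; rewrite ler_wpM2r ?ler_norm//.
Qed.

Lemma asymp_sub (p q p' q' : R) L b F Y : p <= p' -> q' <= q -> asymp p q L b F Y -> asymp p' q' L b F Y.
Proof.
move=> pp qq h N; have [K [rho hK]] := h N; exists K, rho => z /andP[z1 z2]; apply: hK.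
by rewrite (le_trans pp z1) (le_trans z2 qq).
Qed.

Lemma asymp_ext (p q : R) L b F Y Y' : Y =1 Y' -> asymp p q L b F Y -> asymp p q L b F Y'.
Proof.
move=> YY h N; have [K [rho hK]] := h N; exists K, rho => z z1 z2 i j.
by have := hK z z1 z2 i j; rewrite !mxE YY.
Qed.

Lemma fundamental_connection L A Y Y' : is_fundamental L A Y -> is_fundamental L A Y' ->
  exists2 M : 'M[C]_n, M \in unitmx & forall z, Y' z = Y z *m M.
Proof.
move=> /is_fundamentalP hY /is_fundamentalP hY'.
have oT : opn [set: C] by move=> x _; exists 1.
have [Phi [Psi [_ _ h1 h2]]] := @param_system R C [set: C] n (fun=> L) (fun=> A) oT
  (fun _ _ _ => hol_const _ _) (fun _ _ _ _ => hol_const _ _).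
pose P w := Psi (w, 0 : C).
have uP w : P w \in unitmx by have [] := mulmx1_unit (h2 w 0 I).
have dP w : mder P w (- (P w *m sysM L A w)) by exact: h1.
have c1 := fun x => adjoint_const x 0 dP (fun w => (hY w).1).
have c2 := fun x => adjoint_const x 0 dP (fun w => (hY' w).1).
have uY : P 0 *m Y 0 \in unitmx by rewrite unitmx_mul uP (hY 0).2.
exists (invmx (P 0 *m Y 0) *m (P 0 *m Y' 0)).
  by rewrite unitmx_mul unitmx_inv uY unitmx_mul uP (hY' 0).2.
move=> z; apply: (can_inj (mulKmx (uP z))).
by rewrite c2 mulmxA c1 mulKVmx.
Qed.

Lemma is_fundamentalM L A Y M : is_fundamental L A Y -> M \in unitmx ->
  is_fundamental L A (fun z => Y z *m M).
Proof.
move=> /is_fundamentalP hY uM; apply/is_fundamentalP => z; have [h1 h2] := hY z.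
by split; [have := mderMr M h1; rewrite mulmxA | rewrite unitmx_mul h2].
Qed.

Lemma connection_decay L b F Y Y' M th : F 0%N = 1%:M -> (forall z, Y' z = Y z *m M) ->
  asymp th th L b F Y -> asymp th th L b F Y' -> forall N, exists K rho : R, forall z : C,
  complex.Im z = th -> rho <= expR (complex.Re z) -> forall i j,
  rn ((M i j - (i == j)%:R) * cexp (cexp z * (L 0 i - L 0 j) + z * (b 0 i - b 0 j))) <=
    K * expR (complex.Re z) ^- N.
Proof.
move=> F0 YM hY hY' N.
have [K1 [r1 h1]] := hY N; have [K2 [r2 h2]] := hY' N; have [K3 [r3 h3]] := hY 1%N.
(* The last term makes the entries of [H - 1] at most [1 / (2 n)], so that [(H - 1) X] is at most
   half of the norm of [X] and can be absorbed. *)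
pose rho := Num.max (Num.max r1 r2) (Num.max r3 (2 * n%:R * (`|K3| + 1))).
exists (2 * (K1 + K2)), rho => z zth.
rewrite !ge_max => /andP[/andP[z1 z2] /andP[z3 z4]].
have zi : th <= complex.Im z <= th by rewrite zth lexx.
set e := expR _ in z1 z2 z3 z4 *; have e0 : 0 < e by rewrite expR_gt0.
pose D i := cexp (cexp z * L 0 i + z * b 0 i).
pose X i j := (M i j - (i == j)%:R) * cexp (cexp z * (L 0 i - L 0 j) + z * (b 0 i - b 0 j)).
pose H := reduced L b Y z; pose H' := reduced L b Y' z.
have HX i j : H' i j - H i j = \sum_k H i k * X k j.
  rewrite (eq_bigr (fun k => (Y z i k * M k j) * (cexp (- (cexp z * L 0 j)) * cexp (- (z * b 0 j))) -
     (k == j)%:R * (Y z i k * cexp (- (cexp z * L 0 j)) * cexp (- (z * b 0 j))))); last first.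
    move=> k _; rewrite /H /X !mxE.
    have -> : cexp (cexp z * (L 0 k - L 0 j) + z * (b 0 k - b 0 j)) =
       cexp (cexp z * L 0 k) * cexp (z * b 0 k) * cexp (- (cexp z * L 0 j)) * cexp (- (z * b 0 j)).
      by rewrite -!cexpD; congr cexp; ring.
    rewrite !cexpN; field.
    by rewrite !cexp_neq0.
  have e2 (f : 'I_n -> C) : \sum_k (k == j)%:R * f k = f j.
    by rewrite (bigD1 j)//= eqxx mul1r big1 ?addr0// => k /negbTE ->; rewrite mul0r.
  rewrite sumrB -mulr_suml e2.
  have h1E : H' i j = Y' z i j * cexp (- (cexp z * L 0 j)) * cexp (- (z * b 0 j)) by rewrite mxE.
  have h2E : H i j = Y z i j * cexp (- (cexp z * L 0 j)) * cexp (- (z * b 0 j)) by rewrite mxE.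
  by rewrite h1E h2E YM mxE !mulrA.
have small i k : rn (H i k - (i == k)%:R) <= (`|K3| + 1) / e.
  have I1 : (1%:M : 'M[C]_n) i k = (i == k)%:R by rewrite mxE.
  have := h3 z zi z3 i k; rewrite big_ord1 expr0 invr1 mul1r F0 I1 expr1 -/H => hh.
  apply: le_trans hh _; rewrite ler_wpM2r ?invr_ge0 ?(ltW e0)//.
  by apply: le_trans (ler_norm _) _; rewrite lerDl.
pose x := rn (\matrix_(i, j) X i j : 'M[C]_n).
have x0 : 0 <= x by exact: rn_ge0.
have Xx i j : rn (X i j) <= x by have := rn_entry (\matrix_(i, j) X i j : 'M[C]_n) i j; rewrite mxE.
have B i j : rn (X i j) <= (K1 + K2) / e ^+ N + x / 2.
  have -> : X i j = (H' i j - H i j) - \sum_k (H i k - (i == k)%:R) * X k j.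
    rewrite HX -sumrB (eq_bigr (fun k => (k == i)%:R * X k j)) => [|k _].
      by rewrite (bigD1 i)//= eqxx mul1r big1 ?addr0// => k /negbTE ->; rewrite mul0r.
    by rewrite eq_sym; ring.
  apply: le_trans (rnB_le _ _) _; apply: lerD.
    have := h1 z zi z1 i j; have := h2 z zi z2 i j; rewrite -/H -/H' mulrDl => b1 b2.
    by apply: le_trans (rn_tri _ (\sum_(k < N) cexp z ^- k * F k i j) _) _; rewrite addrC lerD// rnB.
  apply: le_trans (rn_sum _ _ _) _.
  apply: (@le_trans _ _ (\sum_(k < n) (`|K3| + 1) / e * x)).
    by apply: ler_sum => k _; rewrite rnM ler_pM ?rn_ge0.
  rewrite sumr_const card_ord -[leLHS]mulr_natr.
  have -> : (`|K3| + 1) / e * x * n%:R = x * (n%:R * (`|K3| + 1) / e) by ring.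
  by rewrite ler_wpM2l// ler_pdivrMr//; lra.
move=> i j; apply: le_trans (Xx i j) _.
have pos : 0 <= (K1 + K2) / e ^+ N.
  rewrite divr_ge0 ?exprn_ge0 ?(ltW e0)//.
  have := h1 z zi z1 i i; have := h2 z zi z2 i i.
  move=> /(le_trans (rn_ge0 _)) p1 /(le_trans (rn_ge0 _)) p2.
  by move: p1 p2; rewrite !pmulr_lge0 ?invr_gt0 ?exprn_gt0// => p1 p2; exact: addr_ge0.
have : x <= (K1 + K2) / e ^+ N + x / 2.
  by apply: rn_mx_le => [|i' j']; rewrite ?mxE ?B// addr_ge0// divr_ge0.
by rewrite -mulrA; lra.
Qed.

(** On the ray [exp(l z)] does not decay and [z^b] decays at most like a power, so the product with
    [c] can be flat only for [c = 0]. *)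
Lemma decay_eq0 (c l b : C) th : 0 <= complex.Re (cexp (0 +i* th) * l) ->
  (forall N : nat, exists K rho : R, forall z : C, complex.Im z = th -> rho <= expR (complex.Re z) ->
    rn (c * cexp (cexp z * l + z * b)) <= K * expR (complex.Re z) ^- N) -> c = 0.
Proof.
move=> hl H; have [N hN] := nat_above (`|complex.Re b|); have [K [rho hK]] := H N.+1.
apply: small_eq0 => e e0.
(* At [log z = s + i th] the factor of [c] has modulus at least [exp(-(s N + A))]. Decay of order
   [N + 1] then gives [|c| exp s <= |K| exp A], and [s] makes the right side at most [e exp s]. *)
pose A := `|th * complex.Im b|; pose s := Num.max 0 (Num.max (ln `|rho|) (`|K| * expR A / e)).
have s0 : 0 <= s by rewrite le_max lexx.
have srho : rho <= expR s.
  have [r0|r0] := leP rho 0; first by rewrite (le_trans r0)// expR_ge0.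
  rewrite -[leLHS]lnK ?posrE// ler_expR !le_max; apply/orP; right; apply/orP; left.
  by rewrite ger0_norm// ltW.
have sK : `|K| * expR A <= e * expR s.
  rewrite -ler_pdivrMl// mulrC; apply: (@le_trans _ _ s).
    by rewrite !le_max lexx !orbT.
  by apply: le_trans (expR_ge1Dx s); rewrite lerDr.
have := hK (s +i* th) erefl srho; rewrite rnM rn_cexp ReD /=.
set T1 := complex.Re (cexp _ * l); set T2 := complex.Re (_ * b).
have T10 : 0 <= T1.
  rewrite /T1 (_ : s +i* th = s%:C + 0 +i* th); last by apply: complexP; rewrite /= ?addr0 ?add0r.
  rewrite cexpD -mulrA (_ : cexp s%:C = (expR s)%:C); last first.
    by apply: complexP; rewrite ?Re_cexp ?Im_cexp /= ?cos0 ?sin0 ?mulr1 ?mulr0.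
  by rewrite ReM /= mul0r subr0 mulr_ge0// expR_ge0.
have T20 : - (s * N%:R + A) <= T2.
  rewrite /T2 ReM /=.
  have : `|s * complex.Re b| <= s * N%:R by rewrite normrM ger0_norm// ler_wpM2l.
  have := ler_norm (th * complex.Im b); rewrite -/A ler_norml => a1 /andP[a2 a3]; lra.
move=> h.
have h2 : rn c * expR (- (s * N%:R + A)) <= `|K| * expR s ^- N.+1.
  apply: le_trans (le_trans _ h) _.
    by rewrite ler_wpM2l ?rn_ge0// ler_expR; lra.
  by rewrite ler_wpM2r ?invr_ge0 ?exprn_ge0 ?expR_ge0// ler_norm.
have eE : expR (- (s * N%:R + A)) = expR s ^- N * (expR A)^-1.
  by rewrite expRN expRD invfM (mulrC s) expRM_natl.
rewrite eE exprS invfM in h2.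
have p1 : 0 < expR s ^+ N by rewrite exprn_gt0// expR_gt0.
have p2 := expR_gt0 s; have p3 := expR_gt0 A.
have : rn c * expR s <= `|K| * expR A.
  have -> : rn c * expR s = rn c * (expR s ^- N / expR A) * (expR s * expR s ^+ N * expR A).
    by field; rewrite !lt0r_neq0.
  have -> : `|K| * expR A = `|K| * ((expR s)^-1 * expR s ^- N) * (expR s * expR s ^+ N * expR A).
    by field; rewrite !lt0r_neq0.
  by rewrite ler_wpM2r// !mulr_ge0// ltW.
move=> /le_trans /(_ sK); rewrite ler_pM2r//.
Qed.

(** For each pair [(i, j)] the real part of [z (L_i - L_j)] is nonnegative on one of two opposite
    rays, and there [decay_eq0] annihilates the entry of [M - 1]. *)
Lemma asymp_unique L A b F Y Y' th : F 0%N = 1%:M -> is_fundamental L A Y -> is_fundamental L A Y' ->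
  asymp th th L b F Y -> asymp th th L b F Y' ->
  asymp (th + pi) (th + pi) L b F Y -> asymp (th + pi) (th + pi) L b F Y' -> forall z, Y' z = Y z.
Proof.
move=> F0 fY fY' h1 h1' h2 h2'; have [M uM YM] := fundamental_connection fY fY'.
have d1 := connection_decay F0 YM h1 h1'; have d2 := connection_decay F0 YM h2 h2'.
suff M1 : M = 1%:M by move=> z; rewrite YM M1 mulmx1.
apply/matrixP => i j; rewrite mxE; apply/eqP; rewrite -subr_eq0; apply/eqP.
have dth (t : R) := fun d => @decay_eq0 (M i j - (i == j)%:R) (L 0 i - L 0 j) (b 0 i - b 0 j) t d.
have H t (d : forall N, exists K rho : R, forall z : C, complex.Im z = t -> rho <= expR (complex.Re z) -> forall i j,
  rn ((M i j - (i == j)%:R) * cexp (cexp z * (L 0 i - L 0 j) + z * (b 0 i - b 0 j))) <= K * expR (complex.Re z) ^- N) N :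
  exists K rho : R, forall z : C, complex.Im z = t -> rho <= expR (complex.Re z) ->
  rn ((M i j - (i == j)%:R) * cexp (cexp z * (L 0 i - L 0 j) + z * (b 0 i - b 0 j))) <= K * expR (complex.Re z) ^- N.
  by have [K [rho hK]] := d N; exists K, rho => z z1 z2; exact: hK.
have [s|s] := leP 0 (complex.Re (cexp (0 +i* th) * (L 0 i - L 0 j))); first by apply: dth s (H _ d1).
apply: (dth (th + pi)) (H _ d2).
rewrite (_ : cexp (0 +i* (th + pi)) = - cexp (0 +i* th)); first by rewrite mulNr ReN oppr_ge0 ltW.
apply: complexP; rewrite ?ReN ?ImN ?Re_cexp ?Im_cexp /= expR0 !mul1r.
  by rewrite cosD cospi sinpi mulr0 subr0 mulrN1.
by rewrite sinD cospi sinpi mulr0 addr0 mulrN1.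
Qed.

End Asymptotics.

(** * Polydiscs and division by linear forms *)

Section Bridge.
Variable R : realType.
Local Notation C := R[i].

Lemma posC (e : C) : 0 < e -> e = (complex.Re e)%:C /\ 0 < complex.Re e.
Proof. by case: e => a b; rewrite ltcE /= => /andP[/eqP -> a0]. Qed.

Lemma nbhs_rn (U : normedModType C) (x : U) (P : set U) :
  nbhs x P <-> exists2 d : R, 0 < d & forall y, rn (y - x) < d -> P y.
Proof.
split.
  move=> /nbhs_normP[e /= e0 h]; have [eE e1] := posC e0.
  exists (complex.Re e) => // y hy; apply: h => /=.
  by rewrite /= eE distrC rn_lt.
move=> [d d0 h]; apply/nbhs_normP; exists d%:C; rewrite /= ?ltcR//.
by move=> y /=; rewrite distrC rn_lt => /h.
Qed.

Lemma open_opn (U : normedModType C) (E : set U) : open E <-> opn E.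
Proof.
rewrite openE; split=> h x Ex; first by have /nbhs_rn := h x Ex.
by apply/nbhs_rn; exact: h.
Qed.

Lemma near0_rn (U : normedModType C) (P : set U) :
  nbhs (0 : U) P <-> exists2 d : R, 0 < d & forall y, rn y < d -> P y.
Proof.
rewrite nbhs_rn; split=> -[d d0 h]; exists d => // y; first by move=> hy; apply: h; rewrite subr0.
by rewrite subr0; exact: h.
Qed.

Lemma differentiable_hol n p q (f : 'rV[C]_n -> 'M[C]_(p, q)) t i j :
  differentiable f t -> hol (fun t => f t i j) t.
Proof.
move=> df; have := diff_locally df; move/eqaddoP => h.
exists (fun h => 'd f t h i j); split.
- by move=> a u v; rewrite linearP mxE; congr (_ + _); rewrite mxE.
- have /linear_bounded_continuous/linear_boundedP := diff_continuous df.
  move=> [M [Mr hM]].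
  pose K := (`|complex.Re M| + 1)%:C : C.
  have MK : M < K.
    have [iM] : (complex.Im M)%:C = 0 :> C := RIm_real Mr.
    have -> : M = (complex.Re M)%:C by apply: complexP.
    by rewrite /K ltcR (le_lt_trans (ler_norm _))// ltrDl.
  exists (`|complex.Re M| + 1); first by rewrite addr_ge0.
  move=> u; rewrite (le_trans (rn_entry _ _ _))//.
  by have := hM _ MK u; rewrite !rnE /K -rmorphM /= lecR.
- move=> e e0; have /h/near0_rn[d d0 hd] : 0 < e%:C :> C by rewrite ltcR.
  exists d => // u /hd /=; rewrite !rnE -rmorphM lecR => hh.
  apply: le_trans hh; apply: le_trans (rn_entry _ i j).
  rewrite le_eqVlt; apply/orP; left; apply/eqP; congr (rn _).
  by rewrite !fctE /= mxsubE /= mxE [u + t]addrC opprD addrA.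
Qed.

Lemma hol_differentiable n p q (f : 'rV[C]_n -> 'M[C]_(p, q)) t :
  (forall i j, hol (fun t => f t i j) t) -> differentiable f t.
Proof.
move=> h; have [L hL] : exists L : 'I_p -> 'I_q -> 'rV[C]_n -> C, forall i j, isd (fun t => f t i j) t (L i j).
  by exists (fun i j => dd (fun t => f t i j) t) => i j; exact: ddP.
pose g u : 'M[C]_(p, q) := \matrix_(i, j) L i j u.
have glin : linear g.
  by move=> a u v; apply/matrixP=> i j; rewrite !mxE; case: (hL i j) => ->.
pose gl : {linear 'rV[C]_n -> 'M[C]_(p, q)} :=
  HB.pack g (GRing.isLinear.Build _ _ _ _ g glin).
have glE : (gl : _ -> _) = g by [].
have gc : continuous gl.
  apply/linear_bounded_continuous/linear_boundedP.
  have [K hK] : exists K : R, forall i j u, rn (L i j u) <= K * rn u.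
    have : exists e M : R, 0 < e /\ forall ij, ij \in enum {: 'I_p * 'I_q} ->
       0 < e /\ forall u, rn (L ij.1 ij.2 u) <= M * rn u.
      apply: fin_bounds.
        move=> [i j] e e' M M' /andP[e0 _] MM [_ hh]; split=> // u.
        by apply: le_trans (hh u) _; rewrite ler_wpM2r// rn_ge0.
      by move=> [i j] _; case: (hL i j) => _ [K _ hK] _; exists 1, K.
    move=> [e [M [_ hM]]]; exists M => i j u.
    by have [|_ ] := hM (i, j) _; first by rewrite mem_enum.
  exists (`|K|%:C); split; first by rewrite complex_real.
  move=> x hx u; have x0 : 0 <= x by apply: le_trans (ltW hx); rewrite lecR.
  apply: (@le_trans _ _ (`|K|%:C * `|u|)); last by rewrite ler_wpM2r// ltW.
  rewrite !rnE -rmorphM lecR; apply: rn_mx_le; first by rewrite mulr_ge0// rn_ge0.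
  move=> i j; rewrite glE mxE; apply: le_trans (hK i j u) _.
  by rewrite ler_wpM2r// ?rn_ge0// ler_norm.
have go : f \o shift t = cst (f t) + gl +o_ (0 : 'rV[C]_n) id.
  apply/eqaddoP => e e0; have [eE {}e0] := posC e0; rewrite eE.
  have : exists d M : R, 0 < d /\ forall ij, ij \in enum {: 'I_p * 'I_q} -> 0 <= M /\ forall u, rn u < d ->
      rn (f (t + u) ij.1 ij.2 - f t ij.1 ij.2 - L ij.1 ij.2 u) <= complex.Re e * rn u.
    apply: fin_bounds.
      move=> [i j] e1 e' M M' /andP[_ e1e] MM [M0 hh].
      by split=> [|u hu]; [exact: le_trans MM|apply: hh; apply: lt_le_trans e1e].
    move=> [i j] _; case: (hL i j) => _ _ /(_ _ e0)[d d0 hd].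
    by exists d, 0.
  move=> [d [? [d0 hd]]]; apply/near0_rn; exists d => // u hu.
  rewrite !rnE -rmorphM lecR; apply: rn_mx_le; first by rewrite mulr_ge0// ?rn_ge0// ltW.
  move=> i j; have [|_ /(_ u hu)] := hd (i, j) _; [by rewrite mem_enum|apply: le_trans].
  rewrite le_eqVlt; apply/orP; left; apply/eqP; congr (rn _).
  have -> : (f \o shift t - (cst (f t) + gl)) u = f (t + u) - (f t + g u) by rewrite -glE [t + u]addrC.
  rewrite mxsubE; have -> : (f t + g u) i j = f t i j + g u i j by rewrite mxE.
  by rewrite opprD addrA /g [in LHS]mxE.
apply/diff_locallyP; rewrite (diff_unique gc go).
by split.
Qed.

Lemma holomorphic_onP n p q (E : set 'rV[C]_n) (f : 'rV[C]_n -> 'M[C]_(p, q)) :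
  holomorphic_on E f <-> exists O, [/\ opn O, E `<=` O &
    forall t i j, O t -> hol (fun t => f t i j) t].
Proof.
split=> -[W [oW EW h]]; exists W; split=> //; try exact/open_opn.
  by move=> t i j /h; exact: differentiable_hol.
by move=> t Ot; apply: hol_differentiable => i j; exact: h.
Qed.

End Bridge.

(** * Compactness of the closed polydisc *)

Section CompactPolydisc.
Variable R : realType.
Local Notation C := R[i].
Variable n : nat.
Local Notation T := 'rV[C]_n.

Lemma polydiscE (eps : R) (t : T) : polydisc eps t <-> rn t <= eps.
Proof. by rewrite /polydisc /= rn_le. Qed.

Lemma disc_compact (r : R) : compact [set z : C | rn z <= r].
Proof.
pose g (x : R * R) : C := x.1%:C + 'i * x.2%:C.
have gc : continuous g.
  move=> x; apply/cvgrPdist_le => /= e e0; have [eE {}e0] := posC e0.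
  have e2 : 0 < complex.Re e / 2 by rewrite divr_gt0.
  near=> y; rewrite eE rn_le; apply: le_trans (rn_ReIm _) _.
  have -> : complex.Re (g x - g y) = x.1 - y.1 by rewrite /g /=; ring.
  have -> : complex.Im (g x - g y) = x.2 - y.2 by rewrite /g /=; ring.
  have h1 : `|x.1 - y.1| <= complex.Re e / 2 by near: y; apply: cvgr_dist_le e2; exact: cvg_fst.
  have h2 : `|x.2 - y.2| <= complex.Re e / 2 by near: y; apply: cvgr_dist_le e2; exact: cvg_snd.
  by rewrite [leRHS]splitr lerD.
pose I := `[- r, r]%classic.
have cK : compact (g @` (I `*` I)).
  apply: continuous_compact; first by apply: continuous_subspaceT.
  by apply: compact_setX; exact: segment_compact.
apply: subclosed_compact cK _.
  rewrite -openC; apply/open_opn => z /= /negP; rewrite -ltNge => zr.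
  exists (rn z - r); first by rewrite subr_gt0.
  move=> y; rewrite rnB => hy /=; apply/negP; rewrite -ltNge.
  by have := rn_sub z y; lra.
have hI x : `|x| <= r -> I x by rewrite /I /mkset in_itv /= ler_norml.
move=> z /= zr; exists (complex.Re z, complex.Im z); last by rewrite /g /= -complex_ReIm.
by split; apply: hI; [apply: le_trans (Re_le_rn _) _|apply: le_trans (Im_le_rn _) _].
Unshelve. all: by end_near.
Qed.

Lemma polydisc_compact (eps : R) : compact (polydisc eps : set T).
Proof.
have := @rV_compact C n (fun=> [set z : C | rn z <= eps]) (fun=> disc_compact (r := eps)).
case: (ltP eps 0) => e0 h.
  rewrite (_ : polydisc eps = set0); first exact: compact0.
  by apply/seteqP; split=> // t /polydiscE; have := rn_ge0 t; lra.
congr (compact _) : h; apply/seteqP; split=> t.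
  by move=> h; apply/polydiscE/rn_mx_le => // i j; rewrite (ord1 i); exact: h.
by move=> /polydiscE h i /=; exact: le_trans (rn_entry _ _ _) h.
Qed.

(** Compactness gives one radius for the balls around all points of the polydisc; a point slightly
    outside is close to its radial projection on [|t| = eps]. *)
Lemma polydisc_nbhd (eps : R) (W : set T) : 0 < eps -> opn W -> polydisc eps `<=` W ->
  exists2 r : R, eps < r & forall t, rn t < r -> W t.
Proof.
move=> e0 oW EW.
have /compact_near_coveringP/(_ nat \oo (fun k t => forall s, rn (s - t) < k.+1%:R^-1 -> W s) _) := (@polydisc_compact eps : compact (polydisc eps)).
case; last first.
  move=> N _ /(_ _ (leqnn N)) hN; exists (eps + N.+2%:R^-1).
    by rewrite ltrDl invr_gt0.
  move=> t ht; case: (leP (rn t) eps) => te; first by apply: EW; apply/polydiscE.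
  have t0 : 0 < rn t by lra.
  pose s := (eps / rn t)%:C *: t.
  have rs : rn s = eps.
    by rewrite /s rnZ rn_real ger0_norm ?divr_ge0 ?ltW// divfK// gt_eqF.
  apply: (hN s); first by apply/polydiscE; rewrite rs.
  have -> : t - s = (1 - eps / rn t)%:C *: t.
    by rewrite /s -[X in X - _]scale1r -scalerBl rmorphB.
  rewrite rnZ rn_real ger0_norm; last by rewrite subr_ge0 ler_pdivrMr// mul1r ltW.
  rewrite mulrBl mul1r divfK ?gt_eqF//.
  rewrite ltrBlDl; apply: lt_le_trans ht _; rewrite lerD2l.
  by rewrite lef_pV2 ?posrE// ler_nat.
move=> t /EW /oW[r r0 hr]; have [N hN] := nat_above r^-1.
exists ([set s | rn (s - t) < r / 2], [set k | (2 * N <= k)%N]); first split => /=.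
- by apply/nbhs_rn; exists (r / 2) => //; rewrite divr_gt0.
- by exists (2 * N)%N.
- move=> [s k] /= [hs hk] y hy; apply: hr; apply: le_lt_trans (rn_tri y s t) _.
  have : k.+1%:R^-1 <= r / 2 :> R.
    rewrite -[r in leRHS]invrK -invfM lef_pV2 ?posrE ?ltr0n ?mulr_gt0 ?invr_gt0//.
    apply: (@le_trans _ _ (2 * N)%N%:R); last by rewrite ler_nat ltnW.
    by rewrite natrM mulrC ler_pM2l.
  by move=> hk2; rewrite [ltRHS]splitr ltrD// (lt_le_trans hy).
Qed.

Lemma hol_bounded_polydisc (r r' : R) (f : T -> C) : r' < r ->
  (forall t, rn t < r -> hol f t) -> exists2 M : R, 0 <= M & forall t, rn t <= r' -> rn (f t) <= M.
Proof.
move=> rr hf.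
have /compact_near_coveringP/(_ nat \oo (fun k t => rn (f t) <= k%:R) _) := (@polydisc_compact r' : compact (polydisc r')).
case; last first.
  move=> N _ /(_ _ (leqnn N)) hN; exists N%:R => // t ht.
  by apply: hN; apply/polydiscE.
move=> t /polydiscE ht; have /hol_bounded[d d0 hd] : hol f t by apply: hf; lra.
have [N hN] := nat_above (rn (f t) + 1).
exists ([set s | rn (s - t) < d], [set k | (N <= k)%N]); first split => /=.
- by apply/nbhs_rn; exists d.
- by exists N.
- move=> [s k] /= [/hd hs hk]; apply: le_trans hs _; apply: le_trans hN _.
  by rewrite ler_nat.
Qed.
End CompactPolydisc.

(** * Division by u_a - u_b *)

Section Division.
Variable R : realType.
Local Notation C := R[i].
Variable n : nat.
Local Notation T := 'rV[C]_n.

Lemma rowDE (u t : T) a : (u + t) 0 a = u 0 a + t 0 a.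
Proof. by rewrite mxE. Qed.

Lemma rowZE (c : C) (t : T) a : (c *: t) 0 a = c * t 0 a.
Proof. by rewrite mxE. Qed.

Lemma rn_delta (i : 'I_n) : rn (delta_mx 0 i : T) <= 1.
Proof.
apply: rn_mx_le => // a b; rewrite mxE.
by case: (_ && _); rewrite ?rn1 ?rn0.
Qed.

Lemma hol_coord (i : 'I_n) (t : T) : isd (fun t : T => t 0 i) t (fun h => h 0 i).
Proof.
apply: (@isd_linear _ _ _ 1) => // [a u v|u]; first by rewrite rowDE rowZE.
by rewrite mul1r rn_entry.
Qed.

Lemma dd_bounded (f : T -> C) (r r' : R) h : r' < r -> (forall t, rn t < r -> hol f t) ->
  exists2 M : R, 0 <= M & forall t, rn t <= r' -> rn (dd f t h) <= M.
Proof.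
move=> rr hf; apply: (@hol_bounded_polydisc _ _ r) => // t ht.
apply: (@hol_dd _ _ _ _ (r - rn t)); first by rewrite subr_gt0.
by move=> y; rewrite ltrBrDl => hy; apply: hf; apply: le_lt_trans (rn_sub y t) _.
Qed.

Lemma convex_lt (x y r s : R) : 0 <= s -> s <= 1 -> x < r -> y < r -> (1 - s) * x + s * y < r.
Proof.
move=> s0 s1 xr yr; case: (leP s (1 / 2)) => hs.
  have : s * (y - r) <= 0 by nra.
  nra.
have : (1 - s) * (x - r) <= 0 by nra.
nra.
Qed.

(** The quotient is the mean of the derivative of [f] in the direction [e] along [q s t], which
    moves the [i]-th coordinate from [t_j], where [f] vanishes, to [t_i]. A coordinate is replaced
    by a convex combination of two, so balls of the maximum norm are preserved. *)
Lemma hol_divide (f : T -> C) (r : R) (i j : 'I_n) : i != j ->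
  (forall t : T, rn t < r -> hol f t) -> (forall t : T, rn t < r -> t 0 i = t 0 j -> f t = 0) ->
  exists g : T -> C, forall t, rn t < r -> hol g t /\ f t = (t 0 i - t 0 j) * g t.
Proof.
move=> ij hf f0; pose e : T := delta_mx 0 i.
have e_i : e 0 i = 1 by rewrite mxE !eqxx.
have e_a a : a != i -> e 0 a = 0 by rewrite mxE eqxx /= => /negPf ->.
pose q (s : R) (t : T) : T := (t - (t 0 i - t 0 j) *: e) + s%:C *: ((t 0 i - t 0 j) *: e).
have qi s t : q s t 0 i = t 0 j + s%:C * (t 0 i - t 0 j).
  by rewrite /q 2!rowDE mxE !rowZE e_i; ring.
have qa s t a : a != i -> q s t 0 a = t 0 a.
  by move=> ai; rewrite /q 2!rowDE mxE !rowZE e_a//; ring.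
have qr s (t : T) (r' : R) : 0 <= s <= 1 -> 0 < r' -> rn t < r' -> rn (q s t) < r'.
  move=> /andP[s0 s1] r0 tr; apply: rn_mx_lt => // z a; rewrite (ord1 z).
  have ta b : rn (t 0 b) < r' by apply: le_lt_trans tr; exact: rn_entry.
  case: (eqVneq a i) => [->|ai]; last by rewrite qa.
  have -> : q s t 0 i = (1 - s)%:C * t 0 j + s%:C * t 0 i by rewrite qi rmorphB /=; ring.
  apply: le_lt_trans (rnD _ _) _; rewrite !rnM !rn_real !ger0_norm ?subr_ge0//.
  have := ta i; have := ta j.
  by move=> h1 h2; exact: convex_lt.
have hde y : rn y < r -> hol (fun y => dd f y e) y.
  move=> hy; apply: (@hol_dd _ _ _ _ (r - rn y)); first by rewrite subr_gt0.
  by move=> x; rewrite ltrBrDl => hx; apply: hf; apply: le_lt_trans (rn_sub x y) _.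
exists (fun t => cint (fun s => dd f (q s t) e)) => t tr.
have r0 : 0 < r by apply: le_lt_trans tr; exact: rn_ge0.
have cq y : rn y < r -> cont01 (fun s => dd f (q s y) e).
  move=> yr; apply: (@rder_cont01 _ _ (fun s => dd (fun y => dd f y e) (q s y) ((y 0 i - y 0 j) *: e))) => s s01.
  apply: (@rder_line _ _ (y - (y 0 i - y 0 j) *: e) ((y 0 i - y 0 j) *: e) (fun y => dd f y e) s).
  by apply: ddP; apply: hde; exact: (qr s).
split.
  pose r' := (rn t + r) / 2; have [rt rr] : rn t < r' /\ r' < r by rewrite /r'; lra.
  have [M M0 hM] := @dd_bounded f r r' e rr hf.
  have in_r y : rn (y - t) < r' - rn t -> rn y < r'.
    by rewrite ltrBrDl; apply: le_lt_trans (rn_sub y t).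
  have [|s y s01 /in_r hy|y /in_r hy|] // := @cint_hol _ _ (fun s t => dd f (q s t) e) t (r' - rn t) M.
  - by rewrite subr_gt0.
  - have qy : rn (q s y) < r' by apply: qr => //; have := rn_ge0 t; lra.
    split; last by apply: hM; exact: ltW.
    pose P (t : T) : T := t - (t 0 i - t 0 j) *: e + s%:C *: ((t 0 i - t 0 j) *: e).
    have PE t' : q s t' = 0 + P t' by rewrite add0r.
    apply: (@hol_ext _ _ (fun t => dd f (0 + P t) e)) => [t'|]; first by rewrite -PE.
    exists (dd (fun y => dd f y e) (0 + P y) \o P); apply: (@isd_compl _ _ _ P 0 (fun y => dd f y e) y _ (1 + 2 + 2)).
    + move=> u v a; rewrite /P !rowDE !rowZE; apply/rowP => b.
      by rewrite !(rowDE, rowZE, mxE); ring.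
    + by rewrite !addr_ge0.
    + move=> u; apply: rn_mx_le; first by rewrite mulr_ge0 ?rn_ge0// !addr_ge0.
      move=> z a; rewrite (ord1 z) -[P u]add0r -PE.
      have := rn_entry u 0 a; have := rn_entry u 0 i; have := rn_entry u 0 j.
      case: (eqVneq a i) => [->|ai]; last by rewrite qa//; have := rn_ge0 u; lra.
      have -> : q s u 0 i = (1 - s)%:C * u 0 j + s%:C * u 0 i by rewrite qi rmorphB /=; ring.
      move=> h1 h2 h3; apply: le_trans (rnD _ _) _; rewrite !rnM !rn_real.
      move/andP: s01 => [s0 s1]; rewrite !ger0_norm ?subr_ge0//.
      by have := rn_ge0 (u 0 i); have := rn_ge0 (u 0 j); nra.
    + by rewrite -PE; apply: ddP; apply: hde; apply: lt_trans rr.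
  - by apply: cq; apply: lt_trans rr.
have -> : f t = f (q 1 t) - f (q 0 t).
  have -> : q 1 t = t by rewrite /q scale1r subrK.
  by rewrite (f0 (q 0 t)) ?subr0 ?qr ?lexx ?ler01// qi qa ?mul0r ?addr0// eq_sym.
rewrite -cintZ; last exact: cq.
symmetry; apply: (@cint_ftc _ (fun s => f (q s t))); first by apply: cont01Z; exact: cq.
move=> s s01; have qs : hol f (q s t) by apply: hf; exact: qr.
by rewrite -(isd_linZ _ _ (ddP qs)); apply: rder_line; exact: ddP.
Qed.

Lemma vanishing_eq0 (u0 : T) (eps : R) (A : T -> 'M[C]_n) a b t : vanishing_conditions u0 eps A ->
  a != b -> rn t <= eps -> (u0 + t) 0 a = (u0 + t) 0 b -> A t a b = 0.
Proof.
move=> h ab te tab.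
have tc : coalescence u0 eps t by split; [exact/polydiscE|exists a, b].
have /eqO_exP[k k0 hk] := h a b ab t tc tab.
have [d d0 /(_ t)] : exists2 d : R, 0 < d & forall y, rn (y - t) < d -> polydisc eps y ->
   `|A y a b| <= k * `|(u0 + y) 0 a - (u0 + y) 0 b| by apply/nbhs_rn; exact: hk.
rewrite subrr rn0 tab subrr normr0 mulr0 => /(_ d0); rewrite normr_le0 => hA.
by apply/eqP/hA/polydiscE.
Qed.

(** The hyperplane [t_a = t_b] contains the complex line through 0 and [t]; on it [f] vanishes near
    0, hence at [t]. This carries the vanishing conditions from the closed polydisc to a larger
    ball. *)
Lemma vanishing_ball (f : T -> C) (eps r : R) (a b : 'I_n) : 0 < eps ->
  (forall t, rn t < r -> hol f t) -> (forall t : T, rn t <= eps -> t 0 a = t 0 b -> f t = 0) ->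
  forall t : T, rn t < r -> t 0 a = t 0 b -> f t = 0.
Proof.
move=> e0 hf f0 t tr tab; have r0 : 0 < r by apply: le_lt_trans tr; exact: rn_ge0.
have t1 : 0 < rn t + 1 by rewrite ltr_wpDl// rn_ge0.
rewrite -[t]scale1r.
apply: (@identity_segment _ _ [set z : C | rn (z *: t) < r] (fun z : C => f (z *: t)) 0 1 (eps / (rn t + 1))).
- move=> z /= zr; exists ((r - rn (z *: t)) / (rn t + 1)); first by rewrite divr_gt0// subr_gt0.
  move=> y; rewrite ltr_pdivlMr// => hy; apply: le_lt_trans (rn_sub (y *: t) (z *: t)) _.
  have -> : rn (y *: t - z *: t) = rn (y - z) * rn t by rewrite -scalerBl rnZ.
  by have := rn_ge0 (y - z); lra.
- move=> z /= zr; apply: (@hol_ext _ _ (fun z : C => f (0 + z *: t))) => [y|]; first by rewrite add0r.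
  by apply: hol_line; rewrite add0r; exact: hf.
- move=> s /andP[s0 s1]; rewrite add0r subr0 /= rnZ rnM rn_real rn1 mulr1 ger0_norm//.
  by apply: le_lt_trans tr; rewrite ler_piMl// rn_ge0.
- exact: divr_gt0.
- move=> y; rewrite subr0 ltr_pdivlMr// => hy; apply: f0; last by rewrite !rowZE tab.
  by rewrite rnZ; have := rn_ge0 y; have := rn_ge0 t; nra.
Qed.

Lemma rn_coordB (t : T) (r : R) a b : 0 < r -> rn t < r -> rn (t 0 a - t 0 b) < 2 * r.
Proof.
move=> r0 h; apply: le_lt_trans (rnB_le _ _) _.
by have := rn_entry t 0 a; have := rn_entry t 0 b; lra.
Qed.

(** Pairs with [u_a(0) = u_b(0)] have the linear form [t_a - t_b] as denominator and [hol_divide]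
    applies. For the other pairs the denominator has no zero, since [|t_a - t_b| < 2 r]. *)
Lemma coalescence_quotient (u0 : T) (eps r : R) (A : T -> 'M[C]_n) : 0 < eps <= r ->
  (forall a b, u0 0 a != u0 0 b -> 2 * r <= rn (u0 0 a - u0 0 b)) ->
  (forall t i j, rn t < r -> hol (fun t => A t i j) t) -> vanishing_conditions u0 eps A ->
  exists N1 : T -> 'M[C]_n,
    [/\ forall t i j, rn t < r -> hol (fun t => N1 t i j) t, forall t a, N1 t a a = 0
      & forall t a b, rn t < r -> a != b -> N1 t a b * ((u0 + t) 0 a - (u0 + t) 0 b) = - A t a b].
Proof.
move=> /andP[e0 er] hu hA va.
have E a b : exists g : T -> C, forall t, rn t < r -> a != b -> hol g t /\ g t * ((u0 + t) 0 a - (u0 + t) 0 b) = - A t a b.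
  case: (eqVneq a b) => [->|ab]; first by exists (fun=> 0) => t _ /eqP.
  case: (eqVneq (u0 0 a) (u0 0 b)) => [uab|/hu uab].
    have [|t tr tab|g hg] := @hol_divide (fun t => - A t a b) r a b ab.
    - by move=> t tr; apply: holN; exact: hA.
    - suff -> : A t a b = 0 by rewrite oppr0.
      apply: (@vanishing_ball (fun t => A t a b) eps r a b) => // [t' /hA //|t' te tab'].
      by apply: vanishing_eq0 va ab te _; rewrite !rowDE uab tab'.
    exists g => t /hg[h1 ->] _; split=> //; rewrite !rowDE uab; ring.
  have u_neq t : rn t < r -> (u0 + t) 0 a - (u0 + t) 0 b != 0.
    move=> tr; rewrite -rn_gt0 !rowDE.
    have := rn_coordB a b (lt_le_trans e0 er) tr.
    have := rn_sub (u0 0 a - u0 0 b) (- (t 0 a - t 0 b)); rewrite rnN.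
    by rewrite (_ : _ - - _ = u0 0 a + t 0 a - (u0 0 b + t 0 b)); [lra|ring].
  exists (fun t => - A t a b * ((u0 + t) 0 a - (u0 + t) 0 b)^-1) => t tr _.
  split; last by rewrite divfK ?u_neq.
  apply: holM; first by apply: holN; exact: hA.
  apply: holV; first exact: u_neq.
  apply: (@hol_ext _ _ (fun t : T => (u0 0 a + t 0 a) - (u0 0 b + t 0 b))) => [y|]; first by rewrite !rowDE.
  have hc (c : 'I_n) : hol (fun t : T => u0 0 c + t 0 c) t.
    by apply: holD; [exact: hol_const|exists (fun h : T => h 0 c); exact: hol_coord].
  by apply: holB; exact: hc.
have /choice[g hg] : forall ab : 'I_n * 'I_n, exists g : T -> C, forall t, rn t < r -> ab.1 != ab.2 ->
  hol g t /\ g t * ((u0 + t) 0 ab.1 - (u0 + t) 0 ab.2) = - A t ab.1 ab.2 by move=> ab; exact: E.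
exists (fun t => \matrix_(a, b) (if a == b then 0 else g (a, b) t)).
split=> [t a b tr|t a|t a b tr ab]; last first.
- by rewrite !mxE (negPf ab); have [] := hg (a, b) t tr ab; rewrite !mxE.
- by rewrite mxE eqxx.
case: (eqVneq a b) => [->|ab].
  by apply: (@hol_ext _ _ (fun=> 0)) => [y|]; [rewrite mxE eqxx|exact: hol_const].
apply: (@hol_ext _ _ (g (a, b))) => [y|]; first by rewrite mxE (negPf ab).
by have [] := hg (a, b) t tr ab.
Qed.
End Division.

Local Opaque cexp.

(** * Matrix-valued functions, logarithms and power series *)

Section MatrixFunctions.
Variable R : realType.
Local Notation C := R[i].

Lemma hol_prod (U : normedModType C) (I : Type) (r : seq I) (f : I -> U -> C) x :
  (forall i, hol (f i) x) -> hol (fun y => \prod_(i <- r) f i y) x.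
Proof.
move=> h; elim: r => [|i r IH].
  by apply: (@hol_ext _ _ (fun=> 1)) => [y|]; [rewrite big_nil|exact: hol_const].
by apply: (@hol_ext _ _ (fun y => f i y * \prod_(j <- r) f j y)) => [y|]; [rewrite big_cons|exact: holM].
Qed.

Lemma hol_det (U : normedModType C) n (M : U -> 'M[C]_n) x :
  (forall i j, hol (fun y => M y i j) x) -> hol (fun y => \det (M y)) x.
Proof.
move=> h; apply: hol_sum => s; apply: holM; first exact: hol_const.
by apply: hol_prod => i; exact: h.
Qed.

Lemma hol_adj (U : normedModType C) n (M : U -> 'M[C]_n) x i j :
  (forall i j, hol (fun y => M y i j) x) -> hol (fun y => (\adj (M y)) i j) x.
Proof.
move=> h; apply: (@hol_ext _ _ (fun y => cofactor (M y) j i)) => [y|]; first by rewrite mxE.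
apply: holM; first exact: hol_const.
apply: hol_det => a b.
by apply: (@hol_ext _ _ (fun y => M y (lift j a) (lift i b))) => [y|]; [rewrite !mxE|exact: h].
Qed.

Lemma hol_mulmx (U : normedModType C) n m p (M : U -> 'M[C]_(n, m)) (N : U -> 'M[C]_(m, p)) x i j :
  (forall i j, hol (fun y => M y i j) x) -> (forall i j, hol (fun y => N y i j) x) ->
  hol (fun y => (M y *m N y) i j) x.
Proof.
move=> hM hN; apply: (@hol_ext _ _ (fun y => \sum_k M y i k * N y k j)) => [y|]; first by rewrite mxE.
by apply: hol_sum => k; exact: holM.
Qed.

Lemma hol_invmx (U : normedModType C) n (M : U -> 'M[C]_n) x (r : R) i j : 0 < r ->
  (forall y, rn (y - x) < r -> M y \in unitmx) -> (forall i j, hol (fun y => M y i j) x) ->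
  hol (fun y => invmx (M y) i j) x.
Proof.
move=> r0 hu h; apply: (@hol_near _ _ (fun y => (\det (M y))^-1 * (\adj (M y)) i j) _ _ r) => //.
  move=> y /hu uy; have -> : invmx (M y) = (\det (M y))^-1 *: \adj (M y) by rewrite /invmx uy.
  by rewrite [RHS]mxE.
apply: holM; last exact: hol_adj.
apply: holV; last exact: hol_det.
by have := hu x; rewrite subrr rn0 unitmxE unitfE => /(_ r0).
Qed.

Lemma clog (tau : R) (x : C) : x != 0 ->
  exists w : C, cexp w = x /\ tau - pi <= complex.Im w <= tau + pi.
Proof.
move=> x0; pose y : C := x * cexp (0 -i* tau) * ((rn x)^-1)%:C.
have rx : 0 < rn x by rewrite rn_gt0.
have ry : rn y = 1.
  rewrite /y (rnM (x * _)) (rnM x) (rn_cexp (0 -i* tau)) /= expR0 mulr1 rn_real.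
  by rewrite ger0_norm ?invr_ge0 ?rn_ge0// divff ?gt_eqF.
have y2 : complex.Re y ^+ 2 + complex.Im y ^+ 2 = 1.
  have := congr1 (fun r => r ^+ 2) ry; rewrite /rn; case: (y) => a b /=.
  by rewrite sqr_sqrtr ?addr_ge0 ?sqr_ge0// expr1n.
have h1 : -1 <= complex.Re y <= 1 by rewrite -ler_norml -ry Re_le_rn.
have c1 := acosK h1; have [a0 api] : 0 <= acos (complex.Re y) /\ acos (complex.Re y) <= pi.
  by rewrite acos_ge0// acos_lepi.
have s1 : sin (acos (complex.Re y)) = `|complex.Im y|.
  by rewrite sin_acos// -sqrtr_sqr; congr Num.sqrt; lra.
have [v [hv1 [hv2 hv3]]] : exists v, -pi <= v <= pi /\ cos v = complex.Re y /\ sin v = complex.Im y.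
  case: (leP 0 (complex.Im y)) => iy.
    exists (acos (complex.Re y)); split; first by lra.
    by rewrite c1 s1 ger0_norm.
  exists (- acos (complex.Re y)); split; first by lra.
  by rewrite cosN sinN c1 s1 ltr0_norm// opprK.
exists (ln (rn x) +i* (tau + v)); split; last by rewrite /=; lra.
have -> : ln (rn x) +i* (tau + v) = (ln (rn x) +i* v) + (0 +i* tau) by apply: complexP => /=; ring.
have xE : x = y * (rn x)%:C * cexp (0 +i* tau).
  rewrite /y (_ : _ * _ = x * (cexp (0 -i* tau) * cexp (0 +i* tau)) * ((rn x)^-1 * rn x)%:C).
    by rewrite mulVf ?gt_eqF// -cexpD [X in cexp X](_ : _ = 0) ?cexp0 ?mulr1//; apply: complexP => /=; ring.
  by rewrite [in RHS]rmorphM /=; ring.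
clearbody y; rewrite cexpD [RHS]xE; congr (_ * _); apply: complexP.
  by rewrite Re_cexp /= lnK ?posrE// hv2 ReM /=; ring.
by rewrite Im_cexp /= lnK ?posrE// hv3 ImM /=; ring.
Qed.

Lemma mx_series_clim n (Psi : nat -> 'M[C]_n) (x : C) (P : 'M[C]_n) :
  (series (fun l => x ^+ l *: Psi l) @ \oo --> P) <->
  forall i j, clim (fun m => \sum_(l < m) x ^+ l * Psi l i j) (P i j).
Proof.
have E m i j : (series (fun l => x ^+ l *: Psi l) m - P) i j = \sum_(l < m) x ^+ l * Psi l i j - P i j.
  rewrite mxsubE /series /= big_mkord summxE; congr (_ - _).
  by apply: eq_bigr => l _; rewrite mxE.
split.
  move=> /cvgrPdist_le h i j e e0; have [|N _ hN] := h e%:C; first by rewrite ltcR.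
  exists N => k hk; have := hN k hk; rewrite rn_le rnB; apply: le_trans.
  by rewrite [leLHS]rnB [leRHS]rnB -(E k i j) rn_entry.
move=> h; apply/cvgrPdist_le => e e0; have [eE {}e0] := posC e0.
have H : \forall m \near \oo, forall ij : 'I_n * 'I_n, rn (\sum_(l < m) x ^+ l * Psi l ij.1 ij.2 - P ij.1 ij.2) <= complex.Re e.
  apply: filter_forall => -[i j]; have [N hN] := h i j _ e0.
  by exists N.
apply: filterS H => m H; rewrite eE rn_le rnB; apply: rn_mx_le; first exact: ltW.
by move=> i j; rewrite E; exact: (H (i, j)).
Qed.

Lemma geom_sum_le m : \sum_(l < m) 2^-1 ^+ l <= 2 :> R.
Proof.
suff -> : \sum_(l < m) 2^-1 ^+ l = 2 - 2 * 2^-1 ^+ m :> R.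
  by rewrite gerBl mulr_ge0// exprn_ge0// invr_ge0.
elim: m => [|m IH]; first by rewrite big_ord0 expr0; lra.
by rewrite big_ord_recr /= IH exprS; lra.
Qed.

(** Convergence at the single point [2 r] bounds [(2 r)^l |a_l|] by some [M], so the partial sums
    are at most [2 M] on [|x| <= r] and [vitali] applies. The value at 0 is given apart, because
    points of the universal covering never project to 0. *)
Lemma pseries_entire (a : nat -> C) (f : C -> C) :
  (forall x, x != 0 -> clim (fun m => \sum_(l < m) x ^+ l * a l) (f x)) -> f 0 = a 0%N ->
  forall x, hol f x.
Proof.
move=> h f0 x; pose r := rn x + 1; have r0 : 0 < r by rewrite ltr_wpDl ?rn_ge0.
have x2 : (2 * r)%:C != 0 :> C by rewrite gt_eqF// ltcR mulr_gt0.
have h0 y : clim (fun m => \sum_(l < m) y ^+ l * a l) (f y).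
  case: (eqVneq y 0) => [->|]; last exact: h.
  move=> e e0; exists 1%N => -[//|k] _.
  rewrite big_ord_recl /= expr0 mul1r big1 ?addr0 ?f0 ?subrr ?rn0 ?ltW// => i _.
  by rewrite exprS mul0r mul0r.
have [M hM] : exists M, forall l, (2 * r) ^+ l * rn (a l) <= M.
  have [N hN] := h0 (2 * r)%:C 1 ltr01.
  pose t l := (2 * r) ^+ l * rn (a l).
  exists (2 + \sum_(l < N) t l) => l; case: (ltnP l N) => lN.
    rewrite (bigD1 (Ordinal lN)) //= -/(t l) addrCA lerDl addr_ge0// sumr_ge0// => i _.
    by rewrite mulr_ge0 ?rn_ge0// exprn_ge0// mulr_ge0// ltW.
  apply: (@le_trans _ _ 2); last first.
    rewrite lerDl sumr_ge0// => i _.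
    by rewrite mulr_ge0 ?rn_ge0// exprn_ge0// mulr_ge0// ltW.
  have := hN l lN; have := hN l.+1 (leqW lN); rewrite big_ord_recr /=.
  set s := \sum_(i < l) _; set v := _ * a l => h1 h2.
  have -> : (2 * r) ^+ l * rn (a l) = rn v.
    by rewrite /v rnM rnX rn_real ger0_norm// mulr_ge0// ltW.
  have -> : v = (s + v - f (2 * r)%:C) - (s - f (2 * r)%:C) by ring.
  by apply: le_trans (rnB_le _ _) _; lra.
have hp (k : nat) (y : C) : hol (fun y : C => \sum_(l < k) y ^+ l * a l) y.
  apply: hol_sum => l; apply: holM; last exact: hol_const.
  by apply: holX; exists id; exact: isd_id.
have M0 : 0 <= M by have := hM 0%N; rewrite expr0 mul1r; apply: le_trans; exact: rn_ge0.
have [] // := @vitali _ _ (fun k (y : C) => \sum_(l < k) y ^+ l * a l) f x 1 (2 * M) ltr01.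
move=> k y hy; apply: le_trans (rn_sum _ _ _) _.
apply: (@le_trans _ _ (M * \sum_(l < k) 2^-1 ^+ l)); last by rewrite mulrC ler_wpM2r// geom_sum_le.
rewrite mulr_sumr; apply: ler_sum => l _; rewrite rnM rnX.
have yr : rn y <= r by rewrite /r; have := rn_sub y x; lra.
apply: (@le_trans _ _ (r ^+ l * rn (a l))).
  by rewrite ler_wpM2r ?rn_ge0// lerXn2r ?nnegrE ?rn_ge0// ltW.
rewrite exprVn -ler_pdivrMr ?invr_gt0 ?exprn_gt0// invrK mulrC mulrA -exprMn.
exact: hM.
Qed.

(** Large [x] isolate the constant term; once it is known to be 0, a factor [1 / x] comes out and
    [m] drops by one. *)
Lemma poly_flat m (c : nat -> C) (K rho : R) :
  (forall x : C, rho <= rn x -> rn (\sum_(j < m) x ^- j * c j) <= K * rn x ^- m) ->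
  forall j, (j < m)%N -> c j = 0.
Proof.
elim: m c K rho => // m IH c K rho h.
have c0 : c 0%N = 0.
  apply: small_eq0 => e e0.
  pose S := \sum_(j < m) rn (c j.+1).
  have S0 : 0 <= S by apply: sumr_ge0 => *; exact: rn_ge0.
  pose X := 1 + `|rho| + (`|K| + S) / e.
  have X1 : 1 <= X by rewrite /X -addrA lerDl addr_ge0// divr_ge0 ?addr_ge0// ltW.
  have X0 : 0 < X by lra.
  have rX : rn (X%:C : C) = X by rewrite rn_real ger0_norm// ltW.
  have := h X%:C; rewrite rX => /(_ _)/wrap[].
    have : 0 <= (`|K| + S) / e by rewrite divr_ge0 ?addr_ge0// ltW.
    by rewrite /X; have := ler_norm rho; lra.
  rewrite big_ord_recl /= expr0 invr1 mul1r => h1.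
  have Xi j : X ^- j.+1 <= X^-1.
    rewrite lef_pV2 ?posrE ?exprn_gt0// exprS ler_peMr ?exprn_ege1//; exact: ltW.
  have h2 : rn (\sum_(i < m) X%:C ^- (lift ord0 i) * c (lift ord0 i) : C) <= S * X^-1.
    apply: le_trans (rn_sum _ _ _) _; rewrite mulr_suml; apply: ler_sum => i _.
    by rewrite rnM rnV rnX rX mulrC ler_wpM2l ?rn_ge0// Xi.
  have h3 : K * X ^- m.+1 <= `|K| * X^-1.
    apply: (@le_trans _ _ (`|K| * X ^- m.+1)); first by rewrite ler_wpM2r ?ler_norm// invr_ge0 exprn_ge0// ltW.
    by rewrite ler_wpM2l// Xi.
  have h4 : (`|K| + S) * X^-1 <= e.
    rewrite ler_pdivrMr// mulrC -ler_pdivrMr// /X.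
    by have : 0 <= 1 + `|rho| by []; lra.
  have := rn_sub (c 0%N) (- (\sum_(i < m) X%:C ^- (lift ord0 i) * c (lift ord0 i))).
  rewrite rnN opprK; lra.
case=> // j jm; have := IH (fun j => c j.+1) K (`|rho| + 1) _ j jm; apply => x hx.
have xr : rho <= rn x by have := ler_norm rho; lra.
have x0 : 0 < rn x by apply: lt_le_trans hx; rewrite ltr_wpDl.
have := h x xr; rewrite big_ord_recl c0 mulr0 add0r.
have -> : \sum_(i < m) x ^- lift ord0 i * c (lift ord0 i) = x^-1 * \sum_(i < m) x ^- i * c i.+1.
  by rewrite mulr_sumr; apply: eq_bigr => i _; rewrite /= /bump /= add1n exprS invfM mulrA.
by rewrite rnM rnV exprS invfM mulrCA ler_pM2l// invr_gt0.
Qed.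
End MatrixFunctions.

(** * Baire's theorem for rows of complex numbers *)

Section Baire.
Variable R : realType.
Local Notation C := R[i].
Variable n : nat.
Local Notation T := 'rV[C]_n.

Lemma row_complete (u : nat -> T) (b : nat -> R) :
  (forall e : R, 0 < e -> exists N, b N <= e) ->
  (forall N k, (N <= k)%N -> rn (u k - u N) <= b N) ->
  exists l, forall N, rn (l - u N) <= b N.
Proof.
move=> hb hu.
have ex a : exists l : C, clim (fun k => u k 0 a) l.
  apply: clim_cauchy => e e0; have [|N hN] := hb (e / 2); first by rewrite divr_gt0.
  exists N => k l Nk Nl; have H m : (N <= m)%N -> rn (u m 0 a - u N 0 a) <= e / 2.
    move=> Nm; apply: le_trans hN; apply: le_trans (hu _ _ Nm).
    by rewrite -[_ - u N 0 a](mxsubE (u m) (u N)) rn_entry.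
  apply: le_trans (rn_tri _ (u N 0 a) _) _; rewrite [leRHS]splitr lerD ?H//.
  by rewrite rnB H.
have [l hl] := choice ex; exists (\row_a l a) => N; apply: rn_mx_le.
  by apply: le_trans (hu N N (leqnn N)); exact: rn_ge0.
move=> i a; rewrite (ord1 i) mxsubE [X in X - _]mxE.
apply: (@clim_le _ _ (fun k => u (k + N)%N 0 a - u N 0 a)).
  by apply: climB; [exact: (clim_shift N (hl a))|exact: clim_const].
move=> k; apply: le_trans (hu N _ (leq_addl k N)).
by rewrite -[_ - u N 0 a](mxsubE (u (k + N)%N) (u N)) rn_entry.
Qed.

(** Otherwise nested closed balls, each avoiding one more of the [E m], would shrink to a point
    outside all of them. It turns bounds with a constant for each [t] into a bound uniform on a
    ball. *)
Lemma baire (E : nat -> set T) (c : T) (r : R) : 0 < r ->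
  (forall m t, rn (t - c) < r -> ~ E m t -> exists2 d : R, 0 < d & forall y, rn (y - t) < d -> ~ E m y) ->
  (forall t, rn (t - c) < r -> exists m, E m t) ->
  exists m t d, [/\ 0 < d & forall y, rn (y - t) < d -> rn (y - c) < r /\ E m y].
Proof.
move=> r0 hE cov; apply: contrapT => no.
have step m (t : T) (d : R) : 0 < d -> (forall y, rn (y - t) <= d -> rn (y - c) < r) ->
    exists t' d', [/\ 0 < d', d' <= d / 2 & forall y, rn (y - t') <= d' -> rn (y - t) <= d /\ ~ E m y].
  move=> d0 hd; apply: contrapT => no'; apply: no; exists m, t, d; split=> // y yd.
  split; first by apply: hd; exact: ltW.
  apply: contrapT => nE; apply: no'.
  have [e e0 he] := hE m y (hd y (ltW yd)) nE.
  exists y, (Num.min (d / 2) (Num.min (e / 2) ((d - rn (y - t)) / 2))); split.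
  - by rewrite !lt_min !divr_gt0// subr_gt0.
  - by rewrite ge_min lexx.
  - move=> z; rewrite !le_min => /andP[z1 /andP[z2 z3]]; split; last by apply: he; lra.
    by have := rn_tri z y t; lra.
pose good (x : T * R) := 0 < x.2 /\ forall y, rn (y - x.1) <= x.2 -> rn (y - c) < r.
have stepE (mx : nat * (T * R)) : exists x' : T * R, good mx.2 -> [/\ good x', x'.2 <= mx.2.2 / 2 &
    forall y, rn (y - x'.1) <= x'.2 -> rn (y - mx.2.1) <= mx.2.2 /\ ~ E mx.1 y].
  case: (pselect (good mx.2)) => [[g1 g2]|]; last by exists (c, 0).
  have [t' [d' [d0 dd hd]]] := step mx.1 _ _ g1 g2.
  exists (t', d') => _; split=> //; split=> // y /hd[/g2 //].
have [f hf] := choice stepE.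
pose x := fix x k := if k is k'.+1 then f (k', x k') else (c, r / 2).
have gx k : good (x k).
  elim: k => [|k IH]; last by have [] := hf (k, x k) IH.
  by split=> /=; [rewrite divr_gt0|move=> y hy; apply: le_lt_trans hy _; lra].
have xS k : x k.+1 = f (k, x k) by [].
have nest k y : rn (y - (x k.+1).1) <= (x k.+1).2 -> rn (y - (x k).1) <= (x k).2 /\ ~ E k y.
  by rewrite xS; have [_ _] := hf (k, x k) (gx k); exact.
have nest' N k y : (N <= k)%N -> rn (y - (x k).1) <= (x k).2 -> rn (y - (x N).1) <= (x N).2.
  elim: k y => [|k IH] y; first by rewrite leqn0 => /eqP ->.
  by rewrite leq_eqVlt => /orP[/eqP -> //|Nk] /nest[/IH + _]; apply.
have [l hl] : exists l, forall N, rn (l - (x N).1) <= (x N).2.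
  apply: row_complete.
    move=> e e0; have hk k : (x k).2 <= r / 2 * 2^-1 ^+ k.
      elim: k => [|k IH]; first by rewrite expr0 mulr1.
      by have [_ h _] := hf (k, x k) (gx k); rewrite xS; apply: le_trans h _; rewrite exprS /=; lra.
    have [k hk'] := half_small (divr_gt0 e0 r0); exists k.
    apply: le_trans (hk k) _; move: hk'; rewrite ltr_pdivlMr//; lra.
  move=> N k Nk; apply: nest' Nk _; rewrite subrr rn0.
  by have [h _] := gx k; exact: ltW.
have [|m] := cov l; last by have [] := nest m l (hl m.+1).
by have [_ h] := gx 0%N; exact: h.
Qed.
End Baire.

(** * Deformation equations of the formal solution *)

Section DeformationEquation.
Variable R : realType.
Local Notation C := R[i].
Variable n : nat.
Local Notation T := 'rV[C]_n.
Local Notation M := 'M[C]_n.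
Implicit Types (k : 'I_n) (t : T).

(* [E_k, X] *)
Definition cmx k (X : M) : M :=
  diag_mx (delta_mx 0 k : T) *m X - X *m diag_mx (delta_mx 0 k : T).

Lemma cmxE k X i j : cmx k X i j = ((delta_mx 0 k : T) 0 i - (delta_mx 0 k : T) 0 j) * X i j.
Proof.
rewrite /cmx mxsubE mul_diag_mx mul_mx_diag.
have E (f : 'I_n -> 'I_n -> C) : (\matrix_(i, j) f i j) i j = f i j by rewrite mxE.
by rewrite !E; ring.
Qed.

Lemma rn_deltaB k i j : rn ((delta_mx 0 k : T) 0 i - (delta_mx 0 k : T) 0 j) <= 2.
Proof.
apply: le_trans (rnB_le _ _) _.
by have := rn_entry (delta_mx 0 k : T) 0 i; have := rn_entry (delta_mx 0 k : T) 0 j; have := rn_delta R k; lra.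
Qed.

Lemma rn_mulmx_entry (P Q : M) (p q : R) i j : (forall i j, rn (P i j) <= p) ->
  (forall i j, rn (Q i j) <= q) -> rn ((P *m Q) i j) <= n%:R * p * q.
Proof.
move=> hp hq; apply: entry_mulmx_le => //.
  by apply: le_trans (hp i j); exact: rn_ge0.
by apply: le_trans (hq i j); exact: rn_ge0.
Qed.

Section Core.
Variables (F : nat -> T -> M) (c0 : T) (dl m K BF : R) (N : nat).
Variables (Rx : C -> T -> M) (Ent : T -> T -> C -> M).
Hypothesis dl0 : 0 < dl.
Hypothesis m1 : 1 <= m.
Let ball t := rn (t - c0) < dl.
Hypothesis hF : forall j t a b, ball t -> hol (fun t => F j t a b) t.
Hypothesis bF : forall j t a b, (j <= N.+1)%N -> ball t -> rn (F j t a b) <= BF.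
Hypothesis F0 : forall t, ball t -> F 0%N t = 1%:M.
Hypothesis hR : forall x t i j, m <= rn x -> ball t -> hol (fun t => Rx x t i j) t.
Hypothesis aR : forall x t i j, m <= rn x -> ball t ->
  rn (Rx x t i j - \sum_(l < N.+2) x ^- l * F l t i j) <= K * rn x ^- N.+2.
Hypothesis hE : forall t t' x i j, ball t -> ball t' -> hol (fun x => Ent t t' x i j) x.
Hypothesis eE : forall t t' x, ball t -> ball t' -> m <= rn x ->
  Ent t t' x *m Rx x t = Rx x t' *m diag_mx (\row_a cexp (x * (t' 0 a - t 0 a))).

Hypothesis K0 : 0 <= K.
Hypothesis BF0 : 0 <= BF.
Variables (t : T) (k : 'I_n).
Hypothesis bt : rn (t - c0) < dl / 2.
Let e : T := delta_mx 0 k.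
Let W : M := cmx k (F 1%N t).
(** The defect [d_k R - x [E_k, R] + W R] of the deformation equation for the reduced solution [R];
    [Cf l] is the coefficient of [x^-l] in its formal expansion. The choice [W = [E_k, F_1]] is the
    one for which [Cf 0] vanishes. *)
Let Pe x i j : C := dd (fun t => Rx x t i j) t e - x * ((e 0 i - e 0 j) * Rx x t i j) + (W *m Rx x t) i j.
Let Cf l i j : C := dd (fun t => F l t i j) t e - cmx k (F l.+1 t) i j + (W *m F l t) i j.

Let near_ball y : rn (y - t) < dl / 2 -> ball y.
Proof. by move=> h; rewrite /ball; apply: le_lt_trans (rn_tri y t c0) _; rewrite [ltRHS]splitr ltrD. Qed.

Let ball_t : ball t.
Proof. by apply: near_ball; rewrite subrr rn0 divr_gt0. Qed.

Let pow_le (x : C) (p q : nat) : m <= rn x -> (p <= q)%N -> rn x ^- q <= rn x ^- p.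
Proof.
move=> mx pq; have x1 : 1 <= rn x by apply: le_trans mx.
have x0 : 0 < rn x by apply: lt_le_trans x1.
by rewrite lef_pV2 ?posrE ?exprn_gt0// ler_weXn2l.
Qed.

(** The factor [x] costs one order, so [R] is expanded to order [N + 2] to get order [N + 1] here;
    the derivative in [t] of the remainder is controlled by Cauchy's inequality. *)
Let Pe_expand : exists2 K1 : R, 0 <= K1 & forall x i j, m <= rn x ->
  rn (Pe x i j - \sum_(l < N.+1) x ^- l * Cf l i j) <= K1 * rn x ^- N.+1.
Proof.
pose Z : M := \matrix_(i, j) (dd (fun t => F N.+1 t i j) t e + (W *m F N.+1 t) i j).
exists (4 * K / (dl / 2) + 2 * K + n%:R * rn W * K + rn Z).
  by rewrite !addr_ge0 ?mulr_ge0 ?rn_ge0 ?invr_ge0 ?divr_ge0// ltW.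
move=> x i j mx; pose D i j t := Rx x t i j - \sum_(l < N.+2) x ^- l * F l t i j.
have x1 : 1 <= rn x by apply: le_trans mx.
have x0 : x != 0 by rewrite -rn_gt0; apply: lt_le_trans x1.
have hD y : rn (y - t) < dl / 2 -> hol (D i j) y.
  move=> /near_ball by_; apply: holB; first exact: hR.
  by apply: hol_sum => l; apply: holM; [exact: hol_const|exact: hF].
have aD a y : ball y -> rn (D a j y) <= K * rn x ^- N.+2 by move=> by_; exact: aR.
have ddD : dd (D i j) t e = dd (fun t => Rx x t i j) t e - \sum_(l < N.+2) x ^- l * dd (fun t => F l t i j) t e.
  rewrite (@ddE _ _ (D i j) t (fun h => dd (fun t => Rx x t i j) t h - \sum_(l < N.+2) x ^- l * dd (fun t => F l t i j) t h))//.
  apply: isdB; first by apply: ddP; exact: hR.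
  by apply: isd_sum => l; apply: isdZ; apply: ddP; exact: hF.
have S2 : x * \sum_(l < N.+2) x ^- l * F l t i j = x * F 0%N t i j + \sum_(l < N.+1) x ^- l * F l.+1 t i j.
  rewrite big_ord_recl mulrDr; congr (_ + _); first by rewrite /= expr0 invr1 mul1r.
  rewrite mulr_sumr; apply: eq_bigr => l _; rewrite /= /bump /= add1n exprS invfM !mulrA.
  by rewrite divff// mul1r.
have S0 : (e 0 i - e 0 j) * F 0%N t i j = 0.
  have -> : F 0%N t i j = (i == j)%:R by rewrite F0// mxE.
  case: (eqVneq i j) => [->|_]; first by rewrite subrr mul0r.
  by rewrite mulr0.
have S3 : (W *m Rx x t) i j = \sum_(l < N.+2) x ^- l * (W *m F l t) i j + \sum_c W i c * D c j t.
  have -> : (W *m Rx x t) i j = \sum_c W i c * Rx x t c j by rewrite mxE.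
  have -> : \sum_(l < N.+2) x ^- l * (W *m F l t) i j = \sum_c W i c * \sum_(l < N.+2) x ^- l * F l t c j.
    under [RHS]eq_bigr do rewrite mulr_sumr.
    rewrite exchange_big; apply: eq_bigr => l _; rewrite mxE mulr_sumr; apply: eq_bigr => c _.
    by rewrite mulrCA.
  by rewrite -big_split; apply: eq_bigr => c _; rewrite /D /=; ring.
have -> : Pe x i j - \sum_(l < N.+1) x ^- l * Cf l i j =
  dd (D i j) t e - x * ((e 0 i - e 0 j) * D i j t) + \sum_c W i c * D c j t + x ^- N.+1 * Z i j.
  have -> : Z i j = dd (fun t => F N.+1 t i j) t e + (W *m F N.+1 t) i j by rewrite mxE.
  have -> : \sum_(l < N.+1) x ^- l * Cf l i j = \sum_(l < N.+1) x ^- l * dd (fun t => F l t i j) t e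
     - (e 0 i - e 0 j) * \sum_(l < N.+1) x ^- l * F l.+1 t i j + \sum_(l < N.+1) x ^- l * (W *m F l t) i j.
    rewrite mulr_sumr -sumrB -big_split; apply: eq_bigr => l _.
    by rewrite /Cf cmxE -/e /=; ring.
  rewrite /Pe S3 ddD /D.
  have S2' : \sum_(l < N.+1) x ^- l * F l.+1 t i j = x * \sum_(l < N.+2) x ^- l * F l t i j - x * F 0%N t i j.
    by rewrite S2; ring.
  rewrite S2' [in RHS]big_ord_recr /= [X in _ + (X + _)]big_ord_recr /=.
  set TT := \sum_(l < N.+2) _.
  have H0 := congr1 (fun z => x * z) S0; rewrite /= mulr0 in H0.
  rewrite -[LHS]addr0 -H0; ring.
apply: le_trans (rnD _ _) _; rewrite [leRHS]mulrDl; apply: lerD; last first.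
  by rewrite rnM rnV rnX mulrC ler_wpM2r ?rn_entry// invr_ge0 exprn_ge0// rn_ge0.
apply: le_trans (rnD _ _) _; rewrite [leRHS]mulrDl; apply: lerD; last first.
  apply: le_trans (rn_sum _ _ _) _.
  apply: (@le_trans _ _ (\sum_(c < n) rn W * K * rn x ^- N.+1)); last first.
    by rewrite sumr_const card_ord -mulr_natl; lra.
  apply: ler_sum => c _; rewrite rnM -mulrA; apply: ler_pM; rewrite ?rn_ge0 ?rn_entry//.
  by apply: le_trans (aD c t ball_t) _; rewrite ler_wpM2l// pow_le.
apply: le_trans (rnB_le _ _) _; rewrite [leRHS]mulrDl; apply: lerD.
  apply: (@le_trans _ _ (4 * (K * rn x ^- N.+2) / (dl / 2) * rn e)).
    apply: cauchy_ineq; [by rewrite divr_gt0|exact: hD|].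
    by move=> y /near_ball by_; exact: aD.
  have -> : 4 * (K * rn x ^- N.+2) / (dl / 2) * rn e = 4 * K / (dl / 2) * (rn x ^- N.+2 * rn e) by ring.
  apply: ler_wpM2l; first by rewrite divr_ge0 ?mulr_ge0 ?divr_ge0// ltW.
  apply: (@le_trans _ _ (rn x ^- N.+2 * 1)).
    by rewrite ler_wpM2l ?rn_delta// invr_ge0 exprn_ge0// rn_ge0.
  by rewrite mulr1 pow_le.
rewrite !rnM.
apply: (@le_trans _ _ (rn x * (2 * (K * rn x ^- N.+2)))).
  rewrite ler_wpM2l ?rn_ge0//; apply: ler_pM; rewrite ?rn_ge0//; first exact: rn_deltaB.
  exact: aD.
rewrite [rn x ^+ N.+2]exprS invfM -subr_ge0 (_ : _ - _ = 0)//.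
have r0 : rn x != 0 by rewrite rn_eq0.
by field; rewrite ?expf_neq0 ?r0.
Qed.

Let Cf0 i j : Cf 0 i j = 0.
Proof.
have d0 : dd (fun t => F 0%N t i j) t e = 0.
  rewrite (@ddE _ _ (fun t => F 0%N t i j) t (fun=> 0))//.
  apply: (@isd_near _ _ (fun=> (1%:M : M) i j) _ _ _ (dl / 2)); first by rewrite divr_gt0.
    by move=> y /near_ball by_; rewrite F0.
  exact: isd_const.
by rewrite /Cf d0 F0// mulmx1 /W sub0r addNr.
Qed.

Let B' : R := K + N.+2%:R * BF.

Let B'0 : 0 <= B'.
Proof. by rewrite addr_ge0// mulr_ge0. Qed.

Let R_bound x y i j : m <= rn x -> ball y ->
  rn (Rx x y i j) <= B' /\ rn (Rx x y i j - (i == j)%:R) <= B' * (rn x)^-1.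
Proof.
move=> mx by_; have x1 : 1 <= rn x by apply: le_trans mx.
have x0 : 0 < rn x by apply: lt_le_trans x1.
have h := aR i j mx by_.
have px q : rn x ^- q.+1 <= (rn x)^-1 by have := @pow_le x 1 q.+1 mx isT; rewrite expr1.
have h1 : rn (Rx x y i j - (i == j)%:R) <= B' * (rn x)^-1.
  have -> : Rx x y i j - (i == j)%:R = (Rx x y i j - \sum_(l < N.+2) x ^- l * F l y i j) + \sum_(l < N.+1) x ^- l.+1 * F l.+1 y i j.
    have E : \sum_(l < N.+2) x ^- l * F l y i j = (i == j)%:R + \sum_(l < N.+1) x ^- l.+1 * F l.+1 y i j.
      by rewrite big_ord_recl /= expr0 invr1 mul1r F0//; congr (_ + _); rewrite mxE.
    by rewrite E; ring.
  apply: le_trans (rnD _ _) _; rewrite /B' mulrDl; apply: lerD.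
    by apply: le_trans h _; rewrite ler_wpM2l.
  apply: le_trans (rn_sum _ _ _) _.
  apply: (@le_trans _ _ (\sum_(l < N.+1) BF * (rn x)^-1)); last first.
    rewrite sumr_const card_ord -[leLHS]mulr_natl mulrA ler_wpM2r ?invr_ge0 ?rn_ge0// ler_wpM2r//.
    by rewrite ler_nat.
  apply: ler_sum => l _; rewrite rnM rnV rnX mulrC ler_pM ?rn_ge0 ?invr_ge0 ?exprn_ge0 ?rn_ge0//.
  by apply: bF => //; rewrite ltnS.
split=> //.
have -> : Rx x y i j = (Rx x y i j - \sum_(l < N.+2) x ^- l * F l y i j) + \sum_(l < N.+2) x ^- l * F l y i j by ring.
have p1 q : rn x ^- q <= 1 by have := @pow_le x 0 q mx (leq0n q); rewrite expr0 invr1.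
apply: le_trans (rnD _ _) _; rewrite /B'; apply: lerD.
  by apply: le_trans h _; rewrite ler_piMr.
apply: le_trans (rn_sum _ _ _) _.
apply: (@le_trans _ _ (\sum_(l < N.+2) BF)); last by rewrite sumr_const card_ord -[leLHS]mulr_natl.
apply: ler_sum => l _; rewrite rnM rnV rnX; apply: le_trans (ler_wpM2r (rn_ge0 _) (p1 l)) _.
by rewrite mul1r; apply: bF => //; rewrite -ltnS.
Qed.

(** [H] is recovered from [H R] by absorbing [H (R - 1)], since [R - 1] is of the order
    [B' / |x|]. *)
Let mulR_bound (H : M) x : m <= rn x -> 2 * (n%:R * B') <= rn x -> rn H <= 2 * rn (H *m Rx x t).
Proof.
move=> mx bx; have x1 : 1 <= rn x by apply: le_trans mx.
have x0 : 0 < rn x by apply: lt_le_trans x1.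
suff : rn H <= rn (H *m Rx x t) + rn H / 2 by lra.
apply: rn_mx_le => [|i j]; first by rewrite addr_ge0 ?divr_ge0 ?rn_ge0.
have -> : H i j = (H *m Rx x t) i j - (H *m (Rx x t - 1%:M)) i j.
  by rewrite mulmxBr mulmx1 mxsubE; ring.
apply: le_trans (rnB_le _ _) _; apply: lerD; first exact: rn_entry.
apply: le_trans (@rn_mulmx_entry _ _ (rn H) (B' * (rn x)^-1) i j _ _) _ => [a b|a b|].
- exact: rn_entry.
- rewrite mxsubE; have [_] := R_bound a b mx ball_t.
  by have -> : (1%:M : M) a b = (a == b)%:R by rewrite mxE.
- have -> : n%:R * rn H * (B' / rn x) = rn H * (n%:R * B' / rn x) by ring.
  by rewrite ler_wpM2l ?rn_ge0// ler_pdivrMr//; lra.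
Qed.

Let dR x i j := dd (fun t => Rx x t i j) t e.

(** [R] is expanded together with the exponential along the line [t + s e_k]. For [|x| <= L] the
    exponential is at most [exp(L dl)], so the constant depends on [L] but not on [s]. *)
Let taylor x (L : R) (s : C) i j : m <= rn x -> rn x <= L -> rn s <= dl / 2 / 4 ->
  rn (Rx x (t + s *: e) i j * cexp (x * (s * e 0 j)) - Rx x t i j
      - s * (dR x i j + Rx x t i j * (x * e 0 j))) <=
  128 * (B' * expR (L * dl)) / (dl / 2) ^+ 2 * rn s ^+ 2.
Proof.
move=> mx xL hs; pose g (s : C) := Rx x (t + s *: e) i j * cexp (x * (s * e 0 j)).
have be (s' : C) : rn (s' - 0) < dl / 2 -> rn (t + s' *: e - t) < dl / 2.
  rewrite subr0 addrAC subrr add0r rnZ; apply: le_lt_trans.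
  by rewrite ler_piMr ?rn_ge0 ?rn_delta.
have hexp z : isd (fun s : C => cexp (x * (s * e 0 j))) z (fun h : C => (x * (h * e 0 j)) * cexp (x * (z * e 0 j))).
  have h1 : isd (fun s : C => x * (s * e 0 j)) z (fun h : C => x * (h * e 0 j)).
    apply: isdZ; apply: isd_eqL (isd_ext _ (isdZ (e 0 j) (isd_id z))) => u; last by rewrite mulrC.
    by rewrite mulrC.
  exact: isd_chain h1 (isd_cexp _).
have hg0 z : rn (z - 0) < dl / 2 -> isd g z (fun h : C => Rx x (t + z *: e) i j * ((x * (h * e 0 j)) * cexp (x * (z * e 0 j)))
     + cexp (x * (z * e 0 j)) * (h * dd (fun t => Rx x t i j) (t + z *: e) e)).
  move=> /be/near_ball bz; apply: isdM; last exact: hexp.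
  by apply: (@isd_line _ _ t e (fun t => Rx x t i j)); apply: ddP; exact: hR.
have g0 : dd g 0 = fun h => h * (dR x i j + Rx x t i j * (x * e 0 j)).
  rewrite (ddE (hg0 0 _)) ?subrr ?rn0 ?divr_gt0//; apply/funext => h.
  by rewrite mul0r mulr0 cexp0 scale0r addr0 /dR; ring.
have := @second_order _ _ g 0 (dl / 2) (B' * expR (L * dl)) s.
have gz : g 0 = Rx x t i j by rewrite /g mul0r mulr0 cexp0 mulr1 scale0r addr0.
rewrite g0 gz add0r; apply => //.
- by rewrite divr_gt0.
- by move=> y hy; exists (fun h : C => Rx x (t + y *: e) i j * ((x * (h * e 0 j)) * cexp (x * (y * e 0 j)))
     + cexp (x * (y * e 0 j)) * (h * dd (fun t => Rx x t i j) (t + y *: e) e)); exact: hg0.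
move=> y hy; have by_ := near_ball (be _ hy); rewrite /g rnM.
have [h1 _] := R_bound i j mx by_.
rewrite subr0 in hy; apply: ler_pM; rewrite ?rn_ge0// rn_cexp ler_expR.
apply: le_trans (ler_norm _) _; apply: le_trans (Re_le_rn _) _; rewrite !rnM.
have e1 : rn (e 0 j) <= 1 by apply: le_trans (rn_entry _ _ _) (rn_delta _ _).
apply: ler_pM; rewrite ?mulr_ge0 ?rn_ge0//.
apply: (@le_trans _ _ (rn y)); first by rewrite ler_piMr ?rn_ge0.
by have := dl0; lra.
Qed.

(** Liouville's argument with a finite step. Let [H] be the entire function [Ent t (t + s e_k)]
    minus its first-order part [1 + s (x E_k - W)]; then [H R] is a Taylor remainder of order [s^2]
    plus [s Pe], where [Pe = O(1 / x)]. The maximum principle on a circle of size about [L] brings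
    the bound to [x0]; [L] is chosen according to [eps], and then [s] tends to 0. *)
Let Pe0 x0 i0 j0 : m <= rn x0 -> Pe x0 i0 j0 = 0.
Proof.
move=> mx0; apply: small_eq0 => eps eps0.
have [K1 K10 hP] := Pe_expand.
pose Z : M := \matrix_(i, j) (\sum_(l < N.+1) rn (Cf l i j))%:C.
pose K2 := K1 + rn Z; have K20 : 0 <= K2 by rewrite addr_ge0// rn_ge0.
have P1 x i j : m <= rn x -> rn (Pe x i j) <= K2 * (rn x)^-1.
  move=> mx; have x1 : 1 <= rn x by apply: le_trans mx.
  have px q : rn x ^- q.+1 <= (rn x)^-1 by have := @pow_le x 1 q.+1 mx isT; rewrite expr1.
  apply: le_trans (rn_sub _ (\sum_(l < N.+1) x ^- l * Cf l i j)) _.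
  rewrite addrC /K2 mulrDl; apply: lerD; first by apply: le_trans (hP x i j mx) _; rewrite ler_wpM2l.
  apply: le_trans (rn_sum _ _ _) _.
  apply: (@le_trans _ _ (\sum_(l < N.+1) rn (Cf l i j) * (rn x)^-1)).
    apply: ler_sum => -[[|l] lN] _ /=; first by rewrite Cf0 mulr0 rn0 mul0r.
    by rewrite rnM rnV rnX mulrC ler_wpM2l ?rn_ge0.
  rewrite -mulr_suml ler_wpM2r ?invr_ge0 ?rn_ge0//.
  apply: le_trans (rn_entry _ i j); rewrite [X in rn X]mxE rn_real ler_norm//.
pose B2 := 2 * n%:R * B'; have B20 : 0 <= B2 by rewrite !mulr_ge0.
(* The terms serve in turn the validity of the expansions, [mulR_bound], and the estimate
   [B2 K2 / L <= eps / 2]. *)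
pose L := m + 2 * (n%:R * B') + 2 * (B2 * K2) / eps + rn x0.
have q0 : 0 <= 2 * (B2 * K2) / eps by rewrite divr_ge0 ?mulr_ge0// ltW.
have nB : 0 <= n%:R * B' by rewrite mulr_ge0.
have [L0 Lm LB LQ] : [/\ 0 < L, m <= L, 2 * (n%:R * B') <= L & 2 * (B2 * K2) / eps <= L].
  have gen (a b q r : R) : 1 <= a -> 0 <= b -> 0 <= q -> 0 <= r ->
      [/\ 0 < a + 2 * b + q + r, a <= a + 2 * b + q + r, 2 * b <= a + 2 * b + q + r & q <= a + 2 * b + q + r].
    by move=> *; split; lra.
  by apply: gen => //; exact: rn_ge0.
(* The circle of radius [L + |x0|] around [x0] lies in the annulus [L <= |x| <= L2]. *)
pose L2 := L + 2 * rn x0.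
pose CL := 128 * (B' * expR (L2 * dl)) / (dl / 2) ^+ 2.
have CL0 : 0 <= CL by rewrite divr_ge0 ?exprn_ge0 ?divr_ge0 ?mulr_ge0 ?expR_ge0// ltW.
suff H : forall s : R, 0 < s <= dl / 2 / 4 -> rn (Pe x0 i0 j0) <= B2 * (CL * s + K2 / L) + CL * s.
  have BC0 : 0 <= B2 * CL + CL by rewrite addr_ge0// mulr_ge0.
  pose s := Num.min (dl / 2 / 4) (eps / 2 / (B2 * CL + CL + 1)).
  have s0 : 0 < s by rewrite lt_min !divr_gt0//; lra.
  apply: le_trans (H s _) _; first by rewrite s0 ge_min lexx.
  have h1 : (B2 * CL + CL) * s <= eps / 2.
    apply: (@le_trans _ _ ((B2 * CL + CL + 1) * s)); first by rewrite ler_wpM2r ?(ltW s0)//; lra.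
    rewrite mulrC -ler_pdivlMr; last lra.
    by rewrite ge_min lexx orbT.
  have h2 : B2 * (K2 / L) <= eps / 2.
    rewrite mulrA ler_pdivrMr//.
    by move: LQ; rewrite ler_pdivrMr//; lra.
  by lra.
move=> s /andP[s0 sd]; pose t' := t + s%:C *: e.
have rs : rn (s%:C : C) = s by rewrite rn_real ger0_norm// ltW.
have bt' : ball t'.
  apply: near_ball; rewrite /t' addrAC subrr add0r rnZ rs.
  by apply: le_lt_trans (_ : _ <= s * 1) _; [rewrite ler_wpM2l ?(ltW s0)// rn_delta|lra].
pose H x : M := Ent t t' x - 1%:M - s%:C *: (x *: diag_mx e - W).
have HR x i j : m <= rn x -> (H x *m Rx x t) i j =
   (Rx x t' i j * cexp (x * (s%:C * e 0 j)) - Rx x t i j - s%:C * (dR x i j + Rx x t i j * (x * e 0 j)))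
   + s%:C * Pe x i j.
  move=> mx; rewrite /H 2!mulmxBl mul1mx eE//= -scalemxAl mulmxBl -scalemxAl !mxsubE.
  have -> : (Rx x t' *m diag_mx (\row_a cexp (x * (t' 0 a - t 0 a)))) i j = Rx x t' i j * cexp (x * (s%:C * e 0 j)).
    rewrite mul_mx_diag.
    have E (f : 'I_n -> 'I_n -> C) : (\matrix_(i, j) f i j) i j = f i j by rewrite mxE.
    rewrite E [X in _ * X]mxE; congr (_ * cexp (x * _)).
    by rewrite /t' rowDE rowZE; ring.
  have -> : (s%:C *: (x *: (diag_mx e *m Rx x t) - W *m Rx x t)) i j = s%:C * (x * (e 0 i * Rx x t i j) - (W *m Rx x t) i j).
    rewrite mxE mxsubE mul_diag_mx; congr (_ * (_ - _)).
    by rewrite mxE [X in _ * X]mxE.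
  by rewrite /Pe -/(dR x i j); ring.
have circ x i j : m <= rn x -> L <= rn x -> rn x <= L2 -> rn (H x i j) <= 2 * (CL * s ^+ 2 + s * (K2 / L)).
  move=> mx Lx xL; apply: le_trans (rn_entry _ i j) _.
  apply: le_trans (mulR_bound (H x) mx _) _; first by apply: le_trans Lx.
  rewrite ler_wpM2l//; apply: rn_mx_le => [|a b].
    by apply: addr_ge0; apply: mulr_ge0 => //; rewrite ?exprn_ge0 ?divr_ge0// ltW.
  rewrite HR//; apply: le_trans (rnD _ _) _; apply: lerD.
    by have := @taylor x L2 s%:C a b mx xL; rewrite rs => /(_ sd).
  rewrite rnM rs ler_wpM2l ?(ltW s0)//; apply: le_trans (P1 x a b mx) _.
  by rewrite ler_wpM2l// lef_pV2 ?posrE//; apply: lt_le_trans Lx.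
have H0 i j : rn (H x0 i j) <= 2 * (CL * s ^+ 2 + s * (K2 / L)).
  apply: (@entire_max _ (fun x => H x i j) x0 (L + rn x0)); first by have := rn_ge0 x0; lra.
    move=> z; apply: (@hol_ext _ _ (fun x : C => Ent t t' x i j - (1%:M : M) i j - s%:C * (x * (diag_mx e : M) i j - W i j))).
      move=> y; rewrite /H (mxsubE (Ent t t' y - 1%:M)) (mxsubE (Ent t t' y)).
      have -> : (s%:C *: (y *: diag_mx e - W)) i j = s%:C * (y * (diag_mx e : M) i j - W i j).
        by rewrite mxE mxsubE; congr (_ * (_ - _)); rewrite mxE.
      by [].
    apply: holB; first by apply: holB; [exact: hE|exact: hol_const].
    apply: holM; first exact: hol_const.
    apply: holB; last exact: hol_const.
    by apply: holM; [exists id; exact: isd_id|exact: hol_const].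
  move=> z hz; have := rn_sub z x0; have := rnB_le z x0; rewrite hz => h1 h2.
  have Lz : L <= rn z by lra.
  by apply: circ => //; [exact: le_trans Lz|rewrite /L2; lra].
have xL2 : rn x0 <= L2 by rewrite /L2; have := rn_ge0 x0; lra.
have sP : s%:C * Pe x0 i0 j0 = (H x0 *m Rx x0 t) i0 j0 - (Rx x0 t' i0 j0 * cexp (x0 * (s%:C * e 0 j0))
   - Rx x0 t i0 j0 - s%:C * (dR x0 i0 j0 + Rx x0 t i0 j0 * (x0 * e 0 j0))).
  by rewrite HR//; ring.
have : rn (s%:C * Pe x0 i0 j0) <= n%:R * (2 * (CL * s ^+ 2 + s * (K2 / L))) * B' + CL * s ^+ 2.
  rewrite sP; apply: le_trans (rnB_le _ _) _; apply: lerD.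
    by apply: rn_mulmx_entry => // a b; have [] := R_bound a b mx0 ball_t.
  by have := @taylor x0 L2 s%:C i0 j0 mx0 xL2; rewrite rs => /(_ sd).
rewrite rnM rs => h; rewrite -(ler_pM2l s0); apply: le_trans h _.
rewrite le_eqVlt; apply/orP; left; apply/eqP; rewrite /B2; ring.
Qed.

(** [Pe] vanishes for all large [x], so by [poly_flat] the coefficients [Cf l] of its expansion
    vanish one by one. *)
Lemma deformation_coef j a b : (j <= N)%N ->
  dd (fun t => F j t a b) t (delta_mx 0 k) = cmx k (F j.+1 t) a b - (cmx k (F 1%N t) *m F j t) a b.
Proof.
move=> jN; have [K1 K10 hP] := Pe_expand.
have C0 : Cf j a b = 0.
  apply: (@poly_flat _ N.+1 (fun l => Cf l a b) K1 m) jN => x mx.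
  by have := hP x a b mx; rewrite Pe0// sub0r rnN.
by rewrite -/e -/W -[LHS]subr0 -C0 /Cf; ring.
Qed.

End Core.

End DeformationEquation.

(** * The deformation equations on a small ball of V *)

Section FormalFamily.
Variable R : realType.
Local Notation C := R[i].
Variable n : nat.
Local Notation T := 'rV[C]_n.
Local Notation M := 'M[C]_n.

Lemma hol_opn (U : normedModType C) (E : set U) (f g : U -> C) x : opn E ->
  (forall y, E y -> f y = g y) -> E x -> hol f x -> hol g x.
Proof. by move=> oE fg /oE[r r0 hr]; apply: (hol_near r0) => y /hr/fg. Qed.

Lemma clog_fun (tau : R) : exists lg : C -> C, forall x : C, x != 0 ->
  cexp (lg x) = x /\ tau - pi <= complex.Im (lg x) <= tau + pi.
Proof.
suff H : forall x : C, exists w : C, x != 0 -> cexp w = x /\ tau - pi <= complex.Im w <= tau + pi.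
  by have [lg hlg] := choice H; exists lg.
move=> x.
case: (eqVneq x 0) => [_|x0]; first by exists 0.
by have [w hw] := clog tau x0; exists w.
Qed.

Lemma formal_solutionP (L : T) (A : M) (F : nat -> M) : is_formal_solution L A F <->
  F 0%N = 1%:M /\ forall k a b,
    (L 0 a - L 0 b) * F k.+1 a b = F k a b * (A b b - k%:R) - (A *m F k) a b.
Proof.
have E (f : 'I_n -> 'I_n -> C) i j : (\matrix_(i, j) f i j) i j = f i j by rewrite mxE.
have H k a b : (F k *m diag_part A - k%:R *: F k + F k.+1 *m diag_mx L) a b = F k a b * A b b - k%:R * F k a b + F k.+1 a b * L 0 b.
  rewrite [LHS]mxE mxsubE /diag_part !mul_mx_diag !E; congr (_ * _ - _ + _); first by rewrite mxE.
  by rewrite mxE.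
have H' k a b : (diag_mx L *m F k.+1 + A *m F k) a b = L 0 a * F k.+1 a b + (A *m F k) a b.
  by rewrite [LHS]mxE mul_diag_mx E.
split=> -[F0 h]; split=> // k.
  move=> a b; have := congr1 (fun X : M => X a b) (h k); rewrite /= H H' => h1.
  apply/eqP; rewrite -subr_eq0; move/eqP: h1; rewrite -subr_eq0 => /eqP h1.
  by apply/eqP; rewrite -oppr0 -h1; ring.
apply/matrixP => a b; rewrite H H'; have h1 := h k a b.
by apply/eqP; rewrite -subr_eq0 -[X in X == _]addr0 -(subrr ((L 0 a - L 0 b) * F k.+1 a b)) {2}h1; apply/eqP; ring.
Qed.

(** This is the diagonal of the recursion one order higher, where the commutator with [diag(L)] is 0
    and the terms in [A b b] cancel. *)
Lemma formal_diag (L : T) (A : M) (F : nat -> M) k b : is_formal_solution L A F ->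
  k.+1%:R * F k.+1 b b = - \sum_(c | c != b) A b c * F k.+1 c b.
Proof.
move=> /formal_solutionP[_ /(_ k.+1 b b)]; rewrite subrr mul0r [X in _ - X]mxE (bigD1 b) //= => h.
by apply/eqP; rewrite -subr_eq0 opprK; apply/eqP; rewrite -[LHS]addr0 {2}h; ring.
Qed.

Lemma formal_unique (L : T) (A : M) (F F' : nat -> M) k : (forall a b, a != b -> L 0 a != L 0 b) ->
  is_formal_solution L A F -> is_formal_solution L A F' -> F k = F' k.
Proof.
move=> du fF fF'; have [F0 hF] := (formal_solutionP _ _ _).1 fF; have [F0' hF'] := (formal_solutionP _ _ _).1 fF'.
elim: k => [|k IH]; first by rewrite F0 F0'.
have off a b : a != b -> F k.+1 a b = F' k.+1 a b.
  move=> ab; apply: (@mulfI _ (L 0 a - L 0 b)); first by rewrite subr_eq0 du.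
  by rewrite hF hF' IH.
apply/matrixP => a b; case: (eqVneq a b) => [<-|/off //].
apply: (@mulfI _ k.+1%:R); first by rewrite pnatr_eq0.
by rewrite (formal_diag _ _ fF) (formal_diag _ _ fF'); congr (- _); apply: eq_bigr => c ca; rewrite off.
Qed.

Lemma formal_hol (V : set T) (L : T -> T) (A : T -> M) (F : nat -> T -> M) : opn V ->
  (forall t a, V t -> hol (fun t => L t 0 a) t) -> (forall t i j, V t -> hol (fun t => A t i j) t) ->
  (forall t a b, V t -> a != b -> L t 0 a != L t 0 b) ->
  (forall t, V t -> is_formal_solution (L t) (A t) (F^~ t)) ->
  forall k t i j, V t -> hol (fun t => F k t i j) t.
Proof.
move=> oV hL hA du fF; elim=> [|k IH] t i j Vt.
  apply: (hol_opn oV _ Vt (hol_const ((1%:M : M) i j) t)) => y /fF[-> _] //.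
have off a b : a != b -> forall t, V t -> hol (fun t => F k.+1 t a b) t.
  move=> ab s Vs; pose f s := (L s 0 a - L s 0 b)^-1 * (F k s a b * (A s b b - k%:R) - \sum_c A s a c * F k s c b).
  apply: (@hol_opn _ _ f _ _ oV _ Vs) => [y Vy|].
    have [_ h] := (formal_solutionP _ _ _).1 (fF y Vy); rewrite /f.
    have -> : \sum_c A y a c * F k y c b = (A y *m F k y) a b by rewrite mxE.
    by rewrite -h mulKf// subr_eq0 du.
  have dus : L s 0 a - L s 0 b != 0 by rewrite subr_eq0; exact: du Vs ab.
  apply: holM; first by apply: (@holV _ _ (fun s : T => L s 0 a - L s 0 b) s dus); apply: holB; exact: hL.
  apply: holB; first by apply: holM; [exact: IH|apply: holB; [exact: hA|exact: hol_const]].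
  by apply: hol_sum => c; apply: holM; [exact: hA|exact: IH].
case: (eqVneq i j) => [<-|ij]; last exact: off.
apply: (@hol_opn _ _ (fun s => k.+1%:R^-1 * - \sum_c (if c != i then A s i c * F k.+1 s c i else 0)) _ _ oV _ Vt).
  by move=> y Vy; rewrite -big_mkcond -(formal_diag k i (fF y Vy)) mulKf// pnatr_eq0.
apply: holM; first exact: hol_const.
apply: holN; apply: hol_sum => c.
case: (eqVneq c i) => [_|ci] /=; first exact: hol_const.
by apply: holM; [exact: hA|exact: off].
Qed.

(** By uniqueness of limits the sum of the series depends on [w] only through [exp w], so it
    descends to a function of [x = exp w]; as the series converges for all [x], this function is
    entire, with value [G] at 0. *)
Lemma levelt_entire (A J : M) d (S Q : M) (Y0 : ucov R -> M) : levelt_form A J d S Q Y0 ->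
  exists (G : M) (Psi : nat -> M) (q : C -> M),
  [/\ G \in unitmx, invmx G *m A *m G = J, Psi 0%N = 1%:M /\ q 0 = G,
    forall x i j, clim (fun m => \sum_(l < m) x ^+ l * (G *m Psi l) i j) (q x i j) /\ hol (fun x => q x i j) x
  & forall w : C, Y0 w = q (cexp w) *m zpow (int_diag R d) w *m zpow (S + Q) w].
Proof.
move=> [G [Psi [uG GJ Psi0 hP]]].
have [P {}hP] : exists P : C -> M, forall z : C, (forall i j, clim (fun m => \sum_(l < m) cexp z ^+ l * Psi l i j) (P z i j)) /\
    Y0 z = G *m P z *m zpow (int_diag R d) z *m zpow (S + Q) z.
  suff H : forall z : C, exists P : M, (forall i j, clim (fun m => \sum_(l < m) cexp z ^+ l * Psi l i j) (P i j)) /\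
     Y0 z = G *m P *m zpow (int_diag R d) z *m zpow (S + Q) z.
    by have [P HP] := choice H; exists P.
  by move=> z; have [P [/mx_series_clim h1 h2]] := hP z; exists P.
have [lg hlg'] := clog_fun (0 : R); have hlg x : x != 0 -> cexp (lg x) = x by move=> /hlg'[].
pose q (x : C) : M := if x == 0 then G else G *m P (lg x).
have q0 : q 0 = G by rewrite /q eqxx.
have cq x i j : x != 0 -> clim (fun m => \sum_(l < m) x ^+ l * (G *m Psi l) i j) (q x i j).
  move=> x0; rewrite /q (negPf x0) mxE.
  apply: (@clim_ext _ _ (fun m => \sum_k G i k * \sum_(l < m) x ^+ l * Psi l k j)).
    move=> m; under eq_bigr do rewrite mulr_sumr.
    rewrite exchange_big; apply: eq_bigr => l _; rewrite mxE mulr_sumr.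
    by apply: eq_bigr => k _; rewrite mulrCA.
  by apply: clim_sum => k; apply: climM; have [h _] := hP (lg x); have := h k j; rewrite hlg.
have c0 i j : q 0 i j = (G *m Psi 0%N) i j by rewrite q0 Psi0 mulmx1.
exists G, Psi, q; split=> // [x i j|w].
  split; last first.
    by apply: (@pseries_entire _ (fun l => (G *m Psi l) i j) (fun x => q x i j)) => // y y0; exact: cq.
  case: (eqVneq x 0) => [-> e e0|]; last exact: cq.
  exists 1%N => -[//|k] _; rewrite big_ord_recl /= expr0 mul1r big1 ?addr0 ?c0 ?subrr ?rn0 ?ltW// => l _.
  by rewrite exprS !mul0r.
have [h1 Yw] := hP w; have PE : P w = P (lg (cexp w)).
  apply/matrixP => i j; apply: clim_unique (h1 i j) _.
  by have [h2 _] := hP (lg (cexp w)); have := h2 i j; rewrite hlg// cexp_neq0.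
by rewrite Yw PE /q (negPf (cexp_neq0 w)).
Qed.

Lemma levelt_unit (q : C -> M) d (S Q : M) (Y0 : C -> M) (w : C) :
  Y0 w = q (cexp w) *m zpow (int_diag R d) w *m zpow (S + Q) w -> Y0 w \in unitmx ->
  q (cexp w) \in unitmx.
Proof. by move=> ->; rewrite !unitmx_mul => /andP[/andP[]]. Qed.

(** The powers of [z] and the connection matrices of the solutions at [t] and [t'] are the same, so
    [Y(t') Y(t)^-1 = q(t') q(t)^-1] is entire in [x = exp w] and is one function for both sectors.
    The sectors of [Y true] and [Y false] make up a full turn, so the expansions control it in all
    directions. *)
Lemma formal_pde (V : set T) (u0 : T) (A : T -> M) (F : nat -> T -> M) (Y : bool -> T -> C -> M)
   (Y0 : T -> C -> M) (b : T) (C0 S1 J : M) d (S Q : M) (tau : R) (c : T) :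
  opn V -> V c -> (forall t i j, V t -> hol (fun t => A t i j) t) ->
  (forall t a b, V t -> a != b -> (u0 + t) 0 a != (u0 + t) 0 b) ->
  (forall t, V t -> is_formal_solution (u0 + t) (A t) (F^~ t)) ->
  (forall r t z i j, V t -> hol (fun t => Y r t z i j) t) ->
  (forall r t, V t -> asymp (if r then tau - pi else tau) (if r then tau else tau + pi) (u0 + t) b (F^~ t) (Y r t)) ->
  (forall t, V t -> levelt_form (A t) J d S Q (Y0 t)) ->
  (forall t z, V t -> Y0 t z \in unitmx) ->
  (forall t z, V t -> Y true t z = Y0 t z *m C0) ->
  (forall t z, V t -> Y false t z = Y true t z *m S1) ->
  forall N : nat, exists c' dl, [/\ 0 < dl, forall t, rn (t - c') < dl -> V t &
    forall t k j a b, rn (t - c') < dl -> (j <= N)%N ->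
    dd (fun t => F j t a b) t (delta_mx 0 k) = cmx k (F j.+1 t) a b - (cmx k (F 1%N t) *m F j t) a b].
Proof.
move=> oV Vc hA du fF hY asY lev uY0 conn1 conn2 N.
have hu t a : V t -> hol (fun t => (u0 + t) 0 a) t.
  move=> _; apply: (@hol_ext _ _ (fun t : T => u0 0 a + t 0 a)) => [y|]; first by rewrite rowDE.
  by apply: holD; [exact: hol_const|exists (fun h : T => h 0 a); exact: hol_coord].
have hF := formal_hol oV hu hA du fF.
have [r1 [BF0 [r10 hB]]] : exists e M : R, 0 < e /\ forall x : 'I_N.+2 * ('I_n * 'I_n), x \in enum {: 'I_N.+2 * ('I_n * 'I_n)} ->
    forall y, rn (y - c) < e -> V y /\ rn (F x.1 y x.2.1 x.2.2) <= M.
  apply: fin_bounds.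
    move=> x e e' m m' /andP[_ ee] mm h y hy; have [h1 h2] := h y (lt_le_trans hy ee).
    by split=> //; exact: le_trans mm.
  move=> x _; have [r [m [r0 h]]] := opn_hol oV (fun y Vy => hF x.1 y x.2.1 x.2.2 Vy) Vc.
  have [r' r'0 h'] := oV c Vc; exists (Num.min r r'), m; split=> [|y]; first by rewrite lt_min r0.
  by rewrite lt_min => /andP[/h[_ ?] /h'].
pose idx (l : nat) (i j : 'I_n) (H : (l < N.+2)%N) : 'I_N.+2 * ('I_n * 'I_n) := (Ordinal H, (i, j)).
pose BF := `|BF0|.
have VB y : rn (y - c) < r1 -> forall l i j, (l <= N.+1)%N -> rn (F l y i j) <= BF.
  move=> hy l i j lN.
  have [|_ h] := hB (idx l i j lN) _ y hy; first by rewrite mem_enum.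
  by apply: le_trans h (ler_norm _).
have [r2 r20 hr2] := oV c Vc.
pose r0 := Num.min r1 r2; have r00 : 0 < r0 by rewrite lt_min r10.
have V1 y : rn (y - c) < r0 -> V y by rewrite lt_min => /andP[_ /hr2].
pose p r := if r then tau - pi else tau; pose p' r := if r then tau else tau + pi.
(* [m + 1] is used both as the constant and as the radius from which the bound holds. These
   conditions are closed in [t] and every [t] of [V] satisfies one of them, as [baire] demands. *)
pose Em (m : nat) (t : T) := forall r (z : C) i j, p r <= complex.Im z <= p' r -> m.+1%:R <= expR (complex.Re z) ->
  rn (reduced (u0 + t) b (Y r t) z i j - \sum_(l < N.+2) cexp z ^- l * F l t i j) <= m.+1%:R * expR (complex.Re z) ^- N.+2.
have hred r (z : C) i j t : V t -> hol (fun t => reduced (u0 + t) b (Y r t) z i j) t.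
  move=> Vt; apply: (@hol_ext _ _ (fun t => Y r t z i j * cexp (- (cexp z * (u0 + t) 0 j)) * cexp (- (z * b 0 j)))).
    by move=> y; rewrite [RHS]mxE.
  apply: holM; last exact: hol_const.
  apply: holM; first exact: hY.
  by apply: hol_cexp; apply: holN; apply: holM; [exact: hol_const|exact: hu].
have [m [t1 [dl [dl0 hball]]]] : exists m t d, [/\ 0 < d & forall y, rn (y - t) < d -> rn (y - c) < r0 /\ Em m y].
  apply: baire => // [m t tr nE|t tr].
    have Vt := V1 t tr.
    have [r [z [i [j [h1 h2 h3]]]]] : exists r (z : C) i j, [/\ p r <= complex.Im z <= p' r, m.+1%:R <= expR (complex.Re z) &
       m.+1%:R * expR (complex.Re z) ^- N.+2 < rn (reduced (u0 + t) b (Y r t) z i j - \sum_(l < N.+2) cexp z ^- l * F l t i j)].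
      apply: contrapT => no; apply: nE => r z i j h1 h2; rewrite leNgt; apply/negP => h3.
      by apply: no; exists r, z, i, j.
    pose g t := reduced (u0 + t) b (Y r t) z i j - \sum_(l < N.+2) cexp z ^- l * F l t i j.
    have hg : hol g t.
      by apply: holB; [exact: hred|apply: hol_sum => l; apply: holM; [exact: hol_const|exact: hF]].
    have h3' : 0 < rn (g t) - m.+1%:R * expR (complex.Re z) ^- N.+2 by rewrite subr_gt0.
    have [d' d0 hd] := hol_cont hg (divr_gt0 h3' (ltr0n _ 2)).
    exists d' => // y /hd hy hE; have := hE r z i j h1 h2; rewrite -/(g y).
    by have := rn_sub (g t) (g y); rewrite [rn (g t - g y)]rnB; lra.
  have Vt := V1 t tr.
  have [K1 [rho1 h1]] := asY true t Vt N.+2; have [K2 [rho2 h2]] := asY false t Vt N.+2.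
  have [m hm] := nat_above (`|K1| + `|rho1| + `|K2| + `|rho2|).
  exists m => r z i j hz mz; have m1 : m%:R <= m.+1%:R :> R by rewrite ler_nat.
  have e0 : 0 <= expR (complex.Re z) ^- N.+2 by rewrite invr_ge0 exprn_ge0// expR_ge0.
  have [n1 n2 n3 n4] : [/\ K1 <= m.+1%:R, rho1 <= expR (complex.Re z), K2 <= m.+1%:R & rho2 <= expR (complex.Re z)].
    have := (ler_norm K1, ler_norm rho1, ler_norm K2, ler_norm rho2).
    have := (normr_ge0 K1, normr_ge0 rho1, normr_ge0 K2, normr_ge0 rho2).
    by move=> [[[a1 a2] a3] a4] [[[b1 b2] b3] b4]; split; lra.
  case: r hz => hz.
    by apply: le_trans (h1 z hz n2 i j) _; rewrite ler_wpM2r.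
  by apply: le_trans (h2 z hz n4 i j) _; rewrite ler_wpM2r.
have Vb y : rn (y - t1) < dl -> V y by move=> /hball[/V1].
have [lg hlg] := clog_fun tau.
(* The logarithm has its argument in [[tau - pi, tau + pi]], and the solution used at [x] is the one
   whose sector contains it. [Rx] may jump with [x]; [Ent] does not. *)
pose rr x := complex.Im (lg x) <= tau.
pose Rx x t := reduced (u0 + t) b (Y (rr x) t) (lg x).
have [q hq] : exists q : T -> C -> M, forall t, V t ->
  [/\ forall x i j, hol (fun x => q t x i j) x, forall x, q t x \in unitmx &
      forall w : C, Y0 t w = q t (cexp w) *m (zpow (int_diag R d) w *m zpow (S + Q) w)].
  suff H : forall t, exists q : C -> M, V t -> [/\ forall x i j, hol (fun x => q x i j) x, forall x, q x \in unitmx &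
      forall w : C, Y0 t w = q (cexp w) *m (zpow (int_diag R d) w *m zpow (S + Q) w)].
    by have [q hq] := choice H; exists q.
  move=> t.
  case: (pselect (V t)) => Vt; last by exists (fun=> 0).
  have [G [Psi [q [uG _ [_ q0] hq Yq]]]] := levelt_entire (lev t Vt).
  exists q => _; split=> [x i j|x|w]; last by rewrite mulmxA.
    by have [] := hq x i j.
  case: (eqVneq x 0) => [->|x0]; first by rewrite q0.
  have [<- _] := hlg x x0; exact: levelt_unit (Yq _) (uY0 _ _ Vt).
pose Ent t t' x := q t' x *m invmx (q t x).
have EY r t t' (w : C) : V t -> V t' -> Ent t t' (cexp w) *m Y r t w = Y r t' w.
  move=> Vt Vt'; have [_ uq Yq] := hq t Vt; have [_ _ Yq'] := hq t' Vt'.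
  have H : Ent t t' (cexp w) *m Y0 t w = Y0 t' w.
    by rewrite Yq Yq' /Ent -mulmxA mulKmx.
  by case: r; rewrite ?conn2// !conn1// !mulmxA H.
have m10 : 1 <= m.+1%:R :> R by rewrite ler1n.
have x_neq0 (x : C) : m.+1%:R <= rn x -> x != 0 by move=> mx; rewrite -rn_gt0; apply: lt_le_trans mx.
have rnlg x : m.+1%:R <= rn x -> expR (complex.Re (lg x)) = rn x.
  by move=> /x_neq0/hlg[h _]; rewrite -rn_cexp h.
(* [deformation_coef] takes [t] within [dl / 2] of the centre, so that a ball of radius [dl / 2]
   around [t] still has the uniform bounds. *)
exists t1, (dl / 2); split; first by rewrite divr_gt0.
  by move=> y hy; apply: Vb; lra.
move=> t k j a b' ht jN; pose K : R := m.+1%:R.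
apply: (@deformation_coef R n F t1 dl K K BF N Rx Ent) => //.
- by move=> l t' i j' /Vb; exact: hF.
- by move=> l t' i j' lN /hball[]; rewrite lt_min => /andP[/VB h _] _; exact: h.
- by move=> t' /Vb/fF[-> _].
- by move=> x t' i j' mx /Vb; exact: hred.
- move=> x t' i j' mx /hball[_ hE]; have [xl xi] := hlg x (x_neq0 x mx).
  have := hE (rr x) (lg x) i j'; rewrite xl rnlg//; apply => //.
  rewrite /p /p' /rr; case: ifP => h; first by rewrite h andbT; case/andP: xi.
  by case/andP: xi => _ ->; rewrite andbT; move/negbT: h; rewrite -ltNge => /ltW.
- move=> t' t2 x i j' /Vb V' /Vb V2; have [h1 h2 _] := hq t' V'; have [h3 _ _] := hq t2 V2.
  apply: hol_mulmx => // a' b2; apply: (@hol_invmx _ _ _ _ _ 1) => //.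
- move=> t' t2 x /Vb V' /Vb V2 mx; have [xl xi] := hlg x (x_neq0 x mx).
  apply/matrixP => i j'; rewrite mul_mx_diag [RHS]mxE [LHS]mxE [X in _ * X]mxE.
  have -> : Rx x t2 i j' = Y (rr x) t2 (lg x) i j' * cexp (- (x * (u0 + t2) 0 j')) * cexp (- (lg x * b 0 j')).
    by rewrite [LHS]mxE xl.
  rewrite -(EY (rr x) t' t2 (lg x))// xl [X in _ = X * _ * _ * _]mxE 3!mulr_suml; apply: eq_bigr => l _.
  have -> : Rx x t' l j' = Y (rr x) t' (lg x) l j' * cexp (- (x * (u0 + t') 0 j')) * cexp (- (lg x * b 0 j')).
    by rewrite [LHS]mxE xl.
  have -> : - (x * (u0 + t') 0 j') = - (x * (u0 + t2) 0 j') + x * (t2 0 j' - t' 0 j') by rewrite !rowDE; ring.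
  rewrite cexpD; ring.
- exact: normr_ge0.
Qed.
End FormalFamily.

(** * Extension of the coefficients across the coalescence locus *)

Section FormalExtension.
Variable R : realType.
Local Notation C := R[i].
Variable n : nat.
Local Notation T := 'rV[C]_n.
Local Notation M := 'M[C]_n.

(* The off-diagonal entries of F_(m+1) are given by the deformation equations
   d_a F_m = [E_a, F_(m+1)] + [N1, E_a] F_m, where the differences u_a - u_b do
   not occur; the diagonal entries by the diagonal part of the recursion. *)
Fixpoint extF (A N1 : T -> M) (m : nat) (t : T) : M :=
  if m is m'.+1 then
    let off a b := dd (fun t => extF A N1 m' t a b) t (delta_mx 0 a) + (cmx a (N1 t) *m extF A N1 m' t) a b in
    \matrix_(a, b) (if a == b then - (m%:R^-1 * \sum_(c | c != b) A t b c * off c b) else off a b)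
  else 1%:M.

Variables (u0 : T) (A N1 : T -> M) (r1 : R).
Hypothesis hA : forall t i j, rn t < r1 -> hol (fun t => A t i j) t.
Hypothesis hN : forall t i j, rn t < r1 -> hol (fun t => N1 t i j) t.
Local Notation Fe := (extF A N1).

Let off m t a b := dd (fun t => Fe m t a b) t (delta_mx 0 a) + (cmx a (N1 t) *m Fe m t) a b.

Lemma extF_off m t a b : a != b -> Fe m.+1 t a b = off m t a b.
Proof. by move=> ab; rewrite [LHS]mxE (negPf ab). Qed.

Lemma extF_diag m t b : m.+1%:R * Fe m.+1 t b b = - \sum_(c | c != b) A t b c * Fe m.+1 t c b.
Proof.
have -> : Fe m.+1 t b b = - (m.+1%:R^-1 * \sum_(c | c != b) A t b c * off m t c b) by rewrite [LHS]mxE eqxx.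
rewrite mulrN mulrA divff ?pnatr_eq0// mul1r; congr (- _).
by apply: eq_bigr => c cb; rewrite extF_off.
Qed.

Lemma hol_cmx k t i j : rn t < r1 -> hol (fun t => cmx k (N1 t) i j) t.
Proof.
move=> tr; apply: (@hol_ext _ _ (fun t => ((delta_mx 0 k : T) 0 i - (delta_mx 0 k : T) 0 j) * N1 t i j)).
  by move=> y; rewrite cmxE.
by apply: holM; [exact: hol_const|exact: hN].
Qed.

Lemma hol_dd_ball (f : T -> C) h t : (forall t, rn t < r1 -> hol f t) -> rn t < r1 -> hol (fun t => dd f t h) t.
Proof.
move=> hf tr; apply: (@hol_dd _ _ _ _ (r1 - rn t)); first by rewrite subr_gt0.
by move=> y; rewrite ltrBrDl => hy; apply: hf; apply: le_lt_trans (rn_sub y t) _.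
Qed.

Lemma extF_hol m t i j : rn t < r1 -> hol (fun t => Fe m t i j) t.
Proof.
elim: m t i j => [|m IH] t i j tr; first exact: hol_const.
have ho a b : hol (fun t => off m t a b) t.
  apply: holD; first by apply: hol_dd_ball => // s sr; exact: IH.
  by apply: hol_mulmx => a' b'; [exact: hol_cmx|exact: IH].
case: (eqVneq i j) => [<-|ij]; last first.
  by apply: (@hol_ext _ _ (fun t => off m t i j)) => [y|//]; rewrite extF_off.
apply: (@hol_ext _ _ (fun t => m.+1%:R^-1 * - \sum_c (if c != i then A t i c * off m t c i else 0))).
  move=> y; rewrite -big_mkcond; have -> : \sum_(c | c != i) A y i c * off m y c i = \sum_(c | c != i) A y i c * Fe m.+1 y c i.
    by apply: eq_bigr => c ci; rewrite extF_off.
  by rewrite -extF_diag mulKf// pnatr_eq0.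
apply: holM; first exact: hol_const.
apply: holN; apply: hol_sum => c; case: (eqVneq c i) => [_|ci] /=; first exact: hol_const.
by apply: holM; [exact: hA|exact: ho].
Qed.

Section OnSubdomain.
Variables (V : set T) (F : nat -> T -> M).
Hypothesis Vr : forall t, V t -> rn t < r1.
Hypothesis du : forall t a b, V t -> a != b -> (u0 + t) 0 a != (u0 + t) 0 b.
Hypothesis N1_diag : forall t a, N1 t a a = 0.
Hypothesis N1_off : forall t a b, rn t < r1 -> a != b -> N1 t a b * ((u0 + t) 0 a - (u0 + t) 0 b) = - A t a b.
Hypothesis fF : forall t, V t -> is_formal_solution (u0 + t) (A t) (F^~ t).
Hypothesis pdeF : forall N : nat, exists c' dl, [/\ 0 < dl, forall t, rn (t - c') < dl -> V t &
  forall t k j a b, rn (t - c') < dl -> (j <= N)%N ->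
  dd (fun t => F j t a b) t (delta_mx 0 k) = cmx k (F j.+1 t) a b - (cmx k (F 1%N t) *m F j t) a b].

(** Off the diagonal the recursion of order 0 gives [F_1 = N1], and a commutator with a diagonal
    matrix does not see the diagonal. *)
Lemma cmx_F1 t k : V t -> cmx k (F 1%N t) = cmx k (N1 t).
Proof.
move=> Vt; apply/matrixP => i j; rewrite !cmxE; case: (eqVneq i j) => [->|ij]; first by rewrite subrr !mul0r.
congr (_ * _); have := N1_off (Vr Vt) ij; have [F0 h] := (formal_solutionP _ _ _).1 (fF Vt).
have := h 0%N i j; rewrite F0 mulmx1.
have -> : (1%:M : M) i j = 0 by rewrite mxE (negPf ij).
rewrite mul0r sub0r => <-; rewrite mulrC => /(mulfI _) -> //.
by rewrite subr_eq0; exact: du.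
Qed.

(** The ball depends on [N], because Baire's theorem is applied order by order. In it the
    deformation equations give the off-diagonal entries of [F] by the formula that defines [extF],
    and [formal_diag] gives the diagonal ones. *)
Lemma extF_eq_ball N : exists c' dl, [/\ 0 < dl, forall t, rn (t - c') < dl -> V t,
  forall j t, rn (t - c') < dl -> (j <= N.+1)%N -> Fe j t = F j t &
  forall t k j a b, rn (t - c') < dl -> (j <= N)%N ->
  dd (fun t => F j t a b) t (delta_mx 0 k) = cmx k (F j.+1 t) a b - (cmx k (N1 t) *m F j t) a b].
Proof.
have [c' [dl [dl0 hV pde]]] := pdeF N; exists c', dl; split=> //; last first.
  by move=> t k j a b tr jN; rewrite -(cmx_F1 k (hV t tr)); exact: pde.
elim=> [|j IH] t tr jN; first by have [-> _] := fF (hV t tr).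
have jN' : (j <= N.+1)%N by apply: leq_trans jN; exact: leqnSn.
have offE a b : a != b -> Fe j.+1 t a b = F j.+1 t a b.
  move=> ab; rewrite extF_off// /off IH//.
  have -> : dd (fun t => Fe j t a b) t = dd (fun t => F j t a b) t.
    have d0 : 0 < dl - rn (t - c') by rewrite subr_gt0.
    apply/ddE/(isd_near d0 (f := fun t => F j t a b)).
      move=> y hy; rewrite IH//.
      by have := rn_tri y t c'; lra.
    apply: ddP; apply: (hol_near d0 (f := fun t => Fe j t a b)).
      by move=> y hy; rewrite IH//; have := rn_tri y t c'; lra.
    by apply: extF_hol; apply: Vr; exact: hV.
  rewrite pde// cmx_F1; last exact: hV.
  by rewrite subrK cmxE !mxE !eqxx /= [b == a]eq_sym (negPf ab) subr0 mul1r.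
apply/matrixP => a b; case: (eqVneq a b) => [<-|/offE //].
apply: (@mulfI _ j.+1%:R); first by rewrite pnatr_eq0.
rewrite extF_diag (formal_diag j a (fF (hV t tr))); congr (- _).
by apply: eq_bigr => c ca; rewrite offE.
Qed.

(** Both sides of each equation are holomorphic for [|t| < r1], and on the small ball of
    [extF_eq_ball] the equation is the one for [F]. *)
Lemma extF_formal t : rn t < r1 -> is_formal_solution (u0 + t) (A t) (Fe^~ t).
Proof.
move=> tr; apply/formal_solutionP; split=> // k a b.
have [c' [dl [dl0 hV eF _]]] := extF_eq_ball k.
have Vc : V c' by apply: hV; rewrite subrr rn0.
apply: (@identity_convex_ball _ _ (fun t => ((u0 + t) 0 a - (u0 + t) 0 b) * Fe k.+1 t a b)
   (fun t => Fe k t a b * (A t b b - k%:R) - (A t *m Fe k t) a b) c' t r1 dl) => //.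
- move=> s sr; apply: holM; last exact: extF_hol.
  apply: (@hol_ext _ _ (fun t : T => (u0 0 a + t 0 a) - (u0 0 b + t 0 b))) => [y|]; first by rewrite !rowDE.
  have hc (c : 'I_n) : hol (fun t : T => u0 0 c + t 0 c) s.
    by apply: holD; [exact: hol_const|exists (fun h : T => h 0 c); exact: hol_coord].
  by apply: holB; exact: hc.
- move=> s sr; apply: holB.
    apply: holM; first exact: extF_hol.
    by apply: holB; [exact: hA|exact: hol_const].
  by apply: hol_mulmx => i j; [exact: hA|exact: extF_hol].
- exact: Vr.
- move=> s hs; rewrite !eF// ?leqnSn//.
  by have [_ ->] := (formal_solutionP _ _ _).1 (fF (hV s hs)).
Qed.

Lemma extF_pde t k j a b : rn t < r1 ->
  dd (fun t => Fe j t a b) t (delta_mx 0 k) = cmx k (Fe j.+1 t) a b - (cmx k (N1 t) *m Fe j t) a b.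
Proof.
move=> tr; have [c' [dl [dl0 hV eF pde]]] := extF_eq_ball j.
have Vc : V c' by apply: hV; rewrite subrr rn0.
apply: (@identity_convex_ball _ _ (fun t => dd (fun t => Fe j t a b) t (delta_mx 0 k))
   (fun t => cmx k (Fe j.+1 t) a b - (cmx k (N1 t) *m Fe j t) a b) c' t r1 dl) => //.
- by move=> s sr; apply: hol_dd_ball => // s' sr'; exact: extF_hol.
- move=> s sr; apply: holB; last by apply: hol_mulmx => i i'; [exact: hol_cmx|exact: extF_hol].
  apply: (@hol_ext _ _ (fun t => ((delta_mx 0 k : T) 0 a - (delta_mx 0 k : T) 0 b) * Fe j.+1 t a b)).
    by move=> y; rewrite cmxE.
  by apply: holM; [exact: hol_const|exact: extF_hol].
- exact: Vr.
- move=> s hs; rewrite !eF// -pde//.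
  have d0 : 0 < dl - rn (s - c') by rewrite subr_gt0.
  have -> // : dd (fun t => Fe j t a b) s = dd (fun t => F j t a b) s.
  apply/esym/ddE/(isd_near d0 (f := fun t => Fe j t a b)).
    by move=> y hy; rewrite eF//; have := rn_tri y s c'; lra.
  by apply: ddP; apply: extF_hol; apply: Vr; exact: hV.
Qed.

End OnSubdomain.

End FormalExtension.

(** * Euler systems and the Borel transform *)

Section EulerSystems.
Variable R : realType.
Local Notation C := R[i].

(** The majorant is the real part of a complex function, so that the one integral [cint] serves for
    both sides. *)
Lemma rsum_major k (f g : R -> C) : (forall s, 0 <= s <= 1 -> rn (f s) <= complex.Re (g s)) ->
  rn (rsum k f) <= complex.Re (rsum k g).
Proof.
elim: k f g => [|k IH] f g h /=; first by apply: h; rewrite lexx ler01.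
have a := IH (fun s => f (s / 2)) (fun s => g (s / 2)) ltac:(move=> s s1; apply: h; lra).
have b := IH (fun s => f ((1 + s) / 2)) (fun s => g ((1 + s) / 2)) ltac:(move=> s s1; apply: h; lra).
have E (z : C) : complex.Re (2^-1 * z) = 2^-1 * complex.Re z.
  have -> : (2^-1 : C) = (2^-1)%:C by rewrite fmorphV rmorph_nat.
  by rewrite ReM /= mul0r subr0.
rewrite rnM rnV rn_nat E ReD ler_wpM2l ?invr_ge0//.
by apply: le_trans (rnD _ _) _; exact: lerD.
Qed.

Lemma cint_major (f g : R -> C) : cont01 f -> cont01 g ->
  (forall s, 0 <= s <= 1 -> rn (f s) <= complex.Re (g s)) -> rn (cint f) <= complex.Re (cint g).
Proof.
move=> cf cg fg; apply/ler_addgt0Pl => e e0.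
have e2 : 0 < e / 2 by rewrite divr_gt0.
have [N1 h1] := cintP cf e2; have [N2 h2] := cintP cg e2.
pose k := maxn N1 N2; have {}h1 := h1 k (leq_maxl _ _); have {}h2 := h2 k (leq_maxr _ _).
have h3 := rsum_major k fg.
have h4 : complex.Re (rsum k g) <= complex.Re (cint g) + e / 2.
  have := le_trans (ler_norm _) (le_trans (Re_le_rn (rsum k g - cint g)) h2).
  by rewrite ReD ReN; lra.
have := rn_sub (cint f) (rsum k f); rewrite [rn (cint f - _)]rnB; lra.
Qed.

Lemma hol_X p (z : C) : hol (fun z : C => z ^+ p) z.
Proof. by apply: holX; exists id; exact: isd_id. Qed.

(** The weight [s^p] has integral [1 / (p + 1)], the gain that makes the Euler iteration contract.
    For [p > 0] the weight vanishes at 0, and no bound on [f] is asked there. *)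
Lemma cint_pow_bound (p : nat) (f : R -> C) (c : R) : cont01 (fun s => s%:C ^+ p * f s) ->
  (forall s, 0 <= s <= 1 -> (0 < s) || (p == 0)%N -> rn (f s) <= c) ->
  rn (cint (fun s => s%:C ^+ p * f s)) <= c / p.+1%:R.
Proof.
move=> cf fc; pose g s : C := c%:C * s%:C ^+ p.
have hg (z : C) : hol (fun z : C => c%:C * z ^+ p) z by apply: holM; [exact: hol_const|exact: hol_X].
have cg : cont01 g by apply: (@cont01_hol _ (fun z => c%:C * z ^+ p)) => s _; exact: hg.
have -> : c / p.+1%:R = complex.Re (cint g).
  rewrite (@cint_ftc _ (fun s => c%:C / p.+1%:R * s%:C ^+ p.+1) g) => //.
    have -> : c%:C / p.+1%:R = (c / p.+1%:R)%:C :> C by rewrite rmorphM fmorphV rmorph_nat.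
    by rewrite expr1n expr0n mulr0 subr0 mulr1.
  move=> s _.
  have h : hol (fun z : C => c%:C / p.+1%:R * z ^+ p.+1) s%:C by apply: holM; [exact: hol_const|exact: hol_X].
  have := hol_real h; rewrite (ddE (isdZ _ (isd_pow p s%:C))).
  have -> : c%:C / p.+1%:R * (1 * (p.+1%:R * s%:C ^+ p)) = g s; last exact.
  by rewrite /g mul1r mulrA divfK// pnatr_eq0.
apply: cint_major => // s /[dup] s01 /andP[s0 s1]; rewrite rnM rnX rn_real ger0_norm//.
have -> : complex.Re (g s) = s ^+ p * c by rewrite /g -rmorphXn -rmorphM /= mulrC.
case: (boolP ((0 < s) || (p == 0)%N)) => [h|]; first by rewrite ler_wpM2l ?exprn_ge0// fc.
rewrite negb_or -leNgt => /andP[s0' p0]; have -> : s = 0 by apply/eqP; rewrite eq_le s0'.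
by rewrite expr0n (negPf p0) !mul0r.
Qed.

Section Star.
Variables (U : normedModType C) (E : set U).
Hypothesis oE : opn E.
Hypothesis sE : forall (s : R) x, 0 <= s <= 1 -> E x -> E (s%:C *: x).

(** The solution operator of the Euler equation [dd y x x + (p + 1) y = f], along the ray from 0
    through [x]. *)
Definition euler_int (p : nat) (f : U -> C) (x : U) : C := cint (fun s : R => s%:C ^+ p * f (s%:C *: x)).

Lemma hol_ray (f : U -> C) x (z : C) : hol f (z *: x) -> hol (fun z : C => f (z *: x)) z.
Proof.
move=> h; apply: (@hol_ext _ _ (fun z : C => f (0 + z *: x))) => [y|]; first by rewrite add0r.
by apply: hol_line; rewrite add0r.
Qed.

Lemma euler_cont p (f : U -> C) x : (forall y, E y -> hol f y) -> E x ->
  cont01 (fun s : R => s%:C ^+ p * f (s%:C *: x)).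
Proof.
move=> hf Ex; apply: (@cont01_hol _ (fun z => z ^+ p * f (z *: x))) => s s01.
by apply: holM; [exact: hol_X|apply: hol_ray; apply: hf; exact: sE].
Qed.

Lemma euler_tube (f : U -> C) x : (forall y, E y -> hol f y) -> E x ->
  exists r M : R, 0 < r /\ forall s y, 0 <= s <= 1 -> rn (y - x) < r -> E (s%:C *: y) /\ rn (f (s%:C *: y)) <= M.
Proof.
move=> hf Ex; apply: (@tube _ _ _ E f (fun s y => s%:C *: y)) => // [s s01|s s01 e e0]; first exact: sE.
have x1 : 0 < rn x + 1 by rewrite ltr_wpDl// rn_ge0.
pose d := Num.min 1 (e / 4 / (rn x + 1)).
have [d1 d2] : d <= 1 /\ d * (rn x + 1) <= e / 4.
  split; first by rewrite /d ge_min lexx.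
  by rewrite -ler_pdivlMr// /d ge_min lexx orbT.
exists d; first by rewrite lt_min ltr01 !divr_gt0.
move=> s' y hs hy; have -> : s'%:C *: y - s%:C *: x = s'%:C *: (y - x) + (s' - s)%:C *: x.
  by rewrite rmorphB scalerBr scalerBl addrA subrK.
apply: le_lt_trans (rnD _ _) _; rewrite !rnZ !rn_real.
have s2 : `|s'| <= 2.
  have := ler_normD (s' - s) s; rewrite subrK; move: s01 => /andP[s0 s1].
  by rewrite (ger0_norm s0); lra.
have h1 : `|s'| * rn (y - x) <= 2 * d by apply: ler_pM; rewrite ?rn_ge0// ltW.
have h2 : `|s' - s| * rn x <= d * (rn x + 1).
  by apply: ler_pM; rewrite ?rn_ge0//; [exact: ltW|rewrite lerDl].
have h3 : d <= d * (rn x + 1).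
  rewrite ler_peMr ?lerDr ?rn_ge0//.
  by rewrite /d le_min ler01 !divr_ge0// ltW.
lra.
Qed.

(** The equation is the integral over [0, 1] of the derivative of [s^(p+1) f(s x)] in [s]. *)
Lemma euler_int_hol p (f : U -> C) x : (forall y, E y -> hol f y) -> E x ->
  hol (euler_int p f) x /\ dd (euler_int p f) x x + p.+1%:R * euler_int p f x = f x.
Proof.
move=> hf Ex; have [r [M [r0 hM]]] := euler_tube hf Ex.
pose k (s : R) y : C := s%:C ^+ p * f (s%:C *: y).
have isk s y : 0 <= s <= 1 -> rn (y - x) < r ->
    isd (k s) y (fun h => s%:C ^+ p * dd f (s%:C *: y) (s%:C *: h)).
  move=> s01 yr; have [Ey _] := hM s y s01 yr.
  apply: isdZ; apply: (@isd_ext _ _ (fun y => f (0 + s%:C *: y))) => [z|]; first by rewrite add0r.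
  apply: (@isd_compl _ _ _ (fun u => s%:C *: u) 0 f y (dd f (s%:C *: y)) `|s|) => //.
  - by move=> u v a; rewrite scalerDr !scalerA mulrC.
  - by move=> u; rewrite rnZ rn_real.
  - by rewrite add0r; apply: ddP; exact: hf.
have hk : forall s y, 0 <= s <= 1 -> rn (y - x) < r -> hol (k s) y /\ rn (k s y) <= M.
  move=> s y s01 yr; split; first by exists (fun h => s%:C ^+ p * dd f (s%:C *: y) (s%:C *: h)); exact: isk.
  rewrite /k rnM rnX rn_real; have [_ h] := hM s y s01 yr; move: s01 => /andP[s0 s1].
  apply: le_trans h; rewrite ler_piMl ?rn_ge0// ger0_norm//; exact: exprn_ile1.
have ck y : rn (y - x) < r -> cont01 (k^~ y).
  by move=> yr; apply: euler_cont => //; have [] := hM 1 y _ yr; rewrite ?ler01 ?lexx// scale1r.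
have [h1 h2] := cint_hol r0 hk ck; split=> //.
pose W : set C := [set z | E (z *: x)].
have oW : opn W.
  move=> z /oE[d d0 hd]; have x1 : 0 < rn x + 1 by rewrite ltr_wpDl// rn_ge0.
  exists (d / (rn x + 1)); first exact: divr_gt0.
  move=> y; rewrite ltr_pdivlMr// => hy; apply: hd; rewrite -scalerBl rnZ.
  by have := rn_ge0 (y - z); lra.
have Ws (s : R) : 0 <= s <= 1 -> W s%:C by move=> s01; exact: sE.
pose Fc (z : C) := z ^+ p.+1 * f (z *: x).
have isF z : W z -> isd Fc z (fun h => z ^+ p.+1 * (h * dd f (z *: x) x) + f (z *: x) * (h * (p.+1%:R * z ^+ p))).
  move=> Wz; apply: isdM; first exact: isd_pow.
  apply: (@isd_ext _ _ (fun z : C => f (0 + z *: x))) => [y|]; first by rewrite add0r.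
  by apply: isd_line; rewrite add0r; apply: ddP; exact: hf.
have hFc z : W z -> hol Fc z.
  by move=> Wz; exists (fun h => z ^+ p.+1 * (h * dd f (z *: x) x) + f (z *: x) * (h * (p.+1%:R * z ^+ p))); exact: isF.
pose dF s := dd Fc s%:C 1.
have cdF : cont01 dF.
  apply: (@cont01_hol _ (fun z => dd Fc z 1)) => s /Ws Wz; have [d d0 hd] := oW _ Wz.
  by apply: (@hol_dd _ _ Fc s%:C d 1 d0) => y /hd; exact: hFc.
have IF : cint dF = f x.
  rewrite (@cint_ftc _ (fun s => Fc s%:C) dF) => //; first by rewrite /Fc expr1n scale1r mul1r expr0n mul0r subr0.
  by move=> s /Ws Wz; apply: hol_real; exact: hFc.
rewrite -IF; apply: (@clim_unique _ _ (fun m => rsum m (fun s => dd (k s) x x) + p.+1%:R * rsum m (k^~ x))).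
  by apply: climD; [exact: h2|apply: climM; apply: cintP; apply: ck; rewrite subrr rn0].
apply: clim_ext (cintP cdF) => m; rewrite -rsumZ -rsumD; apply: rsum_eq => s s01.
rewrite /dF (ddE (isF _ (Ws s s01))) (ddE (isk s x s01 _)) ?subrr ?rn0//.
by rewrite (isd_linZ _ _ (ddP (hf _ (sE s01 Ex)))) exprS /k; ring.
Qed.

Lemma euler_int_bound p (f : U -> C) x c : (forall y, E y -> hol f y) -> E x ->
  (forall s : R, 0 <= s <= 1 -> (0 < s) || (p == 0)%N -> rn (f (s%:C *: x)) <= c) -> rn (euler_int p f x) <= c / p.+1%:R.
Proof. by move=> hf Ex fc; apply: cint_pow_bound => //; exact: euler_cont. Qed.

Lemma euler_int_sub p (f g : U -> C) x : (forall y, E y -> hol f y) -> (forall y, E y -> hol g y) -> E x ->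
  euler_int p f x - euler_int p g x = euler_int p (fun y => f y - g y) x.
Proof.
move=> hf hg Ex; rewrite /euler_int -cintB; try exact: euler_cont.
by apply: cint_eq => s _; rewrite mulrBr.
Qed.

Section System.
Variables (n : nat) (a : 'I_n -> 'I_n -> U -> C) (mu : R) (p : nat).
Hypothesis ha : forall i j x, E x -> hol (a i j) x.
Hypothesis mu0 : 0 <= mu.
Hypothesis ba : forall i j x, E x -> rn (a i j x) <= mu.
Hypothesis pmu : n%:R * mu < p.+1%:R.
Let q : R := n%:R * mu / p.+1%:R.

Let q01 : 0 <= q < 1.
Proof. by rewrite divr_ge0 ?mulr_ge0//= ltr_pdivrMr ?mul1r. Qed.

Let rhs_hol (y : 'I_n -> U -> C) (h : 'I_n -> U -> C) i x :
  (forall i x, E x -> hol (y i) x) -> (forall i x, E x -> hol (h i) x) -> E x ->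
  hol (fun x => \sum_j a i j x * y j x + h i x) x.
Proof.
move=> hy hh Ex; apply: holD; last exact: hh.
by apply: hol_sum => j; apply: holM; [exact: ha|exact: hy].
Qed.

Let rhs_bound (y : 'I_n -> U -> C) i x (K : R) : E x -> (forall j, rn (y j x) <= K) ->
  rn (\sum_j a i j x * y j x) <= n%:R * mu * K.
Proof.
move=> Ex hy; apply: le_trans (rn_sum _ _ _) _.
apply: (@le_trans _ _ (\sum_(j < n) mu * K)); last by rewrite sumr_const card_ord -[leLHS]mulr_natl mulrA.
by apply: ler_sum => j _; rewrite rnM; apply: ler_pM; rewrite ?rn_ge0// ba.
Qed.

(* H = sum of the Picard iterates; p + 1 > n mu makes the iteration contract. *)
Lemma euler_exists (h : 'I_n -> U -> C) (c : R) : 0 <= c ->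
  (forall i x, E x -> hol (h i) x) -> (forall i x, E x -> rn (h i x) <= c) ->
  exists (H : 'I_n -> U -> C) (K : R), forall i x, E x ->
   [/\ hol (H i) x, rn (H i x) <= K &
       dd (H i) x x + p.+1%:R * H i x = \sum_j a i j x * H j x + h i x].
Proof.
move=> c0 hh bh.
pose P := fix P k i x : C := if k is k'.+1 then euler_int p (fun x => \sum_j a i j x * P k' j x + h i x) x else 0.
have hP k i x : E x -> hol (P k i) x.
  elim: k i x => [|k IH] i x Ex; first exact: hol_const.
  by apply: (euler_int_hol p _ Ex).1 => y Ey; exact: rhs_hol.
pose B : R := c / p.+1%:R.
have dif k i x : E x -> rn (P k.+1 i x - P k i x) <= B * q ^+ k.
  elim: k i x => [|k IH] i x Ex.
    rewrite subr0 expr0 mulr1; apply: euler_int_bound => //.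
      by move=> y Ey; apply: rhs_hol => // *; exact: hol_const.
    move=> s s01 _; rewrite big1 ?add0r => [|j _]; last by rewrite mulr0.
    by apply: bh; exact: sE.
  rewrite [P k.+2 i x]/= [P k.+1 i x in X in _ - X]/= euler_int_sub//; last 2 first.
  + by move=> y Ey; apply: rhs_hol => // j z Ez; exact: (hP k.+1).
  + by move=> y Ey; apply: rhs_hol => // j z Ez; exact: hP.
  have -> : B * q ^+ k.+1 = n%:R * mu * (B * q ^+ k) / p.+1%:R by rewrite exprS /q; ring.
  apply: euler_int_bound => // [y Ey|s s01 _].
    by apply: holB; apply: rhs_hol => // j z Ez; [exact: (hP k.+1)|exact: hP].
  have Es := sE s01 Ex.
  rewrite (_ : _ - _ = \sum_j a i j (s%:C *: x) * (P k.+1 j (s%:C *: x) - P k j (s%:C *: x))).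
    by apply: (@rhs_bound (fun j y => P k.+1 j y - P k j y)) => // j; exact: IH.
  rewrite opprD addrACA subrr addr0 -sumrB.
  by apply: eq_bigr => j _; rewrite mulrBr.
have B0 : 0 <= B by rewrite divr_ge0.
pose H i x : C := xget 0 (clim (fun k => P k i x)).
have HP i x : E x -> clim (fun k => P k i x) (H i x) /\ forall k, rn (P k i x) <= B / (1 - q).
  move=> Ex; have [l [cl bl _]] := clim_ratio q01 (fun k => dif k i x Ex).
  split; last by move=> k; have := bl k; rewrite subr0.
  by rewrite /H; case: xgetP => [l' -> //|/(_ l cl)].
exists H, (B / (1 - q)) => i x Ex; have [r r0 hr] := oE Ex.
have V j y : E y -> hol (H j) y /\ forall u, clim (fun k => dd (P k j) y u) (dd (H j) y u).
  move=> Ey; have [r' r'0 hr'] := oE Ey.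
  apply: (@vitali _ _ (fun k => P k j) (H j) y r' (B / (1 - q))) => //.
  - by move=> k z /hr'; exact: hP.
  - by move=> k z /hr' Ez; have [_] := HP j z Ez.
  - by move=> z /hr' Ez; have [] := HP j z Ez.
have [hH dH] := V i x Ex; have [cH bH] := HP i x Ex; split=> //; first exact: clim_le cH bH.
apply: (@clim_unique _ _ (fun k => dd (P k.+1 i) x x + p.+1%:R * P k.+1 i x)).
  apply: climD; first by apply: clim_ext (clim_shift 1 (dH x)) => k; rewrite addn1.
  by apply: climM; apply: clim_ext (clim_shift 1 cH) => k; rewrite addn1.
apply: (@clim_ext _ _ (fun k => \sum_j a i j x * P k j x + h i x)) => [k|].
  have [_ <-] := @euler_int_hol p (fun x => \sum_j a i j x * P k j x + h i x) x (fun y Ey => rhs_hol i (hP k) hh Ey) Ex.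
  by [].
apply: climD; last exact: clim_const.
by apply: clim_sum => j; apply: climM; have [] := HP j x Ex.
Qed.

(** A bounded solution is reproduced by the contraction, so it is at most [c q^k] for every [k]. The
    equation is asked only on [E'], which may omit the origin: this suits quotients whose equation
    is known where the divisor is not 0. *)
Lemma euler_unique (G : 'I_n -> U -> C) (E' : set U) (c : R) : E' `<=` E ->
  (forall (s : R) x, 0 < s <= 1 -> E' x -> E' (s%:C *: x)) ->
  (forall i x, E x -> hol (G i) x) -> (forall i x, E x -> rn (G i x) <= c) -> (0 < p)%N ->
  (forall i x, E' x -> dd (G i) x x + p.+1%:R * G i x = \sum_j a i j x * G j x) ->
  forall i x, E' x -> G i x = 0.
Proof.
move=> E'E sE' hG bG p0 eG i0 x0 Ex0.
have hr i x : E x -> hol (fun x => \sum_j a i j x * G j x) x.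
  by move=> Ex; apply: hol_sum => j; apply: holM; [exact: ha|exact: hG].
have GE i x : E' x -> G i x = euler_int p (fun x => \sum_j a i j x * G j x) x.
  move=> E'x; have Ex := E'E _ E'x; have Es s s01 := @sE s x s01 Ex.
  have isF (z : C) : E (z *: x) -> isd (fun z : C => z ^+ p.+1 * G i (z *: x)) z (fun h : C => z ^+ p.+1 * (h * dd (G i) (z *: x) x) + G i (z *: x) * (h * (p.+1%:R * z ^+ p))).
    move=> Ez; apply: isdM; first exact: isd_pow.
    apply: (@isd_ext _ _ (fun z : C => G i (0 + z *: x))) => [y|]; first by rewrite add0r.
    by apply: isd_line; rewrite add0r; apply: ddP; exact: hG.
  rewrite /euler_int (@cint_ftc _ (fun s => s%:C ^+ p.+1 * G i (s%:C *: x))).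
  - by rewrite expr1n mul1r scale1r expr0n mul0r subr0.
  - by apply: (@euler_cont p (fun x => \sum_j a i j x * G j x)) => // y Ey; exact: hr.
  move=> s s01; have Ez := Es s s01.
  have := hol_real (ex_intro _ _ (isF _ Ez)); rewrite (ddE (isF _ Ez)).
  have -> // : s%:C ^+ p.+1 * (1 * dd (G i) (s%:C *: x) x) + G i (s%:C *: x) * (1 * (p.+1%:R * s%:C ^+ p)) =
     s%:C ^+ p * \sum_j a i j (s%:C *: x) * G j (s%:C *: x).
  case: (eqVneq s 0) => [->|s0]; first by rewrite !expr0n /= gtn_eqF// !(mul0r, mulr0) addr0.
  rewrite -eG; last by apply: sE' => //; move: s01 => /andP[h ->]; rewrite lt_neqAle eq_sym s0 h.
  by rewrite (isd_linZ _ _ (ddP (hG i _ Ez))) exprS; ring.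
have bd k : forall i x, E' x -> rn (G i x) <= c * q ^+ k.
  elim: k => [|k IH] i x E'x; first by rewrite expr0 mulr1; apply: bG; exact: E'E.
  rewrite GE// (_ : c * q ^+ k.+1 = n%:R * mu * (c * q ^+ k) / p.+1%:R); last by rewrite exprS /q; ring.
  apply: euler_int_bound => [y Ey| |s s01]; [exact: hr|exact: E'E|].
  rewrite [(p == 0)%N]gtn_eqF// orbF => s0; apply: rhs_bound; first by apply: sE => //; exact: E'E.
  by move=> j; apply: IH; apply: sE' => //; rewrite s0; case/andP: s01.
apply: small_eq0 => e e0; have [k hk] := geom_small c q01 e0.
by apply: le_trans (bd k i0 x0 Ex0) (hk k (leqnn k)).
Qed.
End System.

End Star.
End EulerSystems.

(** * The Borel transform of a column of the formal solution *)

Section BorelTransform.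
Variable R : realType.
Local Notation C := R[i].
Variable n : nat.
Local Notation T := 'rV[C]_n.
Local Notation M := 'M[C]_n.
Variables (u0 : T) (A N1 : T -> M) (F : nat -> T -> M) (r : R) (D : set C) (kap BA BN : R) (b : 'I_n).
Hypothesis oD : opn D.
Hypothesis sD : forall (s : R) x, 0 <= s <= 1 -> D x -> D (s%:C * x).
Hypothesis D0 : D 0.
Hypothesis kap0 : 0 < kap.
Hypothesis sep : forall (x : C) t a, D x -> rn t < r -> u0 0 a != u0 0 b ->
  kap <= rn (x + (u0 + t) 0 a - (u0 + t) 0 b).
Hypothesis hA : forall t i j, rn t < r -> hol (fun t => A t i j) t.
Hypothesis hN : forall t i j, rn t < r -> hol (fun t => N1 t i j) t.
Hypothesis hF : forall k t i j, rn t < r -> hol (fun t => F k t i j) t.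
Hypothesis bA : forall t i j, rn t < r -> rn (A t i j) <= BA.
Hypothesis bN : forall t i j, rn t < r -> rn (N1 t i j) <= BN.
Hypothesis bF : forall k, exists BF, forall t i j, rn t < r -> rn (F k t i j) <= BF.
Hypothesis fF : forall t, rn t < r -> is_formal_solution (u0 + t) (A t) (F^~ t).
Hypothesis pF : forall t k j a c, rn t < r ->
  dd (fun t => F j t a c) t (delta_mx 0 k) = cmx k (F j.+1 t) a c - (cmx k (N1 t) *m F j t) a c.

Hypothesis rpos : 0 < r.

Let E : set (C * T) := [set z | D z.1 /\ rn z.2 < r].

Let oE : opn E.
Proof.
move=> [x t] [/= Dx tr]; have [d d0 hd] := oD Dx.
exists (Num.min d (r - rn t)); first by rewrite lt_min d0 subr_gt0.
move=> [y s]; rewrite -[_ - _]/(y - x, s - t) => /rn_pair_lt; rewrite !lt_min => -[/andP[h1 _] /andP[_ h2]].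
by split; [exact: hd|have := rn_sub s t; rewrite /=; lra].
Qed.

Let sE (s : R) z : 0 <= s <= 1 -> E z -> E (s%:C *: z).
Proof.
move=> s01 [Dz zr]; split; first exact: sD.
have -> : (s%:C *: z).2 = s%:C *: z.2 by [].
case/andP: (s01) => s0 s1; rewrite rnZ rn_real ger0_norm//; apply: le_lt_trans zr.
by rewrite ler_piMl// rn_ge0.
Qed.

Let hol_x (z : C * T) : hol (fun z : C * T => z.1) z.
Proof. exact: hol_fst. Qed.

Let hol_u (z : C * T) a : hol (fun z : C * T => (u0 + z.2) 0 a) z.
Proof.
apply: (@hol_snd _ _ _ (fun t => (u0 + t) 0 a)).
apply: (@hol_ext _ _ (fun t : T => u0 0 a + t 0 a)) => [y|]; first by rewrite rowDE.
by apply: holD; [exact: hol_const|exists (fun h : T => h 0 a); exact: hol_coord].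
Qed.

Let hol_t (z : C * T) a : hol (fun z : C * T => z.2 0 a) z.
Proof. by apply: (@hol_snd _ _ _ (fun t : T => t 0 a)); exists (fun h : T => h 0 a); exact: hol_coord. Qed.

(** The quotient of [x + t_a - t_b] by [x + u_a(t) - u_b(t)], written so that the denominator
    appears only for [u_a(0) <> u_b(0)]. For coalescing pairs the cancellation is exact. *)
Let Kf a (z : C * T) : C := if u0 0 a == u0 0 b then 1
  else 1 + (u0 0 b - u0 0 a) * (z.1 + (u0 + z.2) 0 a - (u0 + z.2) 0 b)^-1.

Let KfE a z : E z -> Kf a z * (z.1 + (u0 + z.2) 0 a - (u0 + z.2) 0 b) = z.1 + (z.2 0 a - z.2 0 b).
Proof.
move=> [Dz zr]; rewrite /Kf; case: eqP => [e|/eqP ne].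
  by rewrite !rowDE e; ring.
have d0 : z.1 + (u0 + z.2) 0 a - (u0 + z.2) 0 b != 0.
  by rewrite -rn_gt0; apply: lt_le_trans (sep Dz zr ne).
by rewrite mulrDl mul1r divfK// !rowDE; ring.
Qed.

Let Kf_hol a z : E z -> hol (Kf a) z.
Proof.
move=> [Dz zr]; rewrite /Kf; case: eqP => [e|/eqP ne]; first exact: hol_const.
apply: holD; first exact: hol_const.
apply: holM; first exact: hol_const.
apply: holV; first by rewrite -rn_gt0; apply: lt_le_trans (sep Dz zr ne).
by apply: holB; [apply: holD|]; [exact: hol_x|exact: hol_u|exact: hol_u].
Qed.

Let BK : R := 1 + 2 * rn u0 / kap.

Let Kf_bound a z : E z -> rn (Kf a z) <= BK.
Proof.
have h0 : 0 <= 2 * rn u0 / kap by rewrite divr_ge0 ?mulr_ge0 ?rn_ge0// ltW.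
move=> [Dz zr]; rewrite /Kf; case: eqP => [e|/eqP ne]; first by rewrite rn1 /BK lerDl.
apply: le_trans (rnD _ _) _; rewrite rn1 /BK lerD2l rnM rnV.
apply: ler_pM; rewrite ?invr_ge0 ?rn_ge0//.
  by apply: le_trans (rnB_le _ _) _; have := rn_entry u0 0 a; have := rn_entry u0 0 b; lra.
rewrite lef_pV2 ?posrE//; first exact: sep.
by apply: lt_le_trans (sep Dz zr ne).
Qed.

(** In Borel form the equation in [z] gives [(x + u_a - u_b) d_x phi_a = - (A phi)_a - (1 - A_bb)
    phi_a], and the deformation equations give [d_k phi = [E_k, .] d_x phi - [E_k, N1] phi], where
    the first term is [d_x phi_a] for [k = a] minus the same for [k = b]. Contraction with [t_k]
    brings the factor [x + t_a - t_b], and [Kf] eliminates [d_x phi_a]. *)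
Let aij i j (z : C * T) : C :=
  - (Kf i z * (A z.2 i j - (A z.2 b b - 1) * (i == j)%:R)) - \sum_k z.2 0 k * cmx k (N1 z.2) i j.

Let aij_hol i j z : E z -> hol (aij i j) z.
Proof.
move=> Ez; have [Dz zr] := Ez.
have hA' i' j' : hol (fun z : C * T => A z.2 i' j') z by apply: (@hol_snd _ _ _ (fun t => A t i' j')); exact: hA.
apply: holB.
  apply: holN; apply: holM; first exact: Kf_hol.
  apply: holB; first exact: hA'.
  by apply: holM; [apply: holB; [exact: hA'|exact: hol_const]|exact: hol_const].
apply: hol_sum => k; apply: holM; first exact: hol_t.
by apply: (@hol_snd _ _ _ (fun t => cmx k (N1 t) i j)); exact: (@hol_cmx _ _ N1 r).
Qed.

Let mu : R := BK * (2 * `|BA| + 1) + n%:R * (r * (2 * `|BN|)).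

Let r0 z : E z -> 0 <= r.
Proof. by move=> [_ zr]; apply: ltW; apply: le_lt_trans zr; exact: rn_ge0. Qed.

Let aij_bound i j z : E z -> rn (aij i j z) <= mu.
Proof.
move=> Ez; have [Dz zr] := Ez; have rr0 := r0 Ez.
have bA' i' j' : rn (A z.2 i' j') <= `|BA| by apply: le_trans (bA i' j' zr) (ler_norm _).
have bN' i' j' : rn (N1 z.2 i' j') <= `|BN| by apply: le_trans (bN i' j' zr) (ler_norm _).
apply: le_trans (rnB_le _ _) _; apply: lerD.
  rewrite rnN rnM; apply: ler_pM; rewrite ?rn_ge0 ?Kf_bound//.
  apply: le_trans (rnB_le _ _) _; have h1 := bA' i j; have h2 := bA' b b.
  suff : rn ((A z.2 b b - 1) * (i == j)%:R) <= `|BA| + 1 by lra.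
  have h3 := rnB_le (A z.2 b b) 1; rewrite rn1 in h3.
  by case: (i == j); rewrite ?mulr1 ?mulr0 ?rn0; [lra|rewrite addr_ge0].
apply: le_trans (rn_sum _ _ _) _.
apply: (@le_trans _ _ (\sum_(k < n) r * (2 * `|BN|))); last by rewrite sumr_const card_ord -[leLHS]mulr_natl.
apply: ler_sum => k _; rewrite rnM; apply: ler_pM; rewrite ?rn_ge0//.
  by apply: le_trans (rn_entry _ _ _) (ltW zr).
by rewrite cmxE rnM; apply: ler_pM; rewrite ?rn_ge0 ?rn_deltaB.
Qed.

Let term k a (z : C * T) : C := z.1 ^+ k * (F k.+1 z.2 a b / k`!%:R).
Let Pol N a z : C := \sum_(k < N) term k a z.
Let AF k a t : C := (A t *m F k t) a b + (k%:R - A t b b) * F k t a b.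

Let AF_rec k a t : rn t < r -> ((u0 + t) 0 a - (u0 + t) 0 b) * F k.+1 t a b = - AF k a t.
Proof. by move=> tr; have [_ ->] := (formal_solutionP _ _ _).1 (fF tr); rewrite /AF; ring. Qed.

Let isd_X1 k (z : C * T) : isd (fun z : C * T => z.1 ^+ k) z (fun h => h.1 * (k%:R * z.1 ^+ k.-1)).
Proof.
case: k => [|k]; last exact: (isd_chain (isd_fst z) (isd_pow k z.1)).
by apply: isd_eqL (isd_const 1 z) => h /=; rewrite mul0r mulr0.
Qed.

Let isd_term k a z : E z -> isd (term k a) z (fun h => z.1 ^+ k * (dd (fun t => F k.+1 t a b) z.2 h.2 / k`!%:R)
  + F k.+1 z.2 a b / k`!%:R * (h.1 * (k%:R * z.1 ^+ k.-1))).
Proof.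
move=> [Dz zr]; apply: isdM; first exact: isd_X1.
apply: (@isd_pair _ _ _ (fun t => F k.+1 t a b / k`!%:R) z (fun h => dd (fun t => F k.+1 t a b) z.2 h / k`!%:R)).
apply: (@isd_ext _ _ (fun t => k`!%:R^-1 * F k.+1 t a b)) => [y|]; first by rewrite mulrC.
apply: (isd_eqL _ (isdZ _ (ddP (hF k.+1 a b zr)))) => h; by rewrite mulrC.
Qed.

Let Pol_hol N a z : E z -> hol (Pol N a) z.
Proof. by move=> Ez; apply: hol_sum => k; eexists; exact: isd_term. Qed.

Let fact_neq0 k : k`!%:R != 0 :> C.
Proof. by rewrite pnatr_eq0 -lt0n fact_gt0. Qed.

Let x_term k (z : C * T) : z.1 * (k%:R * z.1 ^+ k.-1) = k%:R * z.1 ^+ k.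
Proof. by case: k => [|k]; [rewrite !mul0r mulr0|rewrite exprS mulrCA]. Qed.

Let ddF_t k a t : rn t < r -> dd (fun t => F k t a b) t t =
  (t 0 a - t 0 b) * F k.+1 t a b - \sum_l t 0 l * \sum_j cmx l (N1 t) a j * F k t j b.
Proof.
move=> tr; have hf := hF k a b tr.
have dl (f : 'I_n -> C) : dd (fun t => F k t a b) t (\sum_l f l *: delta_mx 0 l) = \sum_l f l * dd (fun t => F k t a b) t (delta_mx 0 l).
  elim/big_rec2: _ => [|l y1 y2 _ IH]; first by rewrite (isd_lin0 (ddP hf)).
  by rewrite (isd_linD _ _ (ddP hf)) (isd_linZ _ _ (ddP hf)) IH.
rewrite {2}(row_sum_delta t) dl; under eq_bigr => l _ do rewrite pF// mulrBr.
rewrite sumrB; congr (_ - _); last by apply: eq_bigr => l _; congr (_ * _); rewrite mxE.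
under eq_bigr => l _ do rewrite cmxE.
have E1 c : \sum_l t 0 l * (delta_mx 0 l : T) 0 c = t 0 c.
  rewrite (bigD1 c)//= [X in _ * X]mxE !eqxx mulr1 big1 ?addr0// => l lc.
  by rewrite [X in _ * X]mxE eqxx [c == l]eq_sym (negPf lc) mulr0.
rewrite -(E1 a) -(E1 b) -sumrB mulr_suml; apply: eq_bigr => l _; ring.
Qed.

Let gf N a z : C := - (z.1 ^+ N.-1 * ((Kf a z * AF N a z.2 + (z.2 0 a - z.2 0 b) * F N.+1 z.2 a b) / N.-1`!%:R)).

(** The leftovers of consecutive degrees telescope by the recursion for [F], so that the Taylor
    polynomial satisfies the Euler system up to [x^N] times a function without poles, which is
    [gf]. *)
Let euler_Pol N a z : E z -> dd (Pol N.+1 a) z z = \sum_j aij a j z * Pol N.+1 j z - gf N.+1 a z.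
Proof.
move=> Ez; have [Dz zr] := Ez.
have dterm k : dd (term k a) z z = z.1 ^+ k / k`!%:R * ((z.2 0 a - z.2 0 b) * F k.+2 z.2 a b
    - \sum_l z.2 0 l * \sum_j cmx l (N1 z.2) a j * F k.+1 z.2 j b + k%:R * F k.+1 z.2 a b).
  rewrite (ddE (isd_term k a Ez)) x_term ddF_t//; ring.
have dPol : dd (Pol N.+1 a) z z = \sum_(k < N.+1) dd (term k a) z z.
  by rewrite (ddE (isd_sum _ (fun k : 'I_N.+1 => ddP (ex_intro _ _ (isd_term k a Ez))))).
have aterm k : \sum_j aij a j z * term k j z = z.1 ^+ k / k`!%:R * (- (Kf a z * (AF k.+1 a z.2 - k%:R * F k.+1 z.2 a b))
    - \sum_l z.2 0 l * \sum_j cmx l (N1 z.2) a j * F k.+1 z.2 j b).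
  have -> : AF k.+1 a z.2 - k%:R * F k.+1 z.2 a b = \sum_j (A z.2 a j - (A z.2 b b - 1) * (a == j)%:R) * F k.+1 z.2 j b.
    rewrite /AF [X in X + _ - _]mxE; under [RHS]eq_bigr do rewrite mulrBl.
    rewrite sumrB (bigD1 a)//= [X in _ = _ - X](bigD1 a)//= eqxx [X in _ - (_ + X)]big1 ?addr0.
      by rewrite -[k.+1%:R]natr1 (_ : (true%:R : C) = 1)//; ring.
    by move=> j ja; rewrite eq_sym (negPf ja) mulr0 mul0r.
  have -> : \sum_l z.2 0 l * \sum_j cmx l (N1 z.2) a j * F k.+1 z.2 j b = \sum_j (\sum_l z.2 0 l * cmx l (N1 z.2) a j) * F k.+1 z.2 j b.
    under [LHS]eq_bigr do rewrite mulr_sumr; rewrite exchange_big; apply: eq_bigr => j _.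
    by rewrite mulr_suml; apply: eq_bigr => l _; rewrite mulrA.
  rewrite mulr_sumr -sumrN -sumrB mulr_sumr; apply: eq_bigr => j _.
  by rewrite /term /aij; ring.
rewrite dPol; have -> : \sum_j aij a j z * Pol N.+1 j z = \sum_(k < N.+1) \sum_j aij a j z * term k j z.
  by rewrite exchange_big; apply: eq_bigr => j _; rewrite /Pol mulr_sumr.
elim: N {dPol} => [|N IH].
  by rewrite !big_ord1 dterm aterm /gf /=; ring.
rewrite big_ord_recr IH [in RHS]big_ord_recr /= dterm aterm /gf /=.
have K1 := KfE a Ez; have F1 := AF_rec N.+1 a zr; have f0 := fact_neq0 N; have N0 : N.+1%:R != 0 :> C by rewrite pnatr_eq0.
have AFE : AF N.+1 a z.2 = - (((u0 + z.2) 0 a - (u0 + z.2) 0 b) * F N.+2 z.2 a b) by rewrite F1 opprK.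
have tE : z.2 0 a - z.2 0 b = Kf a z * (z.1 + (u0 + z.2) 0 a - (u0 + z.2) 0 b) - z.1 by rewrite K1; ring.
rewrite AFE tE factS natrM exprS.
move: N0 f0; set c1 : C := N.+1%:R; set c2 : C := N`!%:R; clearbody c1 c2 => N0 f0.
by field; rewrite ?N0 ?f0.
Qed.

(** [gf p.+2] without its factor [x^(p+1)]: the inhomogeneous term in the equation for the remainder
    [H]. *)
Let hf p a z : C := - ((Kf a z * AF p.+2 a z.2 + (z.2 0 a - z.2 0 b) * F p.+3 z.2 a b) / p.+1`!%:R).

Let hA2 i j z : E z -> hol (fun z : C * T => A z.2 i j) z.
Proof. by move=> [_ zr]; apply: (@hol_snd _ _ _ (fun t => A t i j)); exact: hA. Qed.

Let hF2 k i j z : E z -> hol (fun z : C * T => F k z.2 i j) z.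
Proof. by move=> [_ zr]; apply: (@hol_snd _ _ _ (fun t => F k t i j)); exact: hF. Qed.

Let AF_hol k a z : E z -> hol (fun z : C * T => AF k a z.2) z.
Proof.
move=> Ez; apply: holD.
  apply: (@hol_ext _ _ (fun z : C * T => \sum_j A z.2 a j * F k z.2 j b)) => [y|]; first by rewrite [RHS]mxE.
  by apply: hol_sum => j; apply: holM; [exact: hA2|exact: hF2].
by apply: holM; [apply: holB; [exact: hol_const|exact: hA2]|exact: hF2].
Qed.

Let hf_hol p a z : E z -> hol (hf p a) z.
Proof.
move=> Ez; apply: holN; apply: holM; last exact: hol_const.
apply: holD; first by apply: holM; [exact: Kf_hol|exact: AF_hol].
by apply: holM; [apply: holB; exact: hol_t|exact: hF2].
Qed.

Let hf_bound p : exists2 c : R, 0 <= c & forall a z, E z -> rn (hf p a z) <= c.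
Proof.
have [B1 h1] := bF p.+2; have [B2 h2] := bF p.+3.
have BK0 : 0 <= BK by rewrite addr_ge0// divr_ge0 ?mulr_ge0 ?rn_ge0// ltW.
have r0' := ltW rpos.
exists (BK * (n%:R * `|BA| * `|B1| + (p.+2%:R + `|BA|) * `|B1|) + 2 * r * `|B2|).
  apply: addr_ge0; last by rewrite !mulr_ge0.
  by apply: mulr_ge0 => //; rewrite addr_ge0 ?mulr_ge0 ?addr_ge0.
move=> a z Ez; have [Dz zr] := Ez; rewrite /hf rnN rnM.
have bA' i' j' : rn (A z.2 i' j') <= `|BA| by apply: le_trans (bA i' j' zr) (ler_norm _).
have b1 i j : rn (F p.+2 z.2 i j) <= `|B1| by apply: le_trans (h1 _ i j zr) (ler_norm _).
have b2 i j : rn (F p.+3 z.2 i j) <= `|B2| by apply: le_trans (h2 _ i j zr) (ler_norm _).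
apply: (@le_trans _ _ (rn (Kf a z * AF p.+2 a z.2 + (z.2 0 a - z.2 0 b) * F p.+3 z.2 a b))).
  by rewrite rnV rn_nat ler_piMr ?rn_ge0// invf_le1 ?ltr0n ?fact_gt0// ler1n fact_gt0.
apply: le_trans (rnD _ _) _; rewrite !rnM; apply: lerD; apply: ler_pM; rewrite ?rn_ge0 ?Kf_bound ?b2//; last first.
  by apply: ltW; exact: rn_coordB.
apply: le_trans (rnD _ _) _; apply: lerD; first exact: rn_mulmx_entry.
rewrite rnM; apply: ler_pM; rewrite ?rn_ge0 ?b1//.
by apply: le_trans (rnB_le _ _) _; rewrite rn_nat lerD2l.
Qed.

Let mu0 : 0 <= mu.
Proof.
have BK0 : 0 <= BK by rewrite addr_ge0// divr_ge0 ?mulr_ge0 ?rn_ge0// ltW.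
apply: addr_ge0; first by apply: mulr_ge0 => //; rewrite addr_ge0// mulr_ge0.
by rewrite !mulr_ge0// ltW.
Qed.

(** On [x^(p+1) H] the Euler operator acts as [x^(p+1)] times itself shifted by [p + 1]; a shift
    above [n mu] makes the system for [H] contractive. *)
Let level p (H : 'I_n -> C * T -> C) i z : C := Pol p.+2 i z + z.1 ^+ p.+1 * H i z.

Let hol_X1 k z : hol (fun z : C * T => z.1 ^+ k) z.
Proof. by eexists; exact: isd_X1. Qed.

Let level_exists p : n%:R * mu < p.+1%:R -> exists (H : 'I_n -> C * T -> C) (K : R),
  (forall i z, E z -> hol (H i) z /\ rn (H i z) <= K) /\
  forall i z, E z -> hol (level p H i) z /\ dd (level p H i) z z = \sum_j aij i j z * level p H j z.
Proof.
move=> pmu; have [c c0 hc] := hf_bound p.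
have [H [K hH]] := euler_exists oE sE aij_hol mu0 aij_bound pmu c0 (hf_hol p) hc.
exists H, K; split=> i z Ez; have [h1 h2 h3] := hH i z Ez => //.
have hl := isdD (ddP (Pol_hol p.+2 i Ez)) (isdM (isd_X1 p.+1 z) (ddP h1)).
split; first by eexists; exact: hl.
rewrite (ddE hl) euler_Pol// x_term.
have -> : \sum_j aij i j z * level p H j z = \sum_j aij i j z * Pol p.+2 j z + z.1 ^+ p.+1 * \sum_j aij i j z * H j z.
  by rewrite mulr_sumr -big_split; apply: eq_bigr => j _; rewrite /level /=; ring.
have -> : \sum_j aij i j z * H j z = dd (H i) z z + p.+1%:R * H i z - hf p i z by rewrite h3; ring.
by rewrite /gf /hf /=; ring.
Qed.

(** The difference of two levels is [x^(p+1) G] with [G] holomorphic, and [G] satisfies the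
    homogeneous system of [euler_unique] where [x] is not 0. So a single function has Taylor
    estimates of every order. *)
Let level_unique p m (H H' : 'I_n -> C * T -> C) (K : R) : (0 < p)%N -> n%:R * mu < p.+1%:R ->
  (forall i z, E z -> hol (H i) z /\ rn (H i z) <= K) -> (forall i z, E z -> hol (H' i) z /\ rn (H' i z) <= K) ->
  (forall i z, E z -> hol (level p H i) z /\ dd (level p H i) z z = \sum_j aij i j z * level p H j z) ->
  (forall i z, E z -> hol (level (p + m) H' i) z /\
     dd (level (p + m) H' i) z z = \sum_j aij i j z * level (p + m) H' j z) ->
  forall i z, E z -> level p H i z = level (p + m) H' i z.
Proof.
move=> p0 pmu hH hH' eH eH' i0 z0 Ez0.
pose G i z : C := H i z - \sum_(k < m) z.1 ^+ k.+1 * (F (p.+2 + k).+1 z.2 i b / (p.+2 + k)`!%:R) - z.1 ^+ m * H' i z.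
have GE i z : level p H i z - level (p + m) H' i z = z.1 ^+ p.+1 * G i z.
  have PE : Pol (p + m).+2 i z = Pol p.+2 i z + \sum_(k < m) z.1 ^+ p.+1 * (z.1 ^+ k.+1 * (F (p.+2 + k).+1 z.2 i b / (p.+2 + k)`!%:R)).
    rewrite /Pol -!addSn big_split_ord; congr (_ + _); apply: eq_bigr => k _.
    by rewrite /term /= [RHS]mulrA -exprD -addSnnS.
  by rewrite /level PE -mulr_sumr /G -addSn exprD; ring.
have hG i z : E z -> hol (G i) z.
  move=> Ez; apply: holB; last by apply: holM; [exact: hol_X1|have [] := hH' i z Ez].
  apply: holB; first by have [] := hH i z Ez.
  by apply: hol_sum => k; apply: holM; [exact: hol_X1|apply: holM; [exact: hF2|exact: hol_const]].
apply/eqP; rewrite -subr_eq0 GE; case: (eqVneq z0.1 0) => [->|x0]; first by rewrite exprS !mul0r.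
(* [G] contains powers of [x], so it is bounded only for bounded [x]; the cut at [|x| < L] keeps the
   domain star-shaped and contains [z0]. *)
pose L := rn z0.1 + 1; have L0 : 0 < L by rewrite ltr_wpDl// rn_ge0.
pose EL : set (C * T) := [set z | E z /\ rn z.1 < L].
have oEL : opn EL.
  move=> z [Ez zL]; have [d d0 hd] := oE Ez; exists (Num.min d (L - rn z.1)); first by rewrite lt_min d0 subr_gt0.
  move=> y; rewrite lt_min => /andP[/hd Ey hy]; split=> //.
  by have := rn_sub y.1 z.1; have := rn_fst (y - z); rewrite /=; lra.
have sEL (s : R) z : 0 <= s <= 1 -> EL z -> EL (s%:C *: z).
  move=> s01 [Ez zL]; split; first exact: sE.
  case/andP: (s01) => s0 s1; have -> : (s%:C *: z).1 = s%:C *: z.1 by [].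
  by rewrite rnZ rn_real ger0_norm//; apply: le_lt_trans zL; rewrite ler_piMl// rn_ge0.
have [Bf hBf] := choice bF.
pose c := K + \sum_(k < m) L ^+ k.+1 * `|Bf (p.+2 + k).+1| + L ^+ m * K.
have bG i z : EL z -> rn (G i z) <= c.
  move=> [Ez zL]; have [Dz zr] := Ez; have xL q : rn (z.1 ^+ q) <= L ^+ q.
    by rewrite rnX lerXn2r ?nnegrE ?rn_ge0 ?ltW.
  apply: le_trans (rnB_le _ _) _; apply: lerD; last first.
    by rewrite rnM; apply: ler_pM; rewrite ?rn_ge0//; have [] := hH' i z Ez.
  apply: le_trans (rnB_le _ _) _; apply: lerD; first by have [] := hH i z Ez.
  apply: le_trans (rn_sum _ _ _) _; apply: ler_sum => k _; rewrite rnM; apply: ler_pM; rewrite ?rn_ge0//.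
  rewrite rnM rnV rn_nat; apply: (@le_trans _ _ (rn (F (p.+2 + k).+1 z.2 i b))).
    by rewrite ler_piMr ?rn_ge0// invf_le1 ?ltr0n ?fact_gt0// ler1n fact_gt0.
  by apply: le_trans (hBf _ _ _ _ zr) (ler_norm _).
suff -> : G i0 z0 = 0 by rewrite mulr0.
apply: (@euler_unique _ _ EL sEL n aij mu p _ mu0 _ pmu G [set z | EL z /\ z.1 != 0] c) => //.
- by move=> i j z [Ez _]; exact: aij_hol.
- by move=> i j z [Ez _]; exact: aij_bound.
- by move=> z [].
- move=> s z /andP[s0 s1] [ELz z1]; split; first by apply: sEL => //; rewrite ltW.
  by have -> : (s%:C *: z).1 = s%:C * z.1 by []; rewrite mulf_neq0// gt_eqF// ltcR.
- by move=> i z [Ez _]; exact: hG.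
- move=> i z [[Ez zL] z1].
  have [h1 e1] := eH i z Ez; have [h2 e2] := eH' i z Ez.
  have d1 : isd (fun z => level p H i z - level (p + m) H' i z) z (fun h => dd (level p H i) z h - dd (level (p + m) H' i) z h).
    by apply: isdB; exact: ddP.
  have d2 := isdM (isd_X1 p.+1 z) (ddP (hG i z Ez)).
  have := isd_unique d1 (isd_ext (fun z => esym (GE i z)) d2) => /(congr1 (fun f => f z)).
  rewrite e1 e2 x_term -sumrB => e3.
  apply: (@mulfI _ (z.1 ^+ p.+1)); first by rewrite expf_neq0.
  rewrite mulrDr [X in _ + X](_ : _ = G i z * (p.+1%:R * z.1 ^+ p.+1)); last by ring.
  rewrite -e3 mulr_sumr; apply: eq_bigr => j _.
  by rewrite -mulrBr GE mulrCA.
- by split; [split=> //; rewrite ltrDl|].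
Qed.

(** The Borel form of the equation in [z]. The Euler system is only a combination of it with the
    deformation equations, so its vanishing on the solution has to be recovered. *)
Let xi (y : 'I_n -> C * T -> C) a z : C := (z.1 + (u0 + z.2) 0 a - (u0 + z.2) 0 b) * dd (y a) z (1, 0)
  + \sum_j A z.2 a j * y j z + (1 - A z.2 b b) * y a z.

Let xi_Pol N a z : E z -> xi (Pol N.+1) a z = z.1 ^+ N / N`!%:R * AF N.+1 a z.2.
Proof.
move=> Ez; have [Dz zr] := Ez.
have dterm k : dd (term k a) z (1, 0) = F k.+1 z.2 a b / k`!%:R * (k%:R * z.1 ^+ k.-1).
  by rewrite (ddE (isd_term k a Ez)) /= (isd_lin0 (ddP (hF k.+1 a b zr))) mul0r mulr0 add0r mul1r.
have dPol : dd (Pol N.+1 a) z (1, 0) = \sum_(k < N.+1) dd (term k a) z (1, 0).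
  by rewrite (ddE (isd_sum _ (fun k : 'I_N.+1 => ddP (ex_intro _ _ (isd_term k a Ez))))).
have aterm k : \sum_j A z.2 a j * term k j z + (1 - A z.2 b b) * term k a z = z.1 ^+ k / k`!%:R * (AF k.+1 a z.2 - k%:R * F k.+1 z.2 a b).
  rewrite /AF [X in _ * (X + _ - _)]mxE -natr1 /term.
  have -> : \sum_j A z.2 a j * (z.1 ^+ k * (F k.+1 z.2 j b / k`!%:R)) = z.1 ^+ k / k`!%:R * \sum_j A z.2 a j * F k.+1 z.2 j b.
    by rewrite mulr_sumr; apply: eq_bigr => j _; ring.
  by ring.
rewrite /xi dPol.
have -> : \sum_j A z.2 a j * Pol N.+1 j z = \sum_(k < N.+1) \sum_j A z.2 a j * term k j z.
  by rewrite exchange_big; apply: eq_bigr => j _; rewrite /Pol mulr_sumr.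
have -> : (1 - A z.2 b b) * Pol N.+1 a z = \sum_(k < N.+1) (1 - A z.2 b b) * term k a z by rewrite /Pol mulr_sumr.
rewrite -[LHS]addrA -big_split /=.
under [X in _ + X]eq_bigr do rewrite aterm.
elim: N {dPol} => [|N IH].
  by rewrite !big_ord1 dterm /=; ring.
rewrite big_ord_recr [X in _ + X]big_ord_recr /= mulrDr addrACA IH dterm /=.
have F1 := AF_rec N.+1 a zr; have f0 := fact_neq0 N; have N0 : N.+1%:R != 0 :> C by rewrite pnatr_eq0.
have -> : AF N.+1 a z.2 = - (((u0 + z.2) 0 a - (u0 + z.2) 0 b) * F N.+2 z.2 a b) by rewrite F1 opprK.
rewrite factS natrM exprS.
move: N0 f0; set c1 : C := N.+1%:R; set c2 : C := N`!%:R; clearbody c1 c2 => N0 f0.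
by field; rewrite ?N0 ?f0.
Qed.

(** Taylor estimates of every order make the defect [xi] flat at [x = 0]; being holomorphic in [x],
    it vanishes on [D]. The exponent [N - 1] is that of the remainder [x^(p+1) H] for [N = p + 2]:
    as [H] is bounded on all of [D], the estimate also gives polynomial growth at infinity. *)
Theorem borel_transform : exists phi : 'I_n -> C * T -> C,
  [/\ forall a x t, D x -> rn t < r -> hol (phi a) (x, t),
      exists N0 : nat, forall N, (N0 <= N)%N -> exists K : R, forall a x t, D x -> rn t < r ->
        rn (phi a (x, t) - \sum_(k < N) x ^+ k * (F k.+1 t a b / k`!%:R)) <= K * rn x ^+ N.-1 
    & forall a x t, D x -> rn t < r ->
        (x + (u0 + t) 0 a - (u0 + t) 0 b) * dd (phi a) (x, t) (1, 0)
        + \sum_j A t a j * phi j (x, t) + (1 - A t b b) * phi a (x, t) = 0].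
Proof.
have [p hp] := nat_above (n%:R * mu + 1).
have p0 : (0 < p)%N.
  rewrite lt0n; apply/eqP => p0; move: hp; rewrite p0; have : 0 <= n%:R * mu by rewrite mulr_ge0.
  lra.
have pmu m : n%:R * mu < (p + m).+1%:R.
  apply: (@lt_le_trans _ _ p%:R); first lra.
  by rewrite ler_nat (leq_trans (leq_addr m p)).
have [H [K [hH eH]]] := level_exists (pmu 0%N); rewrite addn0 in H K hH eH.
have lev m : exists (H' : 'I_n -> C * T -> C) (K' : R), (forall i z, E z -> hol (H' i) z /\ rn (H' i z) <= K') /\
   forall i z, E z -> level p H i z = level (p + m) H' i z.
  have [H' [K' [hH' eH']]] := level_exists (pmu m); exists H', K'; split=> //.
  have h1 : forall i z, E z -> hol (H i) z /\ rn (H i z) <= Num.max K K'.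
    by move=> i z /(hH i)[? ?]; split=> //; rewrite le_max; apply/orP; left.
  have h2 : forall i z, E z -> hol (H' i) z /\ rn (H' i z) <= Num.max K K'.
    by move=> i z /(hH' i)[? ?]; split=> //; rewrite le_max; apply/orP; right.
  by apply: (level_unique p0 _ h1 h2) => //; have := pmu 0%N; rewrite addn0.
have hl i z : E z -> hol (level p H i) z by move=> /(eH i)[].
exists (level p H); split=> [a x t Dx tr|| a x t Dx tr]; first exact: hl.
  exists p.+2 => N pN; have [m {pN}->] : exists m, N = (p + m).+2 by exists (N - p.+2)%N; rewrite -2!addSn subnKC.
  have [H' [K' [hH' eq]]] := lev m; exists K' => a x t Dx tr; rewrite eq// /level /= addrAC subrr add0r rnM rnX mulrC.
  by rewrite ler_wpM2r ?exprn_ge0 ?rn_ge0//; have [] := hH' a (x, t) (conj Dx tr).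
have Dsx (s : R) : 0 <= s <= 1 -> D (0 + s%:C *: (x - 0)) by move=> s01; rewrite add0r subr0; exact: sD.
have xi_hol y : D y -> hol (fun x => xi (level p H) a (x, t)) y.
  move=> Dy; have Ey : E (y, t) by [].
  apply: (@hol_slice1 _ _ _ (xi (level p H) a)).
  apply: holD; last by apply: holM; [apply: holB; [exact: hol_const|exact: hA2]|exact: hl].
  apply: holD; last by apply: hol_sum => j; apply: holM; [exact: hA2|exact: hl].
  apply: holM; first by apply: holB; [apply: holD|]; [exact: hol_x|exact: hol_u|exact: hol_u].
  have [d d0 hd] := oE Ey.
  by apply: (@hol_dd _ _ (level p H a) (y, t) d) => // w /hd; exact: hl.
(* The level [p + q] is used: its Taylor part contributes a multiple of [x^(p+q+1)] by [xi_Pol], and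
   the remainder [x^(p+q+1) H'] loses one power when differentiated. *)
have flat q : exists K d, 0 < d /\ forall w : C, rn w < d -> rn (xi (level p H) a (w, t)) <= K * rn w ^+ q.
  have [H' [K' [hH' eq]]] := lev q.
  pose rem z : C := z.1 / (p + q).+1`!%:R * AF (p + q).+2 a z.2 +
     ((z.1 + (u0 + z.2) 0 a - (u0 + z.2) 0 b) * ((p + q).+1%:R * H' a z + z.1 * dd (H' a) z (1, 0))
      + z.1 * (\sum_j A z.2 a j * H' j z + (1 - A z.2 b b) * H' a z)).
  have xiE z : E z -> xi (level p H) a z = z.1 ^+ (p + q) * rem z.
    move=> Ez; have [Dz zr] := Ez.
    have Ha := (hH' a z Ez).1.
    have hl2 := isdD (ddP (Pol_hol (p + q).+2 a Ez)) (isdM (isd_X1 (p + q).+1 z) (ddP Ha)).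
    have [d d0 hd] := oE Ez.
    have dl : dd (level p H a) z (1, 0) = dd (Pol (p + q).+2 a) z (1, 0) + (z.1 ^+ (p + q).+1 * dd (H' a) z (1, 0)
        + H' a z * (1 * ((p + q).+1%:R * z.1 ^+ (p + q)))).
      have hl3 : isd (level p H a) z (fun h => dd (Pol (p + q).+2 a) z h + (z.1 ^+ (p + q).+1 * dd (H' a) z h
        + H' a z * (h.1 * ((p + q).+1%:R * z.1 ^+ (p + q))))).
        by apply: (isd_near d0 _ hl2) => y /hd Ey; rewrite eq.
      by rewrite (ddE hl3).
    have h3 := xi_Pol (p + q).+1 a Ez; rewrite /xi in h3.
    rewrite /xi dl; under eq_bigr => j _ do rewrite eq// /level mulrDr.
    rewrite big_split eq// /level /=.
    rewrite (_ : \sum_i A z.2 a i * (z.1 ^+ (p + q).+1 * H' i z) = z.1 ^+ (p + q).+1 * \sum_j A z.2 a j * H' j z); last first.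
      by rewrite mulr_sumr; apply: eq_bigr => j _; rewrite mulrCA.
    transitivity (z.1 ^+ (p + q).+1 / (p + q).+1`!%:R * AF (p + q).+2 a z.2 + z.1 ^+ (p + q) *
     ((z.1 + (u0 + z.2) 0 a - (u0 + z.2) 0 b) * ((p + q).+1%:R * H' a z + z.1 * dd (H' a) z (1, 0))
      + z.1 * (\sum_j A z.2 a j * H' j z + (1 - A z.2 b b) * H' a z))).
      by rewrite -h3 exprS; ring.
    by rewrite /rem exprS; ring.
  have E0 : E (0, t) by [].
  have hrem : hol rem (0, t).
    have H'E j : hol (H' j) (0, t) by have [] := hH' j _ E0.
    apply: holD; first by apply: holM; [apply: holM; [exact: hol_x|exact: hol_const]|exact: AF_hol].
    apply: holD; last first.
      apply: holM; first exact: hol_x.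
      apply: holD; first by apply: hol_sum => j; apply: holM; [exact: hA2|exact: H'E].
      by apply: holM; [apply: holB; [exact: hol_const|exact: hA2]|exact: H'E].
    apply: holM; first by apply: holB; [apply: holD|]; [exact: hol_x|exact: hol_u|exact: hol_u].
    apply: holD; first by apply: holM; [exact: hol_const|exact: H'E].
    apply: holM; first exact: hol_x.
    have [d d0 hd] := oE E0.
    by apply: (@hol_dd _ _ (H' a) (0, t) d) => // w /hd Ew; have [] := hH' a w Ew.
  have [d1 d10 hd1] := hol_bounded hrem; have [d2 d20 hd2] := oE E0.
  exists (rn (rem (0, t)) + 1), (Num.min 1 (Num.min d1 d2)); split; first by rewrite !lt_min ltr01 d10.
  move=> w; rewrite !lt_min => /and3P[w1 wd1 wd2].
  have rw : rn ((w, t) - (0, t)) = rn w.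
    have -> : (w, t) - (0, t) = (w, 0) :> C * T by apply: injective_projections => /=; rewrite ?subr0 ?subrr.
    by rewrite rn_pair /= rn0; apply/max_idPl; exact: rn_ge0.
  rewrite xiE; last by apply: hd2; rewrite rw.
  rewrite rnM rnX mulrC /=; apply: ler_pM; rewrite ?rn_ge0 ?exprn_ge0 ?rn_ge0//; first by apply: hd1; rewrite rw.
  by rewrite ler_wiXn2l ?rn_ge0 ?ltW// leq_addl.
have [r' [M' [r'0 hM']]] := opn_hol oD xi_hol D0.
have hM2 w : rn w < r' -> hol (fun x => xi (level p H) a (x, t)) w /\ rn (xi (level p H) a (w, t)) <= M'.
  by move=> hw; apply: hM'; rewrite subr0.
have z0 := flat_eq0 r'0 (fun w hw => (hM2 w hw).1) (fun w hw => (hM2 w hw).2) flat.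
have r4 : 0 < r' / 4 by rewrite divr_gt0.
have := @identity_segment _ _ D (fun x => xi (level p H) a (x, t)) 0 x _ oD xi_hol Dsx r4.
by apply => y; rewrite subr0; exact: z0.
Qed.
End BorelTransform.

(** * Laplace integrals and solutions in sectors *)

Section Laplace.
Variable R : realType.
Local Notation C := R[i].
Variable V : normedModType C.
Variables (D : set C) (r al be : R).
Hypothesis oD : opn D.
Hypothesis sD : forall (s : R) x, 0 <= s <= 1 -> D x -> D (s%:C * x).

Definition dir (th : R) : C := cexp (0 +i* th).

Lemma rn_dir th : rn (dir th) = 1.
Proof. by rewrite /dir rn_cexp /= expR0. Qed.

Hypothesis rayD : forall th (rho : R), al <= th <= be -> 0 <= rho -> D (rho%:C * dir th).
Let E : set (C * V) := [set z | D z.1 /\ rn z.2 < r].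

(** Growth below every exponential, for which the Laplace integral along [th] converges on the whole
    half-plane [Re(z dir th) > 0]. *)
Definition subexp (f : C * V -> C) : Prop := forall dl : R, 0 < dl -> exists2 K : R, 0 <= K &
  forall x t, D x -> rn t < r -> rn (f (x, t)) <= K * expR (dl * rn x).

Definition lap_int (f : C * V -> C) (z : C) (x : C * V) : C := prim (fun x => cexp (- (z * x.1)) * f x) x.

(* The Laplace integral along the ray of direction [th], which is 0 if it does not converge. *)
Definition lap (f : C * V -> C) (th : R) (z : C) (t : V) : C :=
  xget 0 (clim (fun k => lap_int f z (k%:R%:C * dir th, t))).

Let oE : opn E.
Proof.
move=> [x t] [/= Dx tr]; have [d d0 hd] := oD Dx.
exists (Num.min d (r - rn t)); first by rewrite lt_min d0 subr_gt0.
move=> [y s]; rewrite -[_ - _]/(y - x, s - t) => /rn_pair_lt; rewrite !lt_min => -[/andP[h1 _] /andP[_ h2]].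
by split; [exact: hd|have := rn_sub s t; rewrite /=; lra].
Qed.

Lemma Re_realM (a : R) (z : C) : complex.Re (a%:C * z) = a * complex.Re z.
Proof. by rewrite ReM mul0r subr0. Qed.

Lemma rn_kernel th (rho : R) (z : C) : rn (cexp (- (z * (rho%:C * dir th)))) = expR (- (rho * complex.Re (z * dir th))).
Proof. by rewrite mulrCA rn_cexp ReN Re_realM. Qed.

Section Good.
Variable f : C * V -> C.
Hypothesis hf : forall x t, D x -> rn t < r -> hol f (x, t).

Let hker z x : E x -> hol (fun x : C * V => cexp (- (z * x.1)) * f x) x.
Proof.
case: x => x t [/= Dx tr]; apply: holM; last exact: hf.
by apply: hol_cexp; apply: holN; apply: holM; [exact: hol_const|exact: hol_fst].
Qed.

Lemma lap_int_hol z x t : D x -> rn t < r ->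
  hol (lap_int f z) (x, t) /\ dd (lap_int f z) (x, t) (1, 0) = cexp (- (z * x)) * f (x, t).
Proof. by move=> Dx tr; apply: (prim_hol oE (hker z)) => s s01; split=> //=; exact: sD. Qed.

(** As [lap_int] is a primitive in [x], its increments along a path in [D] are integrals along that
    path: rays in [lap_int_major], arcs in [lap_rot]. *)
Lemma lap_int_path z t (g : R -> C) (s : R) (l : C) : D (g s) -> rn t < r -> rder g s l ->
  rder (fun s => lap_int f z (g s, t)) s (l * (cexp (- (z * g s)) * f (g s, t))).
Proof.
move=> Ds tr hg; have [h1 h2] := lap_int_hol z Ds tr.
have hs := isd_slice1 (ddP h1).
have E1 (h : C) : dd (lap_int f z) (g s, t) (h, 0) = h * (cexp (- (z * g s)) * f (g s, t)).
  have -> : (h, 0) = h *: (1, 0) :> C * V by apply: injective_projections => /=; rewrite ?mulr1 ?scaler0//; rewrite /GRing.scale /= mulr1.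
  by rewrite (isd_linZ _ _ (ddP h1)) h2.
move=> e e0; set b := cexp _ * f _ in E1 *.
pose K := rn l + 1; have K0 : 0 < K by rewrite ltr_wpDl ?rn_ge0.
have [_ _ hd] := hs; have [|d d0 {}hd] := hd (e / 2 / K); first by rewrite !divr_gt0.
have b1 : 0 < rn b + 1 by rewrite ltr_wpDl ?rn_ge0.
have [|d1 d10 h1'] := hg (Num.min 1 (e / 2 / (rn b + 1))); first by rewrite lt_min ltr01 !divr_gt0.
exists (Num.min d1 (d / K)); first by rewrite lt_min d10 divr_gt0.
move=> h; rewrite lt_min => /andP[hd1 hdK].
have dg := h1' h hd1; set dlt := g (s + h) - g s in dg.
have m1 : Num.min 1 (e / 2 / (rn b + 1)) <= 1 by rewrite ge_min lexx.
have m2 : Num.min 1 (e / 2 / (rn b + 1)) <= e / 2 / (rn b + 1) by rewrite ge_min lexx orbT.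
have rd : rn dlt <= K * `|h|.
  have := rn_sub dlt (h%:C * l); rewrite rnM rn_real /K mulrDl mul1r.
  have : rn (dlt - h%:C * l) <= `|h| by apply: le_trans dg _; rewrite ler_piMl.
  by rewrite [rn l * _]mulrC; lra.
have := hd dlt _; rewrite /dlt subrKC -/dlt E1 => /(_ _)/wrap[].
  by apply: le_lt_trans rd _; rewrite mulrC -ltr_pdivlMr.
move=> h3; have -> : lap_int f z (g (s + h), t) - lap_int f z (g s, t) - h%:C * (l * b) =
   (lap_int f z (g (s + h), t) - lap_int f z (g s, t) - dlt * b) + (dlt - h%:C * l) * b by ring.
apply: le_trans (rnD _ _) _; rewrite (_ : e * `|h| = e / 2 * `|h| + e / 2 * `|h|); last by lra.
apply: lerD.
  apply: le_trans h3 _; apply: (@le_trans _ _ (e / 2 / K * (K * `|h|))).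
    by rewrite ler_wpM2l// divr_ge0 ?divr_ge0// ltW.
  by rewrite mulrA divfK// gt_eqF.
rewrite rnM; apply: (@le_trans _ _ (e / 2 / (rn b + 1) * `|h| * rn b)).
  rewrite ler_wpM2r ?rn_ge0//; apply: le_trans dg _; by rewrite ler_wpM2r.
apply: (@le_trans _ _ (e / 2 / (rn b + 1) * `|h| * (rn b + 1))).
  by rewrite ler_wpM2l ?lerDl// mulr_ge0// !divr_ge0// ltW.
by rewrite mulrAC divfK// gt_eqF.
Qed.

Lemma lap_int_major th z t (c B rho1 rho2 : R) : al <= th <= be -> rn t < r -> 0 < c -> c <= complex.Re (z * dir th) ->
  0 <= rho1 <= rho2 -> (forall s, rho1 <= s <= rho2 -> rn (f (s%:C * dir th, t)) <= B * expR (c / 2 * s)) ->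
  rn (lap_int f z (rho2%:C * dir th, t) - lap_int f z (rho1%:C * dir th, t)) <=
    2 * B / c * (expR (- (c / 2 * rho1)) - expR (- (c / 2 * rho2))).
Proof.
move=> hth tr c0 cz /andP[r10 r12] hB.
have hrd (s : R) : rder (fun s : R => s%:C * dir th) s (dir th).
  move=> e e0; exists 1 => // h _; rewrite (_ : _ - _ - _ = 0); last by rewrite rmorphD /=; ring.
  rewrite rn0.
  by rewrite mulr_ge0// ltW.
have := @rmvi _ (fun s : R => lap_int f z (s%:C * dir th, t)) (fun s : R => dir th * (cexp (- (z * (s%:C * dir th))) * f (s%:C * dir th, t)))
  (fun s => - (2 * B / c) * expR (- (c / 2 * s))) (fun s => B * expR (- (c / 2 * s))) rho1 rho2 r12.
rewrite (_ : - (2 * B / c) * _ - _ = 2 * B / c * (expR (- (c / 2 * rho1)) - expR (- (c / 2 * rho2)))); last by ring.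
apply.
- by move=> s /andP[s1 _]; apply: lap_int_path => //; apply: rayD => //; lra.
- move=> s _.
  have -> : B * expR (- (c / 2 * s)) = - (2 * B / c) * (- (c / 2) * expR (- (c / 2 * s))) by field; rewrite gt_eqF.
  apply: is_deriveZ.
  have h1 : is_derive s 1 (fun s => - (c / 2 * s)) (- (c / 2)).
    have -> : - (c / 2) = (- (c / 2)) *: (1 : R) by rewrite /GRing.scale /= mulr1.
    have -> : (fun s : R => - (c / 2 * s)) = (- (c / 2)) \*: id by apply/funext => u /=; rewrite /GRing.scale /= mulNr.
    exact: is_deriveZ.
  have := @is_derive1_comp R expR (fun s => - (c / 2 * s)) s _ _ (is_derive_expR _) h1.
  by move=> h; rewrite [_ * expR _]mulrC; exact: h.
- move=> s hs; rewrite rnM rn_dir mul1r rnM rn_kernel; have s0 : 0 <= s by lra.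
  apply: (@le_trans _ _ (expR (- (s * c)) * (B * expR (c / 2 * s)))).
    apply: ler_pM; rewrite ?expR_ge0 ?rn_ge0//; last exact: hB.
    by rewrite ler_expR lerN2 ler_wpM2l.
  by rewrite mulrCA -expRD (_ : - (s * c) + c / 2 * s = - (c / 2 * s))//; lra.
Qed.
Hypothesis gf : subexp f.

Lemma exp_small (c B e : R) : 0 < c -> 0 < e -> exists N, forall k, (N <= k)%N -> B * expR (- (c * k%:R)) <= e.
Proof.
move=> c0 e0; have [N hN] := nat_above (`|B| / e / c); exists N => k Nk.
have k1 : `|B| / e <= c * k%:R.
  by rewrite [leRHS]mulrC -ler_pdivrMr//; apply: le_trans hN _; rewrite ler_nat.
rewrite expRN; have ek := expR_gt0 (c * k%:R).
rewrite ler_pdivrMr//; apply: le_trans (ler_norm _) _.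
rewrite -ler_pdivrMl// mulrC; apply: le_trans k1 _.
by have := expR_ge1Dx (c * k%:R); lra.
Qed.

Lemma lap_cvg th z t (c : R) : al <= th <= be -> rn t < r -> 0 < c -> c <= complex.Re (z * dir th) ->
  clim (fun k => lap_int f z (k%:R%:C * dir th, t)) (lap f th z t).
Proof.
move=> hth tr c0 cz; have [K K0 hK] := gf (divr_gt0 c0 (ltr0n _ 2)).
suff [l hl] : exists l, clim (fun k => lap_int f z (k%:R%:C * dir th, t)) l.
  by rewrite /lap; case: xgetP => [l' -> //|/(_ l hl)].
have maj (k m : nat) : (k <= m)%N -> rn (lap_int f z (m%:R%:C * dir th, t) - lap_int f z (k%:R%:C * dir th, t)) <= 2 * K / c * expR (- (c / 2 * k%:R)).
  move=> km; apply: le_trans (@lap_int_major th z t c K k%:R m%:R hth tr c0 cz _ _) _.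
  - by rewrite ler0n ler_nat.
  - move=> s /andP[s0 _]; have s0' : 0 <= s by apply: le_trans s0; exact: ler0n.
    have := hK _ _ (rayD hth s0') tr; by rewrite rnM rn_dir mulr1 rn_real ger0_norm.
  - by rewrite ler_wpM2l ?divr_ge0 ?mulr_ge0 ?(ltW c0)// gerBl expR_ge0.
apply: clim_cauchy => e e0.
have [N hN] := exp_small (2 * K / c) (divr_gt0 c0 (ltr0n _ 2)) e0.
exists N => k m Nk Nm; case: (leqP k m) => km; last first.
  by apply: le_trans (maj _ _ (ltnW km)) _; exact: hN.
by rewrite rnB; apply: le_trans (maj _ _ km) _; exact: hN.
Qed.

Lemma lap_bound th z t (c B : R) : al <= th <= be -> rn t < r -> 0 < c -> c <= complex.Re (z * dir th) -> 0 <= B ->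
  (forall s, 0 <= s -> rn (f (s%:C * dir th, t)) <= B * expR (c / 2 * s)) -> rn (lap f th z t) <= 2 * B / c.
Proof.
move=> hth tr c0 cz B0 hB; apply: (clim_le (lap_cvg hth tr c0 cz)) => k.
have := @lap_int_major th z t c B 0 k%:R hth tr c0 cz; rewrite lexx ler0n => /(_ isT)/(_ _)/wrap[].
  by move=> s /andP[s0 _]; exact: hB.
rewrite mul0r {1 2}/lap_int {2}/prim mul0r subr0 => h; apply: le_trans h _.
have c2 : 0 <= 2 * B / c by rewrite divr_ge0 ?mulr_ge0// ltW.
by rewrite ler_piMr// mulr0 oppr0 expR0 gerBl expR_ge0.
Qed.

(** The integrals truncated at radius [k] differ by the increment of [lap_int] on an arc of length
    [k (th2 - th1)], where the integrand is at most [K exp(-c k / 2)]. *)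
Lemma lap_rot th1 th2 z t (c : R) : al <= th1 -> th1 <= th2 -> th2 <= be -> rn t < r -> 0 < c ->
  (forall th, th1 <= th <= th2 -> c <= complex.Re (z * dir th)) -> lap f th1 z t = lap f th2 z t.
Proof.
move=> a1 a12 a2 tr c0 cz; have [K K0 hK] := gf (divr_gt0 c0 (ltr0n _ 2)).
have h1 : al <= th1 <= be by rewrite a1 (le_trans a12).
have h2 : al <= th2 <= be by rewrite a2 (le_trans a1).
have l1 := lap_cvg h1 tr c0 (cz th1 _); have l2 := lap_cvg h2 tr c0 (cz th2 _).
have {l1 l2} := climB (l2 _) (l1 _); rewrite !lexx a12 => /(_ isT isT) l12.
apply/eqP; rewrite eq_sym -subr_eq0; apply/eqP; apply: (clim_unique l12) => e e0.
(* The factor [4 / c] comes from [k exp(-c k / 2) <= 4 / c exp(-c k / 4)]. *)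
have [N hN] := exp_small (4 / c * K * (th2 - th1)) (divr_gt0 c0 (ltr0n _ 4)) e0.
exists N => k Nk; rewrite subr0.
have hrd (s : R) : rder (fun s : R => k%:R%:C * dir s) s (k%:R%:C * ('i * dir s)).
  have hd : isd (fun w : C => k%:R%:C * cexp ('i * w)) s%:C (fun h => k%:R%:C * (('i * h) * cexp ('i * s%:C))).
    apply: isdZ; have hi : isd (fun w : C => 'i * w) s%:C (fun h => 'i * h) by apply: isdZ; exact: isd_id.
    exact: isd_chain hi (isd_cexp _).
  have := hol_real (ex_intro _ _ hd); rewrite (ddE hd) mulr1.
  have E1 (u : R) : cexp ('i * u%:C) = dir u by rewrite /dir; congr (cexp _); apply: complexP => /=; ring.
  by rewrite E1; apply: rder_ext => u; rewrite E1.
apply: le_trans (@rmvi_le _ (fun s : R => lap_int f z (k%:R%:C * dir s, t)) _ (K * expR (- (c / 2 * k%:R)) * k%:R) _ _ a12 _ _) _.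
- by move=> s /andP[s1 s2]; apply: lap_int_path => //; apply: rayD => //; rewrite (le_trans a1 s1) (le_trans s2).
- move=> s hs; have Ds : D (k%:R%:C * dir s) by apply: rayD => //; case/andP: hs => s1 s2; rewrite (le_trans a1 s1) (le_trans s2).
  have rr : rn (k%:R%:C * ('i * dir s)) = k%:R.
    by rewrite (rnM k%:R%:C) (rnM 'i) rn_i rn_dir !mulr1 rn_real ger0_norm.
  rewrite rnM rr mulrC ler_wpM2r// rnM rn_kernel.
  have := hK _ _ Ds tr; rewrite rnM rn_dir mulr1 rn_real ger0_norm// => h3.
  apply: (@le_trans _ _ (expR (- (k%:R * c)) * (K * expR (c / 2 * k%:R)))).
    by apply: ler_pM; rewrite ?expR_ge0 ?rn_ge0// ler_expR lerN2 ler_wpM2l// cz.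
  by rewrite mulrCA -expRD (_ : - (k%:R * c) + c / 2 * k%:R = - (c / 2 * k%:R))//; lra.
- apply: le_trans (hN k Nk).
  have y0 : c / 4 * k%:R <= expR (c / 4 * k%:R) by have := expR_ge1Dx (c / 4 * k%:R); lra.
  have y1 : k%:R <= 4 / c * expR (c / 4 * k%:R).
    by rewrite -ler_pdivrMl ?divr_gt0// invf_div.
  have -> : expR (- (c / 2 * k%:R)) = expR (- (c / 4 * k%:R)) * expR (- (c / 4 * k%:R)) by rewrite -expRD; congr expR; lra.
  have ee : expR (- (c / 4 * k%:R)) * expR (c / 4 * k%:R) = 1 by rewrite -expRD addNr expR0.
  have P0 : 0 <= K * (expR (- (c / 4 * k%:R)) * expR (- (c / 4 * k%:R))) by rewrite !mulr_ge0 ?expR_ge0.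
  apply: (@le_trans _ _ (K * (expR (- (c / 4 * k%:R)) * expR (- (c / 4 * k%:R))) * (4 / c * expR (c / 4 * k%:R)) * (th2 - th1))).
    by rewrite ler_wpM2r ?subr_ge0// ler_wpM2l.
  rewrite (_ : _ * (th2 - th1) = 4 / c * K * (th2 - th1) * expR (- (c / 4 * k%:R)) * (expR (- (c / 4 * k%:R)) * expR (c / 4 * k%:R))); last by ring.
  by rewrite ee mulr1.
Qed.

(** The truncated integrals are holomorphic in [(z, t)] jointly and uniformly bounded near the
    point, so [vitali] gives the limit and its derivative in [z]. *)
Lemma lap_hol th z t : al <= th <= be -> rn t < r -> 0 < complex.Re (z * dir th) ->
  hol (fun p : C * V => lap f th p.1 p.2) (z, t) /\
  dd (fun p : C * V => lap f th p.1 p.2) (z, t) (1, 0) = lap (fun x => - (x.1 * f x)) th z t.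
Proof.
move=> hth tr z0; pose c := complex.Re (z * dir th) / 2; have c0 : 0 < c by rewrite divr_gt0.
have [K K0 hK] := gf (divr_gt0 c0 (ltr0n _ 2)).
pose d := Num.min c (r - rn t); have d0 : 0 < d by rewrite lt_min c0 subr_gt0.
have near p : rn (p - (z, t)) < d -> c <= complex.Re (p.1 * dir th) /\ rn p.2 < r.
  case: p => [y s]; rewrite -[_ - _]/(y - z, s - t) => /rn_pair_lt; rewrite !lt_min => -[/andP[h1 _] /andP[_ h2]].
  split; last by have := rn_sub s t; rewrite /=; lra.
  have := le_trans (ler_norm _) (Re_le_rn ((z - y) * dir th)); rewrite rnM rn_dir mulr1 rnB mulrBl ReD ReN.
  by rewrite /= /c in h1 *; lra.
pose kf k (s : R) (p : C * V) : C := cexp (- (p.1 * (s%:C * (k%:R%:C * dir th)))) * f (s%:C * (k%:R%:C * dir th), p.2).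
have Dk k (s : R) : 0 <= s <= 1 -> D (s%:C * (k%:R%:C * dir th)) by move=> s01; apply: sD => //; exact: rayD.
have liE k (p : C * V) : lap_int f p.1 (k%:R%:C * dir th, p.2) = k%:R%:C * dir th * cint (fun s => kf k s p) by [].
have isk k s p : 0 <= s <= 1 -> rn (p - (z, t)) < d -> hol (kf k s) p.
  move=> s01 /near[_ pr]; apply: holM.
    apply: hol_cexp; apply: holN; apply: holM; last exact: hol_const.
    by case: (p) => ? ?; exact: hol_fst.
  case: p pr => y s' pr; apply: (@hol_snd _ _ _ (fun t => f (s%:C * (k%:R%:C * dir th), t))).
  by apply: hol_slice2; apply: hf => //; exact: Dk.
have ck k p : rn (p - (z, t)) < d -> cont01 (fun s => kf k s p).
  move=> /near[_ pr]; apply: (@prim_cont _ _ E (fun x => cexp (- (p.1 * x.1)) * f x) (k%:R%:C * dir th, p.2)); first exact: hker.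
  by move=> s s01; split=> //=; exact: Dk.
have bk k s p : 0 <= s <= 1 -> rn (p - (z, t)) < d -> rn (kf k s p) <= expR ((rn z + d) * k%:R) * (K * expR (c / 2 * k%:R)).
  move=> s01 /[dup] pd /near[_ pr]; have Ds := Dk k s s01.
  have rx : rn (s%:C * (k%:R%:C * dir th)) <= k%:R.
    rewrite (rnM s%:C) (rnM k%:R%:C) rn_dir mulr1 !rn_real [`|k%:R|]ger0_norm//; move: s01 => /andP[s0 s1].
    by rewrite ger0_norm// ler_piMl.
  rewrite rnM; apply: ler_pM; rewrite ?rn_ge0//; last first.
    by apply: le_trans (hK _ _ Ds pr) _; rewrite ler_wpM2l// ler_expR ler_wpM2l// divr_ge0// ltW.
  rewrite rn_cexp ler_expR; apply: le_trans (ler_norm _) _; apply: le_trans (Re_le_rn _) _.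
  rewrite rnN rnM; apply: ler_pM; rewrite ?rn_ge0//.
  have := rn_sub p.1 z; have := rn_fst (p - (z, t)); rewrite /= => h1 h2; lra.
have hk k p : rn (p - (z, t)) < d -> hol (fun p : C * V => lap_int f p.1 (k%:R%:C * dir th, p.2)) p /\
    dd (fun p : C * V => lap_int f p.1 (k%:R%:C * dir th, p.2)) p (1, 0) = lap_int (fun x => - (x.1 * f x)) p.1 (k%:R%:C * dir th, p.2).
  move=> pd; have d' : 0 < d - rn (p - (z, t)) by rewrite subr_gt0.
  have tri y : rn (y - p) < d - rn (p - (z, t)) -> rn (y - (z, t)) < d.
    by have := rn_tri y p (z, t); lra.
  have [h1 h2] := @cint_hol _ _ (kf k) p _ _ d' (fun s y s01 hy => conj (isk k s y s01 (tri y hy)) (bk k s y s01 (tri y hy))) (fun y hy => ck k y (tri y hy)).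
  have h3 := isdZ (k%:R%:C * dir th) (ddP h1); split; first by eexists; exact: (isd_ext (fun p => esym (liE k p)) h3).
  rewrite (ddE (isd_ext (fun p => esym (liE k p)) h3)) /lap_int /prim /=; congr (_ * _).
  have [_ pr] := near _ pd.
  pose g s := cexp (- (p.1 * (s%:C * (k%:R%:C * dir th)))) * - ((s%:C * (k%:R%:C * dir th)) * f (s%:C * (k%:R%:C * dir th), p.2)).
  have cg : cont01 g.
    have hker2 : forall x, E x -> hol (fun x : C * V => cexp (- (p.1 * x.1)) * - (x.1 * f x)) x.
      case=> x s [/= Dx sr]; apply: holM; last by apply: holN; apply: holM; [exact: hol_fst|exact: hf].
      by apply: hol_cexp; apply: holN; apply: holM; [exact: hol_const|exact: hol_fst].
    apply: (@prim_cont _ _ E (fun x => cexp (- (p.1 * x.1)) * - (x.1 * f x)) (k%:R%:C * dir th, p.2) hker2).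
    by move=> s s01; split=> //=; exact: Dk.
  apply: (clim_unique (h2 (1, 0))); apply: clim_ext (cintP cg) => m; apply: rsum_eq => s s01.
  have Ds := Dk k s s01; set x := s%:C * (k%:R%:C * dir th) in Ds *.
  have e1 : isd (fun p : C * V => cexp (- (p.1 * x))) p (fun h => (- (h.1 * x)) * cexp (- (p.1 * x))).
    have e0 : isd (fun p : C * V => - (p.1 * x)) p (fun h => - (h.1 * x)).
      apply: isdN; apply: isd_eqL (isd_ext _ (isdZ x (isd_fst p))) => u; by rewrite mulrC.
    exact: isd_chain e0 (isd_cexp _).
  have e2 : isd (fun p : C * V => f (x, p.2)) p (fun h => dd f (x, p.2) (0, h.2)).
    apply: (@isd_pair _ _ _ (fun t => f (x, t)) p (fun h => dd f (x, p.2) (0, h))).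
    by apply: isd_slice2; apply: ddP; exact: hf.
  rewrite (ddE (isdM e1 e2)) /= (isd_lin0 (ddP (hf Ds pr))) mulr0 add0r mul1r /g -/x; ring.
have bd k p : rn (p - (z, t)) < d -> rn (lap_int f p.1 (k%:R%:C * dir th, p.2)) <= 2 * K / c.
  move=> /near[cp pr].
  have := @lap_int_major th p.1 p.2 c K 0 k%:R hth pr c0 cp; rewrite lexx ler0n => /(_ isT)/(_ _)/wrap[].
    by move=> s /andP[s0 _]; have := hK _ _ (rayD hth s0) pr; rewrite rnM rn_dir mulr1 rn_real ger0_norm.
  rewrite mul0r {1 2}/lap_int {2}/prim mul0r subr0 => h; apply: le_trans h _.
  have c2 : 0 <= 2 * K / c by rewrite divr_ge0 ?mulr_ge0// ltW.
  by rewrite ler_piMr// mulr0 oppr0 expR0 gerBl expR_ge0.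
have cv p : rn (p - (z, t)) < d -> clim (fun k => lap_int f p.1 (k%:R%:C * dir th, p.2)) (lap f th p.1 p.2).
  by move=> /near[cp pr]; exact: lap_cvg cp.
have [h1 h2] := @vitali _ _ (fun k (p : C * V) => lap_int f p.1 (k%:R%:C * dir th, p.2)) (fun p => lap f th p.1 p.2) (z, t) d (2 * K / c) d0
  (fun k p hp => (hk k p hp).1) bd cv.
split=> //; have zt : rn ((z, t) - (z, t)) < d by rewrite subrr rn0.
have h3 := clim_ext (fun k => (hk k (z, t) zt).2) (h2 (1, 0)).
by rewrite /lap /=; case: xgetP => [l' _ hl'|/(_ _ h3)//]; exact: clim_unique h3 hl'.
Qed.
End Good.

Definition lap_good (f : C * V -> C) : Prop := (forall x t, D x -> rn t < r -> hol f (x, t)) /\ subexp f.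

Lemma lap_good_lin a f g : lap_good f -> lap_good g -> lap_good (fun x => a * f x + g x).
Proof.
move=> [hf sf] [hg sg]; split.
  by move=> x t Dx tr; apply: holD; [apply: holM; [exact: hol_const|exact: hf]|exact: hg].
move=> dl dl0; have [K K0 hK] := sf _ dl0; have [K' K'0 hK'] := sg _ dl0.
exists (rn a * K + K'); first by rewrite addr_ge0// mulr_ge0// rn_ge0.
move=> x t Dx tr; apply: le_trans (rnD _ _) _; rewrite mulrDl; apply: lerD; last exact: hK'.
by rewrite rnM -mulrA ler_wpM2l ?rn_ge0// hK.
Qed.

Lemma lap_good0 : lap_good (fun=> 0).
Proof.
split; first by move=> *; exact: hol_const.
by move=> dl _; exists 0 => // x t _ _; rewrite rn0 mul0r.
Qed.

Lemma lap_lin a f g th z t : lap_good f -> lap_good g -> al <= th <= be -> rn t < r -> 0 < complex.Re (z * dir th) ->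
  lap (fun x => a * f x + g x) th z t = a * lap f th z t + lap g th z t.
Proof.
move=> gf gg hth tr z0; have [hl sl] := lap_good_lin a gf gg.
have [hf sf] := gf; have [hg sg] := gg.
apply: (clim_unique (lap_cvg hl sl hth tr z0 (lexx _))).
have c1 := climD (climM a (lap_cvg hf sf hth tr z0 (lexx _))) (lap_cvg hg sg hth tr z0 (lexx _)).
apply: clim_ext c1 => k.
have Dk (s : R) : 0 <= s <= 1 -> D (s%:C * (k%:R%:C * dir th)) by move=> s01; apply: sD => //; exact: rayD.
have ck h : (forall x t, D x -> rn t < r -> hol h (x, t)) ->
   cont01 (fun s : R => cexp (- (z * (s%:C * (k%:R%:C * dir th)))) * h (s%:C * (k%:R%:C * dir th), t)).
  move=> hh; apply: (@prim_cont _ _ E (fun x => cexp (- (z * x.1)) * h x) (k%:R%:C * dir th, t)).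
    case=> x s [/= Dx sr]; apply: holM; last exact: hh.
    by apply: hol_cexp; apply: holN; apply: holM; [exact: hol_const|exact: hol_fst].
  by move=> s s01; split=> //=; exact: Dk.
have cf := ck f hf; have cg := ck g hg.
rewrite /lap_int /prim /= mulrCA -(cintZ a cf) -mulrDr; congr (_ * _); rewrite -(cintD (cont01Z a cf) cg).
by apply: cint_eq => s _; ring.
Qed.

Lemma lap0 th z t : lap (fun=> 0) th z t = 0.
Proof.
rewrite /lap (_ : (fun k => _) = fun=> 0).
  by case: xgetP => [l' _ hl|/(_ 0 (clim_const 0))//]; exact: clim_unique hl (clim_const _).
apply/funext => k; rewrite /lap_int /prim; rewrite (_ : cint _ = 0) ?mulr0//.
by rewrite -[RHS](cint_const 0); apply: cint_eq => s _; rewrite mulr0.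
Qed.

Lemma lap_sum (I : Type) (s : seq I) (c : I -> C) (f : I -> C * V -> C) : (forall i, lap_good (f i)) ->
  lap_good (fun x => \sum_(i <- s) c i * f i x) /\
  forall th z t, al <= th <= be -> rn t < r -> 0 < complex.Re (z * dir th) ->
  lap (fun x => \sum_(i <- s) c i * f i x) th z t = \sum_(i <- s) c i * lap (f i) th z t.
Proof.
move=> gf; elim: s => [|i s [IH1 IH2]].
  have E0 : (fun x : C * V => \sum_(i <- [::]) c i * f i x) = fun=> 0 by apply/funext => x; rewrite big_nil.
  rewrite E0; split; first exact: lap_good0.
  by move=> th z t _ _ _; rewrite lap0 big_nil.
have E1 : (fun x : C * V => \sum_(i <- i :: s) c i * f i x) = fun x => c i * f i x + \sum_(i <- s) c i * f i x.
  by apply/funext => x; rewrite big_cons.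
rewrite E1; split; first exact: lap_good_lin.
by move=> th z t hth tr z0; rewrite lap_lin// big_cons IH2.
Qed.

(** Integration by parts. It is first an identity between primitives, since the function [h] below
    is constant along the segment from 0; at infinity the term [exp(-z x) g] disappears. *)
Lemma lap_deriv f g th z t : lap_good f -> lap_good g -> (forall x, D x -> dd g (x, t) (1, 0) = f (x, t)) ->
  al <= th <= be -> rn t < r -> 0 < complex.Re (z * dir th) ->
  lap f th z t = z * lap g th z t - g (0, t).
Proof.
move=> [hf sf] [hg sg] fg hth tr z0.
have D0 : D 0 by have := rayD hth (lexx 0); rewrite mul0r.
have E1 x : D x -> lap_int f z (x, t) = z * lap_int g z (x, t) + cexp (- (z * x)) * g (x, t) - g (0, t).
  move=> Dx; pose h (p : C * V) := lap_int f z p - z * lap_int g z p - cexp (- (z * p.1)) * g p.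
  suff : h ((0, t) + (x, 0)) = h (0, t).
    have -> : (0, t) + (x, 0) = (x, t) :> C * V by apply: injective_projections => /=; rewrite ?add0r ?addr0.
    have -> : h (0, t) = - g (0, t) by rewrite /h /lap_int !prim0 /= !mulr0 ?(oppr0, cexp0, mul1r, addr0, add0r).
    have -> : h (x, t) = lap_int f z (x, t) - z * lap_int g z (x, t) - cexp (- (z * x)) * g (x, t) by [].
    move=> h1; rewrite -[in RHS](opprK (g (0, t))) -h1; ring.
  apply: const_seg => s s01.
  have -> : (0, t) + s%:C *: (x, 0) = (s%:C * x, t) :> C * V.
    by apply: injective_projections => /=; rewrite ?add0r// scaler0 addr0.
  have Dsx := sD s01 Dx; have [h1 d1] := lap_int_hol hf z Dsx tr; have [h2 d2] := lap_int_hol hg z Dsx tr.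
  have e0 : isd (fun p : C * V => - (z * p.1)) (s%:C * x, t) (fun h => - (z * h.1)).
    by apply: isdN; apply: isdZ; exact: isd_fst.
  have e1 := isd_chain e0 (isd_cexp _).
  have hh := isdB (isdB (ddP h1) (isdZ z (ddP h2))) (isdM e1 (ddP (hg _ _ Dsx tr))).
  split; first by eexists; exact: hh.
  rewrite (ddE hh) /=.
  have -> : (x, 0) = x *: (1, 0) :> C * V by apply: injective_projections => /=; rewrite ?scaler0//; rewrite /GRing.scale /= mulr1.
  rewrite (isd_linZ _ _ (ddP h1)) (isd_linZ _ _ (ddP h2)) (isd_linZ _ _ (ddP (hg _ _ Dsx tr))) d1 d2 fg//=.
  by rewrite /GRing.scale /=; ring.
apply: (clim_unique (lap_cvg hf sf hth tr z0 (lexx _))).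
set c := complex.Re (z * dir th) in z0.
have small : clim (fun k : nat => cexp (- (z * (k%:R%:C * dir th))) * g (k%:R%:C * dir th, t)) 0.
  move=> e e0; have [K K0 hK] := sg _ (divr_gt0 z0 (ltr0n _ 2)).
  have [N hN] := exp_small K (divr_gt0 z0 (ltr0n _ 2)) e0.
  exists N => k Nk; rewrite subr0; apply: le_trans (hN k Nk).
  have Dk : D (k%:R%:C * dir th) by exact: rayD.
  rewrite rnM rn_kernel -/c.
  have := hK _ _ Dk tr; rewrite rnM rn_dir mulr1 rn_real ger0_norm// => h3.
  apply: (@le_trans _ _ (expR (- (k%:R * c)) * (K * expR (c / 2 * k%:R)))).
    by rewrite ler_wpM2l ?expR_ge0.
  by rewrite mulrCA -expRD (_ : - (k%:R * c) + c / 2 * k%:R = - (c / 2 * k%:R))//; lra.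
have c1 := climB (climD (climM z (lap_cvg hg sg hth tr z0 (lexx _))) small) (clim_const (g (0, t))).
rewrite addr0 in c1; apply: clim_ext c1 => k; rewrite [RHS]E1//; exact: rayD.
Qed.

Lemma pow_exp (x d : R) k : 0 < d -> 0 <= x -> x ^+ k <= k`!%:R / d ^+ k * expR (d * x).
Proof.
move=> d0 x0; have := pow_fact_le_exp k (mulr_ge0 (ltW d0) x0).
rewrite ler_pdivrMr ?ltr0n ?fact_gt0// exprMn mulrC -ler_pdivlMr ?exprn_gt0//.
by rewrite [_ * expR _]mulrC mulrA.
Qed.

Lemma lap_good_mono k : lap_good (fun x => x.1 ^+ k).
Proof.
split; first by move=> x t _ _; apply: holX; exact: hol_fst.
move=> dl dl0; exists (k`!%:R / dl ^+ k); first by rewrite divr_ge0// exprn_ge0// ltW.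
by move=> x t _ _; rewrite rnX pow_exp// rn_ge0.
Qed.

Lemma lap_mono k th z t : al <= th <= be -> rn t < r -> 0 < complex.Re (z * dir th) ->
  lap (fun x => x.1 ^+ k) th z t = k`!%:R * z ^- k.+1.
Proof.
move=> hth tr z0; have zn0 : z != 0 by apply: contraTneq z0 => ->; rewrite mul0r /= ltxx.
have dX q (x : C) (s : V) : dd (fun x : C * V => x.1 ^+ q.+1) (x, s) (1, 0) = q.+1%:R * x ^+ q.
  by rewrite (ddE (isd_chain (isd_fst (x, s)) (isd_pow q x))) /= mul1r.
elim: k => [|k IH].
  have d0 : forall x, D x -> dd (fun x : C * V => x.1 ^+ 0) (x, t) (1, 0) = 0.
    by move=> x _; rewrite (ddE (isd_const 1 (x, t))).
  have := lap_deriv lap_good0 (lap_good_mono 0) d0 hth tr z0; rewrite lap0 expr0 => h.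
  apply: (mulfI zn0); rewrite fact0 mul1r expr1 divff//.
  by apply/eqP; rewrite -subr_eq0 -h.
have gl := lap_good_lin k.+1%:R (lap_good_mono k) lap_good0.
have ddX : forall x, D x -> dd (fun x : C * V => x.1 ^+ k.+1) (x, t) (1, 0) = k.+1%:R * x ^+ k + 0.
  by move=> x _; rewrite dX addr0.
have := lap_deriv gl (lap_good_mono k.+1) ddX hth tr z0.
rewrite lap_lin ?lap0 ?addr0//; [|exact: lap_good_mono|exact: lap_good0].
rewrite IH /= expr0n /= subr0 => h; apply: (mulfI zn0).
by rewrite -h factS natrM !exprS !invfM; field; rewrite zn0 expf_neq0.
Qed.

Lemma subexp_pow (f : C * V -> C) (K : R) k :
  (forall x t, D x -> rn t < r -> rn (f (x, t)) <= K * rn x ^+ k) -> subexp f.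
Proof.
move=> hf dl dl0; exists (`|K| * (k`!%:R / dl ^+ k)); first by rewrite mulr_ge0// divr_ge0// exprn_ge0// ltW.
move=> x t Dx tr; apply: le_trans (hf _ _ Dx tr) _.
apply: (@le_trans _ _ (`|K| * rn x ^+ k)); first by rewrite ler_wpM2r ?ler_norm// exprn_ge0// rn_ge0.
by rewrite -[leRHS]mulrA ler_wpM2l// pow_exp// rn_ge0.
Qed.

Lemma subexpD (f g : C * V -> C) : subexp f -> subexp g -> subexp (fun x => f x + g x).
Proof.
move=> sf sg dl dl0; have [K K0 hK] := sf _ dl0; have [K' K'0 hK'] := sg _ dl0.
exists (K + K'); first exact: addr_ge0.
by move=> x t Dx tr; apply: le_trans (rnD _ _) _; rewrite mulrDl; apply: lerD; [exact: hK|exact: hK'].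
Qed.

Lemma subexp_sum (I : Type) (s : seq I) (f : I -> C * V -> C) : (forall i, subexp (f i)) ->
  subexp (fun x => \sum_(i <- s) f i x).
Proof.
move=> sf; elim: s => [|i s IH].
  by move=> dl _; exists 0 => // x t _ _; rewrite big_nil rn0 mul0r.
by move=> dl dl0; have [K K0 hK] := subexpD (sf i) IH dl0; exists K => // x t Dx tr; rewrite big_cons hK.
Qed.

Lemma lap_goodX f : lap_good f -> lap_good (fun x => x.1 * f x).
Proof.
move=> [hf sf]; split; first by move=> x t Dx tr; apply: holM; [exact: hol_fst|exact: hf].
move=> dl dl0; have d2 : 0 < dl / 2 by rewrite divr_gt0.
have [K K0 hK] := sf _ d2; exists ((dl / 2)^-1 * K); first by rewrite mulr_ge0// invr_ge0 ltW.
move=> x t Dx tr; have h1 := pow_exp 1 d2 (rn_ge0 x); have h2 := hK _ _ Dx tr.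
rewrite rnM; apply: le_trans (ler_pM (rn_ge0 _) (rn_ge0 _) h1 h2) _.
by rewrite expr1 (_ : 1`! = 1%N)// div1r mulrACA -expRD (_ : dl / 2 * rn x + dl / 2 * rn x = dl * rn x)//; lra.
Qed.
End Laplace.

(** * Solutions of the system from Laplace integrals *)

Section SectorSolution.
Variable R : realType.
Local Notation C := R[i].
Variable n : nat.
Local Notation T := 'rV[C]_n.
Local Notation M := 'M[C]_n.

Lemma clim_mul (u v : nat -> C) l m : clim u l -> clim v m -> clim (fun k => u k * v k) (l * m).
Proof.
move=> hu hv.
have [N1 h1] := hu 1 ltr01.
have c1 : clim (fun k => (u k - l) * v k) 0.
  have [N2 h2] := hv 1 ltr01; move=> e e0.
  have K0 : 0 < rn m + 1 by rewrite ltr_wpDl ?rn_ge0.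
  have [N3 h3] := hu _ (divr_gt0 e0 K0); exists (maxn N2 N3) => k; rewrite geq_max => /andP[k2 k3].
  rewrite subr0 rnM -[leRHS](divfK (lt0r_neq0 K0)); apply: ler_pM; rewrite ?rn_ge0 ?h3//.
  by apply: le_trans (rn_sub _ m) _; rewrite lerD2l h2.
have c2 := climD c1 (climM l hv); rewrite add0r in c2.
by apply: clim_ext c2 => k; rewrite mulrBl subrK.
Qed.

Lemma clim_prod (I : Type) (s : seq I) (u : nat -> I -> C) (l : I -> C) :
  (forall i, clim (u^~ i) (l i)) -> clim (fun k => \prod_(i <- s) u k i) (\prod_(i <- s) l i).
Proof.
move=> h; elim: s => [|i s IH].
  by rewrite big_nil; apply: clim_ext (@clim_const _ C 1) => k; rewrite big_nil.
by rewrite big_cons; apply: clim_ext (clim_mul (h i) IH) => k; rewrite big_cons.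
Qed.

(** It serves to see that the determinant of [lapW] tends to 1 along a ray, hence that the solution
    is fundamental. *)
Lemma clim_det (P : nat -> M) (Q : M) : (forall i j, clim (fun k => P k i j) (Q i j)) ->
  clim (fun k => \det (P k)) (\det Q).
Proof.
move=> h; rewrite /determinant.
apply: (@clim_sum _ _ _ _ (fun k s => (-1) ^+ perm.odd_perm s * \prod_i P k i (perm.fun_of_perm s i))
  (fun s => (-1) ^+ perm.odd_perm s * \prod_i Q i (perm.fun_of_perm s i))) => s.
by apply: climM; apply: clim_prod => i; exact: h.
Qed.

Variables (u0 : T) (A : T -> M) (F : nat -> T -> M) (r : R) (D : set C) (al be : R).
Hypothesis oD : opn D.
Hypothesis sD : forall (s : R) x, 0 <= s <= 1 -> D x -> D (s%:C * x).
Hypothesis rayD : forall th (rho : R), al <= th <= be -> 0 <= rho -> D (rho%:C * dir th).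
Hypothesis albe : al <= be.
Hypothesis hA : forall t i j, rn t < r -> hol (fun t => A t i j) t.
Hypothesis bF : forall k, exists BF, forall t i j, rn t < r -> rn (F k t i j) <= BF.
Hypothesis fF : forall t, rn t < r -> is_formal_solution (u0 + t) (A t) (F^~ t).
Variable phi : 'I_n -> 'I_n -> C * T -> C.
Hypothesis hphi : forall b a x t, D x -> rn t < r -> hol (phi b a) (x, t).
Hypothesis aphi : forall b, exists N0, forall N, (N0 <= N)%N -> exists K, forall a x t, D x -> rn t < r ->
  rn (phi b a (x, t) - \sum_(k < N) x ^+ k * (F k.+1 t a b / k`!%:R)) <= K * rn x ^+ N.-1.
Hypothesis ephi : forall b a x t, D x -> rn t < r ->
  (x + (u0 + t) 0 a - (u0 + t) 0 b) * dd (phi b a) (x, t) (1, 0) +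
  \sum_j A t a j * phi b j (x, t) + (1 - A t b b) * phi b a (x, t) = 0.

Let D0 : D 0.
Proof. by have := @rayD al 0 _ (lexx 0); rewrite mul0r lexx albe; apply. Qed.

Let good b a : lap_good D r (phi b a).
Proof.
split; first exact: hphi.
have [N0 /(_ N0 (leqnn _))[K hK]] := aphi b.
pose P (k : 'I_N0) (x : C * T) : C := x.1 ^+ k * (F k.+1 x.2 a b / k`!%:R).
have s1 : subexp D r (fun x : C * T => phi b a x - \sum_(k < N0) P k x).
  by apply: (@subexp_pow _ _ _ _ _ K N0.-1) => x t Dx tr; exact: hK.
have s2 : subexp D r (fun x : C * T => \sum_(k < N0) P k x).
  apply: subexp_sum => k; have [BF hB] := bF k.+1.
  apply: (@subexp_pow _ _ _ _ _ (BF / k`!%:R) k) => x t Dx tr.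
  rewrite /P /= rnM rnX mulrC ler_wpM2r ?exprn_ge0 ?rn_ge0// rnM rnV rn_nat ler_wpM2r ?hB// invr_ge0//.
have := subexpD s1 s2; congr subexp; by apply/funext => x; rewrite subrK.
Qed.

(** The Borel sum of [1 + sum F_k z^-k] in the direction [th]: the constant term stays outside, and
    [x^k / k!] becomes [z^-(k+1)]. *)
Definition lapW (th : R) (z : C) (t : T) : M := \matrix_(a, b) ((a == b)%:R + lap (phi b a) th z t).

Let lapWE th z t a b : lapW th z t a b = (a == b)%:R + lap (phi b a) th z t.
Proof. by rewrite mxE. Qed.

(** Under the Laplace integral multiplication by [x] becomes minus the derivative in [z], and the
    derivative in [x] becomes multiplication by [z] with the boundary term [phi(0) = F_1], which the
    recursion of order 0 accounts for. *)
Let lapW_sys th z t a b : al <= th <= be -> rn t < r -> 0 < complex.Re (z * dir th) ->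
  isd (fun z => lapW th z t a b) z
    (fun h => h * (((u0 + t) 0 a - (u0 + t) 0 b) * lapW th z t a b +
      z^-1 * ((A t *m lapW th z t) a b - lapW th z t a b * A t b b))).
Proof.
move=> hth tr z0; have zn0 : z != 0 by apply: contraTneq z0 => ->; rewrite mul0r /= ltxx.
have [h1 d1] := lap_hol oD sD rayD (hphi b a) (good b a).2 hth tr z0.
set c := (u0 + t) 0 a - (u0 + t) 0 b.
have h2 : isd (fun z => lapW th z t a b) z (fun h => h * lap (fun x => - (x.1 * phi b a x)) th z t).
  have h3 := isdD (isd_const (a == b)%:R z) (isd_slice1 (ddP h1)).
  apply: (isd_ext (fun y => esym (lapWE th y t a b))); apply: isd_eqL h3 => h.
  rewrite add0r -d1; have -> : (h, 0) = h *: (1, 0) :> C * T.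
    by apply: injective_projections => /=; rewrite ?scaler0//; rewrite /GRing.scale /= mulr1.
  by rewrite (isd_linZ _ _ (ddP h1)).
apply: isd_eqL h2 => h; congr (h * _).
have gx : lap_good D r (fun x => x.1 * phi b a x) by exact: (lap_goodX (good b a)).
have g0 : lap_good D r (fun=> 0 : C) := @lap_good0 R T D r.
pose g (x : C * T) := c * phi b a x + x.1 * phi b a x.
have gg : lap_good D r g by exact: lap_good_lin.
pose f1 (x : C * T) := \sum_(j <- index_enum 'I_n) (- A t a j) * phi b j x.
have [gf1 lf1] := lap_sum oD sD rayD (index_enum 'I_n) (fun j => - A t a j) (fun j => good b j).
pose f (x : C * T) := A t b b * phi b a x + f1 x.
have gf : lap_good D r f by exact: lap_good_lin.
have df x : D x -> dd g (x, t) (1, 0) = f (x, t).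
  move=> Dx; have hp := ddP (hphi b a Dx tr).
  have hg := isdD (isdZ c hp) (isdM (isd_fst (x, t)) hp).
  rewrite (ddE hg) /= mulr1 /f /f1; have := ephi b a Dx tr.
  rewrite (_ : x + (u0 + t) 0 a - (u0 + t) 0 b = c + x); last by rewrite /c; ring.
  move=> e1; under eq_bigr do rewrite mulNr; rewrite sumrN.
  set s1 := \sum_j _ in e1 *; set dp := dd _ _ _ in e1 *; set p := phi _ _ _ in e1 *.
  apply/eqP; rewrite -subr_eq0 -{}[X in _ == X]e1; apply/eqP; ring.
have := lap_deriv oD sD rayD gf gg df hth tr z0.
rewrite (lap_lin oD sD rayD c (good b a) gx hth tr z0) (lap_lin oD sD rayD _ (good b a) gf1 hth tr z0) lf1//.
have -> : lap (fun x => - (x.1 * phi b a x)) th z t = - lap (fun x => x.1 * phi b a x) th z t.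
  rewrite (_ : (fun x => _) = fun x => (-1) * (x.1 * phi b a x) + (fun=> 0) x); last first.
    by apply/funext => x; rewrite mulN1r addr0.
  by rewrite (lap_lin oD sD rayD _ gx g0 hth tr z0) lap0 mulN1r addr0.
set L := lap (fun x => x.1 * _) th z t.
have phi0 : phi b a (0, t) = F 1%N t a b.
  have [N0 hN0] := aphi b; have [K hK] := hN0 (maxn N0 2) (leq_maxl _ _).
  have := hK a 0 t D0 tr; have N2 : (1 < maxn N0 2)%N by rewrite leq_max orbT.
  case: (maxn N0 2) N2 => [//|[//|N]] _ /=.
  rewrite rn0 expr0n /= mulr0 big_ord_recl /= big1 ?addr0 => [|k _]; last by rewrite exprS !mul0r.
  rewrite expr0 mul1r divr1 => hle; apply/eqP; rewrite -subr_eq0 -rn_eq0 eq_le hle rn_ge0//.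
have fo := (formal_solutionP _ _ _).1 (fF tr).
have [F0 /(_ 0%N a b)] := fo.
rewrite F0 -/c subr0 mulmx1 mxE => f1E.
have AW : (A t *m lapW th z t) a b = A t a b + \sum_j A t a j * lap (phi b j) th z t.
  rewrite mxE (eq_bigr (fun j => A t a j * (j == b)%:R + A t a j * lap (phi b j) th z t)); last first.
    by move=> j _; rewrite lapWE mulrDr.
  rewrite big_split /= (bigD1 b)//= eqxx mulr1 big1 ?addr0// => j jb; rewrite (negPf jb) mulr0//.
rewrite AW lapWE (eq_bigr (fun j => - (A t a j * lap (phi b j) th z t))); last by move=> j _; rewrite mulNr.
rewrite sumrN /g /= mul0r addr0 phi0 f1E.
set S1 := \sum_j _; set l := lap _ _ _ _.
have cd : c * (a == b)%:R = 0 by rewrite /c; case: eqP => [->|]; rewrite ?subrr ?mul0r ?mulr0.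
move: cd; move: ((a == b)%:R) => dl cd e1; apply: (mulfI zn0).
rewrite mulrN mulrDr mulVKf// [c * (_ + _)]mulrDr cd add0r.
have -> : z * L = A t b b * l - S1 - z * (c * l) + (dl * A t b b - A t a b) by rewrite e1; ring.
ring.
Qed.

Let approx : exists N0, forall N, (N0 <= N)%N -> exists2 K : R, 0 <= K & forall b a x t, D x -> rn t < r ->
  rn (phi b a (x, t) - \sum_(k < N) x ^+ k * (F k.+1 t a b / k`!%:R)) <= K * rn x ^+ N.-1.
Proof.
have [N0 hN0] := choice aphi; exists (\max_b N0 b)%N => N hN.
have hK b : exists K, forall a x t, D x -> rn t < r ->
  rn (phi b a (x, t) - \sum_(k < N) x ^+ k * (F k.+1 t a b / k`!%:R)) <= K * rn x ^+ N.-1.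
  by apply: hN0; apply: leq_trans hN; exact: (@leq_bigmax _ N0 b).
have [K {}hK] := choice hK; exists (\sum_b `|K b|); first exact: sumr_ge0.
move=> b a x t Dx tr; apply: le_trans (hK b a x t Dx tr) _.
rewrite ler_wpM2r ?exprn_ge0 ?rn_ge0//; apply: le_trans (ler_norm _) _.
by rewrite (bigD1 b)//= lerDl sumr_ge0.
Qed.

(** Watson's lemma with a constant uniform in the direction and in [t]. The bound is in terms of
    [c], which can be taken proportional to [|z|] away from the boundary of the half-plane. *)
Let lapW_approx : exists N0, forall N, (N0 <= N)%N -> exists2 K : R, 0 <= K & forall th z t (c : R) a b, al <= th <= be ->
  rn t < r -> 0 < c -> c <= complex.Re (z * dir th) ->
  rn (lapW th z t a b - \sum_(k < N.+1) z ^- k * F k t a b) <= K * c ^- N.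
Proof.
have [N0 hN0] := approx; exists N0.+1 => -[//|N] N0N; have [K K0 hK] := hN0 _ (ltnW N0N).
exists (2 * K * N`!%:R * 2 ^+ N); first by rewrite !mulr_ge0// exprn_ge0.
move=> th z t c a b hth tr c0 cz; have z0 : 0 < complex.Re (z * dir th) by exact: lt_le_trans cz.
pose c1 k : C := F k.+1 t a b / k`!%:R.
have [gP lP] := lap_sum oD sD rayD (index_enum 'I_N.+1) (fun k : 'I_N.+1 => c1 k) (fun k : 'I_N.+1 => @lap_good_mono R T D r k).
set P := (fun x : C * T => _) in gP.
have gpsi := lap_good_lin (-1) gP (good b a).
have lpsi := lap_lin oD sD rayD (-1) gP (good b a) hth tr z0.
have E1 : lapW th z t a b - \sum_(k < N.+2) z ^- k * F k t a b = lap (fun x => -1 * P x + phi b a x) th z t.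
  rewrite lpsi lP// lapWE big_ord_recl expr0 invr1 mul1r (fF tr).1 mxE mulN1r.
  rewrite (eq_bigr (fun k : 'I_N.+1 => z ^- k.+1 * F k.+1 t a b)); last by move=> k _; rewrite lift0.
  rewrite (eq_bigr (fun k : 'I_N.+1 => z ^- k.+1 * F k.+1 t a b) (r := index_enum 'I_N.+1) (F1 := fun k : 'I_N.+1 => c1 k * _)).
    by rewrite opprD addrACA subrr add0r addrC.
  move=> k _; rewrite (lap_mono oD sD rayD k hth tr z0) /c1 mulrA divfK ?pnatr_eq0 -?lt0n ?fact_gt0//.
  by rewrite mulrC.
rewrite E1.
have c2 : 0 < c / 2 by rewrite divr_gt0.
have B0 : 0 <= K * (N`!%:R / (c / 2) ^+ N) by rewrite mulr_ge0// divr_ge0// exprn_ge0// ltW.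
apply: le_trans (lap_bound oD sD rayD gpsi.1 gpsi.2 hth tr c0 cz B0 _) _.
  move=> s s0; have Ds := rayD hth s0.
  have := hK b a _ t Ds tr; rewrite mulN1r addrC /P /= => h1.
  rewrite (eq_bigr (fun k : 'I_N.+1 => (s%:C * dir th) ^+ k * (F k.+1 t a b / k`!%:R))); last by move=> k _; rewrite mulrC.
  apply: le_trans h1 _; rewrite -mulrA ler_wpM2l// (rnM s%:C) rn_dir mulr1 rn_real ger0_norm//=.
  exact: pow_exp.
rewrite le_eqVlt; apply/orP; left; apply/eqP; rewrite exprS; have : c ^+ N != 0 by rewrite expf_neq0// lt0r_neq0.
have cn : c != 0 by rewrite lt0r_neq0.
have p2 : (2 : R) ^+ N != 0 by rewrite expf_neq0// pnatr_eq0.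
by rewrite expr_div_n; set C1 := N`!%:R; set C2 := c ^+ N; move=> C20; field; rewrite C20 cn p2.
Qed.

Let Y1 (th : R) (t : T) (w : C) : M :=
  \matrix_(a, b) (lapW th (cexp w) t a b * cexp (cexp w * (u0 + t) 0 b + w * A t b b)).

Let Y1E th t w a b : Y1 th t w a b = lapW th (cexp w) t a b * cexp (cexp w * (u0 + t) 0 b + w * A t b b).
Proof. by rewrite [LHS]mxE. Qed.

Lemma Re_cexp_dir (w : C) (th : R) : complex.Re (cexp w * dir th) = expR (complex.Re w) * cos (complex.Im w + th).
Proof. by rewrite /dir -cexpD Re_cexp ReD ImD /= addr0. Qed.

(** One sheet, over [w = log z], of the half-plane [Re(z dir th) > 0]; the strips of neighbouring
    directions overlap. *)
Let strip (th : R) (w : C) : Prop := - (pi / 2) < complex.Im w + th < pi / 2.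

Let strip_gt0 th w : strip th w -> 0 < complex.Re (cexp w * dir th).
Proof. by move=> hs; rewrite Re_cexp_dir mulr_gt0 ?expR_gt0// cos_gt0_pihalf. Qed.

Lemma cos_ge_even (v m : R) : 0 <= m <= pi -> - m <= v <= m -> cos m <= cos v.
Proof.
move=> hm; wlog v0 : v / 0 <= v => [hw|] /andP[v1 v2].
  case: (leP 0 v) => [v0|v0]; first by apply: hw; rewrite ?v1.
  by rewrite -[cos v]cosN; apply: hw; [lra|apply/andP; split; lra].
rewrite leNgt ltr_cos ?in_itv /= -?leNgt//; apply/andP; split; case/andP: hm; lra.
Qed.

Let Y1_sys th t w : al <= th <= be -> rn t < r -> strip th w ->
  mder (Y1 th t) w (sysM (u0 + t) (A t) w *m Y1 th t w).
Proof.
move=> hth tr /strip_gt0 w0 a b.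
have h1 := isd_chain (isd_cexp w) (lapW_sys a b hth tr w0).
have h2 : isd (fun w => cexp w * (u0 + t) 0 b + w * A t b b) w (fun h => (h * cexp w) * (u0 + t) 0 b + h * A t b b).
  apply: isdD; last first.
    by apply: isd_eqL (isd_ext _ (isdZ (A t b b) (isd_id w))) => [h|y]; rewrite mulrC.
  by apply: isd_eqL (isd_ext _ (isdZ ((u0 + t) 0 b) (isd_cexp w))) => [h|y]; rewrite mulrC.
have h3 := isdM h1 (isd_chain h2 (isd_cexp _)).
apply: (isd_ext (fun y => esym (Y1E th t y a b))); apply: isd_eqL h3 => h /=.
have cn := cexp_neq0 w.
rewrite /sysM mulmxDl -scalemxAl mul_diag_mx.
have -> : (cexp w *: \matrix_(i, j) ((u0 + t) 0 i * Y1 th t w i j) + A t *m Y1 th t w) a b =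
    cexp w * ((u0 + t) 0 a * Y1 th t w a b) + (A t *m Y1 th t w) a b.
  have ED (X Z : M) : (X + Z) a b = X a b + Z a b by rewrite mxE.
  have EZ (c : C) (X : M) : (c *: X) a b = c * X a b by rewrite mxE.
  have EM (g : 'I_n -> 'I_n -> C) : (\matrix_(i, j) g i j) a b = g a b by rewrite mxE.
  by rewrite ED EZ EM.
rewrite Y1E.
have -> : (A t *m Y1 th t w) a b = (A t *m lapW th (cexp w) t) a b * cexp (cexp w * (u0 + t) 0 b + w * A t b b).
  by rewrite [LHS]mxE [X in _ = X * _]mxE mulr_suml; apply: eq_bigr => j _; rewrite Y1E mulrA.
set e := cexp (_ + _); set l := lapW _ _ _ _ _; set q := (_ *m _) a b.
set z := cexp w in cn *; set ua := (u0 + t) 0 a; set ub := (u0 + t) 0 b; set ab := A t b b.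
have -> : h * z * ((ua - ub) * l + z^-1 * (q - l * ab)) = h * (z * (ua - ub) * l + (q - l * ab)).
  by rewrite -mulrA [z * (_ + _)]mulrDr [z * (z^-1 * _)]mulrA divff// mul1r mulrA.
ring.
Qed.

Let E0 : set T := [set t | rn t < r].
Let oE0 : opn E0.
Proof.
move=> t tr; exists (r - rn t); first by rewrite subr_gt0.
by move=> y hy; have := rn_sub y t; rewrite /E0 /=; lra.
Qed.

(** On each strip [Psi Y1] is constant, and nearby directions give the same constant because their
    Laplace integrals agree at a common point. Multiplied by [Phi], this constant gives a solution
    entire in [w] which equals [Y1 th] on the strip of every [th]. *)
Lemma sector_solution (eta : R) : 0 < eta < pi / 2 -> exists Y : T -> C -> M,
  [/\ forall t, rn t < r -> is_fundamental (u0 + t) (A t) (Y t),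
      forall t w a b, rn t < r -> hol (fun t => Y t w a b) t
    & forall t, rn t < r -> asymp (- be - pi / 2 + eta) (- al + pi / 2 - eta) (u0 + t)
        (\row_a A t a a) (F^~ t) (Y t)].
Proof.
move=> /andP[eta0 etapi].
have hL t (i : 'I_n) : E0 t -> hol (fun t => (u0 + t) 0 i) t.
  move=> _; apply: (hol_ext (f := fun t : T => u0 0 i + t 0 i)) => [y|]; first by rewrite mxE.
  by apply: holD; [exact: hol_const|by eexists; exact: hol_coord].
have [Phi [Psi [hol_PP dPhi dPsi PsiPhi]]] := param_system oE0 hL (fun t i j tE => hA i j tE).
(* A point in the middle of the strip of the first direction. *)
pose w1 : C := 0 +i* (- al).
pose Y t w : M := Phi (w, t) *m (Psi (w1, t) *m Y1 al t w1).
have s1 : strip al w1 by rewrite /strip /= addNr oppr_lt0 divr_gt0 ?pi_gt0.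
have al1 : al <= al <= be by rewrite lexx.
have constP th t w w' : al <= th <= be -> rn t < r -> strip th w -> strip th w' ->
    Psi (w, t) *m Y1 th t w = Psi (w', t) *m Y1 th t w'.
  move=> hth tr sw sw'; apply/matrixP => i j.
  have -> : w = w' + (w - w') by rewrite addrCA subrr addr0.
  apply: (@const_seg _ _ (fun w => (Psi (w, t) *m Y1 th t w) i j)) => s s01.
  have ss : strip th (w' + s%:C *: (w - w')).
    move: sw sw'; rewrite /strip ImD /GRing.scale /= ImM /= !ImD !ImN mul0r addr0 => /andP[a1 a2] /andP[b1 b2].
    move: s01 => /andP[s0 s1']; set x := complex.Im w + th in a1 a2; set y := complex.Im w' + th in b1 b2.
    rewrite (_ : _ + th = y + s * (x - y)); last by rewrite /x /y; ring.
    have m0 : 0 <= s * `|x - y| by rewrite mulr_ge0.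
    have m1 : 0 <= (1 - s) * `|x - y| by rewrite mulr_ge0// subr_ge0.
    by case: (leP x y) => xy; [rewrite ler0_norm ?subr_le0// in m0 m1|rewrite gtr0_norm ?subr_gt0// in m0 m1]; apply/andP; split; lra.
  have hm := mderM (dPsi (w' + s%:C *: (w - w')) t tr) (Y1_sys hth tr ss).
  rewrite mulmxA mulNmx addNr in hm; have := hm i j => hm'.
  by split; [eexists; exact: hm'|rewrite (ddE hm') mxE mulr0].
have stepP th th' t : al <= th -> th <= th' -> th' <= be -> th' <= th + 1 -> rn t < r ->
    (forall w, strip th w -> Psi (w, t) *m Y1 th t w = Psi (w1, t) *m Y1 al t w1) ->
    forall w, strip th' w -> Psi (w, t) *m Y1 th' t w = Psi (w1, t) *m Y1 al t w1.
  move=> a1 a12 a2 a3 tr IH w sw; have p1 := @pihalf_ge1 R.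
  (* A point in the middle of the strip of the mean direction. All directions between [th] and [th']
     are within 1/2 of the mean, so [cos(1/2)] is the lower bound that [lap_rot] asks for. *)
  pose wm : C := 0 +i* (- ((th + th') / 2)).
  have sm q : th <= q <= th' -> strip q wm.
    by move=> /andP[q1 q2]; rewrite /strip /=; apply/andP; split; lra.
  have hth' : al <= th' <= be by rewrite (le_trans a1 a12).
  have smth' : strip th' wm by apply: sm; rewrite a12 lexx.
  have smth : strip th wm by apply: sm; rewrite lexx.
  rewrite (constP th' t w wm hth' tr sw smth') -(IH wm smth).
  suff -> : Y1 th' t wm = Y1 th t wm by [].
  apply/matrixP => i j; pose yf (l : C) : C := ((i == j)%:R + l) * cexp (cexp wm * (u0 + t) 0 j + wm * A t j j).
  have yfE q : Y1 q t wm i j = yf (lap (phi j i) q (cexp wm) t) by rewrite Y1E lapWE.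
  suff lE : lap (phi j i) th (cexp wm) t = lap (phi j i) th' (cexp wm) t by rewrite yfE -lE -yfE.
  apply: (lap_rot oD sD rayD (@hphi j i) (good j i).2 (c := cos (2^-1)) a1 a12 a2 tr) => [|q hq].
    by apply: cos_gt0_pihalf; apply/andP; split; lra.
  rewrite Re_cexp_dir /= expR0 mul1r.
  by apply: cos_ge_even; [lra|case/andP: hq => q1 q2; apply/andP; split; lra].
have allP t : rn t < r -> forall k : nat, forall th, al <= th <= be -> th <= al + k%:R ->
    forall w, strip th w -> Psi (w, t) *m Y1 th t w = Psi (w1, t) *m Y1 al t w1.
  move=> tr; elim=> [|k IH] th /andP[h1 h2] h3 w sw.
    have E : th = al by apply/eqP; rewrite eq_le h1 andbT; move: h3; rewrite addr0.
    by move: sw; rewrite E => sw; exact: constP.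
  case: (leP th (al + k%:R)) => h4; first by apply: IH => //; rewrite h1.
  have h5 : al <= th - 1 \/ th - 1 < al by case: (leP al (th - 1)) => ?; [left|right].
  move: h3; rewrite -natr1 addrA => h3; case: h5 => h5.
    apply: (stepP (th - 1) th) => //; try lra.
    by move=> w' sw'; apply: IH sw' => //; [apply/andP; split|]; lra.
  apply: (stepP al th) => //; try lra.
  by move=> w' sw'; exact: constP.
have YE t w th : rn t < r -> al <= th <= be -> strip th w -> Y t w = Y1 th t w.
  move=> tr hth sw; have [N hN] := nat_above (th - al).
  have E := allP t tr N th hth _ w sw.
  rewrite /Y -E; last by lra.
  have [_ u] := mulmx1_unit (PsiPhi w t tr).
  by rewrite mulmxA (mulmx1C (PsiPhi w t tr)) mul1mx.
(* The direction chosen for [w] is [- Im w] cut off to [[al, be]]. Then [w] stays at distance [eta]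
   from the boundary of the strip, and [Re(z dir th) >= |z| sin eta]. *)
have clampP (w : C) : - be - pi / 2 + eta <= complex.Im w <= - al + pi / 2 - eta ->
    exists2 th, al <= th <= be & - (pi / 2 - eta) <= complex.Im w + th <= pi / 2 - eta.
  move=> /andP[w2 w3]; case: (leP al (- complex.Im w)) => c1; last first.
    by exists al; rewrite ?lexx//; apply/andP; split; lra.
  case: (leP (- complex.Im w) be) => c2; last first.
    by exists be; rewrite ?lexx ?albe//; apply/andP; split; lra.
  by exists (- complex.Im w); rewrite ?c1//; rewrite subrr; apply/andP; split; lra.
have sineta : 0 < sin eta by apply: sin_gt0_pi; apply/andP; split => //; have := @pi_gt0 R; lra.
have cosP (v : R) : - (pi / 2 - eta) <= v <= pi / 2 - eta -> sin eta <= cos v.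
  by move=> hv; rewrite -cosBpihalf -cosN opprB cos_ge_even//; have := @pi_gt0 R; lra.
have reY t w th a b : rn t < r -> al <= th <= be -> strip th w ->
    reduced (u0 + t) (\row_a A t a a) (Y t) w a b = lapW th (cexp w) t a b.
  move=> tr hth sw; rewrite /reduced [LHS]mxE (YE t w th tr hth sw) Y1E [(\row_a _) 0 b]mxE.
  set p := cexp w * _; rewrite cexpD !cexpN; move: (cexp_neq0 p) (cexp_neq0 (w * A t b b)).
  by move: (cexp p) (cexp (w * _)) (lapW _ _ _ _ _) => e1 e2 l n1 n2; field; rewrite n1 n2.
  
have near_strip w th : - (pi / 2 - eta) <= complex.Im w + th <= pi / 2 - eta -> strip th w.
  by move=> /andP[? ?]; rewrite /strip; apply/andP; split; lra.
have asY t : rn t < r -> asymp (- be - pi / 2 + eta) (- al + pi / 2 - eta) (u0 + t) (\row_a A t a a) (F^~ t) (Y t).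
  move=> tr; have [N0 hN0] := lapW_approx.
  have big N : (N0 <= N)%N -> exists2 K : R, 0 <= K & forall z : C, - be - pi / 2 + eta <= complex.Im z <= - al + pi / 2 - eta ->
     forall i j, rn (reduced (u0 + t) (\row_a A t a a) (Y t) z i j - \sum_(k < N.+1) cexp z ^- k * F k t i j) <=
       K * expR (complex.Re z) ^- N.
    move=> hN; have [K K0 hK] := hN0 _ hN; exists (K * sin eta ^- N); first by rewrite mulr_ge0// invr_ge0 exprn_ge0// ltW.
    move=> z hz i j; have [th hth hs] := clampP z hz.
    rewrite (reY _ _ th)//; last exact: near_strip.
    rewrite -mulrA -invfM -exprMn; apply: hK => //; first by rewrite mulr_gt0 ?expR_gt0.
    by rewrite Re_cexp_dir mulrC ler_wpM2l ?expR_ge0// cosP.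
  (* Small orders follow from a larger one: for [|z| >= 1] the additional terms, of degree at least
     [N] in [1 / z], are themselves bounded by multiples of [|z|^-N]. *)
  move=> N; have [K K0 hK] := big (maxn N0 N) (leq_maxl _ _).
  have [BF hBF] := choice bF.
  exists (K + \sum_(k < (maxn N0 N).+1) `|BF k|), 1 => z hz z1 i j.
  have e0 : 0 < expR (complex.Re z) by exact: expR_gt0.
  have NN : (N <= (maxn N0 N).+1)%N by rewrite leqW// leq_maxr.
  rewrite -(@big_mkord _ _ _ N xpredT (fun k => cexp z ^- k * F k t i j)).
  have := hK z hz i j; rewrite -(@big_mkord _ _ _ (maxn N0 N).+1 xpredT (fun k => cexp z ^- k * F k t i j)).
  rewrite (@big_cat_nat _ _ _ N)//= => h1.
  set x := reduced _ _ _ _ _ _ in h1 *; set S0 := \sum_(0 <= k < N) _ in h1 *; set S1 := \sum_(_ <= k < _) _ in h1.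
  rewrite (_ : x - S0 = (x - (S0 + S1)) + S1); last by ring.
  apply: le_trans (rnD _ _) _; rewrite mulrDl; apply: lerD.
    apply: le_trans h1 _; rewrite ler_wpM2l// lef_pV2 ?posrE ?exprn_gt0//.
    by rewrite ler_weXn2l// leq_maxr.
  apply: le_trans (rn_sum _ _ _) _; rewrite mulr_suml -(@big_mkord _ _ _ (maxn N0 N).+1 xpredT (fun k => `|BF k| / expR (complex.Re z) ^+ N)).
  rewrite [leRHS](@big_cat_nat _ _ _ N)//= ler_wpDl//; first by apply: sumr_ge0 => k _; rewrite divr_ge0// exprn_ge0// ltW.
  rewrite big_nat [leRHS]big_nat; apply: ler_sum => k /andP[Nk _].
  rewrite rnM rnV rnX rn_cexp mulrC; apply: ler_pM; rewrite ?rn_ge0 ?invr_ge0 ?exprn_ge0 ?(ltW e0)//.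
    exact: le_trans (hBF k t i j tr) (ler_norm _).
  by rewrite lef_pV2 ?posrE ?exprn_gt0// ler_weXn2l.
(* The factor [Psi Y1] is constant, so it is enough to find one point where [Y1] is invertible; far
   out on the ray the determinant of [lapW] is close to 1. *)
have uY t w : rn t < r -> Y t w \in unitmx.
  move=> tr; have [u1 _] := mulmx1_unit (PsiPhi w t tr).
  have [_ u2] := mulmx1_unit (PsiPhi w t tr).
  rewrite unitmx_mul u2 /=.
  (* Points with [z dir al = k + 1], so that [lapW_approx] applies with [c = k + 1]. *)
  pose wk (k : nat) : C := (ln k.+1%:R) +i* (- al).
  have sk k : strip al (wk k) by rewrite /strip /= addNr oppr_lt0 divr_gt0 ?pi_gt0.
  have ck : clim (fun k => \det (lapW al (cexp (wk k)) t)) 1.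
    rewrite -(det1 C n); apply: clim_det => i j.
    have [N0 hN0] := lapW_approx; have [K K0 hK] := hN0 N0.+1 (leqnSn N0).
    have zk k : cexp (wk k) * dir al = k.+1%:R.
      have nC : (k.+1%:R : C) = (k.+1%:R : R)%:C by rewrite rmorph_nat.
      rewrite nC /dir -cexpD; have : (0 : R) < k.+1%:R by rewrite ltr0n.
      rewrite /wk; move: (k.+1%:R : R) => x x0.
      have -> : (ln x) +i* (- al) + 0 +i* al = (ln x)%:C by apply: complexP; rewrite ?ReD ?ImD /= ?addr0 ?addNr.
      apply: complexP; first by rewrite Re_cexp /= cos0 mulr1 lnK.
      by rewrite Im_cexp /= sin0 mulr0.
    have [BF hBF] := choice bF.
    pose b1 : R := K + \sum_(k < N0.+1) `|BF k.+1|.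
    apply: (@clim_bound _ C _ _ (fun k => b1 / k.+1%:R) b1) => // k.
    have c0 : (0 : R) < k.+1%:R by rewrite ltr0n.
    have := hK al (cexp (wk k)) t _ i j al1 tr c0; rewrite zk -(rmorph_nat (real_complex R)) lexx => /(_ isT).
    rewrite big_ord_recl expr0 invr1 mul1r (fF tr).1 [(1%:M) i j]mxE => h1.
    set S1 := \sum_(_ < _) _ in h1; set x := lapW _ _ _ _ _ in h1 *.
    rewrite (_ : x - (i == j)%:R = (x - ((i == j)%:R + S1)) + S1); last by ring.
    have k1 : (1 : R) <= k.+1%:R by rewrite ler1n.
    have kp m : (k.+1%:R : R) ^- m.+1 <= k.+1%:R^-1.
      by rewrite lef_pV2 ?posrE ?exprn_gt0// exprS ler_peMr// exprn_ege1.
    apply: le_trans (rnD _ _) _; rewrite /b1 mulrDl; apply: lerD.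
      by apply: le_trans h1 _; rewrite ler_wpM2l.
    apply: le_trans (rn_sum _ _ _) _; rewrite mulr_suml; apply: ler_sum => m _.
    rewrite lift0 rnM rnV rnX rn_cexp /= lnK ?posrE// mulrC; apply: ler_pM; rewrite ?rn_ge0//.
      exact: le_trans (hBF m.+1 t i j tr) (ler_norm _).
  have [N hN] := ck (1 / 2) (divr_gt0 ltr01 (ltr0n _ 2)).
  have := hN N (leqnn _) => h1.
  have dN : \det (lapW al (cexp (wk N)) t) != 0.
    by apply: contraTneq h1 => ->; rewrite sub0r rnN rn1 -ltNge; lra.
  rewrite -(constP al t (wk N) w1 al1 tr (sk N) s1) unitmx_mul.
  have [u3 _] := mulmx1_unit (PsiPhi (wk N) t tr).
  rewrite u3 /= (_ : Y1 al t (wk N) = lapW al (cexp (wk N)) t *m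
      diag_mx (\row_b cexp (cexp (wk N) * (u0 + t) 0 b + wk N * A t b b))).
    rewrite unitmx_mul !unitmxE !unitfE dN det_diag /=; apply/prodf_neq0 => b _.
    by rewrite mxE cexp_neq0.
  by rewrite mul_mx_diag; apply/matrixP => i j; rewrite Y1E [RHS]mxE [(\row_b _) 0 j]mxE.
exists Y; split=> [t tr|t w a b tr|]; last exact: asY.
  apply/is_fundamentalP => z; split; last exact: uY.
  by have := mderMr (Psi (w1, t) *m Y1 al t w1) (dPhi z t tr); rewrite -mulmxA.
apply: hol_mulmx => [i j|i j].
  by have [h1 _] := hol_PP (w, t) i j tr; exact: hol_slice2 h1.
apply: hol_mulmx => [i' j'|i' j'].
  by have [_ h1] := hol_PP (w1, t) i' j' tr; exact: hol_slice2 h1.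
apply: (hol_ext (fun y => esym (Y1E al y w1 i' j'))).
apply: holM; last first.
  apply: hol_cexp; apply: holD; apply: holM; try exact: hol_const; last exact: hA.
  by apply: (hol_ext (f := fun t : T => u0 0 j' + t 0 j')) => [y|]; [rewrite mxE|apply: holD; [exact: hol_const|by eexists; exact: hol_coord]].
apply: (hol_ext (fun y => esym (lapWE al (cexp w1) y i' j'))).
apply: holD; first exact: hol_const.
have [h1 _] := lap_hol oD sD rayD (@hphi j' i') (good j' i').2 al1 tr (strip_gt0 s1).
exact: hol_slice2 h1.
Qed.
End SectorSolution.

(** * Directions that keep away from the singular points *)

Section SectorGeometry.
Variable R : realType.
Local Notation C := R[i].
Variable n : nat.
Local Notation T := 'rV[C]_n.
Local Notation M := 'M[C]_n.

Lemma Im_dir (c : C) (th : R) : complex.Im (c * dir th) = complex.Re c * sin th + complex.Im c * cos th.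
Proof. by rewrite /dir ImM Re_cexp Im_cexp /= expR0 !mul1r; ring. Qed.

Lemma dirN (th : R) : dir th * dir (- th) = 1 :> C.
Proof.
rewrite /dir -cexpD (_ : _ + _ = 0) ?cexp0//.
by apply: complexP => /=; rewrite ?addr0 ?addrN.
Qed.

Lemma dir_lipschitz (a b : R) : rn (dir b - dir a : C) <= `|b - a|.
Proof.
wlog ab : a b / a <= b => [hw|].
  by case: (leP a b) => [/hw//|/ltW/hw]; rewrite rnB distrC.
have hrd (s : R) : rder (@dir R) s ('i * dir s).
  have hi : isd (fun w : C => 'i * w) s%:C (fun h => 'i * h) by apply: isdZ; exact: isd_id.
  have hd := isd_chain hi (isd_cexp _).
  have := hol_real (ex_intro _ _ hd); rewrite (ddE hd) /= mulr1.
  have E1 (u : R) : cexp ('i * u%:C) = dir u by rewrite /dir; congr (cexp _); apply: complexP => /=; ring.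
  by rewrite E1; apply: rder_ext => u; rewrite /= E1.
rewrite ger0_norm ?subr_ge0//; have := @rmvi_le _ _ _ 1 _ _ ab (fun x _ => hrd x); rewrite mul1r; apply=> x _.
by rewrite (rnM 'i) rn_i rn_dir mulr1.
Qed.

(* As t varies, [Im (c dir th)] takes all the values of an interval of radius [2 eps] around its value at [t = 0]. *)
Lemma ray_gap (u0 : T) (eps : R) (a b : 'I_n) (th : R) : 0 < eps -> a != b ->
  (forall t, rn t <= eps -> complex.Im (((u0 + t) 0 a - (u0 + t) 0 b) * dir th) != 0) ->
  2 * eps < `|complex.Im ((u0 0 a - u0 0 b) * dir th)|.
Proof.
move=> eps0 ab h; rewrite ltNge; apply/negP; set v := complex.Im _ => hv.
pose x : C := 0 +i* (v / 2).
have rx : rn x <= eps.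
  by apply: le_trans (rn_ReIm _) _; rewrite /= normr0 add0r normrM [X in _ * X]ger0_norm ?invr_ge0//; lra.
pose t : T := \row_k (if k == a then - (x * dir (- th)) else if k == b then x * dir (- th) else 0).
have rt : rn t <= eps.
  apply: rn_mx_le; first exact: ltW.
  move=> i k; rewrite mxE; case: eqP => _; first by rewrite rnN (rnM x) rn_dir mulr1.
  by case: eqP => _; rewrite ?rn0 ?(ltW eps0)// (rnM x) rn_dir mulr1.
have := h t rt; rewrite !rowDE !mxE !eqxx [b == a]eq_sym (negPf ab).
have -> : (u0 0 a - x * dir (- th) - (u0 0 b + x * dir (- th))) * dir th =
    (u0 0 a - u0 0 b) * dir th - 2 * x * (dir th * dir (- th)) by ring.
rewrite dirN mulr1 ImD ImN -/v; have -> : complex.Im (2 * x) = v.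
  by rewrite (_ : 2 * x = x + x) ?ImD /=; [lra|ring].
by rewrite subrr eqxx.
Qed.

Lemma finite_gap (I : finType) (P : I -> R -> Prop) : (forall i (x y : R), x <= y -> P i y -> P i x) ->
  (forall i, exists2 x, 0 < x & P i x) -> exists2 x, 0 < x & forall i, P i x.
Proof.
move=> mono h; have {}h i : exists x, 0 < x /\ P i x by have [x x0 hx] := h i; exists x.
have [f hf] := choice h; exists (\big[Num.min/1]_i f i).
  by elim/big_ind: _ => [|x y x0 y0|i _]; rewrite ?lt_min ?x0//; case: (hf i).
by move=> i; apply: mono (hf i).2; apply: bigmin_le_cond.
Qed.

(** For one direction [ray_gap] gives a strict inequality; the minimum over a compact interval of
    directions and over finitely many pairs keeps it strict. The slack [k] is what permits a larger
    polydisc and a wider sector. *)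
Lemma ray_gap_uniform (u0 : T) (eps th1 th2 : R) : 0 < eps -> th1 <= th2 ->
  (forall t a b th, rn t <= eps -> u0 0 a != u0 0 b -> th1 <= th <= th2 ->
    complex.Im (((u0 + t) 0 a - (u0 + t) 0 b) * dir th) != 0) ->
  exists2 k : R, 0 < k & forall a b th, u0 0 a != u0 0 b -> th1 <= th <= th2 ->
    2 * eps + k <= `|complex.Im ((u0 0 a - u0 0 b) * dir th)|.
Proof.
move=> eps0 th12 h.
have [ab x y xy hy th uab hth|[a b]|k k0 hk] := @finite_gap ('I_n * 'I_n)%type (fun ab k => forall th, u0 0 ab.1 != u0 0 ab.2 -> th1 <= th <= th2 ->
    2 * eps + k <= `|complex.Im ((u0 0 ab.1 - u0 0 ab.2) * dir th)|).
- by apply: le_trans (hy th uab hth); rewrite lerD2l.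
- case: (boolP (u0 0 a == u0 0 b)) => [/eqP E|nab]; first by exists 1 => //= th; rewrite E eqxx.
  pose f th := `|complex.Im ((u0 0 a - u0 0 b) * dir th)|.
  have cf : {within `[th1, th2], continuous f}.
    apply: continuous_subspaceT => th.
    have -> : f = (fun th : R => `|complex.Re (u0 0 a - u0 0 b) * sin th + complex.Im (u0 0 a - u0 0 b) * cos th|).
      by apply/funext => s; rewrite /f Im_dir.
    apply: (@cvg_norm _ R^o); apply: cvgD; apply: cvgM; try exact: cvg_cst.
      exact: continuous_sin.
    exact: continuous_cos.
  have [c cin hc] := EVT_min th12 cf.
  have g : 2 * eps < f c.
    apply: ray_gap => //; first by apply: contra nab => /eqP ->.
    by move=> t tr; apply: h => //; move: cin; rewrite in_itv.
  exists (f c - 2 * eps); first by rewrite subr_gt0.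
  by move=> th _ hth /=; rewrite addrC subrK; apply: hc; rewrite in_itv.
- by exists k => // a b th uab hth; apply: (hk (a, b)).
Qed.

Variables (u0 : T) (A N1 : T -> M) (F : nat -> T -> M) (r1 eps : R).
Hypothesis eps0 : 0 < eps.
Hypothesis epsr1 : eps < r1.
Hypothesis hA : forall t i j, rn t < r1 -> hol (fun t => A t i j) t.
Hypothesis hN : forall t i j, rn t < r1 -> hol (fun t => N1 t i j) t.
Hypothesis hF : forall k t i j, rn t < r1 -> hol (fun t => F k t i j) t.
Hypothesis fF : forall t, rn t < r1 -> is_formal_solution (u0 + t) (A t) (F^~ t).
Hypothesis pF : forall t k j a c, rn t < r1 ->
  dd (fun t => F j t a c) t (delta_mx 0 k) = cmx k (F j.+1 t) a c - (cmx k (N1 t) *m F j t) a c.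

Let bounded (G : T -> M) (r : R) : r < r1 -> (forall t i j, rn t < r1 -> hol (fun t => G t i j) t) ->
  exists B, forall t i j, rn t < r -> rn (G t i j) <= B.
Proof.
move=> rr1 hG; have h (ij : 'I_n * 'I_n) : exists B, 0 <= B /\ forall t, rn t < r -> rn (G t ij.1 ij.2) <= B.
  have [B B0 hB] := hol_bounded_polydisc rr1 (fun t => @hG t ij.1 ij.2).
  by exists B; split => // t /ltW; exact: hB.
have [B hB] := choice h; exists (\sum_ij B ij) => t i j tr.
have := (hB (i, j)).2 t tr => /le_trans; apply; rewrite (bigD1 (i, j))//= lerDl.
by apply: sumr_ge0 => ij _; have [] := hB ij.
Qed.

(** Integration in the direction [- th] serves the half-plane of arguments around [th]. A closed
    sector from [p] to [q] therefore needs the directions between [p + pi / 2] and [q - pi / 2] and,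
    since the half-planes are open, a little more on both sides. *)
Lemma sector_exists (p q : R) : p + pi <= q ->
  (forall t a b th, rn t <= eps -> u0 0 a != u0 0 b -> p + pi / 2 <= th <= q - pi / 2 ->
    complex.Im (((u0 + t) 0 a - (u0 + t) 0 b) * dir th) != 0) ->
  exists (r : R) (Y : T -> C -> M), [/\ eps < r < r1,
      forall t, rn t < r -> is_fundamental (u0 + t) (A t) (Y t),
      forall t w a b, rn t < r -> hol (fun t => Y t w a b) t
    & forall t, rn t < r -> asymp p q (u0 + t) (\row_a A t a a) (F^~ t) (Y t)].
Proof.
move=> pq norays; have p0 := @pi_gt0 R.
have th12 : p + pi / 2 <= q - pi / 2 by lra.
have [k k0 hk] := ray_gap_uniform eps0 th12 norays.
(* A turn by [eta] changes the imaginary part by at most [2 |u0| eta <= k / 4], and the radius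
   [r <= eps + k / 8] costs another [k / 4]; of the slack [k] there remains [k / 2]. *)
pose K : R := 4 * (2 * rn u0 + 1).
have K0 : 0 < K by have := rn_ge0 u0; rewrite /K; lra.
pose r := Num.min ((eps + r1) / 2) (eps + k / 8).
pose eta := Num.min (pi / 4) (k / K).
have [r2 r3 r4] : [/\ eps < r, r < r1 & r <= eps + k / 8].
  have epsr := epsr1; split; [rewrite lt_min; apply/andP; split; [lra|lra]|by rewrite gt_min; apply/orP; left; lra|by rewrite ge_min lexx orbT].
have [e1 e2 e3] : [/\ 0 < eta, eta < pi / 2 & eta * K <= k].
  split; first by rewrite lt_min !divr_gt0.
    by rewrite gt_min; apply/orP; left; lra.
  by rewrite -ler_pdivlMr// ge_min lexx orbT.
(* These are the ends for which the sector of [sector_solution] is exactly [[p, q]]. *)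
pose al := pi / 2 - eta - q; pose be := - (pi / 2) + eta - p.
have albe : al <= be by rewrite /al /be; lra.
have gap t a b th : rn t < r -> u0 0 a != u0 0 b -> al <= th <= be ->
    k / 2 <= `|complex.Im (((u0 + t) 0 a - (u0 + t) 0 b) * dir (- th))|.
  move=> tr uab /andP[t1 t2].
  have [th' th'in th'd] : exists2 th', p + pi / 2 <= th' <= q - pi / 2 & `|- th - th'| <= eta.
    case: (leP (p + pi / 2) (- th)) => c1; last first.
      by exists (p + pi / 2); [lra|rewrite ler_norml; move: t1 t2; rewrite /al /be; lra].
    case: (leP (- th) (q - pi / 2)) => c2; last first.
      by exists (q - pi / 2); [lra|rewrite ler_norml; move: t1 t2; rewrite /al /be; lra].
    by exists (- th); [lra|rewrite subrr normr0 ltW].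
  have h1 := hk a b th' uab th'in.
  have E : ((u0 + t) 0 a - (u0 + t) 0 b) * dir (- th) = (u0 0 a - u0 0 b) * dir th' +
      ((u0 0 a - u0 0 b) * (dir (- th) - dir th') + (t 0 a - t 0 b) * dir (- th)).
    by rewrite !rowDE; ring.
  rewrite E ImD; set x := complex.Im _ in h1 *; set w := _ + (t 0 a - t 0 b) * _.
  have hw : `|complex.Im w| <= 2 * rn u0 * eta + 2 * r.
    apply: le_trans (Im_le_rn _) _; apply: le_trans (rnD _ _) _; apply: lerD.
      rewrite rnM; apply: ler_pM; rewrite ?rn_ge0//; last exact: le_trans (dir_lipschitz _ _) _.
      by apply: le_trans (rnB_le _ _) _; have := rn_entry u0 0 a; have := rn_entry u0 0 b; lra.
    rewrite rnM rn_dir mulr1; apply: le_trans (rnB_le _ _) _.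
    by have := rn_entry t 0 a; have := rn_entry t 0 b; lra.
  have h2 : `|x| <= `|x + complex.Im w| + `|complex.Im w|.
    by rewrite -[in leLHS](addrK (complex.Im w) x); exact: ler_normB.
  have h3 : 2 * rn u0 * eta <= k / 4.
    by have := mulr_ge0 (rn_ge0 u0) (ltW e1); move: e3; rewrite /K; lra.
  lra.
(* The open neighbourhood of size [k / 4] of the rays of integration, star-shaped about 0. The
   singular points are at distance [k / 2] from the rays, hence at least [k / 4] from [D]. *)
pose D : set C := [set x | exists rho th, [/\ 0 <= rho, al <= th <= be & rn (x - rho%:C * dir th) < k / 4]].
have rayD th (rho : R) : al <= th <= be -> 0 <= rho -> D (rho%:C * dir th).
  by move=> h1 h2; exists rho, th; split; rewrite ?subrr ?rn0//; lra.
have oD : opn D.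
  move=> x [rho [th [h1 h2 h3]]]; exists (k / 4 - rn (x - rho%:C * dir th)); first by rewrite subr_gt0.
  by move=> y hy; exists rho, th; split => //; have := rn_tri y x (rho%:C * dir th); lra.
have sD (s : R) x : 0 <= s <= 1 -> D x -> D (s%:C * x).
  move=> /andP[s0 s1] [rho [th [h1 h2 h3]]]; exists (s * rho), th; split => //; first exact: mulr_ge0.
  rewrite rmorphM -mulrA -mulrBr rnM rn_real ger0_norm//; apply: le_lt_trans h3.
  by rewrite ler_piMl// rn_ge0.
have D0 : D 0 by have := rayD al 0 _ (lexx 0); rewrite mul0r lexx albe; apply.
have k4 : 0 < k / 4 by rewrite divr_gt0.
have sep (x : C) t a b : D x -> rn t < r -> u0 0 a != u0 0 b -> k / 4 <= rn (x + (u0 + t) 0 a - (u0 + t) 0 b).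
  move=> [rho [th [h1 h2 h3]]] tr uab; have h4 := gap t a b th tr uab h2.
  set c := (u0 + t) 0 a - (u0 + t) 0 b in h4; rewrite -addrA -/c.
  have h5 : `|complex.Im (c * dir (- th))| <= rn (rho%:C * dir th + c).
    have -> : complex.Im (c * dir (- th)) = complex.Im ((rho%:C * dir th + c) * dir (- th)).
      by rewrite (mulrDl (rho%:C * dir th)) ImD -(mulrA rho%:C) dirN mulr1 [complex.Im rho%:C]/= add0r.
    by apply: le_trans (Im_le_rn _) _; rewrite (rnM (_ + _)) rn_dir mulr1.
  have := rn_sub (rho%:C * dir th + c) (x + c).
  rewrite (_ : rho%:C * dir th + c - (x + c) = - (x - rho%:C * dir th)) ?rnN; last by ring.
  lra.
have lt1 (t : T) : rn t < r -> rn t < r1 by move=> h; exact: lt_trans h r3.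
have rpos : 0 < r by exact: lt_trans r2.
have [BA bA] := bounded r3 hA; have [BN bN] := bounded r3 hN.
have bF m := bounded r3 (@hF m).
have hA' (t : T) i j (tr : rn t < r) := hA i j (lt1 t tr); have hN' (t : T) i j (tr : rn t < r) := hN i j (lt1 t tr).
have hF' m (t : T) i j (tr : rn t < r) := @hF m t i j (lt1 t tr).
have fF' (t : T) (tr : rn t < r) := fF (lt1 t tr).
have pF' (t : T) k' j a c (tr : rn t < r) := @pF t k' j a c (lt1 t tr).
have B b := @borel_transform R n u0 A N1 F r D (k / 4) BA BN b oD sD D0 k4
  (fun x t a => @sep x t a b) hA' hN' hF' bA bN bF fF' pF' rpos.
have [phi hphi] := choice B.
have e12 : 0 < eta < pi / 2 by rewrite e1.
have [Y [Y1 Y2 Y3]] := @sector_solution R n u0 A F r D al be oD sD rayD albe hA' bF fF' phi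
  (fun b => let: And3 h _ _ := hphi b in h) (fun b => let: And3 _ h _ := hphi b in h) (fun b => let: And3 _ _ h := hphi b in h) eta e12.
exists r, Y; split=> //; first by rewrite r2.
move=> t tr; have := Y3 t tr; congr asymp; rewrite /al /be; lra.
Qed.
End SectorGeometry.

(** * Continuation of Levelt forms *)

Section CircleMean.
Variable R : realType.
Local Notation C := R[i].
Implicit Type sg : R.

Definition circle_point sg (s : R) : C := sg%:C + s%:C * ('i * (2 * pi)%:C).
(** The mean over the circle [|z| = exp sg] of a function of log z. *)
Definition circle_mean sg (g : C -> C) : C := cint (fun s : R => g (circle_point sg s)).

Lemma Re_circle_point sg s : complex.Re (circle_point sg s) = sg.
Proof. by rewrite /circle_point ReD !ReM /=; ring. Qed.

Lemma circle_mean_cont sg (g : C -> C) : (forall w, hol g w) -> cont01 (fun s : R => g (circle_point sg s)).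
Proof. by move=> hg; apply: (cont_seg (w := sg%:C)) => s _; exact: hg. Qed.

Lemma circle_mean_indep (g : C -> C) s1 s2 : (forall w, hol g w) -> (forall w, g (w + 'i * (2 * pi)%:C) = g w) ->
  circle_mean s1 g = circle_mean s2 g.
Proof.
move=> hg gT; wlog s12 : s1 s2 / s1 <= s2 => [hw|].
  by case: (leP s1 s2) => [/hw//|/ltW/hw].
have p0 : 0 < 2 * pi :> R by rewrite mulr_gt0// pi_gt0.
have s0 : 0 <= s2 - s1 by rewrite subr_ge0.
have := goursat (f := g) (w := s1%:C) s0 (ltW p0) (fun z _ => hg z); rewrite /rect.
have -> : edge g (s1%:C + 'i * (2 * pi)%:C) (s2 - s1)%:C = edge g s1%:C (s2 - s1)%:C.
  by rewrite /edge; congr (_ * _); apply: cint_eq => u _; rewrite addrAC gT.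
have -> : s1%:C + (s2 - s1)%:C = s2%:C :> C by rewrite -rmorphD /=; congr (_%:C); ring.
have Tn0 : 'i * (2 * pi)%:C != 0 :> C by rewrite -rn_eq0 (rnM 'i) rn_i mul1r rn_real gt_eqF// normr_gt0 gt_eqF.
have ee s : edge g s%:C ('i * (2 * pi)%:C) = 'i * (2 * pi)%:C * circle_mean s g by [].
rewrite !ee; move: (circle_mean s1 g) (circle_mean s2 g) (edge _ _ _) => x1 x2 x3 E0.
by apply: (mulfI Tn0); apply/eqP; rewrite eq_sym -subr_eq0 -E0; apply/eqP; ring.
Qed.

Lemma circle_mean_hol0 (h : C -> C) sg : (forall x, hol h x) -> circle_mean sg (fun w => h (cexp w)) = h 0.
Proof.
move=> hh; pose g w := h (cexp w).
have hg w : hol g w by have [L hL] := hh (cexp w); eexists; exact: (isd_chain (isd_cexp w) hL).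
have gT w : g (w + 'i * (2 * pi)%:C) = g w.
  rewrite /g -(cexp_2pi w); congr (h (cexp (w + _))); apply: complexP; rewrite ?ReM ?ImM /=; ring.
apply/eqP; rewrite -subr_eq0; apply/eqP; apply: small_eq0 => e e0.
have [d d0 hd] := hol_cont (hh 0) e0.
rewrite -/g (circle_mean_indep sg (ln d - 1) hg gT).
have -> : h 0 = cint (fun=> h 0).
  by apply/esym; apply: cint_lim => e1 e10; exists 0%N => k _; rewrite rsum_const subrr rn0 ltW.
have cc : cont01 (fun _ : R => h 0) by apply: (@cont_seg _ (fun=> h 0) 0 0) => v _; exact: hol_const.
have cg := circle_mean_cont (ln d - 1) hg.
rewrite /circle_mean -(cintB cg cc); apply: cint_bound => [|s s01].
  apply: (@cont_seg _ (fun w => g w - h 0)) => s _; exact: holB (hg _) (hol_const _ _).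
apply: hd; rewrite subr0 rn_cexp Re_circle_point -[ltRHS]lnK ?posrE// ltr_expR; lra.
Qed.

Lemma circle_mean_negpow sg k : circle_mean sg (fun w => cexp w ^- k.+1) = 0.
Proof.
pose g (w : C) := cexp w ^- k.+1.
have gE w : cexp (- (k.+1%:R * w)) = g w.
  rewrite cexpN /g; congr (_^-1); elim: k.+1 => [|j IH]; first by rewrite mul0r cexp0.
  by rewrite -natr1 mulrDl mul1r cexpD IH exprSr.
have hg w : hol g w.
  apply: (hol_ext gE); apply: hol_cexp; apply: holN; apply: holM; [exact: hol_const|by exists id; exact: isd_id].
have gT w : g (w + 'i * (2 * pi)%:C) = g w.
  rewrite /g -(cexp_2pi w); congr (cexp (w + _) ^- _); apply: complexP; rewrite ?ReM ?ImM /=; ring.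
apply: small_eq0 => e e0; rewrite -/g (circle_mean_indep sg (- ln (Num.min e 1)) hg gT).
apply: cint_bound => [|s s01]; first exact: circle_mean_cont.
have m0 : 0 < Num.min e 1 by rewrite lt_min e0 ltr01.
rewrite rnV rnX rn_cexp Re_circle_point expRN lnK ?posrE// exprVn invrK exprS.
apply: (@le_trans _ _ (Num.min e 1)); last by rewrite ge_min lexx.
by rewrite ler_piMr ?(ltW m0)// exprn_ile1 ?(ltW m0)// ge_min lexx orbT.
Qed.

(** Division by [z^m] turns the terms of degree below [m] into negative powers, whose means vanish;
    what remains is entire in [z] with the value [a m] at 0. *)
Lemma circle_mean_coef (a : nat -> C) (f : C -> C) sg m : (forall x, clim (fun k => \sum_(l < k) x ^+ l * a l) (f x)) ->
  circle_mean sg (fun w => cexp w ^- m * f (cexp w)) = a m.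
Proof.
move=> ha.
have xn (x : C) k : x != 0 -> x ^+ k != 0 by move=> ?; rewrite expf_neq0.
have sumS k (x : C) : \sum_(l < m + k) x ^+ l * a l = \sum_(l < m) x ^+ l * a l + x ^+ m * \sum_(l < k) x ^+ l * a (m + l)%N.
  rewrite big_split_ord /=; congr (_ + _); rewrite mulr_sumr; apply: eq_bigr => l _.
  by rewrite exprD mulrA.
pose h (x : C) : C := if x == 0 then a m else x ^- m * (f x - \sum_(l < m) x ^+ l * a l).
have hh x : hol h x.
  apply: (@pseries_entire _ (fun l => a (m + l)%N)) => [y yn0|]; last by rewrite /h eqxx addn0.
  rewrite /h (negPf yn0).
  have c1 := climM (y ^- m) (climB (clim_shift m (ha y)) (clim_const (\sum_(l < m) y ^+ l * a l))).
  apply: clim_ext c1 => k; rewrite addnC sumS addrC addKr mulKf//; exact: xn.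
have fE w : cexp w ^- m * f (cexp w) = h (cexp w) + \sum_(l < m) a l * cexp w ^- (m - l.+1).+1.
  have cn := cexp_neq0 w; rewrite /h (negPf cn) mulrBr -addrA [X in _ + X](_ : _ = 0) ?addr0//.
  rewrite addrC mulr_sumr -sumrB big1// => l _; apply/eqP; rewrite subr_eq0; apply/eqP.
  have -> : cexp w ^+ m = cexp w ^+ (m - l.+1).+1 * cexp w ^+ l by rewrite -exprD addSn -addnS subnK.
  move: (xn _ (m - l.+1).+1 cn) (xn _ l cn) => x1 x2.
  by rewrite invfM -[RHS]mulrA (mulKf x2) mulrC.
have hg k w : hol (fun w : C => cexp w ^- k) w.
  by apply: holV; [rewrite expf_neq0// cexp_neq0|apply: holX; apply: hol_cexp; exists id; exact: isd_id].
have hw w : hol (fun w => h (cexp w)) w by have [L hL] := hh (cexp w); eexists; exact: (isd_chain (isd_cexp w) hL).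
have cs (I : Type) (s : seq I) (F : I -> C -> C) : (forall i w, hol (F i) w) ->
    circle_mean sg (fun w => \sum_(i <- s) F i w) = \sum_(i <- s) circle_mean sg (F i).
  move=> hF; elim: s => [|i s IH].
    by rewrite big_nil; apply: cint_lim => e e0; exists 0%N => k _; rewrite (@rsum_eq _ _ _ (fun=> 0)) ?rsum_const ?subrr ?rn0 ?ltW// => s _; rewrite big_nil.
  rewrite big_cons -IH /circle_mean -cintD; try exact: circle_mean_cont.
    by apply: cint_eq => u _; rewrite big_cons.
  by apply: (@circle_mean_cont sg (fun w => \sum_(i <- s) F i w)) => w; apply: hol_sum => j; exact: hF.
rewrite /circle_mean (cint_eq (fun s _ => fE (circle_point sg s))).
have cm1 := circle_mean_cont sg hw.
have hs w : hol (fun w => \sum_(l < m) a l * cexp w ^- (m - l.+1).+1) w.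
  by apply: hol_sum => l; apply: holM; [exact: hol_const|exact: hg].
rewrite (cintD cm1 (circle_mean_cont sg hs)) -/(circle_mean sg (fun w => h (cexp w))) (circle_mean_hol0 _ hh) /h eqxx.
rewrite [X in _ + X](_ : _ = 0) ?addr0//.
rewrite -/(circle_mean sg (fun w => \sum_(l < m) a l * cexp w ^- (m - l.+1).+1)).
rewrite cs => [|l w]; last by apply: holM; [exact: hol_const|exact: hg].
rewrite big1// => l _; rewrite /circle_mean (cintZ (a l) (circle_mean_cont sg (hg _))).
by rewrite -/(circle_mean sg (fun w => cexp w ^- (m - l.+1).+1)) circle_mean_negpow mulr0.
Qed.
End CircleMean.

(** * Laurent coefficients that depend on t *)

Section LaurentExtension.
Variable R : realType.
Local Notation C := R[i].
Variables (V : normedModType C) (r : R).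
Implicit Type f : C * V -> C.

(* The first argument of [f] is [log z], so this is the coefficient of [z ^+ m]. *)
Definition laurent_coef f (sg : R) (m : nat) (t : V) : C := circle_mean sg (fun w => cexp w ^- m * f (w, t)).

Let hol_negpow m (w : C) : hol (fun w : C => cexp w ^- m) w.
Proof. by apply: holV; [rewrite expf_neq0// cexp_neq0|apply: holX; apply: hol_cexp; exists id; exact: isd_id]. Qed.

Lemma laurent_coef_local f sg t : (forall w t, rn t < r -> hol f (w, t)) -> rn t < r ->
  exists dl K : R, [/\ 0 < dl, 0 <= K, forall m y, rn (y - t) < dl -> rn (laurent_coef f sg m y) <= K * expR sg ^- m,
    forall y, rn (y - t) < dl -> rn y < r & forall m, hol (laurent_coef f sg m) t].
Proof.
move=> hf tr; pose E : set (C * V) := [set z | rn z.2 < r].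
have oE : opn E.
  move=> [x y] /= yr; exists (r - rn y); first by rewrite subr_gt0.
  move=> [x' y']; rewrite -[_ - _]/(x' - x, y' - y) => /rn_pair_lt[_ h].
  by rewrite /E /=; have := rn_sub y' y; lra.
have [|s s01|s s01 e e0|dl [K [dl0 hK]]] := @tube R V (C * V)%type E f (fun s y => (circle_point sg s, y)) t oE.
- by case=> w y; exact: hf.
- exact: tr.
- have c0 : 0 < 2 * pi + 1 :> R by have := @pi_gt0 R; lra.
  exists (Num.min e (e / (2 * pi + 1))); first by rewrite lt_min e0 divr_gt0.
  move=> s' y; rewrite !lt_min => /andP[_ h1] /andP[h2 _].
  apply/rn_pair_lt; split => //=; rewrite /circle_point opprD addrACA subrr add0r -mulrBl -rmorphB.
  rewrite (rnM (s' - s)%:C) (rnM 'i) rn_i mul1r !rn_real [`|2 * pi|]ger0_norm ?mulr_ge0 ?pi_ge0//.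
  move: h1; rewrite ltr_pdivlMr//; apply: le_lt_trans; rewrite ler_wpM2l//; lra.
have K0 : 0 <= K.
  by have [||_] := hK 0 t; rewrite ?lexx ?ler01 ?subrr ?rn0//; apply: le_trans; exact: rn_ge0.
have bK m s y : 0 <= s <= 1 -> rn (y - t) < dl ->
    rn (cexp (circle_point sg s) ^- m * f (circle_point sg s, y)) <= K * expR sg ^- m.
  move=> s01 hy; have [_ h] := hK s y s01 hy.
  by rewrite rnM rnV rnX rn_cexp Re_circle_point mulrC ler_wpM2r// invr_ge0 exprn_ge0// expR_ge0.
have yr y : rn (y - t) < dl -> rn y < r by move=> hy; have [||h _] := hK 0 y; rewrite ?lexx ?ler01.
have hw m y w : rn (y - t) < dl -> hol (fun w : C => cexp w ^- m * f (w, y)) w.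
  by move=> /yr hy; apply: holM; [exact: hol_negpow|apply: hol_slice1; exact: hf].
exists dl, K; split=> // [m y hy|m].
  apply: cint_bound => [|s s01]; last exact: bK.
  exact: (circle_mean_cont sg (fun w => hw m y w hy)).
apply: (cint_hol dl0 _ _).1 => [s y s01 hy|y hy].
  split; last exact: bK.
  by apply: holM; [exact: hol_const|apply: hol_slice2; apply: hf; exact: yr].
exact: (circle_mean_cont sg (fun w => hw m y w hy)).
Qed.

(** The coefficients are holomorphic in [t] for each radius; near [c] they do not depend on the
    radius, hence nowhere. A circle larger than [|z|] makes the series converge geometrically,
    locally uniformly in [t], and its sum agrees with [f] near [c]. *)
Lemma laurent_extension f (c : V) (dl : R) : (forall w t, rn t < r -> hol f (w, t)) -> rn c < r -> 0 < dl ->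
  (forall y, rn (y - c) < dl -> rn y < r /\ exists (a : nat -> C) (g : C -> C),
     (forall x, clim (fun k => \sum_(l < k) x ^+ l * a l) (g x)) /\ forall w, f (w, y) = g (cexp w)) ->
  forall t w, rn t < r -> clim (fun k => \sum_(l < k) cexp w ^+ l * laurent_coef f 0 l t) (f (w, t)).
Proof.
move=> hf cr dl0 near t w tr.
have hc sg m y : rn y < r -> hol (laurent_coef f sg m) y.
  by move=> yr; have [? [? [_ _ _ _ h]]] := laurent_coef_local sg hf yr; exact: h.
have cE (sg : R) (m : nat) (y : V) (a : nat -> C) (g : C -> C) : rn (y - c) < dl -> (forall x, clim (fun k => \sum_(l < k) x ^+ l * a l) (g x)) ->
    (forall w, f (w, y) = g (cexp w)) -> laurent_coef f sg m y = a m.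
  move=> hy ha hg; rewrite -(circle_mean_coef sg m ha); apply: cint_eq => s _.
  by rewrite hg.
(* The circle has radius [e |z|], so the terms of the series are of the order [q^l] with
   [q = 1 / e]. *)
pose sg := complex.Re w + 1; pose q : R := expR (- 1).
have q01 : 0 <= q < 1 by rewrite expR_ge0 -[ltRHS]expR0 ltr_expR ltrN10.
have -> : (fun k => \sum_(l < k) cexp w ^+ l * laurent_coef f 0 l t) = fun k => \sum_(l < k) cexp w ^+ l * laurent_coef f sg l t.
  apply/funext => k; apply: eq_bigr => l _; congr (_ * _).
  apply: (identity_convex_ball (hc 0 l) (hc sg l) cr tr dl0) => y hy.
  by have [_ [a [g [ha hg]]]] := near y hy; rewrite !(cE _ _ _ _ _ hy ha hg).
pose S k (y : V) := \sum_(l < k) cexp w ^+ l * laurent_coef f sg l y.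
have local y0 : rn y0 < r -> exists d K : R, [/\ 0 < d, 0 <= K, forall y, rn (y - y0) < d -> rn y < r &
    forall k l y, rn (y - y0) < d -> (k <= l)%N -> rn (S l y - S k y) <= K * q ^+ k].
  move=> y0r; have [d [K [d0 K0 hK yr _]]] := laurent_coef_local sg hf y0r.
  have q1 : 0 < 1 - q by rewrite subr_gt0; case/andP: q01.
  exists d, (K / (1 - q)); split=> // [|k l y hy kl]; first by rewrite divr_ge0// ltW.
  have t1 m : rn (cexp w ^+ m * laurent_coef f sg m y) <= K * q ^+ m.
    rewrite rnM rnX rn_cexp; apply: (@le_trans _ _ (expR (complex.Re w) ^+ m * (K * expR sg ^- m))).
      by rewrite ler_wpM2l ?exprn_ge0 ?expR_ge0// hK.
    rewrite mulrCA -exprVn -exprMn -expRN -expRD (_ : _ + - sg = - 1)//; rewrite /sg; ring.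
  rewrite -(subnKC kl); elim: (l - k)%N => [|m IH] in t1 *.
    by rewrite addn0 subrr rn0 mulr_ge0 ?exprn_ge0 ?divr_ge0//; [exact: ltW|case/andP: q01].
  have : rn (S (k + m.+1)%N y - S k y) <= K * (q ^+ k - q ^+ (k + m.+1)%N) / (1 - q).
    elim: (m.+1) => [|j IHj]; first by rewrite addn0 !subrr rn0 mulr0 mul0r.
    rewrite addnS /S big_ord_recr /= -/(S _ y) addrAC; apply: le_trans (rnD _ _) _.
    apply: le_trans (lerD IHj (t1 _)) _; rewrite le_eqVlt; apply/orP; left; apply/eqP.
    by rewrite exprS; field; rewrite gt_eqF.
  move=> h; apply: le_trans h _; rewrite mulrAC ler_wpM2l ?divr_ge0 ?(ltW q1)//.
  by rewrite gerBl exprn_ge0//; case/andP: q01.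
have cv y : rn y < r -> exists l, clim (S^~ y) l.
  move=> yr; have [d [K [d0 K0 _ hK]]] := local y yr; apply: clim_cauchy => e e0.
  have [N hN] := geom_small K q01 e0; exists N => k l Nk Nl.
  have yy : rn (y - y) < d by rewrite subrr rn0.
  case: (leqP k l) => kl; first by rewrite rnB (le_trans (hK _ _ _ yy kl))// hN.
  by rewrite (le_trans (hK _ _ _ yy (ltnW kl)))// hN.
have {}cv y : exists l, rn y < r -> clim (S^~ y) l.
  by case: (pselect (rn y < r)) => [/cv[l hl]|ny]; [exists l|exists 0 => /ny].
have [G hG] := choice cv.
have hGh y0 : rn y0 < r -> hol G y0.
  move=> yr0; have [d [K [d0 K0 yr hK]]] := local y0 yr0.
  apply: (@vitali _ _ S G y0 d K d0 _ _ _).1 => [k y hy|k y hy|y hy]; last exact/hG/yr.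
    by apply: hol_sum => l; apply: holM; [exact: hol_const|exact/hc/yr].
  by have := hK 0%N k y hy (leq0n _); rewrite /S big_ord0 subr0 expr0 mulr1.
rewrite -(_ : G t = f (w, t)); first exact: hG.
apply: (identity_convex_ball hGh _ cr tr dl0 (g := fun y => f (w, y))) => [y yr|y hy].
  by apply: hol_slice2; exact: hf.
have [yr [a [g [ha hg]]]] := near y hy; rewrite hg.
apply: clim_unique (hG y yr) _; apply: clim_ext (ha (cexp w)) => k.
by apply: eq_bigr => l _; rewrite (cE sg l y a g).
Qed.
End LaurentExtension.

(** * From Laurent coefficients to Levelt forms *)

Section LeveltExtension.
Variable R : realType.
Local Notation C := R[i].
Variables (n : nat) (V : normedModType C) (r : R).
Local Notation M := 'M[C]_n.
Variables (A : V -> M) (Y0 : V -> C -> M) (J : M) (Z : C -> M) (c : V) (dl : R).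
Hypothesis hA : forall t i j, rn t < r -> hol (fun t => A t i j) t.
Hypothesis hY : forall w t i j, rn t < r -> hol (fun p : C * V => Y0 p.2 p.1 i j) (w, t).
Hypothesis uY : forall w t, rn t < r -> Y0 t w \in unitmx.
Hypothesis cr : rn c < r.
Hypothesis dl0 : 0 < dl.
Hypothesis uZ : forall w, Z w \in unitmx.
Hypothesis hZ : forall w i j, hol (fun w => Z w i j) w.
Hypothesis near : forall y, rn (y - c) < dl -> rn y < r /\ exists (G : M) (Psi : nat -> M) (h : C -> M),
  [/\ G \in unitmx, invmx G *m A y *m G = J, Psi 0%N = 1%:M /\ h 0 = G,
    forall x i j, clim (fun m => \sum_(l < m) x ^+ l * (G *m Psi l) i j) (h x i j) /\ hol (fun x => h x i j) x
  & forall w, Y0 y w = h (cexp w) *m Z w].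

Let q (p : C * V) : M := Y0 p.2 p.1 *m invmx (Z p.1).
Let qi (p : C * V) : M := Z p.1 *m invmx (Y0 p.2 p.1).

Let hq w t i j : rn t < r -> hol (fun p => q p i j) (w, t).
Proof.
move=> tr; apply: hol_mulmx => i' j'; first exact: hY.
apply: (@hol_fst_comp _ _ (fun w => invmx (Z w) i' j')).
by apply: (hol_invmx _ _ ltr01) => [y _|i1 j1]; [exact: uZ|exact: hZ].
Qed.

Let hqi w t i j : rn t < r -> hol (fun p => qi p i j) (w, t).
Proof.
move=> tr; apply: hol_mulmx => i' j'; first by apply: (@hol_fst_comp _ _ (fun w => Z w i' j')); exact: hZ.
have r0 : 0 < r - rn t by rewrite subr_gt0.
apply: (hol_invmx _ _ r0) => [[x y]|i1 j1]; last exact: hY.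
rewrite -[_ - _]/(x - w, y - t) => /rn_pair_lt[_ h] /=; apply: uY.
by have := rn_sub y t; lra.
Qed.

Let q_near y : rn (y - c) < dl -> exists (G : M) (a : nat -> M) (h : C -> M),
  [/\ G \in unitmx, A y *m G = G *m J, a 0%N = G /\ (forall x, h x \in unitmx),
    forall i j, (forall x, clim (fun k => \sum_(l < k) x ^+ l * a l i j) (h x i j)) /\ forall x, hol (fun x => h x i j) x
  & h 0 = G /\ forall w, q (w, y) = h (cexp w)].
Proof.
move=> hy; have [yr [G [Psi [h [uG AG [P0 h0] hh hYh]]]]] := near hy.
exists G, (fun l => G *m Psi l), h; split=> //.
- by rewrite -AG !mulmxA mulmxV// mul1mx.
- split=> [|x]; first by rewrite P0 mulmx1.
  case: (eqVneq x 0) => [->|xn]; first by rewrite h0.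
  have [w [<- _]] := clog 0 xn; have := uY w yr; rewrite hYh unitmx_mul.
  by case/andP.
- by move=> i j; split => x; have [] := hh x i j.
- by split => // w; rewrite /q /= hYh (mulmxK (uZ w)).
Qed.

Let G (t : V) : M := \matrix_(i, j) laurent_coef (fun p => q p i j) 0 0 t.
(** Near [c] this is the inverse of [G]. The identity [G Gi = 1] then continues, and with it the
    invertibility of [G], which continuation of [G] alone would not give. *)
Let Gi (t : V) : M := \matrix_(i, j) laurent_coef (fun p => qi p i j) 0 0 t.

Let coef_hol (f : C * V -> C) m t : (forall w t, rn t < r -> hol f (w, t)) -> rn t < r -> hol (laurent_coef f 0 m) t.
Proof. by move=> hf tr; have [? [? [_ _ _ _ h]]] := laurent_coef_local 0 hf tr; exact: h. Qed.

Let GE t i j : G t i j = laurent_coef (fun p => q p i j) 0 0 t. Proof. by rewrite [LHS]mxE. Qed.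
Let GiE t i j : Gi t i j = laurent_coef (fun p => qi p i j) 0 0 t. Proof. by rewrite [LHS]mxE. Qed.

Let G_near y : rn (y - c) < dl -> [/\ G y \in unitmx, Gi y = invmx (G y) & A y *m G y = G y *m J].
Proof.
move=> hy; have [G0 [a [h [uG AG [a0 uh] ha [h0 hq0]]]]] := q_near hy.
have E : G y = G0.
  apply/matrixP => i j; rewrite GE; have := circle_mean_coef (a := fun l => a l i j) 0 0 (ha i j).1; rewrite a0 => <-.
  by apply: cint_eq => s _; rewrite hq0.
rewrite E; split=> //; apply/matrixP => i j; rewrite GiE.
have hi x : hol (fun x => invmx (h x) i j) x.
  by apply: (hol_invmx _ _ ltr01) => [x' _|i' j']; [exact: uh|exact: (ha i' j').2].
rewrite -h0 -(circle_mean_hol0 0 hi); apply: cint_eq => s _; rewrite expr0 invr1 mul1r -hq0.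
have yr : rn y < r by have [] := near hy.
set p := (_, y); have e : q p *m qi p = 1%:M by rewrite /q /qi mulmxA (mulmxKV (uZ _)) mulmxV// uY.
have [uq _] := mulmx1_unit e.
suff -> : qi p = invmx (q p) by [].
by rewrite -[RHS]mulmx1 -e (mulKmx uq).
Qed.

(** The relations [G Gi = 1] and [A G = G J] hold near [c] and continue in [t]; [laurent_extension]
    sums the coefficients of [q = Y0 Z^-1] at every [t], and [Psi] is obtained by dividing them by
    the leading one. *)
Lemma power_series_extension t : rn t < r -> exists (G : M) (Psi : nat -> M),
  [/\ G \in unitmx, invmx G *m A t *m G = J, Psi 0%N = 1%:M
    & forall w, exists P : M, series (fun l => cexp w ^+ l *: Psi l) @ \oo --> P /\ Y0 t w = G *m P *m Z w].
Proof.
move=> tr.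
have hG y i j : rn y < r -> hol (fun y => G y i j) y.
  by move=> yr; apply: (hol_ext (fun y => esym (GE y i j))); apply: coef_hol => // w s sr; exact: hq.
have hGi y i j : rn y < r -> hol (fun y => Gi y i j) y.
  by move=> yr; apply: (hol_ext (fun y => esym (GiE y i j))); apply: coef_hol => // w s sr; exact: hqi.
have GGi : G t *m Gi t = 1%:M.
  apply/matrixP => i j; apply: (identity_convex_ball _ _ cr tr dl0 (f := fun t => (G t *m Gi t) i j) (g := fun=> 1%:M i j)).
  - by move=> y yr; apply: hol_mulmx => *; [exact: hG|exact: hGi].
  - by move=> y yr; exact: hol_const.
  - by move=> y hy; have [uG -> _] := G_near hy; rewrite mulmxV.
have AGJ : A t *m G t = G t *m J.
  apply/matrixP => i j; apply: (identity_convex_ball _ _ cr tr dl0 (f := fun t => (A t *m G t) i j) (g := fun t => (G t *m J) i j)).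
  - by move=> y yr; apply: hol_mulmx => *; [exact: hA|exact: hG].
  - by move=> y yr; apply: hol_mulmx => *; [exact: hG|exact: hol_const].
  - by move=> y hy; have [_ _ ->] := G_near hy.
have [uG _] := mulmx1_unit GGi.
pose a l : M := \matrix_(i, j) laurent_coef (fun p => q p i j) 0 l t.
have a0 : a 0%N = G t by [].
exists (G t), (fun l => invmx (G t) *m a l); split; [exact: uG|by rewrite -mulmxA AGJ mulKmx|by rewrite a0 mulVmx|].
move=> w; exists (invmx (G t) *m q (w, t)); split; last first.
  by rewrite mulKVmx// /q mulmxKV.
apply/mx_series_clim => i j.
have cq i1 j1 : clim (fun k => \sum_(l < k) cexp w ^+ l * a l i1 j1) (q (w, t) i1 j1).
  have := @laurent_extension _ _ r (fun p => q p i1 j1) c dl (fun w' t' h => hq w' i1 j1 h) cr dl0 _ t w tr.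
  move=> /(_ _)/wrap[] => [y hy|cl].
    have [G0 [b [h [_ _ _ hb [_ hq0]]]]] := q_near hy; split; first by have [] := near hy.
    by exists (fun l => b l i1 j1), (fun x => h x i1 j1); split=> [|w']; [exact: (hb i1 j1).1|rewrite hq0].
  by apply: clim_ext cl => k; apply: eq_bigr => l _; rewrite /a mxE.
have c1 := clim_sum (index_enum 'I_n) (fun j1 => climM (invmx (G t) i j1) (cq j1 j)).
rewrite mxE; apply: clim_ext c1 => k.
rewrite (eq_bigr (fun l : 'I_k => \sum_j1 cexp w ^+ l * (invmx (G t) i j1 * a l j1 j))); last first.
  by move=> l _; rewrite mxE mulr_sumr.
rewrite exchange_big /=; apply: eq_bigr => j1 _; rewrite mulr_sumr; apply: eq_bigr => l _.
by rewrite mulrCA.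
Qed.
End LeveltExtension.

Lemma levelt_extension (R : realType) (n : nat) (V : normedModType R[i]) (r : R) (A : V -> 'M[R[i]]_n)
   (Y0 : V -> R[i] -> 'M[R[i]]_n) (J S Q : 'M[R[i]]_n) (d : 'rV[int]_n) (c : V) (dl : R) :
  (forall t i j, rn t < r -> hol (fun t => A t i j) t) ->
  (forall w t i j, rn t < r -> hol (fun p : R[i] * V => Y0 p.2 p.1 i j) (w, t)) ->
  (forall w t, rn t < r -> Y0 t w \in unitmx) -> rn c < r -> 0 < dl ->
  (forall y, rn (y - c) < dl -> rn y < r /\ levelt_form (A y) J d S Q (Y0 y)) ->
  forall t, rn t < r -> levelt_form (A t) J d S Q (Y0 t).
Proof.
move=> hA hY uY cr dl0 near t tr.
pose Z w := zpow (int_diag R d) w *m zpow (S + Q) w.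
have uZ w : Z w \in unitmx by rewrite unitmx_mul; apply/andP; split; exact: zpow_unit.
have hZ w i j : hol (fun w => Z w i j) w by apply: hol_mulmx => i' j'; eexists; exact: zpow_mder.
have near' y : rn (y - c) < dl -> rn y < r /\ exists (G : 'M[R[i]]_n) (Psi : nat -> 'M[R[i]]_n) (h : R[i] -> 'M[R[i]]_n),
  [/\ G \in unitmx, invmx G *m A y *m G = J, Psi 0%N = 1%:M /\ h 0 = G,
    forall x i j, clim (fun m => \sum_(l < m) x ^+ l * (G *m Psi l) i j) (h x i j) /\ hol (fun x => h x i j) x
  & forall w, Y0 y w = h (cexp w) *m Z w].
  move=> /near[yr lev]; split; first exact: yr.
  have [G [Psi [h [h1 h2 h3 h4 h5]]]] := levelt_entire lev.
  by exists G, Psi, h; split; [exact: h1|exact: h2|exact: h3|exact: h4|move=> w; rewrite h5 mulmxA].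
have [G [Psi [h1 h2 h3 h4]]] := power_series_extension hA hY uY cr dl0 uZ hZ near' tr.
exists G, Psi; split; [exact: h1|exact: h2|exact: h3|move=> w].
by have [P [P1 P2]] := h4 w; exists P; split; [exact: P1|rewrite P2 /Z !mulmxA].
Qed.

(** * Continuation of the canonical solutions *)

Section HatSector.
Variable R : realType.
Local Notation C := R[i].
Variable n : nat.
Local Notation T := 'rV[C]_n.
Local Notation M := 'M[C]_n.

Lemma dirDpi (th : R) : dir (th + pi) = - dir th :> C.
Proof.
by apply: complexP; rewrite ?ReN ?ImN /dir ?Re_cexp ?Im_cexp /= expR0 !mul1r ?cosDpi ?sinDpi.
Qed.

Lemma dirDpihalf (th : R) : dir (th + pi / 2) = 'i * dir th :> C.
Proof.
by apply: complexP; rewrite ?ReM ?ImM /dir ?Re_cexp ?Im_cexp /= expR0 !mul1r ?cosDpihalf ?sinDpihalf; ring.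
Qed.

Lemma Pi_startS (tau : R) k : Pi_start tau k.+1 = Pi_start tau k + pi.
Proof. by rewrite /Pi_start -natr1; ring. Qed.

Lemma dir_Pi_start (tau : R) k : dir (Pi_start tau k) = (-1) ^+ k * dir tau :> C.
Proof.
elim: k => [|k IH]; last by rewrite Pi_startS dirDpi IH exprS mulN1r mulNr.
have e : tau = Pi_start tau 0 + pi + pi by rewrite /Pi_start; ring.
by rewrite expr0 mul1r [in RHS]e !dirDpi opprK.
Qed.

Lemma Im_dirDpihalf (c : C) (th : R) : complex.Im (c * dir (th + pi / 2)) = complex.Re (c * dir th).
Proof. by rewrite dirDpihalf mulrCA ImM /=; ring. Qed.

(** Joint holomorphy comes from the system: [Y(w, t) = Phi(w, t) Psi(0, t) Y(0, t)], where only the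
    value at [w = 0] involves the given solution. *)
Lemma joint_hol (r : R) (u0 : T) (A : T -> M) (Y : T -> C -> M) : (forall t i j, rn t < r -> hol (fun t => A t i j) t) ->
  (forall t, rn t < r -> is_fundamental (u0 + t) (A t) (Y t)) ->
  (forall t w i j, rn t < r -> hol (fun t => Y t w i j) t) ->
  forall w t i j, rn t < r -> hol (fun p : C * T => Y p.2 p.1 i j) (w, t).
Proof.
move=> hA fY hY w t i j tr; pose E : set T := [set t | rn t < r].
have oE : opn E.
  move=> y yr; exists (r - rn y); first by rewrite subr_gt0.
  by move=> y' hy; have := rn_sub y' y; rewrite /E /=; lra.
have hL y k : E y -> hol (fun t => (u0 + t) 0 k) y.
  move=> _; apply: (hol_ext (f := fun t : T => u0 0 k + t 0 k)) => [z|]; first by rewrite mxE.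
  by apply: holD; [exact: hol_const|by eexists; exact: hol_coord].
have [Phi [Psi [hPP dPhi dPsi PsiPhi]]] := param_system oE hL (fun t i j tE => hA t i j tE).
have YE w' y : rn y < r -> Y y w' = Phi (w', y) *m (Psi (0, y) *m Y y 0).
  move=> yr; have h := adjoint_const w' 0 (fun w => dPsi w y yr) (fun w => ((is_fundamentalP _ _ _).1 (fY y yr) w).1).
  by rewrite -h mulmxA (mulmx1C (PsiPhi w' y yr)) mul1mx.
have r0 : 0 < r - rn t by rewrite subr_gt0.
apply: (hol_near (f := fun p : C * T => (Phi p *m (Psi (0, p.2) *m Y p.2 0)) i j) r0) => [[x y]|].
  rewrite -[_ - _]/(x - w, y - t) => /rn_pair_lt[_ h] /=; rewrite -YE//.
  by have := rn_sub y t; lra.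
apply: hol_mulmx => i1 j1; first by have [] := hPP (w, t) i1 j1 tr.
apply: (@hol_snd _ _ _ (fun y : T => (Psi (0, y) *m Y y 0) i1 j1)).
apply: hol_mulmx => i2 j2; last exact: hY.
have [_ h] := hPP (0, t) i2 j2 tr; exact: (hol_slice2 h).
Qed.

Variables (u0 : T) (A N1 : T -> M) (F : nat -> T -> M) (r1 eps tau : R).
Hypothesis eps0 : 0 < eps.
Hypothesis epsr1 : eps < r1.
Hypothesis hA : forall t i j, rn t < r1 -> hol (fun t => A t i j) t.
Hypothesis hN : forall t i j, rn t < r1 -> hol (fun t => N1 t i j) t.
Hypothesis hF : forall k t i j, rn t < r1 -> hol (fun t => F k t i j) t.
Hypothesis fF : forall t, rn t < r1 -> is_formal_solution (u0 + t) (A t) (F^~ t).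
Hypothesis pF : forall t k j a c, rn t < r1 ->
  dd (fun t => F j t a c) t (delta_mx 0 k) = cmx k (F j.+1 t) a c - (cmx k (N1 t) *m F j t) a c.
Hypothesis gap : forall t a b, rn t <= eps -> u0 0 a != u0 0 b ->
  complex.Re (((u0 + t) 0 a - (u0 + t) 0 b) * dir tau) != 0.

Let gapP k t a b : rn t <= eps -> u0 0 a != u0 0 b ->
  complex.Re (((u0 + t) 0 a - (u0 + t) 0 b) * dir (Pi_start tau k)) != 0.
Proof.
move=> tr uab; have := gap tr uab; rewrite dir_Pi_start -signr_odd.
by case: (odd k); [rewrite expr1 mulN1r mulrN ReN oppr_eq0|rewrite expr0 mul1r].
Qed.

(** [Y] is built for the closed sector from [P] to [P + pi], whose bounding directions are never
    rays of pairs with [u_a(0) <> u_b(0)]. For a larger closed subsector of the hat sector another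
    solution is built, with a radius depending on that subsector; it equals [Y] by the asymptotics
    on the opposite rays [P] and [P + pi]. *)
Lemma hat_solution (k : nat) : exists (r : R) (Y : T -> C -> M), [/\ eps < r < r1,
    forall t, rn t < r -> is_fundamental (u0 + t) (A t) (Y t),
    forall t w a b, rn t < r -> hol (fun t => Y t w a b) t,
    forall t, rn t < r -> asymp (Pi_start tau k) (Pi_start tau k.+1) (u0 + t) (\row_a A t a a) (F^~ t) (Y t)
  & forall t, rn t <= eps -> forall p q, [set z : ucov R | p <= arg z <= q] `<=` hat_sector u0 eps tau k ->
      asymp p q (u0 + t) (\row_a A t a a) (F^~ t) (Y t)].
Proof.
have pi0 := @pi_gt0 R; set P := Pi_start tau k; rewrite Pi_startS -/P.
have [|t a b th tr uab hth|r [Y [rr fY hY aY]]] := @sector_exists R n u0 A N1 F r1 eps eps0 epsr1 hA hN hF fF pF P (P + pi).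
- exact: lexx.
- have -> : th = P + pi / 2 by lra.
  by rewrite Im_dirDpihalf; exact: gapP.
exists r, Y; split=> // t tr p q hpq.
case: (leP p q) => pq; last first.
  by move=> N; exists 0, 0 => z /andP[z1 z2]; have := le_lt_trans (le_trans z1 z2) pq; rewrite ltxx.
have zp : hat_sector u0 eps tau k (0 +i* p : ucov R) by apply: hpq; rewrite /arg /ulog /= lexx.
have zq : hat_sector u0 eps tau k (0 +i* q : ucov R) by apply: hpq; rewrite /arg /ulog /= lexx pq.
have [|s a b th sr uab hth|r' [Y' [/andP[r'1 r'2] fY' hY' aY']]] := @sector_exists R n u0 A N1 F r1 eps eps0 epsr1 hA hN hF fF pF (Num.min p P) (Num.max q (P + pi)).
- have m1 : Num.min p P <= P by rewrite ge_min lexx orbT.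
  have m2 : P + pi <= Num.max q (P + pi) by rewrite le_max lexx orbT.
  lra.
- have sd : polydisc eps s by apply/polydiscE.
  have [hth1 hth2] : Num.min p P <= th - pi / 2 /\ th + pi / 2 <= Num.max q (P + pi) by case/andP: hth; split; lra.
  have e1 : complex.Im (((u0 + s) 0 a - (u0 + s) 0 b) * dir th) = complex.Re (((u0 + s) 0 a - (u0 + s) 0 b) * dir (th - pi / 2)).
    by rewrite -Im_dirDpihalf subrK.
  have g1 := gapP k sr uab; have g2 := gapP k.+1 sr uab; rewrite -/P Pi_startS -/P in g1 g2.
  (* A zero at [th] makes both [th - pi / 2] and [th + pi / 2] directions of rays. Either the first
     is at most [P] or the second is at least [P + pi]; by the definition of the hat sector it then
     lies beyond [p] or [q], against the bounds on [th]. *)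
  case: (leP (th - pi / 2) P) => c1.
    rewrite e1; apply/eqP => ray; have ry : stokes_rays0 u0 s (th - pi / 2) by exists a, b.
    have [/(_ c1) h _] := zp s sd _ ry; rewrite /arg /ulog /= in h.
    have nP : th - pi / 2 != P by apply: contraNneq g1 => <-; rewrite ray.
    move: hth1; rewrite ge_min => /orP[h1|h1]; first by move: h; lra.
    by move: nP; rewrite eq_le c1 h1.
  have e2 : complex.Re (((u0 + s) 0 a - (u0 + s) 0 b) * dir (th + pi / 2)) = - complex.Im (((u0 + s) 0 a - (u0 + s) 0 b) * dir th).
    rewrite e1 (_ : th + pi / 2 = th - pi / 2 + pi); last by lra.
    by rewrite dirDpi mulrN ReN.
  apply/eqP => ray; rewrite ray oppr0 in e2.
  have ry : stokes_rays0 u0 s (th + pi / 2) by exists a, b.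
  have c2 : P + pi <= th + pi / 2 by lra.
  have [_ /(_ c2) h] := zq s sd _ ry; rewrite /arg /ulog /= in h.
  move: hth2; rewrite le_max => /orP[h2|h2]; lra.
have tr' : rn t < r' by exact: le_lt_trans r'1.
have tr1 : rn t < r1 by exact: le_lt_trans epsr1.
have trr : rn t < r by case/andP: rr => rr _; exact: le_lt_trans rr.
have m1 : Num.min p P <= P by rewrite ge_min lexx orbT.
have m2 : P + pi <= Num.max q (P + pi) by rewrite le_max lexx orbT.
have YY : forall z, Y' t z = Y t z.
  apply: (asymp_unique (fF tr1).1 (fY t trr) (fY' t tr') (th := P)).
  - by apply: asymp_sub (aY t trr); lra.
  - by apply: asymp_sub (aY' t tr'); lra.
  - by apply: asymp_sub (aY t trr); lra.
  - by apply: asymp_sub (aY' t tr'); lra.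
apply: (asymp_ext YY); apply: asymp_sub (aY' t tr').
  by rewrite ge_min lexx.
by rewrite le_max lexx.
Qed.
End HatSector.

(** * The radius condition and the cells *)

Section DomainGeometry.
Variable R : realType.
Local Notation C := R[i].
Variable n : nat.
Local Notation T := 'rV[C]_n.
Local Notation M := 'M[C]_n.

(** [delta] is half an infimum, so it is at most half the value at any [rho]. The foot of the
    perpendicular from 0 to the line is at [rho = - Im((y - x) dir tau)], with distance
    [|Re((y - x) dir tau)|]. *)
Lemma delta_ray (tau : R) (x y : C) (e : R) : e < delta tau x y ->
  2 * e < `|complex.Re ((y - x) * dir tau)|.
Proof.
move=> h; have {}h : 2 * e < 2 * delta tau x y by rewrite ltr_pM2l.
apply: lt_le_trans h _; rewrite /delta mulVKf ?pnatr_eq0//.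
pose v := (y - x) * dir tau.
have -> : `|complex.Re ((y - x) * dir tau)| =
    Normc.normc (y - x + (0 +i* (- complex.Im v)) * cexp (0 -i* tau)).
  have e1 : (y - x + (0 +i* (- complex.Im v)) * dir (- tau)) * dir tau = (complex.Re v)%:C.
    rewrite mulrDl -/v -mulrA [dir (- tau) * _]mulrC dirN mulr1.
    by apply: complexP; rewrite ?ReD ?ImD /= ?addr0 ?addrN.
  have := congr1 (@rn R C) e1; rewrite (rnM (_ + _)) rn_dir mulr1 rn_real => <-; by [].
apply: ge_inf; last by exists (- complex.Im v).
exists 0 => _ [rho _ <-]; set z := y - x + _.
exact: (rn_ge0 (z : C)).
Qed.

Lemma cell_noray (u0 : T) (eps tau : R) (E : set T) t : is_cell u0 eps tau E -> E t ->
  [/\ rn t <= eps, forall a b, a != b -> (u0 + t) 0 a != (u0 + t) 0 b & forall k, ~ stokes_rays u0 t (Pi_start tau k)].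
Proof.
move=> [t0 [_ ->]] /connected_component_sub[/[dup] td /polydiscE tr nt]; split=> // [a b ab|k [a [b [uab]]]].
  by apply/eqP => e; apply: nt; left; split=> //; exists a, b.
rewrite /ray_of -/(dir _) dir_Pi_start -signr_odd => ray; apply: nt; right; split=> //.
exists a, b; split=> //; move: ray; rewrite /ray_of -/(dir _).
by case: (odd k); [rewrite expr1 mulN1r mulrN ReN => /eqP; rewrite oppr_eq0 => /eqP|rewrite expr0 mul1r].
Qed.

Lemma sector_contains (u0 : T) (tau : R) (V : set T) k :
  (forall t j, closure V t -> ~ stokes_rays u0 t (Pi_start tau j)) ->
  [set z : ucov R | Pi_start tau k <= arg z <= Pi_start tau k.+1] `<=` sector u0 tau V k.
Proof.
move=> nr z /= /andP[z1 z2] t tV th ray; split=> h.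
  rewrite lt_neqAle (le_trans h z1) andbT; apply: contraT; rewrite negbK => /eqP e.
  by case: (nr t k tV); rewrite (_ : Pi_start tau k = th)//; apply/eqP; rewrite eq_le h e z1.
rewrite -Pi_startS in h; rewrite lt_neqAle (le_trans z2 h) andbT; apply: contraT; rewrite negbK => /eqP e.
by case: (nr t k.+1 tV); rewrite (_ : Pi_start tau k.+1 = th)//; apply/eqP; rewrite eq_le h -e z2.
Qed.
End DomainGeometry.

(** * Assembly of the four assertions *)

Theorem theorem1p1 (R : realType) (n s : nat)
  (lam : 'I_s -> R[i]) (blk : 'I_n -> 'I_s) (u0 : 'rV[R[i]]_n)
  (A : 'rV[R[i]]_n -> 'M[R[i]]_n) (tau eps0 : R) (V : set 'rV[R[i]]_n)
  (F : nat -> 'rV[R[i]]_n -> 'M[R[i]]_n)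
  (Y : nat -> 'rV[R[i]]_n -> ucov R -> 'M[R[i]]_n)
  (Y0 : 'rV[R[i]]_n -> ucov R -> 'M[R[i]]_n)
  (B : 'M[R[i]]_n) (St : nat -> 'M[R[i]]_n) (C0 J : 'M[R[i]]_n)
  (d : 'rV[int]_n) (S Q : 'M[R[i]]_n)
  (* Lambda(0) = lam_1 I_(p_1) + ... + lam_s I_(p_s) (direct sum) *)
  (s_lt_n : (s < n)%N)
  (lam_inj : injective lam)
  (blk_mono : forall a b : 'I_n, (a <= b)%N -> (blk a <= blk b)%N)
  (blk_onto : forall j, exists a, blk a = j)
  (u0E : forall a, u0 0 a = lam (blk a))
  (tau_admissible : ~ stokes_rays u0 0 tau)
  (eps0_gt0 : 0 < eps0)
  (eps0_lt : forall j k, j != k -> eps0 < delta tau (lam j) (lam k))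
  (A_holo : holomorphic_on (polydisc eps0) A)
  (F_formal : is_formal_family u0 eps0 A F)
  (Y_canonical : canonical_solutions u0 tau A V F Y)
  (isomono : isomonodromic u0 eps0 tau A V Y Y0 B St C0 J d S Q)
  (A_vanish : vanishing_conditions u0 eps0 A) :
  (exists Fe : nat -> 'rV[R[i]]_n -> 'M[R[i]]_n,
    (* (1) *)
    [/\ forall k, holomorphic_on (polydisc eps0) (Fe k),
        forall k t, polydisc eps0 t -> ~ coalescence u0 eps0 t ->
          Fe k t = F k t
      & forall t, polydisc eps0 t ->
          is_formal_solution (u0 + t) (A t) (Fe^~ t)] /\
    exists (Ye : nat -> 'rV[R[i]]_n -> ucov R -> 'M[R[i]]_n)
           (Y0e : 'rV[R[i]]_n -> ucov R -> 'M[R[i]]_n),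
      [/\ (* (2) *)
          forall r, (1 <= r <= 3)%N ->
            [/\ forall t z, V t -> Ye r t z = Y r t z,
                forall z, holomorphic_on (polydisc eps0) (fun t => Ye r t z),
                forall t, polydisc eps0 t ->
                  is_fundamental (u0 + t) (A t) (Ye r t),
                forall eps1, 0 < eps1 < eps0 -> forall t, polydisc eps1 t ->
                  asymptotic_in (hat_sector u0 eps0 tau r) (u0 + t)
                    (diag_part (A t)) (Fe^~ t) (Ye r t)
              & forall t, coalescence u0 eps0 t ->
                  asymptotic_in (hat_sector u0 eps0 tau r) (u0 + t)
                    (diag_part (A t)) (Fe^~ t) (Ye r t)],
          [/\ forall t z, V t -> Y0e t z = Y0 t z,
              forall z, holomorphic_on (polydisc eps0) (fun t => Y0e t z)
            & forall t, polydisc eps0 t ->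
                is_fundamental (u0 + t) (A t) (Y0e t)],
          (* (3) *)
          forall t, polydisc eps0 t ->
            has_monodromy_data (A t) (fun r => Ye r t) (Y0e t)
              B St C0 J d S Q
        & has_monodromy_data (A 0) (fun r => Ye r 0) (Y0e 0)
            B St C0 J d S Q]) /\
  (* (4) *)
  (forall a b : 'I_n, a != b -> u0 0 a = u0 0 b ->
    [/\ St 1%N a b = 0, St 1%N b a = 0, St 2%N a b = 0 & St 2%N b a = 0]).
Proof.
have [[[c Vc] Vd /open_opn oV cV [E [cellE clVE]]] [Gm [_ GmJ]] hY0 fY0 mono] := isomono.
have clV t : V t -> closure V t by exact: subset_closure.
have cellV t tV := cell_noray cellE (clVE t tV).
have Veps t : V t -> rn t <= eps0 by move=> /clV/cellV[].
have du t a b : V t -> a != b -> (u0 + t) 0 a != (u0 + t) 0 b by move=> /clV/cellV[_ h _]; exact: h.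
have nr t j : closure V t -> ~ stokes_rays u0 t (Pi_start tau j) by move=> /cellV[_ _ h]; exact: h.
have lam_gap a b : u0 0 a != u0 0 b -> 2 * eps0 < `|complex.Re ((u0 0 a - u0 0 b) * dir tau)|.
  move=> uab; rewrite !u0E; apply: delta_ray; apply: eps0_lt.
  by apply: contra uab => /eqP e; rewrite !u0E e.
have gap t a b : rn t <= eps0 -> u0 0 a != u0 0 b -> complex.Re (((u0 + t) 0 a - (u0 + t) 0 b) * dir tau) != 0.
  move=> tr uab; apply: contraTneq (lam_gap a b uab) => ray; rewrite -leNgt.
  have -> : (u0 0 a - u0 0 b) * dir tau = ((u0 + t) 0 a - (u0 + t) 0 b) * dir tau - (t 0 a - t 0 b) * dir tau.
    by rewrite !rowDE; ring.
  rewrite ReD ray add0r; apply: le_trans (Re_le_rn (- _)) _.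
  rewrite rnN rnM rn_dir mulr1; apply: le_trans (rnB_le _ _) _.
  by have := rn_entry t 0 a; have := rn_entry t 0 b; lra.
have [r0 r0e hA0] : exists2 r0, eps0 < r0 & forall t i j, rn t < r0 -> hol (fun t => A t i j) t.
  have [W [oW dW hW]] := (holomorphic_onP _ _).1 A_holo.
  by have [r0 r0e h] := polydisc_nbhd eps0_gt0 oW dW; exists r0 => // t i j tr; apply: hW; exact: h.
(* The modulus of each difference exceeds [2 eps0] because its projection in the direction [tau]
   does; there are finitely many pairs, so one margin [x] serves all. *)
have [x x0 hx] : exists2 x : R, 0 < x & forall ab : 'I_n * 'I_n, u0 0 ab.1 != u0 0 ab.2 -> 2 * eps0 + x <= rn (u0 0 ab.1 - u0 0 ab.2).
  apply: finite_gap => [ab y z yz h uab|[a b]]; first by apply: le_trans (h uab); rewrite lerD2l.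
  case: (boolP (u0 0 a == u0 0 b)) => [/eqP e|uab]; first by exists 1 => //=; rewrite e eqxx.
  exists (rn (u0 0 a - u0 0 b) - 2 * eps0) => [|_ /=]; last by rewrite addrC subrK.
  rewrite subr_gt0; apply: lt_le_trans (lam_gap a b uab) _; apply: le_trans (Re_le_rn _) _.
  by rewrite rnM rn_dir mulr1.
(* Below [r0], [A] is holomorphic; below [eps0 + x / 2], values that differ at [t = 0] cannot meet,
   as [coalescence_quotient] requires. *)
pose r1 := Num.min r0 (eps0 + x / 2).
have [er1 r10 r1x] : [/\ eps0 < r1, r1 <= r0 & r1 <= eps0 + x / 2].
  by split; rewrite ?ge_min ?lexx ?orbT// lt_min r0e/=; lra.
have hA t i j : rn t < r1 -> hol (fun t => A t i j) t by move=> tr; apply: hA0; exact: lt_le_trans r10.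
have sep a b : u0 0 a != u0 0 b -> 2 * r1 <= rn (u0 0 a - u0 0 b) by move=> uab; have := hx (a, b) uab; rewrite /=; lra.
have [N1 [hN _ N1_off]] : exists N1 : 'rV[R[i]]_n -> 'M[R[i]]_n, [/\ forall t i j, rn t < r1 -> hol (fun t => N1 t i j) t,
    forall t a, N1 t a a = 0 & forall t a b, rn t < r1 -> a != b -> N1 t a b * ((u0 + t) 0 a - (u0 + t) 0 b) = - A t a b].
  by apply: (coalescence_quotient (eps := eps0)) => //; rewrite eps0_gt0 ltW.
have Vr t : V t -> rn t < r1 by move=> /Veps tr; exact: le_lt_trans er1.
have nc t : V t -> ~ coalescence u0 eps0 t.
  by move=> tV [_ [a [b [ab /eqP e]]]]; have := du t a b tV ab; rewrite e.
have fF t : V t -> is_formal_solution (u0 + t) (A t) (F^~ t).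
  by move=> tV; apply: F_formal; [exact: Vd|exact: nc].
pose bv (t : 'rV[R[i]]_n) : 'rV[R[i]]_n := \row_a A t a a.
have diagA t a : V t -> A t a a = B a a.
  move=> /mono[dB _ _ _ _]; have := congr1 (fun X : 'M[R[i]]_n => X a a) dB.
  by rewrite /diag_part !mxE eqxx mulr1n.
have bvE t : V t -> bv t = bv c.
  by move=> tV; apply/rowP => a; rewrite !mxE !diagA.
have YV k t : (1 <= k <= 3)%N -> V t -> is_fundamental (u0 + t) (A t) (Y k t) /\
    asymp (Pi_start tau k) (Pi_start tau k.+1) (u0 + t) (bv t) (F^~ t) (Y k t).
  move=> hk tV; have [h1 h2] := (Y_canonical k hk).2 t tV; split=> //.
  by apply: ((asymptotic_inP _ _ _ _ _).1 h2); exact: sector_contains nr.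
have hY k t z i j : (1 <= k <= 3)%N -> V t -> hol (fun t => Y k t z i j) t.
  move=> hk tV; have [W [oW VW hW]] := (holomorphic_onP _ _).1 ((Y_canonical k hk).1 z).
  by apply: hW; exact: VW.
have uY0 t z : V t -> Y0 t z \in unitmx by move=> /fY0/is_fundamentalP/(_ z)[].
(* [Y 1] and [Y 2] are taken, whose closed sectors [[tau - pi, tau]] and [[tau, tau + pi]] make up a
   full turn. *)
have pde := formal_pde oV Vc (fun t i j tV => hA t i j (Vr t tV)) du fF
  (Y := fun s : bool => Y (if s then 1%N else 2%N)) (Y0 := Y0) (b := bv c) (C0 := C0) (S1 := St 1%N) (tau := tau) (J := J) (d := d) (S := S) (Q := Q).
have {}pde N : exists c' dl, [/\ 0 < dl, forall t, rn (t - c') < dl -> V t &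
    forall t k j a b, rn (t - c') < dl -> (j <= N)%N ->
    dd (fun t => F j t a b) t (delta_mx 0 k) = cmx k (F j.+1 t) a b - (cmx k (F 1%N t) *m F j t) a b].
  apply: pde => [[] t z i j tV|[] t tV|t tV|t z tV|t z tV|t z tV]; try exact: hY.
  - have [_] := YV 1%N t isT tV; rewrite bvE//; congr asymp; rewrite /Pi_start; ring.
  - have [_] := YV 2%N t isT tV; rewrite bvE//; congr asymp; rewrite /Pi_start; ring.
  - by have [_ _ _ _] := mono t tV.
  - exact: uY0.
  - by have [_ _ h _ _] := mono t tV; exact: h.
  - by have [_ h _ _ _] := mono t tV; exact: (h 1%N).
pose Fe := extF A N1.
have hFe k t i j (tr : rn t < r1) : hol (fun t => Fe k t i j) t := extF_hol hA hN k i j tr.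
have fFe t (tr : rn t < r1) : is_formal_solution (u0 + t) (A t) (Fe^~ t) := extF_formal hA hN Vr du N1_off fF pde tr.
have pFe t k j a b (tr : rn t < r1) := extF_pde hA hN Vr du N1_off fF pde k j a b tr.
have FeF k t : rn t < r1 -> (forall a b, a != b -> (u0 + t) 0 a != (u0 + t) 0 b) -> is_formal_solution (u0 + t) (A t) (F^~ t) -> Fe k t = F k t.
  by move=> tr dt fFt; exact: (formal_unique k dt (fFe t tr) fFt).
have epsr t : polydisc eps0 t -> rn t < r1 by move=> /polydiscE tr; exact: le_lt_trans er1.
have [rr [Ye hYe]] : exists (rr : nat -> R) (Ye : nat -> 'rV[R[i]]_n -> R[i] -> 'M[R[i]]_n), forall k, [/\ eps0 < rr k < r1,
    forall t, rn t < rr k -> is_fundamental (u0 + t) (A t) (Ye k t),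
    forall t w a b, rn t < rr k -> hol (fun t => Ye k t w a b) t,
    forall t, rn t < rr k -> asymp (Pi_start tau k) (Pi_start tau k.+1) (u0 + t) (bv t) (Fe^~ t) (Ye k t)
  & forall t, rn t <= eps0 -> forall p q, [set z : ucov R | p <= arg z <= q] `<=` hat_sector u0 eps0 tau k ->
      asymp p q (u0 + t) (bv t) (Fe^~ t) (Ye k t)].
  have [rr hrr] := choice (hat_solution eps0_gt0 er1 hA hN hFe fFe pFe gap).
  by have [Ye hYe] := choice hrr; exists rr, Ye.
(* Each of the three solutions comes with its own radius above [eps0]; the identities between them
   are continued on the common ball. *)
pose rt := Num.min (rr 1%N) (Num.min (rr 2%N) (rr 3%N)).
have rte : eps0 < rt by rewrite !lt_min; case: (hYe 1%N) => /andP[-> _]; case: (hYe 2%N) => /andP[-> _]; case: (hYe 3%N) => /andP[-> _].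
have rtk k : (1 <= k <= 3)%N -> rt <= rr k.
  by case: k => [|[|[|[|k]]]]//= _; rewrite !ge_min lexx ?orbT.
have rt1 (t : 'rV[R[i]]_n) : rn t < rt -> rn t < r1.
  move=> tr; apply: lt_le_trans tr _; apply: le_trans (rtk 1%N isT) _; apply: ltW.
  by case: (hYe 1%N) => /andP[].
have dt (t : 'rV[R[i]]_n) : polydisc eps0 t -> rn t < rt by move=> /polydiscE tr; exact: le_lt_trans rte.
have Vrt t : V t -> rn t < rt by move=> /Veps tr; exact: le_lt_trans rte.
have YeV k t z : (1 <= k <= 3)%N -> V t -> Ye k t z = Y k t z.
  move=> hk tV; have [_ h2 _ h4 _] := hYe k; have tk := lt_le_trans (Vrt t tV) (rtk k hk).
  have [f1 a1] := YV k t hk tV.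
  have FE : Fe^~ t = F^~ t.
    by apply/funext => m; apply: FeF; [exact: Vr|move=> a b; exact: du|exact: fF].
  have := h4 t tk; rewrite FE => a2.
  have pi0 := @pi_gt0 R; rewrite Pi_startS in a1 a2.
  (* The two rays that bound the sector [Pi_k] are opposite, and on both of them the two solutions
     have the expansion [F], which equals [Fe] on [V]. *)
  apply: (asymp_unique (fF t tV).1 f1 (h2 t tk) (th := Pi_start tau k)).
  - by apply: asymp_sub a1; lra.
  - by apply: asymp_sub a2; lra.
  - by apply: asymp_sub a1; lra.
  - by apply: asymp_sub a2; lra.
have [dl dl0 hV] := oV c Vc.
have ident (f g : 'rV[R[i]]_n -> R[i]) : (forall t, rn t < rt -> hol f t) -> (forall t, rn t < rt -> hol g t) ->
    (forall t, V t -> f t = g t) -> forall t, rn t < rt -> f t = g t.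
  by move=> hf hg fg t tr; apply: (identity_convex_ball hf hg (Vrt c Vc) tr dl0) => y hy; apply: fg; exact: hV.
have hYe' k t w i j : (1 <= k <= 3)%N -> rn t < rt -> hol (fun t => Ye k t w i j) t.
  by move=> hk tr; have [_ _ h _ _] := hYe k; apply: h; exact: lt_le_trans (rtk k hk).
have fYe k t : (1 <= k <= 3)%N -> rn t < rt -> is_fundamental (u0 + t) (A t) (Ye k t).
  by move=> hk tr; have [_ h _ _ _] := hYe k; apply: h; exact: lt_le_trans (rtk k hk).
have hmul (f : 'rV[R[i]]_n -> 'M[R[i]]_n) (X : 'M[R[i]]_n) t i j : (forall i j, hol (fun t => f t i j) t) -> hol (fun t => (f t *m X) i j) t.
  by move=> hf; apply: hol_mulmx => // i' j'; exact: hol_const.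
have stokes k t z : (1 <= k <= 2)%N -> rn t < rt -> Ye k.+1 t z = Ye k t z *m St k.
  move=> hk tr; have [k1 k2] : (1 <= k.+1 <= 3)%N /\ (1 <= k <= 3)%N by case: k hk => [|[|[|k]]].
  apply/matrixP => i j; apply: (ident (fun t => Ye k.+1 t z i j) (fun t => (Ye k t z *m St k) i j)) => // [x1 sr|x1 sr|x1 sV].
  - exact: hYe'.
  - by apply: hmul => i' j'; exact: hYe'.
  - by rewrite !YeV//; have [_ h _ _ _] := mono x1 sV; rewrite h.
have uC0 : C0 \in unitmx.
  have [_ _ h _ _] := mono c Vc; have /is_fundamentalP/(_ 0)[_] := (YV 1%N c isT Vc).1.
  by rewrite h unitmx_mul => /andP[].
(* The continuation of [Y0] is read off from that of [Y 1]; on [V] it gives back [Y0] because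
   [Y 1 = Y0 C0] there. *)
pose Y0e t z := Ye 1%N t z *m invmx C0.
have hY0e t w i j : rn t < rt -> hol (fun t => Y0e t w i j) t by move=> tr; apply: hmul => i' j'; exact: hYe'.
have fY0e t : rn t < rt -> is_fundamental (u0 + t) (A t) (Y0e t).
  by move=> tr; apply: is_fundamentalM; [exact: fYe|rewrite unitmx_inv].
have Y0eV t z : V t -> Y0e t z = Y0 t z.
  by move=> tV; rewrite /Y0e YeV//; have [_ _ -> _ _] := mono t tV; rewrite mulmxK.
have diagB t : rn t < rt -> diag_part (A t) = B.
  move=> tr; have [dB _ _ _ _] := mono c Vc.
  rewrite -dB /diag_part; congr diag_mx; apply/rowP => a; rewrite [LHS]mxE [RHS]mxE.
  apply: (ident (fun t => A t a a) (fun=> A c a a)) => // [x1 /rt1 sr|x1 sr|x1 sV].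
  - exact: hA.
  - exact: hol_const.
  - by rewrite !diagA.
have lev t : rn t < rt -> levelt_form (A t) J d S Q (Y0e t).
  apply: (levelt_extension (A := A) (c := c) (dl := dl)) => // [x1 i j /rt1|w x1 i j sr|w x1 sr||y hy].
  - exact: hA.
  - by apply: (joint_hol (r := rt) (u0 := u0) (A := A)) sr => // t' i' j' /rt1; exact: hA.
  - by have /is_fundamentalP/(_ w)[] := fY0e x1 sr.
  - exact: Vrt.
  - have yV := hV y hy; split; first exact: Vrt.
    have [_ _ _ _ h] := mono y yV; rewrite (_ : Y0e y = Y0 y)//.
    by apply/funext => z; exact: Y0eV.
have data t : rn t < rt -> has_monodromy_data (A t) (fun k => Ye k t) (Y0e t) B St C0 J d S Q.
  move=> tr; split; [exact: diagB|by move=> k hk z; exact: stokes|by move=> z; rewrite /Y0e mulmxKV| |exact: lev].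
  by have [_ _ _ h _] := mono c Vc.
have as_in k t : (1 <= k <= 3)%N -> rn t <= eps0 ->
    asymptotic_in (hat_sector u0 eps0 tau k) (u0 + t) (diag_part (A t)) (Fe^~ t) (Ye k t).
  move=> hk tr; apply: (asymptotic_inP _ _ (bv t) _ _).2; have [_ _ _ _ h] := hYe k; exact: h.
have holP (f : 'rV[R[i]]_n -> 'M[R[i]]_n) : (forall t i j, rn t < rt -> hol (fun t => f t i j) t) -> holomorphic_on (polydisc eps0) f.
  move=> hf; apply/holomorphic_onP; exists [set t | rn t < rt]; split=> [t tr|t|t i j]; last exact: hf.
    exists (rt - rn t); first by rewrite subr_gt0.
    by move=> y hy; have := rn_sub y t; rewrite /=; lra.
  exact: dt.
have d0 : polydisc eps0 (0 : 'rV[R[i]]_n) by apply/polydiscE; rewrite rn0 ltW.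
split.
  exists Fe; split.
    split=> [k|k t td tc|t td].
    - by apply: holP => t i j /rt1; exact: hFe.
    - apply: FeF; [exact: epsr| |exact: F_formal].
      by move=> a b ab; apply/eqP => e; apply: tc; split=> //; exists a, b.
    - by apply: fFe; exact: epsr.
  exists Ye, Y0e; split.
  - move=> k hk; split.
    + by move=> t z tV; exact: YeV.
    + by move=> z; apply: holP => t i j; exact: hYe'.
    + by move=> t td; apply: fYe => //; exact: dt.
    + move=> e1 /andP[_ e1e] t /polydiscE tr; apply: as_in => //; exact: le_trans tr (ltW e1e).
    + by move=> t [/polydiscE tr _]; exact: as_in.
  - split=> [t z tV|z|t td]; first exact: Y0eV.
      by apply: holP => t i j; exact: hY0e.
    by apply: fY0e; exact: dt.
  - by move=> t td; apply: data; exact: dt.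
  - by apply: data; exact: dt.
(* The closed sectors of [Ye k] and [Ye k.+1] share the ray [Pi_start tau k.+1]. At [t = 0] the
   exponent [u_a - u_b] is 0, so [decay_eq0] applies with [l = 0], in either order of [a] and
   [b]. *)
have St0 k a b : (1 <= k <= 2)%N -> a != b -> u0 0 a = u0 0 b -> St k a b = 0.
  move=> hk ab uab; have [k1 k2] : (1 <= k.+1 <= 3)%N /\ (1 <= k <= 3)%N by case: k hk => [|[|[|k]]].
  have z0 : rn (0 : 'rV[R[i]]_n) < rt := dt 0 d0.
  have [_ _ _ a1 _] := hYe k; have [_ _ _ a2 _] := hYe k.+1; have pi0 := @pi_gt0 R.
  have {}a1 : asymp (Pi_start tau k.+1) (Pi_start tau k.+1) (u0 + 0) (bv 0) (Fe^~ 0) (Ye k 0).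
    by apply: asymp_sub (a1 0 (lt_le_trans z0 (rtk k k2))); rewrite ?Pi_startS; lra.
  have {}a2 : asymp (Pi_start tau k.+1) (Pi_start tau k.+1) (u0 + 0) (bv 0) (Fe^~ 0) (Ye k.+1 0).
    by apply: asymp_sub (a2 0 (lt_le_trans z0 (rtk k.+1 k1))); rewrite ?Pi_startS; lra.
  have h := connection_decay (fFe 0 (rt1 0 z0)).1 (fun z => stokes k 0 z hk z0) a1 a2.
  have h0 : 0 <= complex.Re (cexp (0 +i* Pi_start tau k.+1) * 0) :> R by rewrite mulr0.
  apply: (decay_eq0 (b := bv 0 0 a - bv 0 0 b) h0) => N; have [K [rho hK]] := h N; exists K, rho => z z1 z2.
  by have := hK z z1 z2 a b; rewrite (negPf ab) subr0 addr0 uab subrr.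
by move=> a b ab uab; have ba : b != a by [rewrite eq_sym]; split; apply: St0.
Qed.
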